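(* Let $d_1,d_2\ge1$ and $d=d_1+d_2$. Assume that the Conjecture stated in the context is true. Let $\mathcal H$ be the set of functions described in the context, and let $S>0$ and $c_\nu>0$ be the remaining parameters of the classes $\Psi$ and $\mathbf Q$ defined in the context. Then for all $\kappa\in(0,1)$, $\beta>0$, $c_\beta>0$, $c_Q>0$ and $\nu>0$, there exists a constant $c>0$ such that $$\inf_{\hat f}\ \sup_{\substack{Q^\star\in\mathbf{Q}(\nu,c_\nu,c_Q)\\ R^\star:\ \Phi_{R^\star}\in\Psi(\kappa,S,\beta,c_\beta)\cap\mathcal{H}}}\ \mathbb{E}_{R^\star,Q^\star}\left[\|\hat f-f^\star\|^2_{L^2(\mathbb{R}^d)}\right]\ \ge\ c\left(\frac{\log n}{\log\log n}\right)^{-2\kappa\beta},$$ where the infimum is taken over all estimators $\hat f$, that is, all measurable functions of $\mathbf{Y}_1,\dots,\mathbf{Y}_n$, and $f^\star$ is the density of $R^\star$.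
   Context: Model. $\mathbf{Y}_1,\dots,\mathbf{Y}_n$ are i.i.d. copies of $\mathbf{Y}=\mathbf{X}+\boldsymbol\varepsilon\in\mathbb{R}^{d_1}\times\mathbb{R}^{d_2}$, where $\mathbf{X}$ has distribution $R^\star$ with Lebesgue density $f^\star$ on $\mathbb{R}^d$, and $\boldsymbol\varepsilon=(\varepsilon^{(1)},\varepsilon^{(2)})$ is independent of $\mathbf{X}$ and has distribution $Q^\star=Q^{\star,(1)}\otimes Q^{\star,(2)}$ (so $\varepsilon^{(1)}$ and $\varepsilon^{(2)}$ are independent). $\mathbb{E}_{R^\star,Q^\star}$ is the corresponding expectation. $\Phi_\mu(t)=\int e^{it^\top x}\mu(dx)$ is the characteristic function of $\mu$, extended analytically to complex arguments when possible; the Fourier transform of a density $f$ is $\mathcal F[f](t)=\int e^{it^\top x}f(x)\,dx$. Classes. For $\kappa>0$ and $S<\infty$, $\Upsilon_{\kappa,S}$ is the set of analytic functions $\phi$ on $\mathbb{C}^d$ with $\overline{\phi(z)}=\phi(-z)$ for all $z\in\mathbb{R}^d$, $\phi(0)=1$ and $\left|\partial^i\phi(0)/\prod_{a=1}^d i_a!\right|\le S^{\|i\|_1}\|i\|_1^{-\kappa\|i\|_1}$ for all $i\in\mathbb{N}^d\setminus\{0\}$, where $\|i\|_1=\sum_a i_a$ (the same notation is used in dimension $1$). For $\kappa,S,\beta,c_\beta>0$, $\Psi(\kappa,S,\beta,c_\beta)$ is the set of functions in $\Upsilon_{\kappa,S}$ that can be written as $\Phi_R$ for some probability measure $R$ on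 $\mathbb{R}^d$ and that satisfy $\int_{\mathbb{R}^d}|\Phi_R(t)|^2(1+\|t\|^2)^\beta dt\le c_\beta$. For $\nu,c_\nu,c_Q>0$, $\mathbf{Q}(\nu,c_\nu,c_Q)$ is the set of probability measures $Q=Q^{(1)}\otimes Q^{(2)}$, with $Q^{(j)}$ a probability measure on $\mathbb{R}^{d_j}$, such that $|\Phi_{Q^{(j)}}|\ge c_\nu$ on $[-\nu,\nu]^{d_j}$ for $j=1,2$, and $\mathbb{E}[\|\varepsilon\|^2]\le c_Q$ if $\varepsilon$ has distribution $Q$. The functions $h_\kappa$ and $u_b$. Let $u(x)=c_u\exp(-1/(1-x^2))\mathbf{1}_{[-1,1]}(x)$ on $\mathbb{R}$, with $c_u>0$ such that $\int u=1$, and $u_b(x)=b\,u(bx)$ for $b>0$. For $\kappa\in(0,1)$ and $x_0>0$, let $h_\kappa(x)=c_h\exp\big(-(\sqrt{[1+(x/x_0)^2]/2})^{1/(1-\kappa)}\big)$, with $c_h$ making it a probability density on $\mathbb{R}$. It is a fact that for all $\kappa\in(0,1)$, $c',T>0$ and $\tau\ge0$ there exists $x_0>0$ such that for all $b\ge1/x_0$, any probability density $\zeta$ with $\zeta\le c'\,([x\mapsto h_\kappa(x)(1+(x/x_0)^2)^\tau]*u_b)$ satisfies $\mathcal F[\zeta]\in\Upsilon_{\kappa,T}$; $x_0$ and $h_\kappa$ below are chosen in this way. Let $(P_K)_{K\ge0}$ be the orthonormal polynomials, $\deg P_K=K$, for the scalar product $\langle f,g\rangle=\int f(x)g(x)h_\kappa(x)^2dx$.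 Conjecture. There exists a nonnegative envelope function $F_{\rm env}$ with at most polynomial growth at infinity such that $\sup_{K\ge1}K^{(1-\kappa)/2}\|P_Kh_\kappa/F_{\rm env}\|_\infty<\infty$, and there exist constants $c_0,c_1,c_2>0$ such that for all $K$ large enough there exist at least $c_0K^\kappa$ intervals of length at least $c_1K^{-\kappa}$ in $[-1,1]$ on which $|P_Kh_\kappa|\ge c_2K^{(\kappa-1)/2}$. For simplicity it is assumed that $\|F_{\rm env}h_\kappa\|_{L^1(\mathbb{R})}=1$; the constants $c'>0$, $\tau\ge0$ used in the choice of $x_0$ are such that $F_{\rm env}(x)\le c'(1+(x/x_0)^2)^\tau$ for all $x\in\mathbb{R}$ ($c'$ not depending on the choice of $x_0$). Densities $f_0,f_n$. Let $(\alpha_n)_{n\ge1}$ be a sequence of nonnegative real numbers with limit zero, $(K_n)_{n\ge1}$ a sequence of integers tending to infinity and $(b_n)_{n\ge1}$ a sequence of real numbers tending to infinity, with $\alpha_n\le\|P_{K_n}h_\kappa/F_{\rm env}\|_\infty^{-1}$. Put $\zeta_0=(F_{\rm env}h_\kappa)*u_{b_n}$ and $\zeta_n=(F_{\rm env}h_\kappa+\alpha_nP_{K_n}h_\kappa^2)*u_{b_n}=\zeta_0+\alpha_n(P_{K_n}h_\kappa^2)*u_{b_n}$, which are probability densities on $\mathbb{R}$. Let $a$ be a (small) real number and $A$ the $d\times d$ matrix with diagonal blocks $I_{d_1}$ and $I_{d_2}$, whose upper-right $d_1\times d_2$ block and lower-left $d_2\times d_1$ block each have first row with all entries equal to $a$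 and all other rows zero. Then $f_0$ is the density of $A\mathbf{S}$ when the coordinates $S_1,\dots,S_d$ of $\mathbf{S}$ are independent with density $\zeta_0$, and $f_n$ is the density of $A\mathbf{S}$ when $S_1,\dots,S_d$ are independent, $S_1$ has density $\zeta_n$ and $S_2,\dots,S_d$ have density $\zeta_0$. The set $\mathcal H$. For a fixed $\nu_{\rm est}>0$, $\mathcal H$ is a set of functions $\mathbb{R}^d\to\mathbb{C}$ (extending to complex arguments), closed in $L^2([-\nu_{\rm est},\nu_{\rm est}]^d)$, such that every $\phi\in\mathcal H$ satisfies: for any $z_0\in\mathbb{C}^{d_1}$, $z\mapsto\phi(z_0,z)$ is not the null function on $\mathbb{C}^{d_2}$, and for any $z_0\in\mathbb{C}^{d_2}$, $z\mapsto\phi(z,z_0)$ is not the null function on $\mathbb{C}^{d_1}$; and $\mathcal H$ contains the Fourier transforms of the probability densities of the form given by $f_0$ and $f_n$.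
   Formalization: Added, since the classes can otherwise be empty: c_ν<1; the T used to choose x_0 is small in terms of d_1, d_2, κ, S; c_β exceeds, by a fixed margin, the Sobolev energy of f_0 for all large b. ''Small'' a is read as |a|<1. *)

(* Defs.v *)
From HB Require Import structures.
From mathcomp Require Import all_boot all_order all_algebra.
From mathcomp Require Import all_classical all_reals all_analysis.
From mathcomp Require Import complex.

Set Implicit Arguments.
Unset Strict Implicit.
Unset Printing Implicit Defensive.

Import Order.TTheory GRing.Theory Num.Theory.
Import numFieldNormedType.Exports.
Import Normc.

Local Open Scope classical_set_scope.
Local Open Scope ring_scope.

Definition rV_display : measure_display.
Proof. exact: default_measure_display. Qed.

Section measurable_rV.
Context {R : realType}.
Variable d : nat.

Let coors : 'I_d -> 'rV[R]_d -> R := fun i x => x ord0 i.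

Let rV_set0 : g_sigma_preimage coors set0.
Proof. exact: sigma_algebra0. Qed.

Let rV_setC A : g_sigma_preimage coors A -> g_sigma_preimage coors (~` A).
Proof. exact: sigma_algebraC. Qed.

Let rV_bigcup (F : (set 'rV[R]_d)^nat) :
  (forall i, g_sigma_preimage coors (F i)) ->
  g_sigma_preimage coors (\bigcup_i (F i)).
Proof. exact: sigma_algebra_bigcup. Qed.

HB.instance Definition _ := @isMeasurable.Build rV_display
  'rV[R]_d (g_sigma_preimage coors) rV_set0 rV_setC rV_bigcup.

End measurable_rV.

Section rV_measurability.
Context {R : realType}.

Lemma measurable_rV_coord d (i : 'I_d) :
  measurable_fun [set: 'rV[R]_d] (fun x : 'rV[R]_d => x ord0 i).
Proof.
move=> _ Y mY; rewrite setTI; apply: sub_sigma_algebra => /=.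
rewrite -bigcup_seq/=; exists i => /=; first by rewrite mem_index_enum.
by exists Y => //; rewrite setTI.
Qed.

Lemma measurable_fun_rV dT (T : measurableType dT) d (f : T -> 'rV[R]_d) :
  (forall i, measurable_fun [set: T] (fun x => f x ord0 i)) ->
  measurable_fun [set: T] f.
Proof.
move=> mf _ Y mY; move: Y mY.
suff : (measurable : set (set 'rV[R]_d)) `<=`
       image_set_system setT f (measurable : set (set T)) by apply.
rewrite [X in X `<=` _]/measurable/=; apply: smallest_sub.
  exact/sigma_algebra_image/sigma_algebra_measurable.
rewrite -bigcup_seq/=; apply: bigcup_sub => i _ A [B mB <-] /=.
by have := mf i measurableT B mB; rewrite /image_set_system/= !setTI.
Qed.

Definition rV_add d (p : 'rV[R]_d * 'rV[R]_d) : 'rV[R]_d := p.1 + p.2.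

Lemma measurable_rV_add d : measurable_fun setT (@rV_add d).
Proof.
apply: measurable_fun_rV => i.
rewrite (_ : (fun _ => _) = (fun p : 'rV[R]_d * 'rV[R]_d =>
  p.1 ord0 i + p.2 ord0 i)); last by apply/funext => p; rewrite mxE.
apply: measurable_realfun.measurable_funD.
- exact: (measurableT_comp (@measurable_rV_coord d i)).
- exact: (measurableT_comp (@measurable_rV_coord d i)).
Qed.

HB.instance Definition _ d :=
  isMeasurableFun.Build _ _ _ _ (@rV_add d) (@measurable_rV_add d).

Definition rV_cat d1 d2 (p : 'rV[R]_d1 * 'rV[R]_d2) : 'rV[R]_(d1 + d2) :=
  row_mx p.1 p.2.

Lemma measurable_rV_cat d1 d2 : measurable_fun setT (@rV_cat d1 d2).
Proof.
apply: measurable_fun_rV => i; case: (split_ordP i) => j ->.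
- rewrite (_ : (fun _ => _) = (fun p : 'rV[R]_d1 * 'rV[R]_d2 => p.1 ord0 j));
    last by apply/funext => p; rewrite row_mxEl.
  exact: (measurableT_comp (measurable_rV_coord j)).
- rewrite (_ : (fun _ => _) = (fun p : 'rV[R]_d1 * 'rV[R]_d2 => p.2 ord0 j));
    last by apply/funext => p; rewrite row_mxEr.
  exact: (measurableT_comp (measurable_rV_coord j)).
Qed.

HB.instance Definition _ d1 d2 :=
  isMeasurableFun.Build _ _ _ _ (@rV_cat d1 d2) (@measurable_rV_cat d1 d2).

Lemma measurable_rV_of_tuple d : measurable_fun [set: d.-tuple R]
  (fun t => \row_(i < d) tnth t i : 'rV[R]_d).
Proof.
apply: measurable_fun_rV => i.
rewrite (_ : (fun _ => _) = (@tnth _ R ^~ i));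
  last by apply/funext => p; rewrite mxE.
exact: measurable_tnth.
Qed.

Lemma measurable_tuple_cons dT (T : measurableType dT) n :
  measurable_fun [set: T * n.-tuple T]
    (fun p => [the n.+1.-tuple T of p.1 :: p.2]).
Proof. exact: measurable_cons. Qed.

End rV_measurability.

Section product_power.
Context {R : realType} dT (T : measurableType dT).
Local Open Scope ereal_scope.

Section step.
Variables (mu : {sigma_finite_measure set T -> \bar R}) (n : nat)
  (M : {sigma_finite_measure set (n.-tuple T) -> \bar R}).

(* [m1 \x m2] is not inferred to be sigma-finite by the library for sigma-finite
   [m1] and [m2], hence the direct proof below. *)
Definition power_step : set (n.+1.-tuple T) -> \bar R :=
  pushforward (mu \x M) (fun p => [the n.+1.-tuple T of p.1 :: p.2]).

HB.instance Definition _ := Measure.copy power_step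
  (measure_function_pushforward__canonical__measure_function_Measure
     (mu \x M) (@measurable_tuple_cons _ T n)).

Let power_step_sigma_finite : sigma_finite setT power_step.
Proof.
have /sigma_finiteP[F [TF ndF Foo]] := sigma_finiteT mu.
have /sigma_finiteP[G [TG ndG Goo]] := sigma_finiteT M.
pose bh (t : n.+1.-tuple T) := [tuple of behead t] : n.-tuple T.
exists (fun k => (@tnth _ T ^~ ord0) @^-1` F k `&` bh @^-1` G k).
  rewrite predeqE => t; split => // _.
  have : setT (tnth t ord0) by []. rewrite TF => -[k _ Fk].
  have : setT (bh t) by []. rewrite TG => -[l _ Gl].
  exists (maxn k l) => //; split.
  - by have /subsetPset := ndF _ _ (leq_maxl k l); exact.
  - by have /subsetPset := ndG _ _ (leq_maxr k l); exact.
move=> k; have [mF Fk] := Foo k; have [mG Gk] := Goo k; split.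
  apply: measurableI; rewrite -[X in measurable X]setTI.
  - exact: measurable_tnth.
  - exact: measurable_behead.
rewrite /power_step /pushforward /=.
rewrite (_ : _ @^-1` _ = F k `*` G k).
  by rewrite product_measure1E// lte_mul_pinfty// ge0_fin_numE.
apply/seteqP; split => -[x t] /=;
  by rewrite (_ : bh _ = t)//; exact: val_inj.
Qed.

HB.instance Definition _ :=
  Measure_isSigmaFinite.Build _ _ _ power_step power_step_sigma_finite.
End step.

Section zero.
Definition power_zero : set (0.-tuple T) -> \bar R := dirac [tuple].
HB.instance Definition _ := SigmaFiniteMeasure.on power_zero.
End zero.

Fixpoint power_measure (mu : {sigma_finite_measure set T -> \bar R}) (n : nat) :
    {sigma_finite_measure set (n.-tuple T) -> \bar R} :=
  if n is m.+1 then [the {sigma_finite_measure set _ -> \bar R} of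
    power_step mu (power_measure mu m)]
  else [the {sigma_finite_measure set _ -> \bar R} of power_zero].

End product_power.

Section lebesgue.
Context {R : realType} {d : nat}.

Definition lebesgue_rV : set 'rV[R]_d -> \bar R :=
  pushforward (power_measure (@lebesgue_measure R) d)
    (fun t => \row_(i < d) tnth t i).

HB.instance Definition _ := Measure.copy lebesgue_rV
  (measure_function_pushforward__canonical__measure_function_Measure
     (power_measure (@lebesgue_measure R) d) (@measurable_rV_of_tuple R d)).
End lebesgue.

Section noise.
Context {R : realType} (d1 d2 : nat).
Variables (P : probability 'rV[R]_(d1 + d2) R)
  (Q1 : probability 'rV[R]_d1 R) (Q2 : probability 'rV[R]_d2 R).

Definition noise_law : probability 'rV[R]_(d1 + d2) R :=
  distribution (Q1 \x Q2)%E (@rV_cat R d1 d2).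

Definition obs_law : probability 'rV[R]_(d1 + d2) R :=
  distribution (P \x noise_law)%E (@rV_add R (d1 + d2)).

End noise.

(* As a [numFieldType], [R[i]] gets the topology and the (complex) derivatives
   of the library. *)
Definition Cplx (R : realType) : numFieldType := R[i].

Section fourier.
Context {R : realType}.
Local Notation C := (Cplx R).

Definition dotp d (t x : 'rV[R]_d) : R := \sum_(i < d) t ord0 i * x ord0 i.

Definition sqnorm d (x : 'rV[R]_d) : R := dotp x x.

Definition box d (nu : R) : set 'rV[R]_d :=
  [set t | forall i, `|t ord0 i| <= nu].

Definition char_fun d (mu : probability 'rV[R]_d R) (t : 'rV[R]_d) : C :=
  Complex (\int[mu]_x cos (dotp t x)) (\int[mu]_x sin (dotp t x)).

Definition fourier d (f : 'rV[R]_d -> R) (t : 'rV[R]_d) : C :=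
  Complex (\int[lebesgue_rV]_x (cos (dotp t x) * f x))
          (\int[lebesgue_rV]_x (sin (dotp t x) * f x)).

Definition has_density d (P : probability 'rV[R]_d R) (f : 'rV[R]_d -> R) :=
  [/\ measurable_fun setT f, (forall x, 0 <= f x) &
      forall B, measurable B -> P B = (\int[lebesgue_rV]_(x in B) (f x)%:E)%E].

Definition toC d (t : 'rV[R]_d) : 'rV[C]_d := map_mx (fun x => Complex x 0) t.

(* The analytic extension of [g] to complex arguments is unique, so a function
   of [R^d] is identified below with the analytic [phi] that extends it. *)
Definition extends d (phi : 'rV[C]_d -> C) (g : 'rV[R]_d -> C) :=
  forall t, phi (toC t) = g t.

Definition sobolev_energy d (beta : R) (g : 'rV[R]_d -> C) : \bar R :=
  (\int[lebesgue_rV]_t (normc (g t) ^+ 2 * (1 + sqnorm t) `^ beta)%:E)%E.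

End fourier.

Section classes.
Context {R : realType}.
Local Notation C := (Cplx R).

Local Notation multi d := {ffun 'I_d -> nat}.

Definition norm1 d (i : multi d) : nat := (\sum_(a < d) i a)%N.

(** [s] is the sum of the absolutely summable family [u]; by absolute
    summability the cubic partial sums can be used. *)
Definition multi_sum d (u : multi d -> C) (s : C) :=
  (\esum_(i in setT) (normc (u i))%:E < +oo)%E /\
  (fun N => \sum_(i : {ffun 'I_d -> 'I_N}) u [ffun a => nat_of_ord (i a)])
    @ \oo --> s.

Definition analytic d (phi : 'rV[C]_d -> C) :=
  forall z0 : 'rV[C]_d, exists (r : R) (c : multi d -> C), 0 < r /\
    forall z : 'rV[C]_d, (forall a, normc (z ord0 a - z0 ord0 a) < r) ->
      multi_sum (fun i => c i * \prod_(a < d) (z ord0 a - z0 ord0 a) ^+ i a)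
        (phi z).

Definition partial d (a : 'I_d) (f : 'rV[C]_d -> C) : 'rV[C]_d -> C :=
  fun z => 'D_(delta_mx ord0 a) f z.

Definition multi_partial d (i : multi d) (f : 'rV[C]_d -> C) : 'rV[C]_d -> C :=
  foldr (fun a g => iter (i a) (partial a) g) f (enum 'I_d).

Definition Upsilon d (kappa S : R) : set ('rV[C]_d -> C) := [set phi |
  [/\ analytic phi,
      (forall z : 'rV[R]_d, (phi (toC z))^*%C = phi (toC (- z))),
      phi 0 = 1 &
      forall i : multi d, norm1 i != 0%N ->
        normc (multi_partial i phi 0 / (\prod_(a < d) (i a)`!)%N%:R)
        <= S ^+ norm1 i * (norm1 i)%:R `^ (- (kappa * (norm1 i)%:R))]].

Definition Psi d (kappa S beta cbeta : R) : set ('rV[C]_d -> C) := [set phi |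
  [/\ Upsilon kappa S phi,
      (exists P : probability 'rV[R]_d R, extends phi (char_fun P)) &
      (sobolev_energy beta (fun t : 'rV[R]_d => phi (toC t)) <= cbeta%:E)%E]].

Definition noise_class d1 d2 (nu cnu cQ : R)
    (Q1 : probability 'rV[R]_d1 R) (Q2 : probability 'rV[R]_d2 R) :=
  [/\ (forall t, box nu t -> cnu <= normc (char_fun Q1 t)),
      (forall t, box nu t -> cnu <= normc (char_fun Q2 t)) &
      (\int[noise_law Q1 Q2]_e (sqnorm e)%:E <= cQ%:E)%E].

Definition in_L2_box d (nu : R) (g : 'rV[R]_d -> C) :=
  [/\ measurable_fun (box nu) (fun t => complex.Re (g t)),
      measurable_fun (box nu) (fun t => complex.Im (g t)) &
      (\int[lebesgue_rV]_(t in box nu) (normc (g t) ^+ 2)%:E < +oo)%E].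

(* A limit in [L^2] only determines its representative in [H] almost everywhere
   on the real cube. *)
Definition closed_L2_box d (nu : R) (H : set ('rV[C]_d -> C)) :=
  (forall phi, H phi -> in_L2_box nu (fun t => phi (toC t))) /\
  (forall (phi : nat -> 'rV[C]_d -> C) (g : 'rV[R]_d -> C),
    (forall k, H (phi k)) -> in_L2_box nu g ->
    (fun k => \int[lebesgue_rV]_(t in box nu)
       (normc (phi k (toC t) - g t) ^+ 2)%:E)%E @ \oo --> 0%E ->
    exists2 psi, H psi &
      {ae @lebesgue_rV R d, forall t, box nu t -> psi (toC t) = g t}).

Definition nonnull_sections d1 d2 (phi : 'rV[C]_(d1 + d2) -> C) :=
  (forall z0 : 'rV[C]_d1, exists z : 'rV[C]_d2, phi (row_mx z0 z) != 0) /\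
  (forall z0 : 'rV[C]_d2, exists z : 'rV[C]_d1, phi (row_mx z z0) != 0).

End classes.

Section minimax.
Context {R : realType} (d1 d2 : nat).
Local Notation d := (d1 + d2)%N.

(* An estimator is a jointly measurable function of the sample and of the point
   where the density is evaluated; its loss is [+oo] outside [L^2]. *)
Definition estimator n : set (n.-tuple 'rV[R]_d * 'rV[R]_d -> R) :=
  [set fhat | measurable_fun setT fhat].

Definition risk n (fhat : n.-tuple 'rV[R]_d * 'rV[R]_d -> R)
    (P : probability 'rV[R]_d R) (f : 'rV[R]_d -> R)
    (Q1 : probability 'rV[R]_d1 R) (Q2 : probability 'rV[R]_d2 R) : \bar R :=
  (\int[power_measure (obs_law P Q1 Q2) n]_y
     \int[lebesgue_rV]_x ((fhat (y, x) - f x) ^+ 2)%:E)%E.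

Definition minimax_risk n (kappa S beta cbeta nu cnu cQ : R)
    (H : set ('rV[Cplx R]_d -> Cplx R)) : \bar R :=
  ereal_inf [set ereal_sup [set r | exists P f Q1 Q2,
      [/\ noise_class nu cnu cQ Q1 Q2, has_density P f,
          (exists phi, [/\ extends phi (char_fun P),
             Psi kappa S beta cbeta phi & H phi]) &
          r = risk fhat P f Q1 Q2]]
    | fhat in @estimator n].

End minimax.

Section least_favourable.
Context {R : realType}.
Local Notation C := (Cplx R).
Local Notation leb := (@lebesgue_measure R).

Definition conv (f g : R -> R) (x : R) : R := \int[leb]_y (f (x - y) * g y).

(* [exp (- 1 / 0)] is read as 0 at the endpoints. *)
Definition bump_raw (x : R) : R :=
  if x ^+ 2 < 1 then expR (- (1 - x ^+ 2)^-1) else 0.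

Definition bump (x : R) : R := bump_raw x / \int[leb]_y bump_raw y.

Definition bump_b (b x : R) : R := b * bump (b * x).

Section h_kappa.
Variables kappa x0 : R.

Definition h_raw (x : R) : R :=
  expR (- (Num.sqrt ((1 + (x / x0) ^+ 2) / 2) `^ (1 - kappa)^-1)).

Definition h_kappa (x : R) : R := h_raw x / \int[leb]_y h_raw y.

Definition weight (tau x : R) : R := (1 + (x / x0) ^+ 2) `^ tau.

Definition is_pdf (zeta : R -> R) :=
  [/\ measurable_fun setT zeta, (forall x, 0 <= zeta x) &
      (\int[leb]_x (zeta x)%:E = 1)%E].

Definition as_rV1 (zeta : R -> R) (x : 'rV[R]_1) : R := zeta (x ord0 ord0).

Definition scale_choice (c' tau T : R) :=
  forall b zeta, x0^-1 <= b -> is_pdf zeta ->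
    (forall x, zeta x <= c' * conv (fun y => h_kappa y * weight tau y) (bump_b b) x) ->
    exists2 phi, Upsilon kappa T phi & extends phi (fourier (as_rV1 zeta)).

Definition orthonormal_polys (P : nat -> {poly R}) :=
  (forall K, size (P K) = K.+1) /\
  (forall K L, \int[leb]_x ((P K).[x] * (P L).[x] * h_kappa x ^+ 2) = (K == L)%:R).

(* With the conventions of [\bar R], the quotient is [+oo] where [F] vanishes
   and [g] does not, and [0] where both vanish. *)
Definition sup_ratio (g F : R -> R) : \bar R :=
  ereal_sup [set (`|g x|%:E / (F x)%:E)%E | x in setT].

Definition Ph (P : nat -> {poly R}) K (x : R) : R := (P K).[x] * h_kappa x.

Definition envelope (P : nat -> {poly R}) (F : R -> R) :=
  [/\ measurable_fun setT F, (forall x, 0 <= F x),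
      (exists A (m : nat) M, forall x, M <= `|x| -> F x <= A * `|x| ^+ m) &
      (ereal_sup [set ((K%:R `^ ((1 - kappa) / 2))%:E * sup_ratio (Ph P K) F)%E
         | K in [set K : nat | (1 <= K)%N]] < +oo)%E].

(* The intervals are counted without overlap; otherwise any interval would
   contain arbitrarily many of them. *)
Definition oscillation (P : nat -> {poly R}) :=
  exists c0 c1 c2 : R, [/\ 0 < c0, 0 < c1, 0 < c2 &
    exists K0 : nat, forall K, (K0 <= K)%N ->
      exists (m : nat) (l r : 'I_m -> R),
        [/\ c0 * K%:R `^ kappa <= m%:R,
            (forall i j, i != j -> r i <= l j \/ r j <= l i) &
            forall i, [/\ -1 <= l i, r i <= 1,
              c1 * K%:R `^ (- kappa) <= r i - l i &
              forall x, l i <= x <= r i ->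
                c2 * K%:R `^ ((kappa - 1) / 2) <= `|Ph P K x|]]].

Definition conjecture (P : nat -> {poly R}) :=
  (exists F, envelope P F) /\ oscillation P.

Definition zeta0 (F : R -> R) (b : R) : R -> R :=
  conv (fun x => F x * h_kappa x) (bump_b b).

Definition zeta1 (P : nat -> {poly R}) (F : R -> R) (alpha : R) K (b : R) :
    R -> R :=
  conv (fun x => F x * h_kappa x + alpha * ((P K).[x] * h_kappa x ^+ 2)) (bump_b b).

(* [1 <= K] makes [P K] orthogonal to the constants, hence [zeta1] of mass 1;
   [x0^-1 <= b] is the range of [b] in [scale_choice]. *)
Definition admissible_seqs (P : nat -> {poly R}) (F : R -> R)
    (alpha : nat -> R) (K : nat -> nat) (b : nat -> R) :=
  [/\ (forall n, [/\ 0 <= alpha n, (1 <= K n)%N, x0^-1 <= b n &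
         ((alpha n)%:E <= (sup_ratio (Ph P (K n)) F)^-1)%E]),
      alpha @ \oo --> 0,
      (forall M : nat, \forall n \near \oo, (M <= K n)%N) &
      b n @[n --> \oo] --> +oo].

End h_kappa.

Section mixing.
Variables (d1 d2 : nat) (a : R).

Definition first_row m n : 'M[R]_(m, n) :=
  \matrix_(i, j) (if i == 0%N :> nat then a else 0).

Definition mixing_mx : 'M[R]_(d1 + d2) :=
  block_mx 1%:M (first_row d1 d2) (first_row d2 d1) 1%:M.

(** [f] is the density of [A S], where [S] has independent coordinates with
    densities [zeta j]; vectors are rows here, so [A S] reads [s *m A^T]. *)
Definition mixture_density (zeta : 'I_(d1 + d2) -> R -> R)
    (f : 'rV[R]_(d1 + d2) -> R) :=
  [/\ measurable_fun setT f, (forall x, 0 <= f x) &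
      forall B, measurable B ->
        (\int[lebesgue_rV]_(x in B) (f x)%:E =
         \int[lebesgue_rV]_(s in [set s | B (s *m mixing_mx^T)])
           (\prod_(j < d1 + d2) zeta j (s ord0 j))%:E)%E].

Definition density_f0 kappa x0 F b :=
  mixture_density (fun=> zeta0 kappa x0 F b).

Definition density_fn kappa x0 P F alpha K b :=
  mixture_density (fun j => if j == 0%N :> nat
    then zeta1 kappa x0 P F alpha K b else zeta0 kappa x0 F b).

Definition contains_family kappa x0 P F (H : set ('rV[C]_(d1 + d2) -> C)) :=
  forall alpha K b n f, admissible_seqs kappa x0 P F alpha K b ->
    density_f0 kappa x0 F (b n) f \/
    density_fn kappa x0 P F (alpha n) (K n) (b n) f ->
    exists phi, [/\ H phi, analytic phi & extends phi (fourier f)].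

(* [Psi kappa S beta cbeta] is empty when [cbeta] is small compared to [S]: all
   its elements are bounded below near 0 uniformly, by the bounds on the Taylor
   coefficients. This condition on the parameters rules such cases out: [f_0]
   lies strictly inside the Sobolev ball of radius [cbeta]. *)
Definition sobolev_room kappa x0 F (beta cbeta : R) :=
  exists2 e, 0 < e & \forall b \near +oo, forall f,
    density_f0 kappa x0 F b f ->
    (sobolev_energy beta (fourier f) <= (cbeta - e)%:E)%E.

End mixing.

End least_favourable.

(* Main.v *)
(* Two-point lower bound. The laws of [f_0] and [f_n] differ only in the factor
   of [S_1], by [w = alpha (P_K h^2) * u_b], which is orthogonal to the
   polynomials of degree less than [K]. The noise is degenerate in all but the
   first coordinate of each block, where it is a small multiple of a law with
   density [q] proportional to the square of the Fourier transform of the bump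
   [u]: the derivatives of [q] decay and grow only geometrically with their
   order. Observing [A S + eps] smooths the law of [S_1] by a product of two
   translates of [q]; expanding it at order [K], only the Taylor remainder sees
   [w], so that the moment bounds of [zeta_0] make the total variation distance
   of the two observation laws at most [C^K K^(- kappa K)]. It is at most
   [1 / (2 n)] for [K] of order [log n / log log n].

   With [b] of order [K^kappa] and [alpha] of order
   [K^((1 - kappa) / 2 - kappa beta)], the Sobolev energy of [w] is bounded by a
   small constant, while the conjectured oscillations, wider than the support of
   [u_b], give [|w|_2^2 >= c K^(- 2 kappa beta)]. *)

Require Import Defs.
From HB Require Import structures.
From mathcomp Require Import all_boot all_order all_algebra.
From mathcomp Require Import all_classical all_reals all_analysis.
From mathcomp Require Import complex.
From mathcomp Require Import measurable_realfun ring lra zify.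
(* Again, because mathcomp has its own [bump] and [conv]. *)
Require Import Defs.

Set Implicit Arguments.
Unset Strict Implicit.
Unset Printing Implicit Defensive.

Import Order.TTheory GRing.Theory Num.Theory.
Import numFieldNormedType.Exports.
Import Normc.

Local Open Scope classical_set_scope.
Local Open Scope ring_scope.

(** A Taylor remainder of order [K] costs a [K]-th moment, which, up to geometric factors, may be as
    large as [K! K^(- kappa K)]. The [1 / K!] of the remainder cancels the factorial only if the
    derivatives of the noise density grow geometrically. Such a density is entire, so compactly
    supported noise is excluded; a density whose own Fourier transform has compact support
    qualifies, and squaring the transform of the bump makes it nonnegative. Membership in [Upsilon]
    is handled through moments. The hypothesis on one-variable densities is applied to [zeta0]; it
    becomes a bound on absolute moments, which carries over to [zeta1] because [zeta1 <= 2 * zeta0].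
    For the mixtures, [H] supplies the analytic extension and only the Taylor coefficients at 0
    remain to be bounded; the smallness of [T] pays for the passage from one to [d] variables. In
    the Sobolev ball [f_0] leaves a room [e], and the perturbation is scaled down by a constant
    until a weighted square inequality fits the cross terms into that room. *)

Lemma ge0_integralZlT (R : realType) dT (T : measurableType dT)
    (mu : {measure set T -> \bar R}) (f : T -> \bar R) (k : R) :
  measurable_fun setT f -> (forall x, 0 <= f x)%E -> 0 <= k ->
  (\int[mu]_x (k%:E * f x) = k%:E * \int[mu]_x f x)%E.
Proof. by move=> mf f0 k0; rewrite ge0_integralZl_EFin. Qed.

(** * Integration on [R] and on row vectors *)

Section real_line.
Context {R : realType}.
Local Notation leb := (@lebesgue_measure R).

Lemma leb_integralZl (f : R -> \bar R) (k : R) :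
  measurable_fun [set: R] f -> (forall x, 0 <= f x)%E -> 0 <= k ->
  (\int[leb]_x (k%:E * f x) = k%:E * \int[leb]_x f x)%E.
Proof. by move=> mf f0 k0; rewrite ge0_integralZl_EFin. Qed.

Lemma integral_inv_oneDsqr_lty :
  (\int[leb]_x ((1 + x ^+ 2)^-1)%:E < +oo)%E.
Proof.
have m1 : measurable_fun [set: R] (EFin \o (fun x : R => (1 + x ^+ 2)^-1)).
  apply/measurable_EFinP; apply: continuous_measurable_fun.
  by move=> x; exact: continuous_oneDsqrV.
have ge0 (x : R) : (0 <= ((1 + x ^+ 2)^-1)%:E)%E.
  by rewrite lee_fin invr_ge0 addr_ge0// sqr_ge0.
have half : (\int[leb]_(x in `[0%R, +oo[) ((1 + x ^+ 2)^-1)%:E = (pi / 2)%:E)%E.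
  exact: integral0y_oneDsqr.
rewrite -(setUv `[0%R, +oo[%classic) ge0_integral_setU//=; last first.
- by apply/disj_setPS => x [].
- by rewrite setUv.
- exact: measurableC.
rewrite half lte_add_pinfty ?ltry//.
apply: (@le_lt_trans _ _ (\int[leb]_(x in `]-oo, 0%R]) ((1 + x ^+ 2)^-1)%:E)%E).
  apply: ge0_subset_integral => //=.
  - exact: measurableC.
  - exact: measurable_funTS.
  - by move=> x /=; rewrite !in_itv/= andbT => /negP; rewrite -ltNge => /ltW.
have := @ge0_integration_by_substitution0 R (fun x => ((1 + x ^+ 2)^-1)%:E) m1 ge0.
by rewrite half; under [in X in _ = X -> _]eq_integral do rewrite sqrrN; move=> <-; rewrite ltry.
Qed.

Definition affine (c d : R) (x : measurableTypeR R) : measurableTypeR R := c * x + d.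

Lemma measurable_affine c d : measurable_fun setT (affine c d).
Proof. by apply: measurable_funD => //; apply: measurable_funM. Qed.

HB.instance Definition _ c d :=
  isMeasurableFun.Build _ _ _ _ (affine c d) (measurable_affine c d).

(** After multiplication by [c], the image measure gives every half-open interval its length, so the
    uniqueness of Lebesgue measure applies. *)
Lemma lebesgue_measure_affine (c d : R) (A : set R) : 0 < c -> measurable A ->
  pushforward leb (affine c d) A = ((c^-1)%:E * leb A)%E.
Proof.
move=> c0 mA.
rewrite -[LHS]mul1e -(@mulVf _ c) ?gt_eqF// EFinM -muleA; congr (_ * _)%E.
pose pf : {measure set (measurableTypeR R) -> \bar R} :=
  measure_function_pushforward__canonical__measure_function_Measure leb (measurable_affine c d).
suff : mscale (NngNum (ltW c0)) pf A = leb A by [].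
apply/esym/lebesgue_measure_unique => //= _ [[a b]] _ <-.
rewrite /mscale/= /pushforward.
have -> : affine c d @^-1` [set` `]a, b]] = [set` `](a - d) / c, (b - d) / c]].
  apply/seteqP; split => x /=;
  by rewrite !in_itv/= ltr_pdivrMr// ler_pdivlMr// ltrBlDr lerBrDr (mulrC x).
rewrite !lebesgue_measure_itv/= !lte_fin ltr_pM2r ?invr_gt0// ltrD2r; case: ifPn => ab.
  by rewrite -!EFinB -EFinM; congr (_%:E); field; rewrite gt_eqF.
by rewrite mule0.
Qed.

Lemma ge0_integral_opp (f : R -> \bar R) :
  measurable_fun [set: R] f -> (forall x, 0 <= f x)%E ->
  (\int[leb]_x f x = \int[leb]_x f (- x)%R)%E.
Proof.
move=> mf f0.
transitivity (\int[pushforward leb (-%R : _ -> measurableTypeR R)]_x f x)%E.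
  by apply: eq_measure_integral => A mA _; rewrite -[LHS]lebesgue_measureN.
by rewrite ge0_integral_pushforward.
Qed.

Lemma ge0_integral_affine (c d : R) (f : R -> \bar R) : c != 0 ->
  measurable_fun [set: R] f -> (forall x, 0 <= f x)%E ->
  (\int[leb]_x f x = `|c|%:E * \int[leb]_x f (c * x + d)%R)%E.
Proof.
wlog c0 : c d f / 0 < c.
  move=> H cn0 mf f0; have [c0|c0] := ltP 0 c; first exact: H.
  have {}c0 : 0 < - c by rewrite oppr_gt0 lt_neqAle cn0.
  have mfN : measurable_fun [set: R] (f \o -%R) by exact: measurableT_comp.
  rewrite ge0_integral_opp// (H (- c) (- d) (f \o -%R))//; last 2 first.
  - by rewrite oppr_eq0.
  - by move=> x; exact: f0.
  rewrite normrN; congr (_ * _)%E; apply: eq_integral => x _ /=.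
  by rewrite mulNr -opprD opprK.
move=> cn0 mf f0; rewrite gtr0_norm//.
rewrite -[LHS]mul1e -(@mulfV _ c)// EFinM -muleA; congr (_ * _)%E.
have ci0 : 0 < c^-1 by rewrite invr_gt0.
transitivity (\int[mscale (NngNum (ltW ci0)) leb]_x f x)%E.
  by rewrite ge0_integral_mscale.
rewrite [LHS](eq_measure_integral (pushforward leb (affine c d))) => [|A mA _].
  by rewrite ge0_integral_pushforward//; exact: measurable_affine.
by rewrite [RHS]lebesgue_measure_affine.
Qed.
End real_line.

(** * Lebesgue measure on row vectors and linear changes of variables *)

Section rV.
Context {R : realType}.
Local Notation leb := (@lebesgue_measure R).
Local Notation lam d := (@lebesgue_rV R d).

Lemma measurable_mulmx m n (M : 'M[R]_(m, n)) :
  measurable_fun [set: 'rV[R]_m] (fun x => x *m M).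
Proof.
apply: measurable_fun_rV => j; under eq_fun do rewrite mxE.
apply: measurable_sum => i; apply: measurable_funM => //.
exact: measurable_rV_coord.
Qed.

Lemma measurable_row_mx dT (T : measurableType dT) m n (f : T -> 'rV[R]_m) (g : T -> 'rV[R]_n) :
  measurable_fun setT f -> measurable_fun setT g ->
  measurable_fun setT (fun x => row_mx (f x) (g x)).
Proof.
move=> mf mg; apply: measurable_fun_rV => i; case: (split_ordP i) => j ->.
- under eq_fun do rewrite row_mxEl.
  exact: (measurableT_comp (measurable_rV_coord j)).
- under eq_fun do rewrite row_mxEr.
  exact: (measurableT_comp (measurable_rV_coord j)).
Qed.

Lemma measurable_addmx dT (T : measurableType dT) n (f g : T -> 'rV[R]_n) :
  measurable_fun setT f -> measurable_fun setT g ->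
  measurable_fun setT (fun x => f x + g x).
Proof.
move=> mf mg; apply: measurable_fun_rV => i; under eq_fun do rewrite mxE.
by apply: measurable_funD; exact: (measurableT_comp (measurable_rV_coord i)).
Qed.

Lemma measurable_scalar_mx : measurable_fun [set: R] (fun x => x%:M : 'rV[R]_1).
Proof. apply: measurable_fun_rV => i; under eq_fun do rewrite mxE.
by rewrite !ord1 eqxx; under eq_fun do rewrite mulr1n; exact: measurable_id. Qed.

(** Sigma-finiteness, which Tonelli's theorem requires, is carried over from tuples along the
    inverse of the map that defines [lebesgue_rV]. *)
Let lam_sigma_finite d : sigma_finite setT (lam d).
Proof.
have [F TF Foo] := sigma_finiteT (power_measure leb d).
pose tt := fun x : 'rV[R]_d => [tuple x ord0 i | i < d] : d.-tuple R.
have rowK : cancel (fun t : d.-tuple R => \row_i tnth t i : 'rV[R]_d) tt.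
  by move=> t; apply: eq_from_tnth => i; rewrite tnth_mktuple mxE.
have mtt : measurable_fun setT tt.
  apply/measurable_fun_tnthP => i.
  rewrite [X in measurable_fun _ X](_ : _ = (fun x : 'rV[R]_d => x ord0 i)).
    exact: measurable_rV_coord.
  by apply/funext => x /=; rewrite tnth_mktuple.
exists (fun k => tt @^-1` F k).
  by rewrite -preimage_bigcup -TF preimage_setT.
move=> k; have [mF Fk] := Foo k; split.
  by rewrite -[X in measurable X]setTI; exact: mtt.
rewrite /lebesgue_rV /pushforward /=.
rewrite (_ : _ @^-1` _ = F k)//.
by apply/seteqP; split => t /=; rewrite rowK.
Qed.

HB.instance Definition _ d :=
  Measure_isSigmaFinite.Build _ _ _ (lam d) (@lam_sigma_finite d).

Lemma integral_rV_recl d (f : 'rV[R]_d.+1 -> \bar R) :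
  measurable_fun setT f -> (forall x, 0 <= f x)%E ->
  (\int[lam d.+1]_x f x = \int[leb]_x \int[lam d]_y f (row_mx x%:M y : 'rV_(1 + d)))%E.
Proof.
move=> mf f0.
rewrite ge0_integral_pushforward//; last exact: measurable_rV_of_tuple.
rewrite preimage_setT /=.
have mg : measurable_fun setT (f \o (fun t : d.+1.-tuple R => \row_(i < d.+1) tnth t i)).
  exact: (measurableT_comp mf (@measurable_rV_of_tuple _ _)).
rewrite ge0_integral_pushforward//; last exact: measurable_tuple_cons.
rewrite preimage_setT fubini_tonelli1//; last 2 first.
- exact: (measurableT_comp mg (@measurable_tuple_cons _ _ _)).
- by move=> x; exact: f0.
apply: eq_integral => x _; rewrite /fubini_F/=.
rewrite [in RHS]ge0_integral_pushforward//; last 2 first.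
- exact: measurable_rV_of_tuple.
- apply: (measurableT_comp mf).
  apply: (@measurable_row_mx _ _ 1 d); last exact: measurable_id.
  exact: measurable_cst.
rewrite preimage_setT; apply: eq_integral => t _ /=; congr (f _).
apply/rowP => i; rewrite mxE.
case: (@split_ordP 1 d i) => j ->.
  rewrite (@row_mxEl _ 1 1 d) !ord1 mxE eqxx mulr1n.
  by rewrite (tnth_nth 0).
rewrite (@row_mxEr _ 1 1 d) mxE (tnth_nth 0) [RHS](tnth_nth 0) /=.
by rewrite add0n.
Qed.

Definition rV_cons d (p : R * 'rV[R]_d) : 'rV[R]_d.+1 := row_mx p.1%:M p.2 : 'rV_(1 + d).

Lemma measurable_rV_cons d : measurable_fun setT (@rV_cons d).
Proof.
apply: (@measurable_row_mx _ _ 1 d); last exact: measurable_snd.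
exact: (measurableT_comp measurable_scalar_mx measurable_fst).
Qed.

Lemma rV_cons_surj d (v : 'rV[R]_d.+1) : exists x y, v = rV_cons (x, y).
Proof.
exists ((lsubmx (v : 'rV_(1 + d))) ord0 ord0), (rsubmx (v : 'rV_(1 + d))).
rewrite /rV_cons/=.
suff -> : ((lsubmx (v : 'rV_(1 + d))) ord0 ord0)%:M = lsubmx (v : 'rV_(1 + d)) by rewrite hsubmxK.
by apply/rowP => i; rewrite !ord1 !mxE eqxx mulr1n.
Qed.

Lemma rV_cons_ord0 d x (y : 'rV[R]_d) : rV_cons (x, y) ord0 ord0 = x.
Proof.
have := @row_mxEl R 1 1 d x%:M y ord0 ord0; rewrite [RHS]mxE eqxx mulr1n => {2}<-.
by congr (_ _ _); exact: val_inj.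
Qed.

Lemma rV_cons_lift d x (y : 'rV[R]_d) i : rV_cons (x, y) ord0 (lift ord0 i) = y ord0 i.
Proof.
have := @row_mxEr R 1 1 d x%:M y ord0 i => <-.
by congr (_ _ _); exact: val_inj.
Qed.

Lemma ge0_integral_rV_cons d (f : 'rV[R]_d.+1 -> \bar R) :
  measurable_fun setT f -> (forall x, 0 <= f x)%E ->
  (\int[lam d.+1]_x f x = \int[leb]_x \int[lam d]_y f (rV_cons (x, y)))%E.
Proof. exact: integral_rV_recl. Qed.

Lemma rV0_all (x y : 'rV[R]_0) : x = y.
Proof. by apply/rowP => -[]. Qed.

Lemma measurable_integral_rV_cons d (f : 'rV[R]_d.+1 -> \bar R) :
  measurable_fun setT f -> (forall x, 0 <= f x)%E ->
  measurable_fun [set: R] (fun x => \int[lam d]_y f (rV_cons (x, y)))%E.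
Proof.
move=> mf f0.
apply: (@measurable_fun_fubini_tonelli_F _ _ _ _ _ (lam d) (f \o @rV_cons d)).
  by apply: (measurableT_comp mf); exact: measurable_rV_cons.
by move=> p; exact: f0.
Qed.

Lemma measurable_rV_cons_r d x : measurable_fun setT (fun y : 'rV[R]_d => rV_cons (x, y)).
Proof. exact: (measurableT_comp (@measurable_rV_cons d) (measurable_pair1 x)). Qed.

Lemma ge0_integral_rV_shift d (v : 'rV[R]_d) (f : 'rV[R]_d -> \bar R) :
  measurable_fun setT f -> (forall x, 0 <= f x)%E ->
  (\int[lam d]_x f (x + v)%R = \int[lam d]_x f x)%E.
Proof.
elim: d v f => [|d IH] v f mf f0.
  by apply: eq_integral => x _; congr (f _); exact: rV0_all.
have mfv : measurable_fun [set: 'rV[R]_d.+1] (fun x => f (x + v)).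
  by apply: (measurableT_comp mf); exact: measurable_addmx.
rewrite (ge0_integral_rV_cons mfv (fun x => f0 _)) (ge0_integral_rV_cons mf f0).
have [x0 [y0 ->]] := rV_cons_surj v.
rewrite [RHS](@ge0_integral_affine _ 1 x0) ?oner_neq0//; last 2 first.
- exact: measurable_integral_rV_cons.
- by move=> x; exact: integral_ge0.
rewrite normr1 mul1e; apply: eq_integral => x _.
rewrite -[RHS](IH y0); last 2 first.
- by apply: (measurableT_comp mf); exact: measurable_rV_cons_r.
- by move=> y; exact: f0.
apply: eq_integral => y _; congr (f _).
by rewrite /rV_cons/= (@add_row_mx _ 1 1 d) mul1r -raddfD.
Qed.

(* Only the existence of the Jacobian constant matters, hence no determinant. *)
Definition lin_jac d (M : 'M[R]_d) := exists2 k : R, 0 < k &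
  forall f : 'rV[R]_d -> \bar R, measurable_fun setT f -> (forall x, 0 <= f x)%E ->
  (\int[lam d]_x f (x *m M)%R = k%:E * \int[lam d]_x f x)%E.

Lemma lin_jacM d (M N : 'M[R]_d) : lin_jac M -> lin_jac N -> lin_jac (M *m N).
Proof.
move=> [k k0 kM] [l l0 lN]; exists (k * l); first exact: mulr_gt0.
move=> f mf f0; under eq_integral do rewrite mulmxA.
rewrite (kM (fun x => f (x *m N)))//; last first.
  by apply: (measurableT_comp mf); exact: measurable_mulmx.
by rewrite lN// EFinM muleA.
Qed.

(** Induction on the dimension. The coordinates after the first are transformed by the smaller
    triangular block; with them fixed, the first one undergoes an affine substitution, so it is
    integrated first. *)
Lemma lin_jac_trig d (M : 'M[R]_d) : is_trig_mx M -> (forall i, M i i != 0) -> lin_jac M.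
Proof.
elim: d M => [|d IH] M Mt Mi.
  exists 1 => // f mf f0; rewrite mul1e.
  by apply: eq_integral => x _; congr (f _); exact: rV0_all.
pose B : 'M[R]_(1 + d) := M.
have uE : ursubmx B = 0.
  apply/matrixP => i j; rewrite !mxE; apply: (is_trig_mxP Mt).
  by rewrite ord1.
have [k k0 kD] : lin_jac (drsubmx B).
  apply: IH; last by move=> i; rewrite !mxE; exact: Mi.
  by apply/is_trig_mxP => i j ij; rewrite !mxE; apply: (is_trig_mxP Mt).
set m := M ord0 ord0; have m0 : m != 0 by exact: Mi.
have MxE (x : R) (y : 'rV[R]_d) : rV_cons (x, y) *m M =
    rV_cons (m * x + (y *m dlsubmx B) ord0 ord0, y *m drsubmx B).
  rewrite /rV_cons/= -[M in LHS]/B -[B in LHS]submxK uE.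
  rewrite (@mul_row_block _ 1 1 d 1 d) mulmx0 add0r; apply: (congr2 (@row_mx _ 1 1 d)) => //.
  apply/rowP => i; rewrite !ord1 !mxE !eqxx !mulr1n big_ord1 !mxE eqxx mulr1n; congr (_ + _).
  rewrite mulrC; congr (M _ _ * _); exact: val_inj.
exists (`|m|^-1 * k); first by rewrite mulr_gt0// invr_gt0 normr_gt0.
move=> f mf f0.
have mM : measurable_fun [set: 'rV[R]_d.+1] (fun x => f (x *m M)).
  by apply: (measurableT_comp mf); exact: measurable_mulmx.
rewrite (ge0_integral_rV_cons mM (fun x => f0 _)) (ge0_integral_rV_cons mf f0).
under eq_integral do under eq_integral do rewrite MxE.
pose g (p : R * 'rV[R]_d) := f (rV_cons (m * p.1 + (p.2 *m dlsubmx B) ord0 ord0, p.2 *m drsubmx B)).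
have mc : measurable_fun setT (fun p : R * 'rV[R]_d => (p.2 *m dlsubmx B) ord0 ord0).
  apply: (measurableT_comp (measurable_rV_coord ord0)).
  exact: (measurableT_comp (measurable_mulmx _) measurable_snd).
have mg : measurable_fun setT g.
  apply: (measurableT_comp mf); apply: (measurableT_comp (@measurable_rV_cons d)).
  apply/measurable_fun_pairP; split => /=.
    by apply: measurable_funD => //; apply: measurable_funM.
  exact: (measurableT_comp (measurable_mulmx _) measurable_snd).
etransitivity.
  exact: (fubini_tonelli (m1 := leb) (m2 := lam d) g mg (fun p => f0 _)).
pose h y := (\int[leb]_x f (rV_cons (x, y)))%E.
have mh : measurable_fun setT h.
  apply: (@measurable_fun_fubini_tonelli_G _ _ _ _ _ leb (f \o @rV_cons d)).
    by apply: (measurableT_comp mf); exact: measurable_rV_cons.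
  by move=> p; exact: f0.
transitivity (\int[lam d]_y (`|m|^-1%:E * h (y *m drsubmx B)))%E.
  apply: eq_integral => y _.
  rewrite /h (@ge0_integral_affine _ m ((y *m dlsubmx B) ord0 ord0))//; last first.
    by apply: (measurableT_comp mf); exact: (measurableT_comp (@measurable_rV_cons d) (measurable_pair2 _)).
  by rewrite muleA -EFinM mulVf ?mul1e ?normr_eq0.
rewrite (@ge0_integralZlT _ _ _ _ (fun y => h (y *m drsubmx B))); last 3 first.
- by apply: (measurableT_comp mh); exact: measurable_mulmx.
- by move=> y; exact: integral_ge0.
- by rewrite invr_ge0.
rewrite (kD h mh); last by move=> y; exact: integral_ge0.
rewrite EFinM -muleA; congr (_ * (_ * _))%E.
apply/esym/(fubini_tonelli (m1 := leb) (m2 := lam d) (f \o @rV_cons d)).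
  by apply: (measurableT_comp mf); exact: measurable_rV_cons.
by move=> p; exact: f0.
Qed.

(** Here the first coordinate is only scaled; with it fixed, the others undergo a linear map
    followed by a translation, so they are integrated first. *)
Lemma lin_jac_trig_tr d (M : 'M[R]_d) : is_trig_mx M^T -> (forall i, M i i != 0) -> lin_jac M.
Proof.
elim: d M => [|d IH] M Mt Mi.
  exists 1 => // f mf f0; rewrite mul1e.
  by apply: eq_integral => x _; congr (f _); exact: rV0_all.
pose B : 'M[R]_(1 + d) := M.
have uE : dlsubmx B = 0.
  apply/matrixP => i j; rewrite !mxE.
  have := is_trig_mxP Mt; move=> /(_ (lshift d j) (rshift 1 i)); rewrite !mxE; apply.
  by rewrite ord1.
have [k k0 kD] : lin_jac (drsubmx B).
  apply: IH; last by move=> i; rewrite !mxE; exact: Mi.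
  apply/is_trig_mxP => i j ij; rewrite !mxE.
  by have := is_trig_mxP Mt; move=> /(_ (rshift 1 i) (rshift 1 j)); rewrite !mxE; apply.
set m := M ord0 ord0; have m0 : m != 0 by exact: Mi.
have MxE (x : R) (y : 'rV[R]_d) : rV_cons (x, y) *m M =
    rV_cons (m * x + 0, y *m drsubmx B + x *: ursubmx B).
  rewrite /rV_cons/= -[M in LHS]/B -[B in LHS]submxK uE.
  rewrite (@mul_row_block _ 1 1 d 1 d) mulmx0 !addr0 addrC mul_scalar_mx; apply: (congr2 (@row_mx _ 1 1 d)) => //.
  2: by rewrite mul_scalar_mx.
  apply/rowP => i; rewrite !ord1 !mxE !eqxx !mulr1n.
  rewrite mulrC; congr (M _ _ * _); exact: val_inj.
exists (`|m|^-1 * k); first by rewrite mulr_gt0// invr_gt0 normr_gt0.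
move=> f mf f0.
have mM : measurable_fun [set: 'rV[R]_d.+1] (fun x => f (x *m M)).
  by apply: (measurableT_comp mf); exact: measurable_mulmx.
rewrite (ge0_integral_rV_cons mM (fun x => f0 _)) (ge0_integral_rV_cons mf f0).
under eq_integral do under eq_integral do rewrite MxE.
have mfc x : measurable_fun setT (fun y : 'rV[R]_d => f (rV_cons (x, y))).
  by apply: (measurableT_comp mf); exact: measurable_rV_cons_r.
pose h x := (\int[lam d]_y f (rV_cons (x, y)))%E.
have mh : measurable_fun [set: R] h by exact: measurable_integral_rV_cons.
have h0 x : (0 <= h x)%E by exact: integral_ge0.
transitivity (\int[leb]_x (k%:E * h (m * x + 0)%R))%E.
  apply: eq_integral => x _.
  rewrite (kD (fun y => f (rV_cons (m * x + 0, y + x *: ursubmx B))))//; last first.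
    by apply: (measurableT_comp (mfc _)); exact: measurable_addmx.
  by rewrite (@ge0_integral_rV_shift _ _ (fun y => f (rV_cons (m * x + 0, y)))).
rewrite (@leb_integralZl _ (fun x => h (m * x + 0)%R)); last 3 first.
- apply: (measurableT_comp mh).
  by apply: measurable_funD => //; apply: measurable_funM.
- by move=> x; exact: h0.
- exact: ltW.
rewrite -/(h) [in RHS](@ge0_integral_affine _ m 0)//.
by rewrite muleA -EFinM mulrAC mulVf ?normr_eq0// mul1r.
Qed.

(** Block LU factorization with Schur complement [1%:M - C *m B]. Since only the first row of [B] is
    nonzero, [C *m B] has first row [a ^+ 2] and zeros below: the complement is triangular, with
    first diagonal entry [1 - a ^+ 2], nonzero for [|a| < 1], and the others 1. *)
Lemma lin_jac_mixing d1 d2 (a : R) : (0 < d1)%N -> (0 < d2)%N -> `|a| < 1 ->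
  [/\ lin_jac (mixing_mx d1 d2 a), lin_jac (mixing_mx d1 d2 a)^T &
      mixing_mx d1 d2 a \in unitmx].
Proof.
move=> d1_gt0 d2_gt0 a1.
pose B := first_row a d1 d2; pose C := first_row a d2 d1.
pose L : 'M[R]_(d1 + d2) := block_mx 1%:M 0 C 1%:M.
pose U : 'M[R]_(d1 + d2) := block_mx 1%:M B 0 (1%:M - C *m B).
have ALU : mixing_mx d1 d2 a = L *m U.
  by rewrite mulmx_block !mul1mx !mul0mx !mulmx1 !addr0 [C *m B + _]addrC subrK.
have CBE i j : (C *m B) i j = if i == 0%N :> nat then a ^+ 2 else 0.
  rewrite mxE (bigD1 (Ordinal d1_gt0))//= big1 ?addr0; last first.
    move=> k /negbTE k0; rewrite !mxE [X in _ * (if X then _ else _)](_ : _ = false) ?mulr0//.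
  by rewrite !mxE/=; case: ifP => _; rewrite ?mul0r ?expr2.
have tL : is_trig_mx L.
  apply/is_trig_mxP => i j.
  case: (split_ordP i) => i' ->; case: (split_ordP j) => j' ->.
  - by rewrite block_mxEul mxE/= => ij; rewrite -val_eqE /= (ltn_eqF ij).
  - by rewrite block_mxEur mxE.
  - by rewrite /= ltnNge (leq_trans (ltnW (ltn_ord j')))// leq_addr.
  - by rewrite block_mxEdr mxE/= ltn_add2l => ij; rewrite -val_eqE /= (ltn_eqF ij).
have tU : is_trig_mx U^T.
  apply/is_trig_mxP => j i; rewrite mxE.
  case: (split_ordP i) => i' ->; case: (split_ordP j) => j' ->.
  - by rewrite block_mxEul mxE/= => ij; rewrite -val_eqE /= (gtn_eqF ij).
  - by rewrite /= ltnNge (leq_trans (ltnW (ltn_ord i')))// leq_addr.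
  - by rewrite block_mxEdl mxE.
  - rewrite block_mxEdr mxE [X in _ + X]mxE CBE mxE/= ltn_add2l => ij.
    rewrite -val_eqE /= (gtn_eqF ij) add0r ifF ?oppr0//.
    by apply/negbTE; rewrite -lt0n (leq_ltn_trans _ ij).
have dL i : L i i = 1.
  by case: (split_ordP i) => i' ->; rewrite ?block_mxEul ?block_mxEdr mxE eqxx.
have dU i : U i i != 0.
  case: (split_ordP i) => i' ->; rewrite ?block_mxEul ?block_mxEdr.
    by rewrite mxE eqxx oner_neq0.
  rewrite mxE [X in _ + X]mxE CBE mxE eqxx; case: ifP => _; last by rewrite subr0 oner_neq0.
  by rewrite subr_eq0 eq_sym lt_eqF// -real_normK ?num_real// expr_lt1.
have dL0 i : L i i != 0 by rewrite dL oner_neq0.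
rewrite ALU; split; first by apply: lin_jacM; [exact: lin_jac_trig|exact: lin_jac_trig_tr].
  2: rewrite unitmxE unitfE det_mulmx (det_trig tL) -det_tr (det_trig tU) mulf_neq0//.
  2: by apply/prodf_neq0 => i _; exact: dL0.
  2: by apply/prodf_neq0 => i _; rewrite [U^T i i]mxE; exact: dU.
rewrite trmx_mul; apply: lin_jacM; [apply: lin_jac_trig|apply: lin_jac_trig_tr] => //.
- by move=> i; rewrite mxE.
- by rewrite trmxK.
- by move=> i; rewrite mxE.
Qed.

End rV.

(** * Densities and linear mixtures *)

Section transport.
Context {R : realType} d1 d2 (X : measurableType d1) (Y : measurableType d2).
Variables (mu : {measure set X -> \bar R}) (nu : {measure set Y -> \bar R}).
Variables (f : X -> R) (p : Y -> R) (T : Y -> X).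

(* Change of variables for densities: [f dmu] is the image of [p dnu] by [T]. *)
Definition dens_push := forall G : X -> \bar R, measurable_fun setT G ->
  (forall x, 0 <= G x)%E ->
  (\int[mu]_x (G x * (f x)%:E) = \int[nu]_y (G (T y) * (p y)%:E))%E.

Hypotheses (mf : measurable_fun setT f) (mp : measurable_fun setT p)
  (mT : measurable_fun setT T) (f0 : forall x, 0 <= f x) (p0 : forall y, 0 <= p y)
  (H : dens_push).

Lemma dens_push_ge0 (G : X -> R) : measurable_fun setT G -> (forall x, 0 <= G x) ->
  (\int[mu]_x (G x * f x)%:E = \int[nu]_y (G (T y) * p y)%:E)%E.
Proof.
move=> mG G0; rewrite (@H (EFin \o G))//; exact/measurable_EFinP.
Qed.

Lemma dens_push_abs (G : X -> R) : measurable_fun setT G ->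
  (\int[mu]_x `|(G x * f x)%:E| = \int[nu]_y `|(G (T y) * p y)%:E|)%E.
Proof.
move=> mG; under eq_integral do rewrite /= normrM (ger0_norm (f0 _)).
under [in RHS]eq_integral do rewrite /= normrM (ger0_norm (p0 _)).
by rewrite (dens_push_ge0 (G := fun x => `|G x|))//; exact: measurableT_comp.
Qed.

Lemma dens_push_integrable (G : X -> R) : measurable_fun setT G ->
  nu.-integrable setT (fun y => (G (T y) * p y)%:E) ->
  mu.-integrable setT (fun x => (G x * f x)%:E).
Proof.
move=> mG /integrableP[_ Goo]; apply/integrableP; split.
  by apply/measurable_EFinP; exact: measurable_funM.
by rewrite dens_push_abs.
Qed.

Lemma dens_push_Rintegral (G : X -> R) : measurable_fun setT G ->
  nu.-integrable setT (fun y => (G (T y) * p y)%:E) ->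
  \int[mu]_x (G x * f x) = \int[nu]_y (G (T y) * p y).
Proof.
move=> mG iG.
pose Gp x := Num.max (G x) 0; pose Gn x := Num.max (- G x) 0.
have mGp : measurable_fun setT Gp by exact: measurable_maxr.
have mGn : measurable_fun setT Gn by apply: measurable_maxr => //; exact: measurableT_comp.
have Gp0 x : 0 <= Gp x by rewrite le_max lexx orbT.
have Gn0 x : 0 <= Gn x by rewrite le_max lexx orbT.
have GE x : G x = Gp x - Gn x.
  rewrite /Gp /Gn; have [G0|G0] := leP 0 (G x).
    by rewrite (max_idPr _) ?subr0// oppr_le0.
  by rewrite (max_idPl _) ?sub0r ?opprK// oppr_ge0 ltW.
have Gple x : `|Gp x| <= `|G x|.
  by rewrite ger0_norm// ge_max normr_ge0 ler_norm.
have Gnle x : `|Gn x| <= `|G x|.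
  by rewrite ger0_norm// ge_max normr_ge0 -normrN ler_norm.
have iGp : nu.-integrable setT (fun y => (Gp (T y) * p y)%:E).
  apply: le_integrable iG => //.
    by apply/measurable_EFinP; apply: measurable_funM => //; exact: measurableT_comp.
  by move=> y _ /=; rewrite lee_fin !normrM ler_wpM2r.
have iGn : nu.-integrable setT (fun y => (Gn (T y) * p y)%:E).
  apply: le_integrable iG => //.
    by apply/measurable_EFinP; apply: measurable_funM => //; exact: measurableT_comp.
  by move=> y _ /=; rewrite lee_fin !normrM ler_wpM2r.
transitivity (\int[mu]_x (Gp x * f x - Gn x * f x)).
  by apply: eq_Rintegral => x _; rewrite -mulrBl -GE.
rewrite RintegralB//; [|exact: dens_push_integrable..].
transitivity (\int[nu]_x (Gp (T x) * p x - Gn (T x) * p x)); last first.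
  by apply: eq_Rintegral => x _; rewrite -mulrBl -GE.
by rewrite RintegralB//; congr (_ - _); rewrite /Rintegral dens_push_ge0.
Qed.
End transport.

Section density_measure.
Context {R : realType} dX (X : measurableType dX) (mu : {measure set X -> \bar R}).

Record pdf := Pdf { pdf_fun :> X -> R;
  measurable_pdf : measurable_fun setT pdf_fun;
  pdf_ge0 : forall x, 0 <= pdf_fun x;
  integral_pdf : (\int[mu]_x (pdf_fun x)%:E = 1)%E }.

Definition pdf_measure (f : pdf) (A : set X) : \bar R := (\int[mu]_(x in A) (f x)%:E)%E.

Variable f : pdf.

Let mfE : measurable_fun setT (fun x => (f x)%:E).
Proof. by apply/measurable_EFinP; exact: measurable_pdf. Qed.

Let m0 : pdf_measure f set0 = 0%E.
Proof. exact: integral_set0. Qed.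

Let mge0 A : (0 <= pdf_measure f A)%E.
Proof. by apply: integral_ge0 => x _; rewrite lee_fin pdf_ge0. Qed.

Let msigma : semi_sigma_additive (pdf_measure f).
Proof.
move=> F mF tF mUF; rewrite /pdf_measure ge0_integral_bigcup//.
- apply: is_cvg_ereal_nneg_natsum_cond => n _ _.
  by apply: integral_ge0 => x _; rewrite lee_fin pdf_ge0.
- exact: measurable_funTS.
- by move=> x _; rewrite lee_fin pdf_ge0.
Qed.

HB.instance Definition _ := isMeasure.Build _ _ _ (pdf_measure f) m0 mge0 msigma.

Let mprob : pdf_measure f setT = 1%E.
Proof. exact: integral_pdf. Qed.

HB.instance Definition _ := Measure_isProbability.Build _ _ _ (pdf_measure f) mprob.

End density_measure.

Section density_integral.
Context {R : realType} dX (X : measurableType dX) (mu : {measure set X -> \bar R}).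
Import HBNNSimple.

(** From indicators to simple functions by linearity, then to nonnegative functions by monotone
    convergence. *)
Lemma dens_push_measure (nu : {measure set X -> \bar R}) (f : X -> R) :
  measurable_fun setT f -> (forall x, 0 <= f x) ->
  (forall B, measurable B -> nu B = \int[mu]_(x in B) (f x)%:E)%E ->
  forall G : X -> \bar R, measurable_fun setT G -> (forall x, 0 <= G x)%E ->
  (\int[mu]_x (G x * (f x)%:E) = \int[nu]_x G x)%E.
Proof.
move=> mf f0 nuE G mG G0.
have mfE : measurable_fun setT (EFin \o f) by exact/measurable_EFinP.
pose h := nnsfun_approx measurableT mG.
have hG x : (EFin \o h n) x @[n --> \oo] --> G x by exact: cvg_nnsfun_approx.
transitivity (limn (fun n => \int[mu]_x ((h n x)%:E * (f x)%:E)))%E.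
  rewrite -monotone_convergence//.
  - apply: eq_integral => x _; apply/esym/cvg_lim => //.
    apply: cvgeZr => //.
    exact: hG.
  - by move=> n; apply: emeasurable_funM => //; exact/measurable_EFinP/measurable_funP.
  - by move=> n x _; rewrite mule_ge0// lee_fin.
  - move=> x _ m n mn; rewrite lee_wpmul2r// lee_fin//; exact/lefP/nd_nnsfun_approx.
transitivity (limn (fun n => \int[nu]_x (h n x)%:E))%E; last first.
  rewrite -monotone_convergence//.
  - by apply: eq_integral => x _; apply/cvg_lim => //; exact: hG.
  - by move=> n; exact/measurable_EFinP/measurable_funP.
  - by move=> n x _; rewrite lee_fin.
  - by move=> x _ m n mn; rewrite lee_fin//; exact/lefP/nd_nnsfun_approx.
congr (limn _); apply/funext => n.
have mI k : measurable_fun setT (fun x => (k * \1_(h n @^-1` [set k]) x)%:E).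
  by apply/measurable_EFinP; exact: measurable_funM.
have hI k x : (0 <= (k * \1_(h n @^-1` [set k]) x)%:E)%E.
  by rewrite EFinM nnfun_muleindic_ge0.
transitivity (\sum_(k \in range (h n)) \int[mu]_x ((k * \1_(h n @^-1` [set k]) x)%:E * (f x)%:E))%E.
  rewrite -ge0_integral_fsum//; last 2 first.
  - by move=> k; exact: emeasurable_funM.
  - by move=> k x _; apply: mule_ge0; [exact: hI|rewrite lee_fin].
  apply: eq_integral => x _; rewrite fimfunE -fsumEFin// ge0_mule_fsuml//.
transitivity (\sum_(k \in range (h n)) \int[nu]_x (k * \1_(h n @^-1` [set k]) x)%:E)%E; last first.
  rewrite -ge0_integral_fsum//.
  by apply: eq_integral => x _; rewrite fimfunE fsumEFin.
apply: eq_fsbigr => k; rewrite inE => -[y _ <-].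
rewrite integralZl_indic_nnsfun//.
rewrite integral_indic//= setIT nuE//.
under eq_integral do rewrite EFinM -muleA.
rewrite ge0_integralZl_EFin//; last 2 first.
- by move=> x _; rewrite -EFinM lee_fin mulr_ge0.
- by apply: emeasurable_funM => //; exact/measurable_EFinP.
congr (_ * _)%E; rewrite [RHS]integral_mkcond; apply: eq_integral => x _.
by rewrite patchE indicE; case: ifP => _; rewrite ?mul1e ?mul0e.
Qed.

End density_integral.

Section products.
Context {R : realType} d1 d2 (X : measurableType d1) (Y : measurableType d2).
Variables (mu : {sigma_finite_measure set X -> \bar R})
  (nu : {sigma_finite_measure set Y -> \bar R}).
Variables (f : X -> R) (g : Y -> R).
Hypotheses (fi : mu.-integrable setT (EFin \o f)) (gi : nu.-integrable setT (EFin \o g)).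

Let mf : measurable_fun setT f.
Proof. by have /measurable_int/measurable_EFinP := fi. Qed.

Let mg : measurable_fun setT g.
Proof. by have /measurable_int/measurable_EFinP := gi. Qed.

Lemma integrable_prodM : (mu \x nu)%E.-integrable setT (fun p => (f p.1 * g p.2)%:E).
Proof.
have mfg : measurable_fun setT (fun p : X * Y => f p.1 * g p.2).
  by apply: measurable_funM; [exact: (measurableT_comp mf)|exact: (measurableT_comp mg)].
apply/integrable12ltyP; first exact/measurable_EFinP.
have gfin : (\int[nu]_y `|(g y)%:E|)%E \is a fin_num.
  by rewrite ge0_fin_numE ?integral_ge0//; have /integrableP[] := gi.
have ffin : (\int[mu]_y `|(f y)%:E|)%E \is a fin_num.
  by rewrite ge0_fin_numE ?integral_ge0//; have /integrableP[] := fi.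
under eq_integral => x _.
  under eq_integral do rewrite EFinM abseM /=.
  rewrite ge0_integralZl_EFin//; last first.
    by do 2 apply: measurableT_comp => //; exact/measurable_EFinP.
  rewrite muleC -(fineK gfin).
  over.
rewrite ge0_integralZl_EFin//; last 2 first.
- by do 2 apply: measurableT_comp => //; exact/measurable_EFinP.
- by rewrite fine_ge0// integral_ge0.
by rewrite -(fineK ffin) -EFinM ltry.
Qed.

Lemma Rintegral_prodM :
  \int[(mu \x nu)%E]_p (f p.1 * g p.2) = (\int[mu]_x f x) * (\int[nu]_y g y).
Proof.
rewrite [LHS]/Rintegral -(integral12_prod_meas1 integrable_prodM)/=.
under eq_integral => x _.
  rewrite /fubini_F/=; under eq_integral do rewrite EFinM.
  rewrite integralZl// -(fineK (integrable_fin_num _ gi))// -EFinM mulrC EFinM.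
  over.
rewrite integralZl// fineM//=; first by rewrite mulrC.
exact: integrable_fin_num.
Qed.
End products.

(** * Products of one-variable functions, their Fourier transforms, and linear mixtures *)

Section rV_products.
Context {R : realType}.
Local Notation leb := (@lebesgue_measure R).
Local Notation lam d := (@lebesgue_rV R d).
Local Notation C := (Cplx R).

Lemma measurable_rV_cons' d :
  measurable_fun [set: measurableTypeR R * 'rV[R]_d] (@rV_cons R d).
Proof.
apply: (@measurable_row_mx _ _ _ 1 d); last exact: measurable_snd.
apply: measurable_fun_rV => i; under eq_fun do rewrite mxE.
by rewrite !ord1 eqxx; under eq_fun do rewrite mulr1n; exact: measurable_fst.
Qed.

Lemma lam_consE d (A : set 'rV[R]_d.+1) : measurable A ->
  lam d.+1 A = pushforward (leb \x lam d)%E (@rV_cons R d) A.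
Proof.
move=> mA.
have mA' : measurable (@rV_cons R d @^-1` A).
  by rewrite -[X in measurable X]setTI; exact: measurable_rV_cons.
rewrite -[LHS]/(lam d.+1 A) -[in LHS](setIT A) -(integral_indic (lam d.+1))//.
rewrite ge0_integral_rV_cons; last 2 first.
- by apply/measurable_EFinP; exact: measurable_indic.
- by move=> x; rewrite lee_fin.
rewrite /pushforward -[in RHS](setIT (_ @^-1` A)) -(integral_indic (leb \x lam d)%E)//.
rewrite fubini_tonelli1//.
by apply/measurable_EFinP; exact: measurable_indic.
Qed.

(** Fubini's theorem for signed products, by viewing [lebesgue_rV] in dimension [d.+1] as an image
    of the product measure. *)
Lemma integrable_rV_cons d (f : R -> R) (g : 'rV[R]_d -> R) (F : 'rV[R]_d.+1 -> R) :
  leb.-integrable setT (EFin \o f) -> (lam d).-integrable setT (EFin \o g) ->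
  measurable_fun setT F -> (forall x y, F (rV_cons (x, y)) = f x * g y) ->
  (lam d.+1).-integrable setT (EFin \o F) /\
  \int[lam d.+1]_x F x = (\int[leb]_x f x) * (\int[lam d]_y g y).
Proof.
move=> fi gi mF FE.
have ci : (leb \x lam d)%E.-integrable setT ((EFin \o F) \o @rV_cons R d).
  rewrite (_ : _ \o _ = (fun p : measurableTypeR R * 'rV[R]_d => (f p.1 * g p.2)%:E)).
    exact: integrable_prodM.
  by apply/funext => -[x y] /=; rewrite FE.
have mFE : measurable_fun setT (EFin \o F) by exact/measurable_EFinP.
have mc := @measurable_rV_cons' d.
have pi := integrable_pushforward mc mFE (D := setT) ci measurableT.
have li : (lam d.+1).-integrable setT (EFin \o F).
  apply/integrableP; split => //.
  have /integrableP[_] := pi; apply: le_lt_trans.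
  by rewrite (eq_measure_integral (pushforward (leb \x lam d)%E (@rV_cons R d)))// => A mA _; first [exact: lam_consE|exact/esym/lam_consE].
split => //.
rewrite -(Rintegral_prodM fi gi) /Rintegral; congr fine.
transitivity (\int[pushforward (leb \x lam d)%E (@rV_cons R d)]_x (F x)%:E)%E.
  by apply: eq_measure_integral => A mA _; first [exact: lam_consE|exact/esym/lam_consE].
rewrite (integral_pushforward mc mFE (D := setT) ci measurableT) preimage_setT.
by apply: eq_integral => -[x y] _ /=; rewrite FE.
Qed.

Definition prodf d (z : 'I_d -> R -> R) (s : 'rV[R]_d) : R := \prod_(j < d) z j (s ord0 j).

Lemma prodf_cons d (z : 'I_d.+1 -> R -> R) x (y : 'rV[R]_d) :
  prodf z (rV_cons (x, y)) = z ord0 x * prodf (fun j => z (lift ord0 j)) y.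
Proof.
rewrite /prodf big_ord_recl rV_cons_ord0; congr (_ * _).
by apply: eq_bigr => j _; rewrite rV_cons_lift.
Qed.

Lemma measurable_prodf d (z : 'I_d -> R -> R) :
  (forall j, measurable_fun setT (z j)) -> measurable_fun setT (prodf z).
Proof.
move=> mz; apply: measurable_prod => j _.
by apply: (measurableT_comp (mz j)); exact: measurable_rV_coord.
Qed.

Lemma prodf_ge0 d (z : 'I_d -> R -> R) s : (forall j x, 0 <= z j x) -> 0 <= prodf z s.
Proof. by move=> z0; apply: prodr_ge0 => j _. Qed.

Lemma lam0_setT : lam 0 setT = 1%E.
Proof. by rewrite /lebesgue_rV/pushforward preimage_setT /= /power_zero diracE in_setT. Qed.

Lemma ge0_integral_prodf d (z : 'I_d -> R -> R) :
  (forall j, measurable_fun setT (z j)) -> (forall j x, 0 <= z j x) ->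
  (\int[lam d]_s (prodf z s)%:E = \prod_(j < d) \int[leb]_x (z j x)%:E)%E.
Proof.
elim: d z => [|d IH] z mz z0.
  rewrite big_ord0; under eq_integral do rewrite /prodf big_ord0.
  by rewrite integral_cst// mul1e; exact: lam0_setT.
rewrite ge0_integral_rV_cons; last 2 first.
- by apply/measurable_EFinP; exact: measurable_prodf.
- by move=> s; rewrite lee_fin prodf_ge0.
rewrite big_ord_recl -IH//.
set I := (X in (_ * X)%E).
have I0 : (0 <= I)%E by apply: integral_ge0 => y _; rewrite lee_fin prodf_ge0.
transitivity (\int[leb]_x ((z ord0 x)%:E * I))%E.
  apply: eq_integral => x _; under eq_integral do rewrite prodf_cons EFinM.
  rewrite ge0_integralZl_EFin//.
  - by move=> y _; rewrite lee_fin prodf_ge0.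
  - by apply/measurable_EFinP; exact: measurable_prodf.
have mz0 : measurable_fun [set: R] (EFin \o z ord0) by exact/measurable_EFinP.
apply: ge0_integralZr => // x _; rewrite lee_fin; exact: z0.
Qed.

Lemma dotp_cons d (t0 x : R) (t y : 'rV[R]_d) :
  dotp (rV_cons (t0, t)) (rV_cons (x, y)) = t0 * x + dotp t y.
Proof.
rewrite /dotp big_ord_recl !rV_cons_ord0; congr (_ + _).
by apply: eq_bigr => j _; rewrite !rV_cons_lift.
Qed.

Lemma measurable_dotp d (t : 'rV[R]_d) : measurable_fun setT (dotp t).
Proof.
by apply: measurable_sum => i; apply: measurable_funM => //; exact: measurable_rV_coord.
Qed.

Lemma dotp_mulmx d (t s : 'rV[R]_d) (A : 'M[R]_d) : dotp t (s *m A^T) = dotp (t *m A) s.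
Proof.
rewrite /dotp.
transitivity (\sum_(i < d) \sum_(j < d) t ord0 i * (s ord0 j * A i j)).
  by apply: eq_bigr => i _; rewrite mxE mulr_sumr; apply: eq_bigr => j _; rewrite mxE.
rewrite exchange_big/=; apply: eq_bigr => j _; rewrite mxE mulr_suml.
by apply: eq_bigr => i _; ring.
Qed.

Definition Phi (z : R -> R) (u : R) : C :=
  Complex (\int[leb]_x (cos (u * x) * z x)) (\int[leb]_x (sin (u * x) * z x)).

Lemma measurable_cos : measurable_fun [set: R] (@cos R).
Proof. by apply: continuous_measurable_fun => x; exact: continuous_cos. Qed.

Lemma measurable_sin : measurable_fun [set: R] (@sin R).
Proof. by apply: continuous_measurable_fun => x; exact: continuous_sin. Qed.

Lemma integrable_boundedM dT (T : measurableType dT) (mu : {measure set T -> \bar R})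
    (c f : T -> R) : measurable_fun setT c -> (forall x, `|c x| <= 1) ->
  mu.-integrable setT (EFin \o f) -> mu.-integrable setT (fun x => (c x * f x)%:E).
Proof.
move=> mc c1 fi.
have mf : measurable_fun setT f by have /measurable_int/measurable_EFinP := fi.
apply: le_integrable fi => //.
  by apply/measurable_EFinP; exact: measurable_funM.
by move=> x _ /=; rewrite lee_fin normrM ler_piMl.
Qed.

Lemma integrable_cosM (z : R -> R) u : leb.-integrable setT (EFin \o z) ->
  leb.-integrable setT (fun x => (cos (u * x) * z x)%:E).
Proof.
apply: integrable_boundedM => [|x]; last by rewrite ler_norml cos_geN1 cos_le1.
by apply: (measurableT_comp measurable_cos); apply: measurable_funM.
Qed.

Lemma integrable_sinM (z : R -> R) u : leb.-integrable setT (EFin \o z) ->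
  leb.-integrable setT (fun x => (sin (u * x) * z x)%:E).
Proof.
apply: integrable_boundedM => [|x]; last by rewrite ler_norml sin_geN1 sin_le1.
by apply: (measurableT_comp measurable_sin); apply: measurable_funM.
Qed.

Lemma integrable_prodf d (z : 'I_d -> R -> R) :
  (forall j, leb.-integrable setT (EFin \o z j)) ->
  (lam d).-integrable setT (EFin \o prodf z).
Proof.
elim: d z => [|d IH] z zi.
  apply: (@eq_integrable _ _ _ _ _ _ (cst 1%E)) => //.
    by move=> s _; rewrite /prodf/= big_ord0.
  apply/integrableP; split; first exact: measurable_cst.
  under eq_integral do rewrite /= normr1.
  by rewrite integral_cst// mul1e [X in (X < _)%E]lam0_setT ltry.
have mz j : measurable_fun setT (z j) by have /measurable_int/measurable_EFinP := zi j.
apply: (proj1 (@integrable_rV_cons d (z ord0) (prodf (fun j => z (lift ord0 j))) _ _ _ _ _)) => //.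
- exact: IH.
- exact: measurable_prodf.
- by move=> x y; rewrite prodf_cons.
Qed.

(** One coordinate is peeled off at a time; the addition formulas of cosine and sine then reproduce
    the real and imaginary parts of a complex product. *)
Lemma fourier_prodf d (z : 'I_d -> R -> R) (t : 'rV[R]_d) :
  (forall j, leb.-integrable setT (EFin \o z j)) ->
  fourier (prodf z) t = \prod_(j < d) Phi (z j) (t ord0 j).
Proof.
elim: d z t => [|d IH] z t zi.
  rewrite big_ord0 /fourier.
  have cE : \int[lam 0]_x (cos (dotp t x) * prodf z x) = 1.
    transitivity (\int[lam 0]_x (1 : R)).
      by apply: eq_Rintegral => x _; rewrite /dotp /prodf !big_ord0 cos0 mulr1.
    by rewrite Rintegral_cst// mul1r [X in fine X]lam0_setT.
  have sE : \int[lam 0]_x (sin (dotp t x) * prodf z x) = 0.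
    transitivity (\int[lam 0]_x (0 : R)).
      by apply: eq_Rintegral => x _; rewrite /dotp /prodf !big_ord0 sin0 mul0r.
    by rewrite Rintegral_cst// mul0r.
  by rewrite cE sE.
have [t0 [t' ->]] := rV_cons_surj t.
pose z' j := z (lift ord0 j).
have zi' j : leb.-integrable setT (EFin \o z' j) by exact: zi.
rewrite big_ord_recl rV_cons_ord0.
have -> : \prod_(i < d) Phi (z (lift ord0 i)) (rV_cons (t0, t') ord0 (lift ord0 i)) = fourier (prodf z') t'.
  by rewrite IH//; apply: eq_bigr => i _; rewrite rV_cons_lift.
have ip := integrable_prodf zi'.
have icos : (lam d).-integrable setT (EFin \o (fun y => cos (dotp t' y) * prodf z' y)).
  apply: integrable_boundedM => // [|x]; last by rewrite ler_norml cos_geN1 cos_le1.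
  by apply: (measurableT_comp measurable_cos); exact: measurable_dotp.
have isin : (lam d).-integrable setT (EFin \o (fun y => sin (dotp t' y) * prodf z' y)).
  apply: integrable_boundedM => // [|x]; last by rewrite ler_norml sin_geN1 sin_le1.
  by apply: (measurableT_comp measurable_sin); exact: measurable_dotp.
have jcos := integrable_cosM t0 (zi ord0).
have jsin := integrable_sinM t0 (zi ord0).
have mz j : measurable_fun setT (z j) by have /measurable_int/measurable_EFinP := zi j.
have mp := @measurable_prodf _ _ mz.
have md := @measurable_dotp _ (rV_cons (t0, t')).
pose x0 (s : 'rV[R]_d.+1) := s ord0 ord0.
pose y0 (s : 'rV[R]_d.+1) : 'rV[R]_d := \row_i s ord0 (lift ord0 i).
have x0E x y : x0 (rV_cons (x, y)) = x by exact: rV_cons_ord0.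
have y0E x y : y0 (rV_cons (x, y)) = y by apply/rowP => i; rewrite mxE rV_cons_lift.
have mx0 : measurable_fun setT x0 by exact: measurable_rV_coord.
have my0 : measurable_fun setT y0.
  by apply: measurable_fun_rV => i; under eq_fun do rewrite mxE; exact: measurable_rV_coord.
have key (f : R -> R) (g : 'rV[R]_d -> R) : leb.-integrable setT (EFin \o f) ->
    (lam d).-integrable setT (EFin \o g) ->
    (lam d.+1).-integrable setT (EFin \o (fun s => f (x0 s) * g (y0 s))) /\
    \int[lam d.+1]_s (f (x0 s) * g (y0 s)) = (\int[leb]_x f x) * (\int[lam d]_y g y).
  move=> fi gi; apply: integrable_rV_cons => //.
  - apply: measurable_funM.
      by apply: measurableT_comp mx0; have /measurable_int/measurable_EFinP := fi.
    by apply: measurableT_comp my0; have /measurable_int/measurable_EFinP := gi.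
  - by move=> x y; rewrite x0E y0E.
have [icc ccE] := key _ _ jcos icos.
have [iss ssE] := key _ _ jsin isin.
have [ics csE] := key _ _ jcos isin.
have [isc scE] := key _ _ jsin icos.
rewrite /fourier /Phi.
have -> : \int[lam d.+1]_x (cos (dotp (rV_cons (t0, t')) x) * prodf z x) =
    (\int[leb]_x (cos (t0 * x) * z ord0 x)) * (\int[lam d]_y (cos (dotp t' y) * prodf z' y)) -
    (\int[leb]_x (sin (t0 * x) * z ord0 x)) * (\int[lam d]_y (sin (dotp t' y) * prodf z' y)).
  rewrite -ccE -ssE -RintegralB//; apply: eq_Rintegral => s _.
  have [x [y ->]] := rV_cons_surj s.
  by rewrite x0E y0E dotp_cons prodf_cons cosD; ring.
have -> : \int[lam d.+1]_x (sin (dotp (rV_cons (t0, t')) x) * prodf z x) =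
    (\int[leb]_x (cos (t0 * x) * z ord0 x)) * (\int[lam d]_y (sin (dotp t' y) * prodf z' y)) +
    (\int[leb]_x (sin (t0 * x) * z ord0 x)) * (\int[lam d]_y (cos (dotp t' y) * prodf z' y)).
  rewrite -csE -scE -RintegralD//; apply: eq_Rintegral => s _.
  have [x [y ->]] := rV_cons_surj s.
  by rewrite x0E y0E dotp_cons prodf_cons sinD; ring.
by [].
Qed.

Section mixture.
Variables (d : nat) (N : 'M[R]_d) (k : R) (z : 'I_d -> R -> R).
Hypotheses (k0 : 0 < k) (uN : N \in unitmx)
  (kN : forall f : 'rV[R]_d -> \bar R, measurable_fun setT f -> (forall x, 0 <= f x)%E ->
    (\int[lam d]_x f (x *m N)%R = k%:E * \int[lam d]_x f x)%E)
  (mz : forall j, measurable_fun setT (z j)) (z0 : forall j x, 0 <= z j x).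

(** The density of [s *m N] when [s] has density [prodf z]. By [kN], the constant [k] is the inverse
    of the absolute determinant of [N]. *)
Definition mixf (x : 'rV[R]_d) := k * prodf z (x *m invmx N).

Lemma measurable_mixf : measurable_fun setT mixf.
Proof.
apply: measurable_funM => //.
by apply: (measurableT_comp (measurable_prodf mz)); exact: measurable_mulmx.
Qed.

Lemma mixf_ge0 x : 0 <= mixf x.
Proof. by rewrite mulr_ge0 ?(ltW k0)// prodf_ge0. Qed.

Lemma mixf_push : dens_push (lam d) (lam d) mixf (prodf z) (fun s => s *m N).
Proof.
move=> G mG G0.
pose g x := (G x * (prodf z (x *m invmx N))%:E)%E.
have mg : measurable_fun setT g.
  apply: emeasurable_funM => //; apply/measurable_EFinP.
  by apply: (measurableT_comp (measurable_prodf mz)); exact: measurable_mulmx.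
have g0 x : (0 <= g x)%E by rewrite mule_ge0// lee_fin prodf_ge0.
transitivity (k%:E * \int[lam d]_x g x)%E.
  rewrite -ge0_integralZlT//; last exact: ltW.
  by apply: eq_integral => x _; rewrite /g /mixf EFinM muleCA.
by rewrite -kN//; apply: eq_integral => s _; rewrite /g mulmxK.
Qed.

End mixture.

Lemma mixture_densityP d1 d2 (a k : R) (z : 'I_(d1 + d2) -> R -> R) :
  0 < k -> mixing_mx d1 d2 a \in unitmx ->
  (forall f : 'rV[R]_(d1 + d2) -> \bar R, measurable_fun setT f -> (forall x, 0 <= f x)%E ->
    (\int[lam _]_x f (x *m (mixing_mx d1 d2 a)^T)%R = k%:E * \int[lam _]_x f x)%E) ->
  (forall j, measurable_fun setT (z j)) -> (forall j x, 0 <= z j x) ->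
  mixture_density a z (mixf (mixing_mx d1 d2 a)^T k z).
Proof.
move=> k0 uA kN mz z0; split.
- exact: measurable_mixf.
- by move=> x; exact: mixf_ge0.
have uAT : (mixing_mx d1 d2 a)^T \in unitmx by rewrite unitmx_tr.
move=> B mB.
rewrite integral_mkcond [RHS]integral_mkcond.
have mB1 : measurable_fun setT (EFin \o \1_B : 'rV[R]_(d1 + d2) -> \bar R).
  by apply/measurable_EFinP; exact: measurable_indic.
have B0 x : (0 <= (EFin \o \1_B : 'rV[R]_(d1 + d2) -> \bar R) x)%E by rewrite lee_fin.
have H := @mixf_push _ _ k z k0 uAT kN mz z0 _ mB1 B0.
transitivity (\int[lam _]_x ((\1_B x)%:E * (mixf (mixing_mx d1 d2 a)^T k z x)%:E))%E.
  apply: eq_integral => x _; rewrite patchE indicE.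
  by case: ifP => _; rewrite ?mul1e ?mul0e.
etransitivity; first exact: H.
apply: eq_integral => s _; rewrite patchE /= indicE.
have -> : (s \in [set s0 : 'rV[R]_(d1 + d2) | B (s0 *m (mixing_mx d1 d2 a)^T)]) =
          (s *m (mixing_mx d1 d2 a)^T \in B).
  by apply/idP/idP; rewrite !inE.
by case: ifP => _; rewrite ?mul1e ?mul0e.
Qed.

Lemma fourier_mixf d (A : 'M[R]_d) (k : R) (z : 'I_d -> R -> R) (t : 'rV[R]_d) :
  0 < k -> A \in unitmx ->
  (forall f : 'rV[R]_d -> \bar R, measurable_fun setT f -> (forall x, 0 <= f x)%E ->
    (\int[lam _]_x f (x *m A^T)%R = k%:E * \int[lam _]_x f x)%E) ->
  (forall j x, 0 <= z j x) ->
  (forall j, leb.-integrable setT (EFin \o z j)) ->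
  fourier (mixf A^T k z) t = \prod_(j < d) Phi (z j) ((t *m A) ord0 j).
Proof.
move=> k0 uA kN z0 zi.
have mz j : measurable_fun setT (z j) by have /measurable_int/measurable_EFinP := zi j.
have uAT : A^T \in unitmx by rewrite unitmx_tr.
rewrite -fourier_prodf// /fourier.
have ip := integrable_prodf zi.
have mcos (u : 'rV[R]_d) : measurable_fun setT (fun s => cos (dotp u s)).
  by apply: (measurableT_comp measurable_cos); exact: measurable_dotp.
have msin (u : 'rV[R]_d) : measurable_fun setT (fun s => sin (dotp u s)).
  by apply: (measurableT_comp measurable_sin); exact: measurable_dotp.
have push := mixf_push k0 uAT kN mz z0.
have mm : measurable_fun setT (fun s : 'rV[R]_d => s *m A^T) by exact: measurable_mulmx.
have mf := @measurable_mixf d A^T k z mz.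
have f0 := @mixf_ge0 d A^T k z k0 z0.
have mp := measurable_prodf mz.
have p0 s : 0 <= prodf z s by exact: prodf_ge0.
congr Complex.
- rewrite (dens_push_Rintegral mf mp mm f0 p0 push (G := fun x => cos (dotp t x)))//.
    by apply: eq_Rintegral => s _; rewrite dotp_mulmx.
  rewrite (_ : (fun y => _) = (fun y => (cos (dotp (t *m A) y) * prodf z y)%:E)); last first.
    by apply/funext => s; rewrite dotp_mulmx.
  by apply: integrable_boundedM => // x; rewrite ler_norml cos_geN1 cos_le1.
- rewrite (dens_push_Rintegral mf mp mm f0 p0 push (G := fun x => sin (dotp t x)))//.
    by apply: eq_Rintegral => s _; rewrite dotp_mulmx.
  rewrite (_ : (fun y => _) = (fun y => (sin (dotp (t *m A) y) * prodf z y)%:E)); last first.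
    by apply/funext => s; rewrite dotp_mulmx.
  by apply: integrable_boundedM => // x; rewrite ler_norml sin_geN1 sin_le1.
Qed.

Lemma integral_mixf d (A : 'M[R]_d) (k : R) (z : 'I_d -> R -> R) :
  0 < k -> A \in unitmx ->
  (forall f : 'rV[R]_d -> \bar R, measurable_fun setT f -> (forall x, 0 <= f x)%E ->
    (\int[lam _]_x f (x *m A^T)%R = k%:E * \int[lam _]_x f x)%E) ->
  (forall j, measurable_fun setT (z j)) -> (forall j x, 0 <= z j x) ->
  (forall j, \int[leb]_x (z j x)%:E = 1)%E ->
  (\int[lam d]_x (mixf A^T k z x)%:E = 1)%E.
Proof.
move=> k0 uA kN mz z0 z1.
have uAT : A^T \in unitmx by rewrite unitmx_tr.
have := mixf_push k0 uAT kN mz z0 (G := cst 1%E).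
under eq_integral do rewrite /= mul1e; move=> -> //.
under eq_integral do rewrite /= mul1e; by rewrite ge0_integral_prodf// big1.
Qed.

End rV_products.

(** * Noise on the first axis and integrals against the observation law *)

Section observation.
Context {R : realType}.
Local Notation leb := (@lebesgue_measure R).
Local Notation lam d := (@lebesgue_rV R d).

Definition first_coord d (x : R) : 'rV[R]_d := \row_i (if i == 0%N :> nat then x else 0).

Lemma measurable_first_coord d : measurable_fun [set: R] (@first_coord d).
Proof.
apply: measurable_fun_rV => i; under eq_fun do rewrite mxE.
by case: (i == 0%N :> nat); [exact: measurable_id|exact: measurable_cst].
Qed.

(* The noise is carried by the first coordinate axis: the two hypotheses only
   differ in the factor of [S_1], which the mixing matrix sends to the first
   coordinates of both blocks. *)
Definition first_law d (q : probability (measurableTypeR R) R) (sg : R) : set 'rV[R]_d -> \bar R :=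
  pushforward q (fun x => @first_coord d (sg * x)).

Let mfs d sg : measurable_fun [set: measurableTypeR R] (fun x => @first_coord d (sg * x)).
Proof.
apply: measurable_fun_rV => i; under eq_fun do rewrite mxE.
by case: (i == 0%N :> nat); [exact: measurable_funM|exact: measurable_cst].
Qed.

HB.instance Definition _ d q sg := Measure.copy (@first_law d q sg)
  (measure_function_pushforward__canonical__measure_function_Measure q (@mfs d sg)).

Let first_law_prob d q sg : @first_law d q sg setT = 1%E.
Proof. by rewrite /first_law /pushforward preimage_setT probability_setT. Qed.

HB.instance Definition _ d q sg := Measure_isProbability.Build _ _ _ (@first_law d q sg)
  (@first_law_prob d q sg).

Lemma ge0_integral_first_law d q sg (f : 'rV[R]_d -> \bar R) :
  measurable_fun setT f -> (forall x, 0 <= f x)%E ->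
  (\int[@first_law d q sg]_x f x = \int[q]_x f (first_coord d (sg * x)))%E.
Proof.
by move=> mf f0; rewrite /first_law ge0_integral_pushforward//; exact: mfs.
Qed.

Lemma Rintegral_first_law d q sg (f : 'rV[R]_d -> R) :
  measurable_fun setT f -> (forall x, `|f x| <= 1) ->
  \int[@first_law d q sg]_x f x = \int[q]_x f (first_coord d (sg * x)).
Proof.
move=> mf f1; rewrite /Rintegral; congr fine.
rewrite (integral_pushforward (@mfs d sg))//; first exact/measurable_EFinP.
rewrite preimage_setT; apply: (@le_integrable _ _ _ _ _ _ _ (cst 1%E)) => //.
- by apply/measurable_EFinP; exact: (measurableT_comp mf (@mfs d sg)).
- by move=> x _ /=; rewrite normr1 lee_fin.
- exact: finite_measure_integrable_cst.
Qed.

Lemma ge0_integral_noise_law d1 d2 (Q1 : probability 'rV[R]_d1 R) (Q2 : probability 'rV[R]_d2 R)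
    (f : 'rV[R]_(d1 + d2) -> \bar R) :
  measurable_fun setT f -> (forall x, 0 <= f x)%E ->
  (\int[noise_law Q1 Q2]_e f e = \int[Q1]_x \int[Q2]_y f (row_mx x y))%E.
Proof.
move=> mf f0; rewrite ge0_integral_distribution// fubini_tonelli1//; last by move=> x; exact: f0.
by apply: measurableT_comp => //; exact: measurable_funP.
Qed.

Lemma ge0_integral_obs_law d1 d2 (P : probability 'rV[R]_(d1 + d2) R)
    (Q1 : probability 'rV[R]_d1 R) (Q2 : probability 'rV[R]_d2 R)
    (f : 'rV[R]_(d1 + d2) -> \bar R) :
  measurable_fun setT f -> (forall x, 0 <= f x)%E ->
  (\int[obs_law P Q1 Q2]_e f e =
   \int[P]_z \int[Q1]_x \int[Q2]_y f (z + row_mx x y)%R)%E.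
Proof.
move=> mf f0; rewrite ge0_integral_distribution// fubini_tonelli1//; last 2 first.
- by apply: measurableT_comp => //; exact: measurable_funP.
- by move=> x; exact: f0.
apply: eq_integral => z _; rewrite /fubini_F/= ge0_integral_noise_law//.
by apply: (measurableT_comp mf); apply: (@measurable_addmx _ _ _ _ (fun=> z) id).
Qed.

End observation.

(** * Two-point lower bound for the minimax risk *)

Section le_cam.
Context {R : realType} dT (T : measurableType dT).
Local Open Scope ereal_scope.

Definition tuple_cons n (p : T * n.-tuple T) : n.+1.-tuple T := [the n.+1.-tuple T of p.1 :: p.2].

Lemma ge0_integral_power_cons (mu : {sigma_finite_measure set T -> \bar R}) n
    (g : n.+1.-tuple T -> \bar R) : measurable_fun setT g -> (forall t, 0 <= g t) ->
  \int[power_measure mu n.+1]_t g t =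
  \int[mu]_x \int[power_measure mu n]_t g (tuple_cons (x, t)).
Proof.
move=> mg g0; rewrite ge0_integral_pushforward//; last exact: measurable_tuple_cons.
rewrite preimage_setT fubini_tonelli1//; last by move=> x; exact: g0.
by apply: (measurableT_comp mg); exact: measurable_tuple_cons.
Qed.

Lemma measurable_integral_power_cons (mu : {sigma_finite_measure set T -> \bar R}) n
    (g : n.+1.-tuple T -> \bar R) : measurable_fun setT g -> (forall t, 0 <= g t) ->
  measurable_fun setT (fun x => \int[power_measure mu n]_t g (tuple_cons (x, t))).
Proof.
move=> mg g0.
apply: (@measurable_fun_fubini_tonelli_F _ _ _ _ _ (power_measure mu n)
  (g \o @tuple_cons n)).
  by apply: (measurableT_comp mg); exact: measurable_tuple_cons.
by move=> p; exact: g0.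
Qed.

Lemma power_measure_setT (M : probability T R) n : power_measure M n setT = 1.
Proof.
elim: n => [|n IH]; first by rewrite /= /power_zero diracE in_setT.
rewrite -[LHS]mul1e -(integral_cst _ measurableT 1) ge0_integral_power_cons//.
rewrite (eq_integral (cst 1)) => [|x _].
  by rewrite (integral_cst M measurableT 1) mul1e; exact: probability_setT.
transitivity (1 * power_measure M n setT); last by rewrite IH mul1e.
exact: (integral_cst (power_measure M n) measurableT 1).
Qed.

Lemma integral_power_le (M : probability T R) n (g : n.-tuple T -> \bar R) (r : \bar R) :
  measurable_fun setT g -> (forall t, 0 <= g t <= r) -> \int[power_measure M n]_t g t <= r.
Proof.
move=> mg g01; have g0 t : 0 <= g t by have /andP[] := g01 t.
have -> : r = \int[power_measure M n]_t (cst r) t.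
  by rewrite integral_cst// -[RHS]/(r * power_measure M n setT) power_measure_setT mule1.
by apply: ge0_le_integral => // t _; have /andP[] := g01 t.
Qed.

(* The hypothesis bounds the total variation distance by [de]; it is stated with
   test functions so that it tensorizes one coordinate at a time. *)
Lemma tensor_le (M0 M1 : probability T R) (de : R) : (0 <= de)%R ->
  (forall g : T -> \bar R, measurable_fun setT g -> (forall x, 0 <= g x <= 1) ->
    \int[M0]_x g x <= \int[M1]_x g x + de%:E) ->
  forall n (g : n.-tuple T -> \bar R), measurable_fun setT g -> (forall x, 0 <= g x <= 1) ->
    \int[power_measure M0 n]_x g x <= \int[power_measure M1 n]_x g x + (n%:R * de)%:E.
Proof.
move=> de0 H; elim => [|n IH] g mg g01.
  by rewrite mul0r adde0.
have g0 t : 0 <= g t by have /andP[] := g01 t.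
rewrite !ge0_integral_power_cons//.
pose G1 x := \int[power_measure M1 n]_t g (tuple_cons (x, t)).
have mgx x : measurable_fun setT (fun t : n.-tuple T => g (tuple_cons (x, t))).
  apply: (measurableT_comp mg).
  exact: (measurableT_comp (@measurable_tuple_cons _ T n) (measurable_pair1 x)).
have G10 x : 0 <= G1 x by exact: integral_ge0.
have mG1 : measurable_fun setT G1 by exact: measurable_integral_power_cons.
apply: (@le_trans _ _ (\int[M0]_x (G1 x + (n%:R * de)%:E))).
  apply: ge0_le_integral => //.
  - by move=> x _; exact: integral_ge0.
  - exact: measurable_integral_power_cons.
  - exact: emeasurable_funD.
  - by move=> x _; exact: IH.
rewrite ge0_integralD//; last by move=> x _; rewrite lee_fin mulr_ge0.
rewrite integral_cst// [X in _ * X]probability_setT mule1.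
rewrite -addn1 natrD mulrDl mul1r EFinD (addeC _ de%:E) addeA leeD2r//.
apply: H => // x; rewrite G10 /=.
by apply: integral_power_le.
Qed.

(** Le Cam's argument. Truncated at [D], the losses still add up to at least [D], and divided by [D]
    they are admissible test functions. Changing the law under which the second one is integrated
    costs at most [D / 2], and one of the two risks receives half of what is left. *)
Lemma two_point (M0 M1 : probability T R) (n : nat) (L0 L1 : n.-tuple T -> \bar R) (D de : R) :
  (0 < D)%R -> (0 <= de)%R -> (n%:R * de <= 2^-1)%R ->
  (forall g : T -> \bar R, measurable_fun setT g -> (forall x, 0 <= g x <= 1) ->
    \int[M0]_x g x <= \int[M1]_x g x + de%:E) ->
  measurable_fun setT L0 -> measurable_fun setT L1 ->
  (forall y, 0 <= L0 y) -> (forall y, 0 <= L1 y) -> (forall y, D%:E <= L0 y + L1 y) ->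
  (D / 4)%:E <= \int[power_measure M0 n]_y L0 y \/
  (D / 4)%:E <= \int[power_measure M1 n]_y L1 y.
Proof.
move=> D0 de0 nde H mL0 mL1 L00 L10 DL.
pose m0 y := mine (L0 y) D%:E; pose m1 y := mine (L1 y) D%:E.
have mm0 : measurable_fun setT m0 by apply: measurable_mine.
have mm1 : measurable_fun setT m1 by apply: measurable_mine.
have DE0 : 0 <= D%:E by rewrite lee_fin ltW.
have m00 y : 0 <= m0 y by rewrite le_min L00.
have m10 y : 0 <= m1 y by rewrite le_min L10.
have m0L y : m0 y <= L0 y by rewrite ge_min lexx.
have m1L y : m1 y <= L1 y by rewrite ge_min lexx.
have mD y : D%:E <= m0 y + m1 y.
  rewrite /m0 /m1; have [h0|h0] := leP (L0 y) D%:E; have [h1|h1] := leP (L1 y) D%:E => //.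
  - by rewrite leeDr.
  - by rewrite leeDl.
  - by rewrite leeDl.
set r0 := \int[power_measure M0 n]_y L0 y; set r1 := \int[power_measure M1 n]_y L1 y.
have h0 : \int[power_measure M0 n]_y m0 y <= r0 by exact: ge0_le_integral.
have h1 : \int[power_measure M1 n]_y m1 y <= r1 by exact: ge0_le_integral.
pose g y := (D^-1)%:E * m1 y.
have Di0 : (0 <= D^-1)%R by rewrite invr_ge0 ltW.
have mg : measurable_fun setT g by exact: measurable_funeM.
have g01 y : 0 <= g y <= 1.
  rewrite /g mule_ge0 ?lee_fin//= -(@mulVf _ D) ?gt_eqF// EFinM lee_wpmul2l ?lee_fin//.
  by rewrite /m1 ge_min lexx orbT.
have := tensor_le de0 H mg g01.
rewrite /g !ge0_integralZlT// => h2.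
have key (a b : \bar R) : 0 <= a -> 0 <= b ->
    (D^-1)%:E * a <= (D^-1)%:E * b + (n%:R * de)%:E -> a <= b + (D / 2)%:E.
  move=> a0 b0 ab.
  have : D%:E * ((D^-1)%:E * a) <= D%:E * ((D^-1)%:E * b + (n%:R * de)%:E).
    by rewrite lee_wpmul2l.
  rewrite ge0_muleDr ?mule_ge0 ?lee_fin ?mulr_ge0//.
  rewrite !muleA -!EFinM mulfV ?gt_eqF// !mul1e => /le_trans; apply.
  by rewrite leeD// lee_fin ler_pM2l.
have {}h2 : \int[power_measure M0 n]_y m1 y <= r1 + (D / 2)%:E.
  apply: (@le_trans _ _ (\int[power_measure M1 n]_y m1 y + (D / 2)%:E)).
    by apply: key => //; exact: integral_ge0.
  by rewrite leeD.
have h3 : D%:E <= r0 + (r1 + (D / 2)%:E).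
  apply: (@le_trans _ _ (\int[power_measure M0 n]_y (m0 y + m1 y))).
    have {1}-> : D%:E = \int[power_measure M0 n]_t (cst D%:E) t.
      by rewrite integral_cst// -[RHS]/(_ * power_measure M0 n setT) power_measure_setT mule1.
    apply: ge0_le_integral => //.
    exact: emeasurable_funD.
  by rewrite ge0_integralD// leeD.
have [|r0l] := leP (D / 4)%:E r0; first by left.
have [|r1l] := leP (D / 4)%:E r1; first by right.
exfalso; move: h3; apply/negP; rewrite -ltNge.
have r00 : 0 <= r0 by exact: integral_ge0.
have r10 : 0 <= r1 by exact: integral_ge0.
have r0f : r0 \is a fin_num by rewrite ge0_fin_numE// (lt_trans r0l) ?ltry.
have r1f : r1 \is a fin_num by rewrite ge0_fin_numE// (lt_trans r1l) ?ltry.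
move: r0l r1l; rewrite -(fineK r0f) -(fineK r1f) !lte_fin => a b.
by rewrite ?lte_fin; lra.
Qed.

End le_cam.

Section minimax_lower.
Context {R : realType} (d1 d2 : nat).
Local Notation d := (d1 + d2)%N.
Local Notation lam := (@lebesgue_rV R (d1 + d2)).

Lemma sqr_dist_le (a b c : R) : (b - c) ^+ 2 <= 2 * ((a - b) ^+ 2 + (a - c) ^+ 2).
Proof. by have := sqr_ge0 ((a - b) + (a - c)); nra. Qed.

(** By [sqr_dist_le], the losses of any estimate at [f0] and [f1] add up to at least half of the
    squared distance of [f0] and [f1], that is, to at least [D], as [two_point] requires. *)
Lemma minimax_lower n (fhat : n.-tuple 'rV[R]_d * 'rV[R]_d -> R)
    (P0 P1 : probability 'rV[R]_d R) (f0 f1 : 'rV[R]_d -> R)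
    (Q1 : probability 'rV[R]_d1 R) (Q2 : probability 'rV[R]_d2 R) (D de : R) :
  estimator fhat -> 0 < D -> 0 <= de -> n%:R * de <= 2^-1 ->
  measurable_fun setT f0 -> measurable_fun setT f1 ->
  (forall g : 'rV[R]_d -> \bar R, measurable_fun setT g -> (forall x, 0 <= g x <= 1)%E ->
    (\int[obs_law P0 Q1 Q2]_x g x <= \int[obs_law P1 Q1 Q2]_x g x + de%:E)%E) ->
  ((2 * D)%:E <= \int[lam]_x ((f0 x - f1 x) ^+ 2)%:E)%E ->
  ((D / 4)%:E <= risk fhat P0 f0 Q1 Q2)%E \/ ((D / 4)%:E <= risk fhat P1 f1 Q1 Q2)%E.
Proof.
move=> mfh D0 de0 nde mf0 mf1 H DD.
have mL (f : 'rV[R]_d -> R) : measurable_fun setT f ->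
    measurable_fun setT (fun p : n.-tuple 'rV[R]_d * 'rV[R]_d => ((fhat p - f p.2) ^+ 2)%:E).
  move=> mf; apply/measurable_EFinP; apply: measurable_funX; apply: measurable_funB => //.
  exact: (measurableT_comp mf).
have mLi (f : 'rV[R]_d -> R) : measurable_fun setT f ->
    measurable_fun setT (fun y => \int[lam]_x ((fhat (y, x) - f x) ^+ 2)%:E)%E.
  move=> mf.
  apply: (@measurable_fun_fubini_tonelli_F _ _ _ _ _ lam
    (fun p : n.-tuple 'rV[R]_d * 'rV[R]_d => ((fhat p - f p.2) ^+ 2)%:E)).
    exact: mL.
  by move=> p; rewrite lee_fin sqr_ge0.
have mLy (f : 'rV[R]_d -> R) y : measurable_fun setT f ->
    measurable_fun setT (fun x => ((fhat (y, x) - f x) ^+ 2)%:E).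
  move=> mf; exact: (measurableT_comp (mL _ mf) (measurable_pair1 y)).
have L0 (f : 'rV[R]_d -> R) y : (0 <= \int[lam]_x ((fhat (y, x) - f x) ^+ 2)%:E)%E.
  by apply: integral_ge0 => x _; rewrite lee_fin sqr_ge0.
apply: (two_point D0 de0 nde H); [exact: mLi|exact: mLi|exact: L0|exact: L0|].
move=> y.
rewrite -ge0_integralD//; last 4 first.
- by move=> x _; rewrite lee_fin sqr_ge0.
- exact: mLy.
- by move=> x _; rewrite lee_fin sqr_ge0.
- exact: mLy.
have two0 : 0 <= 2 :> R by [].
suff : ((2 * D)%:E <= 2%:E * \int[lam]_x (((fhat (y, x) - f0 x) ^+ 2)%:E + ((fhat (y, x) - f1 x) ^+ 2)%:E))%E.
  by rewrite EFinM lee_pmul2l.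
rewrite -ge0_integralZlT//; last 2 first.
- by apply: emeasurable_funD; exact: mLy.
- by move=> x; rewrite adde_ge0// lee_fin sqr_ge0.
apply: (le_trans DD); apply: ge0_le_integral => //.
- by move=> x _; rewrite lee_fin sqr_ge0.
- by apply/measurable_EFinP; apply: measurable_funX; exact: measurable_funB.
- by apply: measurable_funeM; apply: emeasurable_funD; exact: mLy.
- by move=> x _; rewrite -EFinD -EFinM lee_fin sqr_dist_le.
Qed.

End minimax_lower.

Import Normc.

(** * Moments as derivatives of an analytic characteristic function *)

Section normc_facts.
Context {R : realType}.
Local Notation C := (Cplx R).
Local Notation Re := complex.Re.
Local Notation Im := complex.Im.
Implicit Types z : C.

Lemma normc_ge0 z : 0 <= normc z.
Proof. by case: z => a b; exact: sqrtr_ge0. Qed.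

Lemma normr_normc z : `|z| = ((normc z)%:C)%C :> R[i].
Proof. by []. Qed.

Lemma Re_le_normc z : `|Re z| <= normc z.
Proof. by case: z => a b /=; rewrite -sqrtr_sqr ler_wsqrtr// lerDl sqr_ge0. Qed.

Lemma Im_le_normc z : `|Im z| <= normc z.
Proof. by case: z => a b /=; rewrite -sqrtr_sqr ler_wsqrtr// lerDr sqr_ge0. Qed.

Lemma normc_Complex (x y : R) : normc (Complex x y : C) <= `|x| + `|y|.
Proof.
rewrite /normc -(ger0_norm (addr_ge0 (normr_ge0 x) (normr_ge0 y))) -sqrtr_sqr.
apply: ler_wsqrtr; rewrite -(real_normK (num_real x)) -(real_normK (num_real y)).
by have := normr_ge0 x; have := normr_ge0 y; nra.
Qed.

Lemma normcR (x : R) : normc (Complex x 0 : C) = `|x|.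
Proof. by rewrite /normc expr0n/= addr0 sqrtr_sqr. Qed.

Lemma normcX z n : normc (z ^+ n) = normc z ^+ n.
Proof. by elim: n => [|n IH]; rewrite ?expr0 ?normc1// !exprS normcM IH. Qed.

Lemma normc_prod (I : Type) (r : seq I) (P : pred I) (F : I -> C) :
  normc (\prod_(i <- r | P i) F i) = \prod_(i <- r | P i) normc (F i).
Proof.
by elim/big_rec2: _ => [|i x y _ <-]; rewrite ?normc1// normcM.
Qed.

Lemma eq_from_normc z z' : (forall e : R, 0 < e -> normc (z - z') <= e) -> z = z'.
Proof.
move=> H; apply/eqP; rewrite -subr_eq0; apply/eqP; apply: eq0_normc.
apply/eqP; rewrite eq_le normc_ge0 andbT; apply/ler_addgt0Pl => e e0.
by rewrite addr0; exact: H.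
Qed.

Lemma complex_pos (e : C) : 0 < e -> exists2 r : R, 0 < r & e = Complex r 0.
Proof.
case: e => a b; rewrite ltcE/= => /andP[/eqP <- a0].
by exists a.
Qed.

End normc_facts.

Section cubes.
Context {R : realType} (d : nat).
Local Notation C := (Cplx R).
Local Notation multi := {ffun 'I_d -> nat}.

Definition mval N (i : {ffun 'I_d -> 'I_N}) : multi := [ffun a => nat_of_ord (i a)].

(* The cubic partial sums of [multi_sum]. *)
Definition cs (V : zmodType) N (u : multi -> V) : V := \sum_(i : {ffun 'I_d -> 'I_N}) u (mval i).

(** The effect of one derivative in direction [a], both on the index of a power series coefficient
    and on the exponent of a moment. *)
Definition mshift (a : 'I_d) (i : multi) : multi := [ffun b => (i b + (b == a))%N].

Lemma mval_inj N : injective (@mval N).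
Proof.
move=> i j ij; apply/ffunP => a; apply/val_inj.
by have /ffunP/(_ a) := ij; rewrite !ffunE.
Qed.

Definition mwiden N (i : {ffun 'I_d -> 'I_N}) : {ffun 'I_d -> 'I_N.+1} :=
  [ffun a => widen_ord (leqnSn N) (i a)].

Lemma mval_widen N (i : {ffun 'I_d -> 'I_N}) : mval (mwiden i) = mval i.
Proof. by apply/ffunP => a; rewrite !ffunE. Qed.

Lemma mwiden_inj N : injective (@mwiden N).
Proof. by move=> i j ij; apply: mval_inj; rewrite -mval_widen ij mval_widen. Qed.

Lemma mshift_bound N a (i : {ffun 'I_d -> 'I_N}) b : (mshift a (mval i) b < N.+1)%N.
Proof.
rewrite !ffunE; case: (b == a); rewrite ?addn1 ?addn0 ?ltnS//.
by rewrite ltnW.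
Qed.

Definition mshiftS N a (i : {ffun 'I_d -> 'I_N}) : {ffun 'I_d -> 'I_N.+1} :=
  [ffun b => Ordinal (mshift_bound a i b)].

Lemma mval_shift N a (i : {ffun 'I_d -> 'I_N}) : mval (mshiftS a i) = mshift a (mval i).
Proof. by apply/ffunP => b; rewrite !ffunE. Qed.

Lemma mshift_inj a : injective (mshift a).
Proof. by move=> i j /ffunP ij; apply/ffunP => b; have := ij b; rewrite !ffunE => /addIn. Qed.

Lemma mshiftS_inj N a : injective (@mshiftS N a).
Proof.
move=> i j ij; apply: mval_inj; apply: (@mshift_inj a).
by rewrite -!mval_shift ij.
Qed.

Lemma cs_widen (V : zmodType) N (u : multi -> V) :
  cs N u = \sum_(j in (@mwiden N) @: [set: {ffun 'I_d -> 'I_N}]%SET) u (mval j).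
Proof.
rewrite big_imset/=; last by move=> i j _ _; exact: mwiden_inj.
by apply: eq_big => [i|i _]; rewrite ?finset.in_setT// mval_widen.
Qed.

Lemma cs_shift (V : zmodType) N a (u : multi -> V) :
  cs N (u \o mshift a) = \sum_(j in (@mshiftS N a) @: [set: {ffun 'I_d -> 'I_N}]%SET) u (mval j).
Proof.
rewrite big_imset/=; last by move=> i j _ _; exact: mshiftS_inj.
by apply: eq_big => [i|i _]; rewrite ?finset.in_setT// mval_shift.
Qed.

Lemma csB (V : zmodType) N (u v : multi -> V) : cs N (fun i => u i - v i) = cs N u - cs N v.
Proof. exact: sumrB. Qed.

Lemma csZ N (k : C) (u : multi -> C) : cs N (fun i => k * u i) = k * cs N u.
Proof. by rewrite /cs mulr_sumr. Qed.

Lemma csZR N (k : R) (u : multi -> R) : cs N (fun i => k * u i) = k * cs N u.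
Proof. by rewrite /cs mulr_sumr. Qed.

Lemma ler_cs N (u v : multi -> R) : (forall i, u i <= v i) -> cs N u <= cs N v.
Proof. by move=> uv; apply: ler_sum. Qed.

Lemma ler_cs_wide N (u : multi -> R) : (forall i, 0 <= u i) -> cs N u <= cs N.+1 u.
Proof.
move=> u0; rewrite cs_widen [leRHS](bigID (mem ((@mwiden N) @: [set: {ffun 'I_d -> 'I_N}]%SET)))/=.
by rewrite lerDl sumr_ge0.
Qed.

Lemma nd_cs (u : multi -> R) : (forall i, 0 <= u i) -> nondecreasing_seq (fun N => cs N u).
Proof. by move=> u0; apply/nondecreasing_seqP => N; exact: ler_cs_wide. Qed.

Lemma normc_sum (I : Type) (r : seq I) (P : pred I) (F : I -> C) :
  normc (\sum_(i <- r | P i) F i) <= \sum_(i <- r | P i) normc (F i).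
Proof.
elim/big_rec2: _ => [|i x y _ xy]; first by rewrite normc0.
by rewrite (le_trans (le_normcD _ _))// lerD2l.
Qed.

Lemma normc_cs N (u : multi -> C) : normc (cs N u) <= cs N (fun i => normc (u i)).
Proof. exact: normc_sum. Qed.

(** The shifted cube lies in the cube of side [N.+1] and contains every index of the cube of side
    [N] at which [u] may be nonzero. The difference thus lives in the shell between the two cubes,
    whose absolute mass tends to 0 for a summable family. *)
Lemma cs_shift_diff N a (u : multi -> C) : (forall i : multi, i a = 0%N -> u i = 0) ->
  normc (cs N (u \o mshift a) - cs N u) <=
  cs N.+1 (fun i => normc (u i)) - cs N (fun i => normc (u i)).
Proof.
move=> ua; rewrite cs_shift (@cs_widen C N) (@cs_widen R N) [cs N.+1 _]/cs.
set S' := imset _ _; set S := imset _ _.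
have -> : \sum_(j in S) u (mval j) = \sum_(j in S' :&: S) u (mval j).
  rewrite (big_setID S')/= finset.setIC [X in _ + X]big1 ?addr0// => j.
  rewrite !inE => /andP[jS' /imsetP[i _ ji]]; apply: ua.
  apply/eqP; rewrite -leqn0 leqNgt; apply: contra jS' => ja.
  apply/imsetP.
  have lt b : (mval j b - (b == a) < N)%N.
    rewrite ji mval_widen ffunE; exact: leq_ltn_trans (leq_subr _ _) (ltn_ord _).
  exists [ffun b => Ordinal (lt b)] => //; apply: mval_inj; rewrite mval_shift.
  apply/ffunP => b; rewrite !ffunE /= ffunE.
  have [ba|ba] := eqVneq b a; last by rewrite subn0 addn0.
  by rewrite subnK// ba; move: ja; rewrite ffunE.
rewrite (big_setID S)/= addrC addrK.
rewrite (le_trans (normc_sum _ _ _))//.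
rewrite [X in _ <= X - _](bigID (mem S))/= addrC addrK.
rewrite [leRHS](bigID (mem S'))/=.
rewrite (eq_bigl (fun j => (j \notin S) && (j \in S'))); last by move=> j; rewrite !inE.
by rewrite lerDl sumr_ge0// => j _; rewrite normc_ge0.
Qed.


Lemma esum_cs_le (b : multi -> R) N : (forall i, 0 <= b i) ->
  ((cs N b)%:E <= \esum_(i in setT) (b i)%:E)%E.
Proof.
move=> b0; apply: esum_ge.
exists [set` map (@mval N) (enum {: {ffun 'I_d -> 'I_N}})]; first by split; [exact: finite_seq|].
rewrite -fsbig_seq; last by rewrite map_inj_uniq ?enum_uniq//; exact: mval_inj.
by rewrite big_map big_enum/= sumEFin.
Qed.

Lemma esum_le_cs (b : multi -> R) (B : R) : (forall i, 0 <= b i) ->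
  (forall N, cs N b <= B) -> (\esum_(i in setT) (b i)%:E <= B%:E)%E.
Proof.
move=> b0 bB; apply: ge_ereal_sup => _ [X [fX _] <-].
rewrite fsbig_finite//= sumEFin lee_fin.
set s := fset_set X.
pose N := (\max_(i <- finmap.enum_fset s) \max_(a < d) i a).+1.
have lt (i : multi) a : i \in finmap.enum_fset s -> (i a < N.+1)%N.
  move=> si; rewrite ltnS (leq_trans _ (leqnSn _))//.
  have := @leq_bigmax_seq _ (finmap.enum_fset s) xpredT (fun j : multi => (\max_(a < d) j a)%N) i si isT.
  apply: leq_trans.
  exact: (@leq_bigmax _ (fun a => i a) a).
apply: le_trans (bB N.+1).
pose h (i : multi) : {ffun 'I_d -> 'I_N.+1} := [ffun a => inord (i a)].
have hK i : i \in finmap.enum_fset s -> mval (h i) = i.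
  by move=> si; apply/ffunP => a; rewrite !ffunE inordK// lt.
have hu : uniq (map h (finmap.enum_fset s)).
  rewrite map_inj_in_uniq ?finmap.fset_uniq// => i j si sj hij.
  by rewrite -(hK i)// hij hK.
have -> : \sum_(i <- finmap.enum_fset s) b i = \sum_(j <- map h (finmap.enum_fset s)) b (mval j).
  by rewrite big_map big_seq [RHS]big_seq; apply: eq_bigr => i si; rewrite hK.
rewrite big_uniq//= /cs [leRHS](bigID (mem (map h (finmap.enum_fset s))))/=.
by rewrite lerDl sumr_ge0.
Qed.

Lemma multi_sum_bounded (u : multi -> C) s : multi_sum u s ->
  exists2 B, 0 <= B & forall N, cs N (fun i => normc (u i)) <= B.
Proof.
move=> [uoo _].
have u0 i : 0 <= normc (u i) by exact: normc_ge0.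
have fin : (\esum_(i in setT) (normc (u i))%:E)%E \is a fin_num.
  by rewrite ge0_fin_numE// esum_ge0// => i _; rewrite lee_fin.
exists (fine (\esum_(i in setT) (normc (u i))%:E)%E).
  by rewrite fine_ge0// esum_ge0// => i _; rewrite lee_fin.
by move=> N; rewrite -lee_fin fineK// esum_cs_le.
Qed.

Lemma multi_sumP (u : multi -> C) s B : (forall N, cs N (fun i => normc (u i)) <= B) ->
  (fun N => cs N u) @ \oo --> s -> multi_sum u s.
Proof.
move=> uB us; split.
  by rewrite (le_lt_trans (@esum_le_cs _ B _ _)) ?ltry// => i; exact: normc_ge0.
exact: us.
Qed.

Lemma cvg_complexP (u : nat -> C) (s : C) :
  (forall e : R, 0 < e -> exists N0, forall N, (N0 <= N)%N -> normc (s - u N) < e) ->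
  u @ \oo --> s.
Proof.
move=> H; apply/cvgrPdist_lt => e e0.
have [r r0 ->] := complex_pos e0.
have [N0 hN] := H _ r0.
exists N0 => // N /= hN0; rewrite -[`|_|]/(Complex (normc (s - u N)) 0) ltcR.
exact: hN.
Qed.

Lemma cvg_complexE (u : nat -> C) (s : C) : u @ \oo --> s ->
  forall e : R, 0 < e -> exists N0, forall N, (N0 <= N)%N -> normc (s - u N) < e.
Proof.
move=> /cvgrPdist_lt us e e0.
have e0' : 0 < (Complex e 0 : C) by rewrite ltcR.
have [N0 _ hN] := us _ e0'.
by exists N0 => N /hN /=; rewrite -[`|_|]/(Complex (normc (s - u N)) 0) ltcR.
Qed.

(** Adding [normc (u i)] to the real or imaginary part makes the terms nonnegative, so each sequence
    of partial sums is a difference of two bounded nondecreasing sequences. *)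
Lemma cs_cvg (u : multi -> C) B : (forall N, cs N (fun i => normc (u i)) <= B) ->
  exists s : C, (fun N => cs N u) @ \oo --> s.
Proof.
move=> uB; have u0 i : 0 <= normc (u i) by exact: normc_ge0.
have key (w : multi -> R) : (forall i, `|w i| <= normc (u i)) ->
    exists l : R, (fun N => cs N w) @ \oo --> l.
  move=> wu; pose w' i := normc (u i) + w i.
  have w'0 i : 0 <= w' i by have := wu i; rewrite ler_norml /w' => /andP[? _]; lra.
  have w'2 i : w' i <= 2 * normc (u i) by have := wu i; rewrite ler_norml /w' => /andP[_ ?]; lra.
  have c1 : cvgn (fun N => cs N w').
    apply: (@nondecreasing_is_cvgn _ (fun N => cs N w')); first exact: nd_cs.
    exists (2 * B) => _ [N _ <-]; rewrite (le_trans (ler_cs N w'2))// csZR.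
    by rewrite ler_pM2l.
  have c2 : cvgn (fun N => cs N (fun i => normc (u i))).
    apply: (@nondecreasing_is_cvgn _ (fun N => cs N (fun i => normc (u i)))); first exact: nd_cs.
    by exists B => _ [N _ <-].
  exists (limn (fun N => cs N w') - limn (fun N => cs N (fun i => normc (u i)))).
  rewrite (_ : (fun N => _) = (fun N => cs N w' - cs N (fun i => normc (u i)))).
    exact: cvgB.
  by apply/funext => N; rewrite -csB; congr cs; apply/funext => i; rewrite /w' addrC addKr.
have [l1 /cvgrPdist_lt h1] := key (fun i => complex.Re (u i)) (fun i => Re_le_normc (u i)).
have [l2 /cvgrPdist_lt h2] := key (fun i => complex.Im (u i)) (fun i => Im_le_normc (u i)).
exists (Complex l1 l2); apply: cvg_complexP => e e0.
have e2 : 0 < e / 2 by rewrite divr_gt0.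
have [N1 _ hN1] := h1 _ e2; have [N2 _ hN2] := h2 _ e2.
exists (maxn N1 N2) => N; rewrite geq_max => /andP[/hN1/= k1 /hN2/= k2].
have -> : Complex l1 l2 - cs N u = Complex (l1 - cs N (fun i => complex.Re (u i)))
    (l2 - cs N (fun i => complex.Im (u i))).
  have -> : cs N u = Complex (cs N (fun i => complex.Re (u i))) (cs N (fun i => complex.Im (u i))).
    rewrite /cs; elim/big_rec3: _ => [//|i x y z _ ->].
    by case: (u (mval i)).
  by [].
by rewrite (le_lt_trans (normc_Complex _ _))// (splitr e) ltrD.
Qed.

End cubes.

(** * Termwise differentiation of power series in several variables *)

Section termwise.
Context {R : realType} (d : nat).
Local Notation C := (Cplx R).
Local Notation multi := {ffun 'I_d -> nat}.

(** The remainder of order [k.+1] is [w + h] times the one of order [k] plus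
    [h ^+ 2 * (k%:R * w ^+ k.-1)]. Both sides carry the factor [rho ^+ 2] so that the natural bound,
    with [rho] to the power [k - 2], needs no negative exponent. *)
Lemma pow_taylor1 (w h : C) (rho : R) k : normc w <= rho -> normc (w + h) <= rho ->
  rho ^+ 2 * normc ((w + h) ^+ k - w ^+ k - h * (k%:R * w ^+ k.-1)) <=
  normc h ^+ 2 * (k%:R ^+ 2 * rho ^+ k).
Proof.
move=> w_rho wh_rho.
have rho0 : 0 <= rho by rewrite (le_trans _ w_rho)// normc_ge0.
elim: k => [|k IH].
  by rewrite !expr0 subrr mul0r mulr0 subrr normc0 mulr0 expr0n/= mul0r mulr0.
have -> : (w + h) ^+ k.+1 - w ^+ k.+1 - h * (k.+1%:R * w ^+ k.+1.-1) =
    (w + h) * ((w + h) ^+ k - w ^+ k - h * (k%:R * w ^+ k.-1)) + h ^+ 2 * (k%:R * w ^+ k.-1).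
  case: k {IH} => [|k] /=; first by rewrite !expr0 !expr1; ring.
  rewrite (_ : k.+2%:R = k.+1%:R + 1 :> C); last by rewrite -[k.+2]addn1 natrD.
  by rewrite (exprS (w + h) k.+1) (exprS w k.+1) (exprS w k); ring.
rewrite (le_trans (ler_wpM2l _ (le_normcD _ _)))// ?exprn_ge0//.
rewrite (normcM (w + h)) (normcM (h ^+ 2)) (normcM k%:R) !normcX.
have h1 : rho ^+ 2 * (normc (w + h) * normc ((w + h) ^+ k - w ^+ k - h * (k%:R * w ^+ k.-1))) <=
    rho * (normc h ^+ 2 * (k%:R ^+ 2 * rho ^+ k)).
  by rewrite mulrCA ler_pM ?normc_ge0// mulr_ge0 ?normc_ge0// exprn_ge0.
have h2 : rho ^+ 2 * (normc h ^+ 2 * (normc (k%:R : C) * normc w ^+ k.-1)) <=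
    normc h ^+ 2 * (k%:R * rho ^+ k.+1).
  rewrite mulrCA ler_wpM2l ?exprn_ge0 ?normc_ge0//.
  have -> : normc (k%:R : C) = k%:R by rewrite normcMn normc1.
  case: k {IH h1} => [|k] /=; first by rewrite !mul0r mulr0.
  rewrite mulrCA ler_wpM2l// [leRHS](exprD _ 2 k) ler_wpM2l ?exprn_ge0//.
  by rewrite lerXn2r// nnegrE normc_ge0.
rewrite mulrDr (le_trans (lerD h1 h2))//.
have -> : rho * (normc h ^+ 2 * (k%:R ^+ 2 * rho ^+ k)) + normc h ^+ 2 * (k%:R * rho ^+ k.+1) =
  normc h ^+ 2 * ((k%:R ^+ 2 + k%:R) * rho ^+ k.+1) by rewrite (exprS rho k); ring.
rewrite ler_wpM2l ?exprn_ge0 ?normc_ge0// ler_wpM2r ?exprn_ge0//.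
by rewrite -natr1; have := ler0n R k; nra.
Qed.

Lemma sqrn_le_exp2 k : (k ^ 2 <= 4 * 2 ^ k)%N.
Proof.
elim: k => [//|[|[|[|k]]] IH]; [by []|by []|by []|].
apply: (@leq_trans (2 * k.+3 ^ 2)); last by rewrite (expnS 2 k.+3); lia.
by rewrite !expnS !expn0 !muln1; nia.
Qed.

Definition mono (w : 'rV[C]_d) (i : multi) : C := \prod_(b < d) w ord0 b ^+ i b.

Definition wt (r : R) (i : multi) : R := \prod_(b < d) r ^+ i b.

(* The factor lost by differentiating twice is absorbed by doubling the radius. *)
Lemma sqr_wt_le (r : R) (i : multi) a : 0 <= r ->
  (i a)%:R ^+ 2 * wt r i <= 4 * wt (2 * r) i.
Proof.
move=> r0; rewrite /wt (bigD1 a)//= [in leRHS](bigD1 a)//= mulrA [leRHS]mulrA.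
apply: ler_pM.
- by rewrite mulr_ge0 ?exprn_ge0.
- by apply: prodr_ge0 => b _; rewrite exprn_ge0.
- rewrite exprMn mulrA ler_wpM2r ?exprn_ge0//.
  by rewrite -!natrX -natrM ler_nat sqrn_le_exp2.
- apply: ler_prod => b _; rewrite exprn_ge0//= lerXn2r// ?nnegrE ?mulr_ge0//.
  by rewrite ler_peMl// ler1n.
Qed.

Definition rest (a : 'I_d) (w : 'rV[C]_d) (i : multi) : C := \prod_(b < d | b != a) w ord0 b ^+ i b.

Lemma monoE a w i : mono w i = w ord0 a ^+ i a * rest a w i.
Proof. by rewrite /mono (bigD1 a). Qed.

Definition dmono a (w : 'rV[C]_d) (i : multi) : C := (i a)%:R * w ord0 a ^+ (i a).-1 * rest a w i.

Lemma rest_shift a (h : C) w i : rest a (w + h *: delta_mx ord0 a) i = rest a w i.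
Proof.
apply: eq_bigr => b ba; rewrite !mxE eqxx /=.
by rewrite (negbTE ba) mulr0 addr0.
Qed.

Lemma mono_taylor1 a (w : 'rV[C]_d) (h : C) (r : R) i : 0 <= r ->
  (forall b, normc (w ord0 b) <= r) -> normc (w ord0 a + h) <= r ->
  r ^+ 2 * normc (mono (w + h *: delta_mx ord0 a) i - mono w i - h * dmono a w i) <=
  normc h ^+ 2 * (4 * wt (2 * r) i).
Proof.
move=> r0 wr whr.
rewrite !(monoE a) rest_shift !mxE !eqxx mulr1 /dmono.
have -> : (w ord0 a + h) ^+ i a * rest a w i - w ord0 a ^+ i a * rest a w i -
    h * ((i a)%:R * w ord0 a ^+ (i a).-1 * rest a w i) =
    ((w ord0 a + h) ^+ i a - w ord0 a ^+ i a - h * ((i a)%:R * w ord0 a ^+ (i a).-1)) * rest a w i by ring.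
rewrite normcM (mulrA (r ^+ 2)).
have rest0 : 0 <= normc (rest a w i) by exact: normc_ge0.
apply: le_trans (ler_wpM2r rest0 (pow_taylor1 (i a) (wr a) whr)) _.
rewrite -mulrA ler_wpM2l ?exprn_ge0 ?normc_ge0//.
apply: le_trans (sqr_wt_le i a r0).
rewrite -mulrA ler_wpM2l ?exprn_ge0// /wt (bigD1 a)//= ler_wpM2l ?exprn_ge0//.
rewrite normc_prod; apply: ler_prod => b _.
by rewrite normc_ge0 normcX lerXn2r// nnegrE ?normc_ge0.
Qed.

Lemma dmono_le a (w : 'rV[C]_d) (r : R) i : 0 <= r -> (forall b, normc (w ord0 b) <= r) ->
  r * normc (dmono a w i) <= 4 * wt (2 * r) i.
Proof.
move=> r0 wr; apply: le_trans (sqr_wt_le i a r0).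
rewrite /dmono !normcM normcX.
have -> : normc ((i a)%:R : C) = (i a)%:R by rewrite normcMn normc1.
have rl : normc (rest a w i) <= \prod_(b < d | b != a) r ^+ i b.
  rewrite normc_prod; apply: ler_prod => b _.
  by rewrite normc_ge0 normcX lerXn2r// nnegrE ?normc_ge0.
have pr0 : 0 <= \prod_(b < d | b != a) r ^+ i b by apply: prodr_ge0 => b _; rewrite exprn_ge0.
rewrite /wt (bigD1 a)//=; case: (i a) => [|k] /=.
  by rewrite !mulr0n expr0n/= !mul0r mulr0.
rewrite [leLHS](_ : _ = k.+1%:R * ((r * normc (w ord0 a) ^+ k) * normc (rest a w i))); last by ring.
have k1 : (k.+1%:R : R) <= k.+1%:R ^+ 2 by rewrite expr2 ler_peMr// ler1n.
apply: ler_pM => //; first by rewrite !mulr_ge0 ?exprn_ge0 ?normc_ge0.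
apply: ler_pM; rewrite ?mulr_ge0 ?exprn_ge0 ?normc_ge0//.
by rewrite exprS ler_wpM2l// lerXn2r// nnegrE normc_ge0.
Qed.

(* A quadratic remainder is all that differentiability needs, and it can be
   summed termwise. *)
Lemma analytic_partial (f : 'rV[C]_d -> C) (a : 'I_d) (z0 : 'rV[C]_d) : analytic f ->
  exists (r M : R) (c : multi -> C) (g : 'rV[C]_d -> C), [/\ 0 < r,
    forall z : 'rV[C]_d, (forall b, normc (z ord0 b - z0 ord0 b) < r) ->
      multi_sum (fun i => c i * \prod_(b < d) (z ord0 b - z0 ord0 b) ^+ i b) (g z) &
    forall z : 'rV[C]_d, (forall b, normc (z ord0 b - z0 ord0 b) < r) ->
      forall h : C, normc h < r ->
      normc (f (z + h *: delta_mx ord0 a) - f z - h * g z) <= M * normc h ^+ 2].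
Proof.
move=> /(_ z0)[r0 [c [r00 fc]]].
(* The points [z] and [z + h] stay within [2 * r] of [z0], and the quadratic remainder doubles this
   to [4 * r], at most [r0 / 2]: the absolute sum at the single point [zc] dominates all the
   series. *)
pose r := r0 / 8; have r_gt0 : 0 < r by rewrite divr_gt0.
have r_ge0 := ltW r_gt0; have r02 : 0 <= r0 / 2 by rewrite divr_ge0 ?(ltW r00).
pose zc : 'rV[C]_d := z0 + const_mx (Complex (r0 / 2) 0).
have [B B0 hB] : exists2 B, 0 <= B & forall N, cs N (fun i => normc (c i) * wt (4 * r) i) <= B.
  have /fc /multi_sum_bounded[B B0 hB] : forall b, normc (zc ord0 b - z0 ord0 b) < r0.
    move=> b; rewrite !mxE addrAC subrr add0r normcR ger0_norm//.
    by rewrite ltr_pdivrMr// ltr_pMr// ltr1n.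
  exists B => // N; apply: le_trans (hB N); apply: ler_cs => i.
  rewrite normcM ler_wpM2l ?normc_ge0// normc_prod; apply: ler_prod => b _.
  apply/andP; split; first by rewrite exprn_ge0// mulr_ge0.
  rewrite !mxE addrAC subrr add0r normcX normcR.
  have hr4 : 4 * r <= r0 / 2 by rewrite /r; lra.
  by rewrite ger0_norm// lerXn2r// nnegrE /r; lra.
pose v (z : 'rV[C]_d) (i : multi) := c i * dmono a (z - z0) i.
have r2 : 0 <= 2 * r by rewrite mulr_ge0.
have vle (z : 'rV[C]_d) (i : multi) : (forall b, normc (z ord0 b - z0 ord0 b) < r) ->
    normc (v z i) <= (2 / r) * (normc (c i) * wt (4 * r) i).
  move=> zr; rewrite /v normcM mulrCA ler_wpM2l ?normc_ge0//.
  rewrite -(ler_pM2l (_ : 0 < 2 * r)); last by rewrite mulr_gt0.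
  rewrite [leRHS]mulrA (_ : 2 * r * (2 / r) = 4); last by field; rewrite gt_eqF.
  rewrite (_ : 4 * r = 2 * (2 * r)); last by ring.
  apply: dmono_le => // b; rewrite !mxE (le_trans (ltW (zr b)))//.
  by lra.
have vB (z : 'rV[C]_d) : (forall b, normc (z ord0 b - z0 ord0 b) < r) ->
    forall N, cs N (fun i => normc (v z i)) <= (2 / r) * B.
  move=> zr N; apply: (@le_trans _ _ (cs N (fun i => (2 / r) * (normc (c i) * wt (4 * r) i)))).
    by apply: ler_cs => i; exact: vle.
  by rewrite csZR ler_wpM2l// divr_ge0// ltW.
have [g hg] : exists g : 'rV[C]_d -> C, forall z : 'rV[C]_d, (forall b, normc (z ord0 b - z0 ord0 b) < r) ->
    (fun N => cs N (v z)) @ \oo --> g z.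
  have ex (z : 'rV[C]_d) : exists s : C, (forall b, normc (z ord0 b - z0 ord0 b) < r) ->
      (fun N => cs N (v z)) @ \oo --> s.
    have [zr|zr] := pselect (forall b, normc (z ord0 b - z0 ord0 b) < r).
      by have [s hs] := cs_cvg (vB z zr); exists s.
    by exists 0.
  by exists (fun z => sval (cid (ex z))) => z; exact: (svalP (cid (ex z))).
(* Written as a power series, the derivative has coefficient [(i a).+1%:R * c (mshift a i)]. Its
   cubic partial sums are those of [v z] over a shifted cube, which [cs_shift_diff] compares with
   the unshifted ones. *)
exists r, ((2 * r) ^- 2 * 4 * B), (fun i : multi => (i a).+1%:R * c (mshift a i)), g; split => //.
- move=> z zr.
  have vsE : (fun i : multi => (i a).+1%:R * c (mshift a i) * \prod_(b < d) (z ord0 b - z0 ord0 b) ^+ i b) = v z \o mshift a.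
    apply/funext => i /=; rewrite /v /dmono !ffunE eqxx addn1 /=.
    rewrite (_ : \prod_(b < d) _ = (z - z0) ord0 a ^+ i a * rest a (z - z0) (mshift a i)); first by ring.
    rewrite (bigD1 a)//= !mxE; congr (_ * _); apply: eq_bigr => b ba.
    by rewrite !mxE ffunE (negbTE ba) addn0.
  rewrite vsE.
  have v0 (i : multi) : i a = 0%N -> v z i = 0 by move=> ia; rewrite /v /dmono ia !mul0r mulr0.
  have nv0 (i : multi) : i a = 0%N -> Complex (normc (v z i)) 0 = 0 :> C by move=> /v0 ->; rewrite normc0.
  have bsh N : cs N (fun i => normc ((v z \o mshift a) i)) <= (2 / r) * B.
    apply: le_trans (vB z zr N.+1).
    rewrite -[leLHS]/(cs N ((fun i => normc (v z i)) \o mshift a)) cs_shift [leRHS]/cs.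
    rewrite [leRHS](bigID (mem ((@mshiftS d N a) @: [set: {ffun 'I_d -> 'I_N}]%SET)))/=.
    by rewrite lerDl sumr_ge0// => i _; exact: normc_ge0.
  apply: (multi_sumP bsh); apply: cvg_complexP => e e0.
  have [N1 hN1] := cvg_complexE (hg z zr) (divr_gt0 e0 (ltr0n _ 2)).
  have cvb : cvgn (fun N => cs N (fun i => normc (v z i))).
    apply: (@nondecreasing_is_cvgn _ (fun N => cs N (fun i => normc (v z i)))).
      by apply: nd_cs => i; exact: normc_ge0.
    by exists ((2 / r) * B) => _ [N _ <-]; exact: vB.
  have [N2 hN2] : exists N2, forall N, (N2 <= N)%N ->
      cs N.+1 (fun i => normc (v z i)) - cs N (fun i => normc (v z i)) < e / 2.
    have e4 : 0 < e / 4 by rewrite divr_gt0.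
    have /cvgrPdist_lt/(_ _ e4)[N2 _ hN2] := cvb.
    exists N2 => N N2N; have := hN2 _ N2N; have := hN2 N.+1 (leqW N2N) => /=.
    by rewrite !ltr_norml => /andP[? ?] /andP[? ?]; lra.
  exists (maxn N1 N2) => N; rewrite geq_max => /andP[/hN1 k1 /hN2 k2].
  rewrite -[cs N _](subrK (cs N (v z))) opprD addrCA.
  rewrite (le_lt_trans (le_normcD _ _))// [ltRHS]splitr ltrD// normcN.
  exact: le_lt_trans (cs_shift_diff N v0) k2.
- move=> z zr h hr.
  have zhr b : normc ((z + h *: delta_mx ord0 a) ord0 b - z0 ord0 b) < r0.
    rewrite !mxE eqxx /= (_ : _ - _ = (z ord0 b - z0 ord0 b) + h * (b == a)%:R); last by ring.
    rewrite (le_lt_trans (le_normcD _ _))// (_ : r0 = 4 * r + 4 * r); last by rewrite /r; field.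
    apply: ltrD; first by apply: lt_le_trans (zr b) _; lra.
    case: (b == a); rewrite ?mulr1 ?mulr0 ?normc0; last by lra.
    by apply: lt_le_trans hr _; lra.
  have zr0 b : normc (z ord0 b - z0 ord0 b) < r0.
    by apply: lt_le_trans (zr b) _; rewrite /r; lra.
  have [_ c1] := fc _ zhr; have [_ c2] := fc _ zr0.
  pose S1 N := cs N (fun i => c i * \prod_(b < d) ((z + h *: delta_mx ord0 a) ord0 b - z0 ord0 b) ^+ i b).
  pose S2 N := cs N (fun i => c i * \prod_(b < d) (z ord0 b - z0 ord0 b) ^+ i b).
  have SN N : normc (S1 N - S2 N - h * cs N (v z)) <= (2 * r) ^- 2 * 4 * B * normc h ^+ 2.
    rewrite /S1 /S2 -csZ -!csB (le_trans (normc_cs _ _))//.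
    apply: (@le_trans _ _ (cs N (fun i => (2 * r) ^- 2 * 4 * normc h ^+ 2 * (normc (c i) * wt (4 * r) i)))).
      apply: ler_cs => i.
      have -> : c i * \prod_(b < d) ((z + h *: delta_mx ord0 a) ord0 b - z0 ord0 b) ^+ i b -
        c i * \prod_(b < d) (z ord0 b - z0 ord0 b) ^+ i b - h * v z i =
        c i * (mono ((z - z0) + h *: delta_mx ord0 a) i - mono (z - z0) i - h * dmono a (z - z0) i).
        have -> : \prod_(b < d) (z ord0 b - z0 ord0 b) ^+ i b = mono (z - z0) i.
          by apply: eq_bigr => b _; rewrite !mxE.
        have -> : \prod_(b < d) ((z + h *: delta_mx ord0 a) ord0 b - z0 ord0 b) ^+ i b =
          mono ((z - z0) + h *: delta_mx ord0 a) i.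
          by apply: eq_bigr => b _; rewrite !mxE addrAC.
        by rewrite /v; ring.
      rewrite normcM [leRHS]mulrCA ler_wpM2l ?normc_ge0//.
      rewrite -(ler_pM2l (_ : 0 < (2 * r) ^+ 2)); last by rewrite exprn_gt0// mulr_gt0.
      rewrite [leRHS](_ : _ = normc h ^+ 2 * (4 * wt (4 * r) i)); last first.
        by field; rewrite gt_eqF.
      rewrite (_ : 4 * r = 2 * (2 * r)); last by ring.
      apply: mono_taylor1 => //.
        by move=> b; rewrite !mxE (le_trans (ltW (zr b)))//; lra.
      rewrite !mxE (le_trans (le_normcD _ _))// (_ : 2 * r = r + r); last by ring.
      by rewrite lerD ?ltW.
    have k0 : 0 <= (2 * r) ^- 2 * 4 * normc h ^+ 2.
      by rewrite !mulr_ge0 ?invr_ge0 ?exprn_ge0 ?normc_ge0.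
    rewrite csZR [leRHS](_ : _ = (2 * r) ^- 2 * 4 * normc h ^+ 2 * B); last by ring.
    exact: ler_wpM2l.
  apply/ler_addgt0Pl => e e0.
  have e4 : 0 < e / 4 by rewrite divr_gt0.
  have hh : 0 < e / 4 / (1 + normc h) by rewrite divr_gt0// ltr_wpDr ?normc_ge0.
  have [N1 k1] := cvg_complexE c1 e4; have [N2 k2] := cvg_complexE c2 e4.
  have [N3 k3] := cvg_complexE (hg z zr) hh.
  pose N := maxn N1 (maxn N2 N3).
  have {}k1 := k1 N (leq_maxl _ _).
  have {}k2 := k2 N (leq_trans (leq_maxl _ _) (leq_maxr _ _)).
  have {}k3 := k3 N (leq_trans (leq_maxr _ _) (leq_maxr _ _)).
  have k4 : normc (h * (g z - cs N (v z))) <= e / 4.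
    rewrite normcM.
    apply: (@le_trans _ _ ((1 + normc h) * (e / 4 / (1 + normc h)))).
      by apply: ler_pM; rewrite ?normc_ge0 ?lerDr// ltW.
    by rewrite mulrCA mulfV ?mulr1// gt_eqF// ltr_wpDr ?normc_ge0.
  set F1 := f (z + _) in k1 *.
  have -> : F1 - f z - h * g z = (F1 - S1 N) - (f z - S2 N) - h * (g z - cs N (v z)) +
     (S1 N - S2 N - h * cs N (v z)) by ring.
  rewrite (le_trans (le_normcD _ _))//; apply: lerD; last exact: SN.
  rewrite (le_trans (le_normcD _ _))// normcN.
  have := le_normcD (F1 - S1 N) (- (f z - S2 N)); rewrite normcN => k5.
  move: k1 k2; rewrite -/(S1 N) -/(S2 N) => k1 k2.
  have k1' : normc (F1 - S1 N) < e / 4 by exact: k1.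
  have k2' : normc (f z - S2 N) < e / 4 by exact: k2.
  lra.
Qed.


Lemma partial_expansion (f : 'rV[C]_d -> C) (a : 'I_d) (z : 'rV[C]_d) (G : C) (r M : R) :
  0 < r -> (forall h : C, normc h < r ->
    normc (f (z + h *: delta_mx ord0 a) - f z - h * G) <= M * normc h ^+ 2) ->
  partial a f z = G.
Proof.
move=> r0 H; rewrite /partial /derive; apply/cvg_lim => //.
have M0 : 0 <= M.
  have nr : normc (Complex (r / 2) 0 : C) = r / 2 by rewrite normcR ger0_norm ?divr_ge0 ?(ltW r0).
  have := H (Complex (r / 2) 0); rewrite nr => /(_ _)/(le_trans (normc_ge0 _)).
  rewrite pmulr_lge0 ?exprn_gt0 ?divr_gt0//; apply.
  by rewrite ltr_pdivrMr// ltr_pMr// ltr1n.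
apply/cvgrPdist_le => e /complex_pos[e' e0 ->].
pose s := Num.min (r / 2) (e' / (M + 1)).
have s0 : 0 < s by rewrite lt_min !divr_gt0// ltr_wpDl.
have sc0 : 0 < (Complex s 0 : C) by rewrite ltcR.
near=> h.
have h0 : h != 0 by near: h; exact: nbhs_dnbhs_neq.
have hs : normc h < s.
  rewrite -ltcR -[X in X < _]/(`|h|); near: h.
  exact: (dnbhs0_lt sc0).
rewrite -[X in X <= _]/((normc (G - h^-1 *: ((f \o shift z) (h *: delta_mx ord0 a) - f z)))%:C)%C lecR.
have nh0 : 0 < normc h.
  by rewrite lt_neqAle normc_ge0 andbT eq_sym; apply: contra_neq h0 => /eq0_normc.
rewrite /= [h *: _ + z]addrC.
have -> : G - h^-1 *: (f (z + h *: delta_mx ord0 a) - f z) =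
    - h^-1 * (f (z + h *: delta_mx ord0 a) - f z - h * G).
  by rewrite -[_ *: _]/(_ * _); field.
rewrite normcM normcN normcV.
have hr : normc h < r.
  by apply: lt_le_trans hs _; rewrite ge_min ler_pdivrMr// ler_pMr// ler1n.
apply: (@le_trans _ _ ((normc h)^-1 * (M * normc h ^+ 2))).
  by rewrite ler_wpM2l ?invr_ge0 ?normc_ge0 ?H.
have -> : (normc h)^-1 * (M * normc h ^+ 2) = M * normc h by field; rewrite gt_eqF.
have he : normc h <= e' / (M + 1) by apply: le_trans (ltW hs) _; rewrite ge_min lexx orbT.
apply: (@le_trans _ _ ((M + 1) * (e' / (M + 1)))).
  by apply: ler_pM; rewrite ?normc_ge0 ?lerDl.
by rewrite mulrCA mulfV ?mulr1// gt_eqF// ltr_wpDl.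
Unshelve. all: by end_near. Qed.

Lemma analytic_partialP (f : 'rV[C]_d -> C) (a : 'I_d) : analytic f ->
  analytic (partial a f) /\
  forall z, exists r M : R, 0 < r /\ forall h : C, normc h < r ->
    normc (f (z + h *: delta_mx ord0 a) - f z - h * partial a f z) <= M * normc h ^+ 2.
Proof.
move=> af; split=> z0; have [r [M [c [g [r0 gs gM]]]]] := analytic_partial a z0 af.
  exists r, c; split; [exact: r0|move=> z zr]; rewrite (@partial_expansion f a z (g z) r M r0 (gM z zr)).
  exact: gs.
have z0r b : normc (z0 ord0 b - z0 ord0 b) < r by rewrite subrr normc0.
exists r, M; split; [exact: r0|move=> h hr]; rewrite (@partial_expansion f a z0 (g z0) r M r0 (gM z0 z0r)).
exact: gM.
Qed.

End termwise.

(** * Quadratic remainders of sine and cosine *)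

Section trig_expansion.
Context {R : realType}.
Implicit Types u v : R.

Lemma sin_le_abs v : `|sin v| <= `|v|.
Proof.
wlog v0 : v / 0 <= v.
  move=> H; have [|/ltW v0] := leP 0 v; first exact: H.
  by have := H (- v); rewrite oppr_ge0 v0 sinN !normrN => /(_ isT).
move: v0; rewrite le_eqVlt => /predU1P[<-|v0]; first by rewrite sin0.
have ds x : x \in `]0, v[ -> is_derive x (1 : R) (@sin R) (cos x) by move=> _; exact: is_derive_sin.
have cs : {within `[0, v], continuous (@sin R)}.
  by apply: continuous_subspaceT => x; exact: continuous_sin.
have [c _] := MVT v0 ds cs; rewrite sin0 !subr0 => ->.
rewrite normrM -[leRHS]mul1r ler_wpM2r// ler_norml.
by rewrite cos_geN1 cos_le1.
Qed.

Lemma cosB1_le v : `|cos v - 1| <= v ^+ 2.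
Proof.
have -> : cos v - 1 = - (2 * sin (v / 2) ^+ 2).
  rewrite [in cos v](splitr v) cosD -!expr2 cos2sin2; ring.
rewrite normrN normrM (ger0_norm (_ : 0 <= 2))// normrX.
have h := sin_le_abs (v / 2).
have : `|sin (v / 2)| ^+ 2 <= `|v / 2| ^+ 2 by rewrite lerXn2r// nnegrE.
rewrite [X in _ <= X -> _]real_normK ?num_real// expr_div_n.
have := sqr_ge0 v; lra.
Qed.

Lemma cosB1_le1 v : `|cos v - 1| <= `|v|.
Proof.
have [v1|v1] := leP `|v| 1.
  apply: le_trans (cosB1_le v) _; rewrite -real_normK ?num_real// expr2.
  by rewrite ler_piMr.
rewrite ler_norml; have := cos_geN1 v; have := cos_le1 v => h1 h2.
have [v2|v2] := leP 2 `|v|; first by apply/andP; split; lra.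
have : `|cos v - 1| <= `|v|.
  have -> : cos v - 1 = - (2 * sin (v / 2) ^+ 2).
    rewrite [in cos v](splitr v) cosD -!expr2 cos2sin2; ring.
  rewrite normrN normrM (ger0_norm (_ : 0 <= 2))// normrX expr2.
  have h := sin_le_abs (v / 2).
  have h' : `|sin (v / 2)| <= 1 by rewrite ler_norml sin_geN1 sin_le1.
  have hv : `|v / 2| = `|v| / 2 by rewrite normrM [X in _ * X]ger0_norm ?invr_ge0.
  rewrite hv in h.
  have := normr_ge0 (sin (v / 2)); nra.
by rewrite ler_norml.
Qed.

Lemma sinB_le v : `|sin v - v| <= v ^+ 2.
Proof.
wlog v0 : v / 0 <= v.
  move=> H; have [|/ltW v0] := leP 0 v; first exact: H.
  have := H (- v); rewrite oppr_ge0 v0 sinN sqrrN => /(_ isT).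
  by rewrite -opprD normrN.
move: v0; rewrite le_eqVlt => /predU1P[<-|v0]; first by rewrite sin0 subrr normr0 expr0n.
have ds x : x \in `]0, v[ -> is_derive x (1 : R) (fun x => sin x - x) (cos x - 1).
  by move=> _; apply: is_deriveB.
have cs : {within `[0, v], continuous (fun x : R => sin x - x)}.
  apply: continuous_subspaceT => x; apply: cvgB; [exact: continuous_sin|exact: cvg_id].
have [c cv] := MVT v0 ds cs; rewrite sin0 !subr0 => ->.
rewrite normrM expr2 (ger0_norm (ltW v0)) ler_wpM2r ?(ltW v0)//.
apply: le_trans (cosB1_le1 c) _; move: cv; rewrite in_itv/= => /andP[c0 cv].
by rewrite ger0_norm ltW.
Qed.

Lemma cos_taylor u v : `|cos (u + v) - cos u + v * sin u| <= 2 * v ^+ 2.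
Proof.
have -> : cos (u + v) - cos u + v * sin u = cos u * (cos v - 1) - sin u * (sin v - v).
  by rewrite cosD; ring.
rewrite (le_trans (ler_normB _ _))// !normrM mulr2n mulrDl mul1r.
apply: lerD.
- by apply: le_trans (cosB1_le v); rewrite ler_piMl// ler_norml ?cos_geN1 ?cos_le1 ?sin_geN1 ?sin_le1.
- by apply: le_trans (sinB_le v); rewrite ler_piMl// ler_norml ?cos_geN1 ?cos_le1 ?sin_geN1 ?sin_le1.
Qed.

Lemma sin_taylor u v : `|sin (u + v) - sin u - v * cos u| <= 2 * v ^+ 2.
Proof.
have -> : sin (u + v) - sin u - v * cos u = sin u * (cos v - 1) + cos u * (sin v - v).
  by rewrite sinD; ring.
rewrite (le_trans (ler_normD _ _))// !normrM mulr2n mulrDl mul1r.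
apply: lerD.
- by apply: le_trans (cosB1_le v); rewrite ler_piMl// ler_norml ?cos_geN1 ?cos_le1 ?sin_geN1 ?sin_le1.
- by apply: le_trans (sinB_le v); rewrite ler_piMl// ler_norml ?cos_geN1 ?cos_le1 ?sin_geN1 ?sin_le1.
Qed.

End trig_expansion.

(** * Derivatives of a Fourier transform as moments *)

Section moments.
Context {R : realType} (d : nat).
Local Notation C := (Cplx R).
Local Notation multi := {ffun 'I_d -> nat}.
Variables (mu : {measure set 'rV[R]_d -> \bar R}) (f : 'rV[R]_d -> R).

Definition mm (i : multi) (x : 'rV[R]_d) : R := \prod_(b < d) x ord0 b ^+ i b.

Hypothesis mmi : forall i, mu.-integrable setT (EFin \o (fun x => mm i x * f x)).

(* [mG i] is the partial derivative of order [i] of [mG 0], the Fourier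
   transform of [f] with respect to [mu]. *)
Definition mC i t := \int[mu]_x (cos (dotp t x) * (mm i x * f x)).
Definition mS i t := \int[mu]_x (sin (dotp t x) * (mm i x * f x)).
Definition mG i t : C := Complex 0 1 ^+ norm1 i * Complex (mC i t) (mS i t).

Lemma mm_shift a i x : mm (mshift a i) x = x ord0 a * mm i x.
Proof.
rewrite /mm (bigD1 a)//= [in RHS](bigD1 a)//= mulrA; congr (_ * _).
  by rewrite ffunE eqxx addn1 exprS.
by apply: eq_bigr => b ba; rewrite ffunE (negbTE ba) addn0.
Qed.

Lemma norm1_shift a (i : multi) : norm1 (mshift a i) = (norm1 i).+1.
Proof.
rewrite /norm1 (bigD1 a)//= [in RHS](bigD1 a)//= ffunE eqxx addn1 addSn; congr (_ + _).+1.
by apply: eq_bigr => b ba; rewrite ffunE (negbTE ba) addn0.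
Qed.

Lemma dotp_shift (t x : 'rV[R]_d) (h : R) a :
  dotp (t + h *: delta_mx ord0 a) x = dotp t x + h * x ord0 a.
Proof.
rewrite /dotp; under eq_bigr do rewrite !mxE mulrDl.
rewrite big_split/=; congr (_ + _).
rewrite (bigD1 a)//= !eqxx mulr1 big1 ?addr0// => b ba.
by rewrite (negbTE ba) mulr0 mul0r.
Qed.

Lemma toC_shift (t : 'rV[R]_d) (h : R) a :
  toC (t + h *: delta_mx ord0 a) = toC t + (Complex h 0 : C) *: delta_mx ord0 a.
Proof.
apply/matrixP => i j; rewrite !mxE.
case: (_ && _); rewrite ?mulr1 ?mulr0 ?mulr0n ?mulr1n.
  by apply/eqP; rewrite eq_complex/= addr0 !eqxx.
by rewrite !addr0.
Qed.

Let mcosm i t : mu.-integrable setT (EFin \o (fun x => cos (dotp t x) * (mm i x * f x))).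
Proof.
apply: integrable_boundedM => // [|x]; last by rewrite ler_norml cos_geN1 cos_le1.
by apply: (measurableT_comp measurable_cos); exact: measurable_dotp.
Qed.

Let msinm i t : mu.-integrable setT (EFin \o (fun x => sin (dotp t x) * (mm i x * f x))).
Proof.
apply: integrable_boundedM => // [|x]; last by rewrite ler_norml sin_geN1 sin_le1.
by apply: (measurableT_comp measurable_sin); exact: measurable_dotp.
Qed.

Lemma integrable_RZl (k : R) (g : 'rV[R]_d -> R) : mu.-integrable setT (EFin \o g) ->
  mu.-integrable setT (EFin \o (fun x => k * g x)).
Proof. by move=> gi; apply: (integrableZl measurableT k gi). Qed.

Lemma integrable_RD (g1 g2 : 'rV[R]_d -> R) : mu.-integrable setT (EFin \o g1) ->
  mu.-integrable setT (EFin \o g2) -> mu.-integrable setT (EFin \o (fun x => g1 x + g2 x)).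
Proof. by move=> i1 i2; apply: (integrableD measurableT i1 i2). Qed.

Lemma integrable_RB (g1 g2 : 'rV[R]_d -> R) : mu.-integrable setT (EFin \o g1) ->
  mu.-integrable setT (EFin \o g2) -> mu.-integrable setT (EFin \o (fun x => g1 x - g2 x)).
Proof. by move=> i1 i2; apply: (integrableB measurableT i1 i2). Qed.

Lemma Rintegral_le_abs (g b : 'rV[R]_d -> R) :
  mu.-integrable setT (EFin \o g) -> mu.-integrable setT (EFin \o b) ->
  (forall x, `|g x| <= b x) -> `|\int[mu]_x g x| <= \int[mu]_x b x.
Proof.
move=> gi bi gb; apply: le_trans (le_normr_Rintegral measurableT gi) _.
by apply: le_Rintegral => //; exact: (integrable_norm gi).
Qed.

(** The trigonometric factor is expanded pointwise under the integral, and its quadratic remainder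
    is dominated by the absolute moment with two more powers in direction [a]. *)
Lemma mG_expansion i a t : exists M : R, forall h : R,
  normc (mG i (t + h *: delta_mx ord0 a) - mG i t - (Complex h 0 : C) * mG (mshift a i) t)
  <= M * h ^+ 2.
Proof.
pose b x := `|mm (mshift a (mshift a i)) x * f x|.
have bi : mu.-integrable setT (EFin \o b) by exact: (integrable_norm (mmi _)).
exists (4 * \int[mu]_x b x) => h.
pose DC := mC i (t + h *: delta_mx ord0 a) - mC i t + h * mS (mshift a i) t.
pose DS := mS i (t + h *: delta_mx ord0 a) - mS i t - h * mC (mshift a i) t.
have -> : mG i (t + h *: delta_mx ord0 a) - mG i t - (Complex h 0 : C) * mG (mshift a i) t =
    Complex 0 1 ^+ norm1 i * Complex DC DS.
  rewrite /mG norm1_shift exprSr.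
  have -> : (Complex DC DS : C) = Complex (mC i (t + h *: delta_mx ord0 a)) (mS i (t + h *: delta_mx ord0 a)) -
      Complex (mC i t) (mS i t) - (Complex h 0 : C) * ((Complex 0 1 : C) * Complex (mC (mshift a i) t) (mS (mshift a i) t)).
    by rewrite /DC /DS; apply/eqP; rewrite eq_complex/=; apply/andP; split; apply/eqP; ring.
  by ring.
have n1 : normc (Complex 0 1 : C) = 1 by rewrite /normc expr0n add0r expr1n sqrtr1.
rewrite normcM normcX n1 expr1n mul1r.
apply: le_trans (normc_Complex _ _) _.
have bnd (g : 'rV[R]_d -> R) : mu.-integrable setT (EFin \o g) ->
    (forall x, `|g x| <= (2 * h ^+ 2) * b x) -> `|\int[mu]_x g x| <= 2 * h ^+ 2 * \int[mu]_x b x.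
  move=> gi gb; rewrite -RintegralZl//; apply: Rintegral_le_abs => //; exact: integrable_RZl.
have bE x : b x = x ord0 a ^+ 2 * `|mm i x * f x|.
  rewrite /b !mm_shift (_ : _ * f x = x ord0 a ^+ 2 * (mm i x * f x)); last by ring.
  by rewrite normrM (ger0_norm (sqr_ge0 _)).
have hC : `|DC| <= 2 * h ^+ 2 * \int[mu]_x b x.
  have -> : DC = \int[mu]_x (cos (dotp (t + h *: delta_mx ord0 a) x) * (mm i x * f x) -
     cos (dotp t x) * (mm i x * f x) + h * (sin (dotp t x) * (mm (mshift a i) x * f x))).
    rewrite RintegralD//; last 2 first.
    - by apply: integrable_RB; exact: mcosm.
    - by apply: integrable_RZl; exact: msinm.
    by rewrite RintegralB// RintegralZl.
  apply: bnd.
    apply: integrable_RD; first by apply: integrable_RB; exact: mcosm.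
    by apply: integrable_RZl; exact: msinm.
  move=> x; rewrite dotp_shift mm_shift bE.
  have -> : cos (dotp t x + h * x ord0 a) * (mm i x * f x) - cos (dotp t x) * (mm i x * f x) +
     h * (sin (dotp t x) * (x ord0 a * mm i x * f x)) =
     (cos (dotp t x + h * x ord0 a) - cos (dotp t x) + (h * x ord0 a) * sin (dotp t x)) * (mm i x * f x) by ring.
  rewrite normrM mulrA ler_wpM2r//; apply: le_trans (cos_taylor _ _) _.
  by rewrite exprMn mulrA.
have hS : `|DS| <= 2 * h ^+ 2 * \int[mu]_x b x.
  have -> : DS = \int[mu]_x (sin (dotp (t + h *: delta_mx ord0 a) x) * (mm i x * f x) -
     sin (dotp t x) * (mm i x * f x) - h * (cos (dotp t x) * (mm (mshift a i) x * f x))).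
    rewrite RintegralB//; last 2 first.
    - by apply: integrable_RB; exact: msinm.
    - by apply: integrable_RZl; exact: mcosm.
    by rewrite RintegralB// RintegralZl.
  apply: bnd.
    apply: integrable_RB; first by apply: integrable_RB; exact: msinm.
    by apply: integrable_RZl; exact: mcosm.
  move=> x; rewrite dotp_shift mm_shift bE.
  have -> : sin (dotp t x + h * x ord0 a) * (mm i x * f x) - sin (dotp t x) * (mm i x * f x) -
     h * (cos (dotp t x) * (x ord0 a * mm i x * f x)) =
     (sin (dotp t x + h * x ord0 a) - sin (dotp t x) - (h * x ord0 a) * cos (dotp t x)) * (mm i x * f x) by ring.
  rewrite normrM mulrA ler_wpM2r//; apply: le_trans (sin_taylor _ _) _.
  by rewrite exprMn mulrA.
rewrite (_ : 4 * _ * _ = 2 * h ^+ 2 * \int[mu]_x b x + 2 * h ^+ 2 * \int[mu]_x b x); last by ring.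
exact: lerD.
Qed.

(** Along real increments [h] both the analytic extension and the integral have a first-order
    expansion with an error of order [h ^+ 2]; their linear coefficients therefore agree. *)
Lemma partial_moment (psi : 'rV[C]_d -> C) i a : analytic psi ->
  (forall t, psi (toC t) = mG i t) -> forall t, partial a psi (toC t) = mG (mshift a i) t.
Proof.
move=> /(analytic_partialP a)[_ pe] pG t.
have [r [M1 [r0 h1]]] := pe (toC t); have [M2 h2] := mG_expansion i a t.
apply: eq_from_normc => e e0.
pose M := `|M1| + `|M2|; have M0 : 0 <= M by rewrite addr_ge0.
pose h := Num.min (r / 2) (e / (M + 1)).
have hh0 : 0 < h by rewrite lt_min !divr_gt0// ltr_wpDl.
have nh : normc (Complex h 0 : C) = h by rewrite normcR gtr0_norm.
have hr : normc (Complex h 0 : C) < r.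
  by rewrite nh gt_min ltr_pdivrMr// ltr_pMr// ltr1n.
have {}h1 := h1 _ hr; have {}h2 := h2 h.
rewrite -(ler_pM2l hh0) -{1}nh -normcM.
have -> : (Complex h 0 : C) * (partial a psi (toC t) - mG (mshift a i) t) =
   (psi (toC t + (Complex h 0 : C) *: delta_mx ord0 a) - psi (toC t) - (Complex h 0 : C) * mG (mshift a i) t)
 - (psi (toC t + (Complex h 0 : C) *: delta_mx ord0 a) - psi (toC t) - (Complex h 0 : C) * partial a psi (toC t)) by ring.
rewrite -[X in normc (X - _ - _ - _)]/(psi _) -{1}toC_shift !pG.
apply: le_trans (le_normcD _ _) _; rewrite normcN.
apply: (@le_trans _ _ (M2 * h ^+ 2 + M1 * h ^+ 2)).
  by apply: lerD => //; move: h1; rewrite nh pG.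
apply: (@le_trans _ _ (h * ((M + 1) * h))).
  rewrite -mulrDl (_ : h * ((M + 1) * h) = (M + 1) * h ^+ 2); last by ring.
  rewrite ler_wpM2r ?sqr_ge0//.
  by rewrite /M; have := ler_norm M1; have := ler_norm M2; lra.
rewrite ler_wpM2l ?(ltW hh0)//.
have : h <= e / (M + 1) by rewrite ge_min lexx orbT.
by rewrite ler_pdivlMr 1?mulrC// ltr_wpDl.
Qed.

(** At the origin the cosine is 1 and the sine vanishes, and the power of the imaginary unit has
    modulus 1. *)
Lemma multi_partial_moment (psi : 'rV[C]_d -> C) (i : multi) : analytic psi ->
  (forall t, psi (toC t) = mG [ffun=> 0%N] t) ->
  normc (multi_partial i psi 0) = `|\int[mu]_x (mm i x * f x)|.
Proof.
move=> ap pG.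
have iterP (a : 'I_d) n (g : 'rV[C]_d -> C) (j : multi) :
    analytic g -> (forall t, g (toC t) = mG j t) ->
    analytic (iter n (partial a) g) /\
    forall t, iter n (partial a) g (toC t) = mG (iter n (mshift a) j) t.
  move=> ag gj; elim: n => [//|n [an en]] /=; split.
    by have [] := analytic_partialP a an.
  exact: partial_moment.
pose fj := foldr (fun a j => iter (i a) (mshift a) j) [ffun=> 0%N] (enum 'I_d).
have [_ mpE] : analytic (multi_partial i psi) /\
    forall t, multi_partial i psi (toC t) = mG fj t.
  rewrite /multi_partial /fj; elim: (enum 'I_d) => [//|a s [as_ es]] /=.
  exact: iterP.
have fjE : fj = i.
  apply/ffunP => b.
  have itE (a : 'I_d) n (j : multi) : iter n (mshift a) j b = (j b + n * (b == a))%N.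
    by elim: n => [|n IH]; rewrite ?mul0n ?addn0//= ffunE IH mulSn addnAC addnA.
  have fE s : foldr (fun a j => iter (i a) (mshift a) j) [ffun=> 0%N] s b =
      (\sum_(a <- s) i a * (b == a))%N.
    by elim: s => [|a s IH]; rewrite ?big_nil/= ?ffunE// big_cons itE IH addnC.
  rewrite /fj fE big_enum/= (bigD1 b)//= eqxx muln1 big1 ?addn0// => a ab.
  by rewrite eq_sym (negbTE ab) muln0.
have z0 : (0 : 'rV[C]_d) = toC 0 by apply/matrixP => k l; rewrite !mxE.
rewrite z0 mpE fjE /mG normcM normcX.
have -> : normc (Complex 0 1 : C) = 1 by rewrite /normc expr0n add0r expr1n sqrtr1.
rewrite expr1n mul1r.
have d0 x : dotp (0 : 'rV[R]_d) x = 0 by rewrite /dotp big1// => k _; rewrite mxE mul0r.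
have -> : mS i 0 = 0.
  transitivity (\int[mu]_x (0 * (mm i x * f x))).
    by apply: eq_Rintegral => x _; rewrite d0 sin0.
  by rewrite RintegralZl// mul0r.
rewrite normcR /mC; congr `|_|; apply: eq_Rintegral => x _.
by rewrite d0 cos0 mul1r.
Qed.

Lemma fourier_mG (t : 'rV[R]_d) :
  mG [ffun=> 0%N] t = Complex (\int[mu]_x (cos (dotp t x) * f x)) (\int[mu]_x (sin (dotp t x) * f x)).
Proof.
have m0 x : mm [ffun=> 0%N] x = 1 by rewrite /mm big1// => b _; rewrite ffunE expr0.
rewrite /mG /norm1 big1 => [|b _]; last by rewrite ffunE.
rewrite expr0 mul1r /mC /mS.
by congr Complex; apply: eq_Rintegral => x _; rewrite m0 mul1r.
Qed.

End moments.

(** * Rapidly decreasing functions *)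

Section rapid_decrease.
Context {R : realType}.
Local Notation leb := (@lebesgue_measure R).
Implicit Types f g : R -> R.

(** Schwartz-type decay without any smoothness: stable under multiplication by polynomials and, by
    Peetre's inequality, under convolution. *)
Definition rdec f := forall N : nat, exists C : R, forall x, `|f x| * (1 + x ^+ 2) ^+ N <= C.

Lemma leXn (a b : R) n : 0 <= a -> a <= b -> a ^+ n <= b ^+ n.
Proof. by move=> a0 ab; apply: lerXn2r => //; rewrite nnegrE// (le_trans a0). Qed.

Lemma oneDsqr_ge1' (x : R) : 1 <= 1 + x ^+ 2.
Proof. by rewrite lerDl sqr_ge0. Qed.

Lemma oneDsqr_gt0' (x : R) : 0 < 1 + x ^+ 2.
Proof. exact: lt_le_trans (oneDsqr_ge1' x). Qed.

Lemma rdec_dom f g C : rdec f -> (forall x, `|g x| <= C * `|f x|) -> rdec g.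
Proof.
move=> rf gf N; have [B hB] := rf N; exists (`|C| * B) => x.
apply: (@le_trans _ _ (`|C| * `|f x| * (1 + x ^+ 2) ^+ N)).
  rewrite ler_wpM2r ?exprn_ge0 ?(ltW (oneDsqr_gt0' x))// (le_trans (gf x))//.
  by rewrite ler_wpM2r// ler_norm.
by rewrite -mulrA ler_wpM2l.
Qed.

Lemma rdec_poly f g C n : rdec f -> (forall x, `|g x| <= C * (1 + x ^+ 2) ^+ n * `|f x|) -> rdec g.
Proof.
move=> rf gf N; have [B hB] := rf (n + N)%N; exists (`|C| * B) => x.
apply: (@le_trans _ _ (`|C| * ((1 + x ^+ 2) ^+ n * `|f x|) * (1 + x ^+ 2) ^+ N)).
  rewrite ler_wpM2r ?exprn_ge0 ?(ltW (oneDsqr_gt0' x))// (le_trans (gf x))//.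
  by rewrite mulrA ler_wpM2r// ler_wpM2r ?ler_norm// exprn_ge0 ?(ltW (oneDsqr_gt0' x)).
rewrite -!mulrA ler_wpM2l//; apply: le_trans (hB x).
by rewrite exprD mulrCA mulrA.
Qed.

Lemma rdecD f g : rdec f -> rdec g -> rdec (fun x => f x + g x).
Proof.
move=> rf rg N; have [B hB] := rf N; have [B' hB'] := rg N; exists (B + B') => x.
apply: le_trans (lerD (hB x) (hB' x)); rewrite -mulrDl.
by rewrite ler_wpM2r ?ler_normD// exprn_ge0 ?(ltW (oneDsqr_gt0' x)).
Qed.

Lemma rdecZ f k : rdec f -> rdec (fun x => k * f x).
Proof. by move=> rf; apply: (@rdec_dom f _ `|k|) => // x; rewrite normrM. Qed.

Lemma rdec_bounded f : rdec f -> exists2 C, 0 < C & forall x, `|f x| <= C.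
Proof.
move=> /(_ 0)[C hC]; exists (`|C| + 1); first by rewrite ltr_wpDl.
move=> x; have := hC x; rewrite expr0 mulr1 => /le_trans; apply.
by rewrite (le_trans (ler_norm _))// lerDl.
Qed.

Lemma abs_le_oneDsqr (x : R) : `|x| <= 1 + x ^+ 2.
Proof. by rewrite -(real_normK (num_real x)); have := sqr_ge0 (`|x| - 1); nra. Qed.

Lemma rdec_integrable f : measurable_fun setT f -> rdec f -> leb.-integrable setT (EFin \o f).
Proof.
move=> mf /(_ 1%N)[C hC]; apply/integrableP; split; first exact/measurable_EFinP.
have C0 : 0 <= C.
  by apply: le_trans (hC 0); rewrite mulr_ge0// exprn_ge0// (ltW (oneDsqr_gt0' 0)).
have m1 : measurable_fun [set: R] (EFin \o (fun x : R => (1 + x ^+ 2)^-1)).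
  by apply/measurable_EFinP; apply: continuous_measurable_fun => x; exact: continuous_oneDsqrV.
apply: (@le_lt_trans _ _ (\int[leb]_x (C%:E * ((1 + x ^+ 2)^-1)%:E)))%E.
  apply: ge0_le_integral => //.
  - by do 2 apply: measurableT_comp => //.
  - exact: measurable_funeM.
  - by move=> x _ /=; rewrite -EFinM lee_fin ler_pdivlMr ?oneDsqr_gt0'//.
rewrite leb_integralZl//; last by move=> x; rewrite lee_fin invr_ge0 (ltW (oneDsqr_gt0' x)).
have := @integral_inv_oneDsqr_lty R.
have : (0 <= \int[leb]_x ((1 + x ^+ 2)^-1)%:E)%E.
  by apply: integral_ge0 => x _; rewrite lee_fin invr_ge0 (ltW (oneDsqr_gt0' x)).
by case: (\int[leb]_x _)%E => // r _ _; rewrite -EFinM ltry.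
Qed.

(** Peetre's inequality, which distributes a polynomial weight over the two factors of a
    convolution. *)
Lemma oneDsqr_shift (x y : R) : 1 + x ^+ 2 <= 2 * (1 + (x - y) ^+ 2) * (1 + y ^+ 2).
Proof. by have := sqr_ge0 (x - 2 * y); have := sqr_ge0 ((x - y) * y); nra. Qed.

(** The [m]-th power of [y / m <= exp (y / m)]. *)
Lemma powe_le (y : R) m : 0 <= y -> y ^+ m <= m%:R ^+ m * expR y.
Proof.
move=> y0; case: m => [|m]; first by rewrite !expr0 mul1r -expR0 ler_expR.
rewrite -[in leRHS](@divfK _ m.+1%:R _ y)// expRM_natr -exprMn; apply: leXn => //.
rewrite -[leLHS](@divfK _ m.+1%:R)// mulrC ler_wpM2l//.
by rewrite (le_trans _ (expR_ge1Dx _))// lerDr.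
Qed.

End rapid_decrease.

(** * The density [h_kappa] and its polynomial weights *)

Section h_kappa_facts.
Context {R : realType}.
Local Notation leb := (@lebesgue_measure R).
Variables (kappa x0 : R).
Hypotheses (k01 : 0 < kappa < 1) (x00 : 0 < x0).

Local Notation hr := (h_raw kappa x0).
Local Notation hk := (h_kappa kappa x0).
Let y (x : R) : R := Num.sqrt ((1 + (x / x0) ^+ 2) / 2).
Let p := (1 - kappa)^-1.

Let p1 : 1 <= p.
Proof. by case/andP: k01 => k0 k1; rewrite /p invf_ge1 ?subr_gt0//; lra. Qed.

Lemma h_raw_gt0 x : 0 < hr x. Proof. exact: expR_gt0. Qed.

Let y0 x : 0 < y x.
Proof. by rewrite sqrtr_gt0 divr_gt0// ltr_wpDr// sqr_ge0. Qed.

Let ysqr x : y x ^+ 2 = (1 + (x / x0) ^+ 2) / 2.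
Proof. by rewrite sqr_sqrtr// divr_ge0// addr_ge0// sqr_ge0. Qed.

(** The exponent [(1 - kappa)^-1] is at least 1, so the decay is at least exponential in [y x]; the
    factor [expR 1] covers the region [y x < 1]. *)
Let h_raw_le x : hr x <= expR 1 * expR (- y x).
Proof.
rewrite -expRD ler_expR lerNl opprD opprK.
have [y1|y1] := leP 1 (y x).
  apply: (@le_trans _ _ (y x)); first by rewrite gerDr lerN10.
  rewrite -/(y x) -/p -[leLHS]powRr1 ?(ltW (y0 x))//; exact: ler_powR.
by apply: (@le_trans _ _ 0); [lra|exact: powR_ge0].
Qed.

Let A : R := 2 * (1 + x0 ^+ 2).

Let oneD_le x : 1 + x ^+ 2 <= A * y x ^+ 2.
Proof.
rewrite ysqr /A.
have -> : 2 * (1 + x0 ^+ 2) * ((1 + (x / x0) ^+ 2) / 2) = 1 + x0 ^+ 2 + (x / x0) ^+ 2 + x ^+ 2.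
  by field; rewrite gt_eqF.
by have := sqr_ge0 x0; have := sqr_ge0 (x / x0); lra.
Qed.

Lemma rdec_h_raw : rdec hr.
Proof.
move=> N; exists (A ^+ N * (expR 1 * (2 * N)%:R ^+ (2 * N))) => x.
rewrite (ger0_norm (ltW (h_raw_gt0 x))).
have A0 : 0 <= A by rewrite mulr_ge0// addr_ge0// sqr_ge0.
apply: (@le_trans _ _ ((expR 1 * expR (- y x)) * (A * y x ^+ 2) ^+ N)).
  apply: ler_pM; rewrite ?(ltW (h_raw_gt0 x)) ?exprn_ge0 ?(ltW (oneDsqr_gt0' x)) ?h_raw_le//.
  by apply: leXn => //; exact: ltW (oneDsqr_gt0' x).
rewrite exprMn -exprM mulrCA ler_wpM2l ?exprn_ge0// -mulrA ler_wpM2l ?expR_ge0//.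
rewrite expRN ler_pdivrMl ?expR_gt0// mulrC.
exact: powe_le (ltW (y0 x)).
Qed.

Lemma continuous_h_raw : continuous hr.
Proof.
move=> x; apply: continuous_comp; last exact: continuous_expR.
apply: cvgN; apply: (@continuous_comp _ _ _ y (fun z => z `^ p)).
  apply: continuous_comp; last exact: sqrt_continuous.
  apply: cvgM; last exact: cvg_cst.
  apply: cvgD; first exact: cvg_cst.
  by rewrite expr2; under eq_fun do rewrite expr2; apply: cvgM; (apply: cvgM; [exact: cvg_id|exact: cvg_cst]).
apply: differentiable_continuous; apply/derivable1_diffP.
by apply: derivable_powR; rewrite in_itv/= andbT y0.
Qed.

Lemma integral_indic_itv (a b : R) : a <= b -> (\int[leb]_x (\1_`[a, b]%classic x)%:E = (b - a)%:E)%E.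
Proof.
move=> ab; rewrite integral_indic//= setIT.
have := @lebesgue_measure_itv R `[a, b]; rewrite /= lte_fin => ->.
by case: ltgtP ab => // -> _; rewrite subrr.
Qed.

Lemma integrable_indic_itv (a b : R) : leb.-integrable setT (EFin \o \1_`[a, b]%classic).
Proof.
apply/integrableP; split; first by apply/measurable_EFinP; exact: measurable_indic.
under eq_integral do rewrite /= ger0_norm//.
have [ab|ba] := leP a b; first by rewrite integral_indic_itv// ltry.
rewrite (_ : `[a, b]%classic = set0).
  by under eq_integral do rewrite indic0; rewrite integral0.
by rewrite set_itv_ge// bnd_simp -ltNge.
Qed.

Lemma measurable_h_raw : measurable_fun [set: R] hr.
Proof. exact: continuous_measurable_fun continuous_h_raw. Qed.

Lemma h_raw_min x : `|x| <= 1 -> hr 1 <= hr x.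
Proof.
move=> x1; rewrite ler_expR lerN2; apply: ge0_ler_powR.
- by rewrite (le_trans _ p1).
- by rewrite nnegrE (ltW (y0 x)).
- by rewrite nnegrE (ltW (y0 1)).
rewrite ler_wsqrtr// ler_pM2r ?invr_gt0// lerD2l !exprMn ler_wpM2r ?sqr_ge0//.
by rewrite -(real_normK (num_real x)) expr1n expr_le1.
Qed.

Definition h_mass := \int[leb]_y hr y.

Lemma integrable_h_raw : leb.-integrable setT (EFin \o hr).
Proof. exact: rdec_integrable measurable_h_raw rdec_h_raw. Qed.

Lemma h_mass_gt0 : 0 < h_mass.
Proof.
rewrite /h_mass; apply: (@lt_le_trans _ _ (\int[leb]_x (hr 1 * \1_`[0, 1]%classic x))).
  rewrite RintegralZl//; last exact: integrable_indic_itv.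
  by rewrite mulr_gt0 ?h_raw_gt0// /Rintegral integral_indic_itv//= subr0.
apply: le_Rintegral => //.
- exact: (integrableZl measurableT (hr 1) (integrable_indic_itv 0 1)).
- exact: integrable_h_raw.
- move=> x _; rewrite indicE; case: (boolP (x \in _)) => xI; last first.
    by rewrite mulr0; exact: ltW (h_raw_gt0 x).
  rewrite mulr1; apply: h_raw_min; move: xI; rewrite inE/= in_itv/= => /andP[a0 a1].
  by rewrite ger0_norm.
Qed.

Lemma h_kappa_gt0 x : 0 < hk x.
Proof. by rewrite divr_gt0 ?h_raw_gt0 ?h_mass_gt0. Qed.

Lemma measurable_h_kappa : measurable_fun [set: R] hk.
Proof. by apply: measurable_funM => //; exact: measurable_h_raw. Qed.

Lemma continuous_h_kappa : continuous hk.
Proof. by move=> x; apply: cvgM; [exact: continuous_h_raw|exact: cvg_cst]. Qed.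

Lemma rdec_h_kappa : rdec hk.
Proof.
apply: (@rdec_dom _ hr _ h_mass^-1); first exact: rdec_h_raw.
by move=> x; rewrite /h_kappa normrM mulrC ger0_norm// invr_ge0 (ltW h_mass_gt0).
Qed.

Lemma h_kappa_min : exists2 m, 0 < m & forall x, `|x| <= 1 -> m <= hk x.
Proof.
exists (hk 1); first exact: h_kappa_gt0.
move=> x x1; rewrite /h_kappa ler_wpM2r ?h_raw_min// invr_ge0.
exact: (ltW h_mass_gt0).
Qed.

Lemma weight_le tau : 0 <= tau -> exists C n, 0 < C /\ forall x, 0 <= weight x0 tau x <= C * (1 + x ^+ 2) ^+ n.
Proof.
move=> tau0; pose n := (Num.trunc tau).+1; pose a := 1 + x0 ^- 2.
have a0 : 0 < a by rewrite ltr_wpDr// invr_ge0 exprn_ge0// ltW.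
exists (a ^+ n), n; split; first exact: exprn_gt0.
move=> x; rewrite powR_ge0/= -exprMn.
have u1 : 1 <= 1 + (x / x0) ^+ 2 by rewrite lerDl sqr_ge0.
apply: (@le_trans _ _ ((1 + (x / x0) ^+ 2) `^ n%:R)).
  by apply: ler_powR => //; rewrite ltW// truncnS_gt.
rewrite powR_mulrn ?(le_trans _ u1)//; apply: leXn; first by rewrite (le_trans _ u1).
rewrite /a exprMn exprVn.
have := sqr_ge0 x; have : 0 <= x0 ^- 2 by rewrite invr_ge0 exprn_ge0// ltW.
by nra.
Qed.

Lemma measurable_weight tau : measurable_fun [set: R] (weight x0 tau).
Proof.
apply: (measurableT_comp (measurable_powR tau)).
by apply: measurable_funD => //; apply: measurable_funX; apply: measurable_funM.
Qed.

Lemma rdec_weight tau : 0 <= tau -> rdec (fun x => hk x * weight x0 tau x).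
Proof.
move=> /weight_le[C [n [C0 hC]]]; apply: (@rdec_poly _ hk _ C n); first exact: rdec_h_kappa.
move=> x; have /andP[w0 wC] := hC x.
by rewrite normrM mulrC ler_wpM2r// ger0_norm.
Qed.

End h_kappa_facts.

(** * Integrals of rapidly decreasing functions *)

Section line_integral.
Context {R : realType}.
Local Notation leb := (@lebesgue_measure R).
Implicit Types f g c : R -> R.

Definition intR f : R := \int[leb]_x f x.

(** The class in which the one-variable densities and perturbations are kept. Being closed under
    products with functions of polynomial growth, nondegenerate affine substitutions and
    convolution, it settles integrability once and for all. *)
Definition nice f := measurable_fun [set: R] f /\ rdec f.

Definition pgrow c := measurable_fun [set: R] c /\
  exists C n, forall x, `|c x| <= C * (1 + x ^+ 2) ^+ n.

Lemma nice_integrable f : nice f -> leb.-integrable setT (EFin \o f).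
Proof. by case=> mf rf; exact: rdec_integrable. Qed.

Lemma niceD f g : nice f -> nice g -> nice (fun x => f x + g x).
Proof. by move=> [mf rf] [mg rg]; split; [exact: measurable_funD|exact: rdecD]. Qed.

Lemma niceZ k f : nice f -> nice (fun x => k * f x).
Proof. by move=> [mf rf]; split; [exact: measurable_funM|exact: rdecZ]. Qed.

Lemma niceN f : nice f -> nice (fun x => - f x).
Proof.
move=> nf; rewrite (_ : (fun _ => _) = (fun x => -1 * f x)); first exact: niceZ.
by apply/funext => x; rewrite mulN1r.
Qed.

Lemma niceB f g : nice f -> nice g -> nice (fun x => f x - g x).
Proof. by move=> nf ng; exact: (niceD nf (niceN ng)). Qed.

Lemma nice_norm f : nice f -> nice (fun x => `|f x|).
Proof.
move=> [mf rf]; split; first exact: measurableT_comp.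
by apply: (@rdec_dom _ f _ 1) => // x; rewrite normr_id mul1r.
Qed.

Lemma nice_dom f g C : nice f -> measurable_fun [set: R] g ->
  (forall x, `|g x| <= C * `|f x|) -> nice g.
Proof. by move=> [_ rf] mg gf; split=> //; exact: rdec_dom gf. Qed.

Lemma pgrowM c f : pgrow c -> pgrow f -> pgrow (fun x => c x * f x).
Proof.
move=> [mc [C [n hC]]] [mf [D [m hD]]]; split; first exact: measurable_funM.
exists (C * D), (n + m)%N => x; rewrite normrM exprD mulrACA.
by apply: ler_pM.
Qed.

Lemma pgrow_bdd c C : measurable_fun [set: R] c -> (forall x, `|c x| <= C) -> pgrow c.
Proof. by move=> mc hC; split=> //; exists C, 0%N => x; rewrite expr0 mulr1. Qed.

Lemma pgrow_cst k : pgrow (fun=> k).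
Proof. exact: (@pgrow_bdd _ `|k|). Qed.

Lemma nice_pgrow f : nice f -> pgrow f.
Proof. by move=> [mf /rdec_bounded[C _ hC]]; exact: pgrow_bdd hC. Qed.

Lemma pgrow_id : pgrow id.
Proof. by split=> //; exists 1, 1%N => x; rewrite mul1r expr1 abs_le_oneDsqr. Qed.

Lemma pgrowX c k : pgrow c -> pgrow (fun x => c x ^+ k).
Proof.
move=> pc; elim: k => [|k IH].
  by under eq_fun do rewrite expr0; exact: pgrow_cst.
by under eq_fun do rewrite exprS; exact: pgrowM.
Qed.

Lemma pgrowD c f : pgrow c -> pgrow f -> pgrow (fun x => c x + f x).
Proof.
move=> [mc [C [n hC]]] [mf [D [m hD]]]; split; first exact: measurable_funD.
exists (`|C| + `|D|), (n + m)%N => x; rewrite mulrDl (le_trans (ler_normD _ _))//.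
apply: lerD.
  apply: le_trans (hC x) _; rewrite exprD mulrA.
  have p0 : 0 <= (1 + x ^+ 2) ^+ n by apply: exprn_ge0; rewrite (ltW (oneDsqr_gt0' x)).
  apply: (@le_trans _ _ (`|C| * (1 + x ^+ 2) ^+ n)); first by rewrite ler_wpM2r// ler_norm.
  by rewrite ler_peMr ?mulr_ge0// exprn_ege1// oneDsqr_ge1'.
apply: le_trans (hD x) _; rewrite addnC exprD mulrA.
have p0 : 0 <= (1 + x ^+ 2) ^+ m by apply: exprn_ge0; rewrite (ltW (oneDsqr_gt0' x)).
apply: (@le_trans _ _ (`|D| * (1 + x ^+ 2) ^+ m)); first by rewrite ler_wpM2r// ler_norm.
by rewrite ler_peMr ?mulr_ge0// exprn_ege1// oneDsqr_ge1'.
Qed.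

Lemma pgrow_poly (p : {poly R}) : pgrow (fun x => p.[x]).
Proof.
elim/poly_ind: p => [|p c IH].
  by under eq_fun do rewrite horner0; exact: pgrow_cst.
under eq_fun do rewrite hornerMXaddC; apply: pgrowD; last exact: pgrow_cst.
by apply: pgrowM => //; exact: pgrow_id.
Qed.

Lemma niceM c f : pgrow c -> nice f -> nice (fun x => c x * f x).
Proof.
move=> [mc [C [n hC]]] [mf rf]; split; first exact: measurable_funM.
apply: (@rdec_poly _ f _ C n) => // x.
by rewrite normrM ler_wpM2r.
Qed.

Lemma eq_intR f g : f =1 g -> intR f = intR g.
Proof. by move=> /funext ->. Qed.

Lemma intRZ k f : nice f -> intR (fun x => k * f x) = k * intR f.
Proof. by move=> nf; rewrite /intR RintegralZl//; exact: nice_integrable. Qed.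

Lemma intRD f g : nice f -> nice g -> intR (fun x => f x + g x) = intR f + intR g.
Proof. by move=> nf ng; rewrite /intR RintegralD//; exact: nice_integrable. Qed.

Lemma intRB f g : nice f -> nice g -> intR (fun x => f x - g x) = intR f - intR g.
Proof. by move=> nf ng; rewrite /intR RintegralB//; exact: nice_integrable. Qed.

Lemma intR_le f g : nice f -> nice g -> (forall x, f x <= g x) -> intR f <= intR g.
Proof. by move=> nf ng fg; apply: le_Rintegral => //; exact: nice_integrable. Qed.

Lemma intR_ge0 f : (forall x, 0 <= f x) -> 0 <= intR f.
Proof. by move=> f0; exact: Rintegral_ge0. Qed.

Lemma intR_abs f : nice f -> `|intR f| <= intR (fun x => `|f x|).
Proof. by move=> nf; apply: le_normr_Rintegral => //; exact: nice_integrable. Qed.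

Lemma intR_le_abs f g : nice f -> nice g -> (forall x, `|f x| <= g x) -> `|intR f| <= intR g.
Proof.
move=> nf ng fg; apply: le_trans (intR_abs nf) _.
by apply: intR_le => //; exact: nice_norm.
Qed.

Lemma intR_ereal f : nice f -> (\int[leb]_x (f x)%:E = (intR f)%:E)%E.
Proof. by move=> nf; rewrite /intR/Rintegral fineK//; exact: integrable_fin_num (nice_integrable nf). Qed.

Lemma rdec_affine k d f : k != 0 -> rdec f -> rdec (fun x => f (k * x + d)).
Proof.
move=> k0 rf N; have [C hC] := rf N.
pose B := 2 * (1 + k ^- 2) * (1 + d ^+ 2).
have C0 : 0 <= C.
  by apply: le_trans (hC 0); rewrite mulr_ge0// exprn_ge0// (ltW (oneDsqr_gt0' 0)).
exists (C * B ^+ N) => x.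
have k2 : 0 <= k ^- 2 by rewrite invr_ge0 sqr_ge0.
have xB : 1 + x ^+ 2 <= (1 + (k * x + d) ^+ 2) * B.
  have h1 := oneDsqr_shift (k * x) (- d).
  rewrite opprK sqrrN in h1.
  apply: (@le_trans _ _ ((1 + k ^- 2) * (1 + (k * x) ^+ 2))).
    have e : k ^- 2 * (k * x) ^+ 2 = x ^+ 2 by field.
    by rewrite mulrDl mul1r mulrDr mulr1 e; have := sqr_ge0 (k * x); lra.
  have -> : (1 + (k * x + d) ^+ 2) * B = (1 + k ^- 2) * (2 * (1 + (k * x + d) ^+ 2) * (1 + d ^+ 2)).
    by rewrite /B; ring.
  by rewrite ler_wpM2l// addr_ge0.
apply: (@le_trans _ _ (`|f (k * x + d)| * ((1 + (k * x + d) ^+ 2) * B) ^+ N)).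
  by rewrite ler_wpM2l//; apply: leXn => //; exact: ltW (oneDsqr_gt0' x).
rewrite exprMn mulrA ler_wpM2r// exprn_ge0// mulr_ge0// ?(ltW (oneDsqr_gt0' d))//.
by rewrite mulr_ge0// addr_ge0.
Qed.

Lemma nice_affine k d f : k != 0 -> nice f -> nice (fun x => f (k * x + d)).
Proof.
move=> k0 [mf rf]; split; last exact: rdec_affine.
by apply: (measurableT_comp mf); apply: measurable_funD => //; exact: measurable_funM.
Qed.

Lemma nice_shift d f : nice f -> nice (fun x => f (x + d)).
Proof. by move=> /(nice_affine d (oner_neq0 R)); under eq_fun do rewrite mul1r. Qed.

Lemma intR_affine k d f : k != 0 -> nice f -> intR f = `|k| * intR (fun x => f (k * x + d)).
Proof.
move=> k0.
suff H g : nice g -> (forall x, 0 <= g x) -> intR g = `|k| * intR (fun x => g (k * x + d)).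
  (* The signed case follows by writing [f] as the difference of the nonnegative functions [f + |f|]
     and [|f|]. *)
  move=> nf; have n2 := niceD nf (nice_norm nf).
  have -> : intR f = intR (fun x => f x + `|f x|) - intR (fun x => `|f x|).
    by rewrite -intRB//; [apply: eq_intR => x; rewrite addrK|exact: nice_norm].
  rewrite (H _ n2); last by move=> x; rewrite -lerBlDr sub0r lerNl -normrN ler_norm.
  rewrite (H _ (nice_norm nf))// -mulrBr -intRB.
  - by congr (_ * _); apply: eq_intR => x; rewrite addrK.
  - exact: (nice_affine d k0 n2).
  - exact: (nice_affine d k0 (nice_norm nf)).
move=> ng g0; apply: EFin_inj; rewrite EFinM -!intR_ereal//; last exact: nice_affine.
by apply: ge0_integral_affine => //; apply/measurable_EFinP; case: ng.
Qed.

Lemma intR_shift d f : nice f -> intR (fun x => f (x + d)) = intR f.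
Proof.
move=> nf; rewrite (intR_affine d (oner_neq0 R) nf) normr1 mul1r.
by apply: eq_intR => x; rewrite mul1r.
Qed.

(** An integrable product majorant, the form in which Fubini's theorem is applied to signed
    kernels. *)
Definition dom2 (h : R -> R -> R) :=
  exists C, forall x y, `|h x y| <= C * ((1 + x ^+ 2)^-1 * (1 + y ^+ 2)^-1).

Definition meas2 (h : R -> R -> R) :=
  measurable_fun [set: measurableTypeR R * measurableTypeR R] (fun p => h p.1 p.2).

Lemma measurable_oneDsqrV : measurable_fun [set: R] (fun x : R => (1 + x ^+ 2)^-1).
Proof. by apply: continuous_measurable_fun => x; exact: continuous_oneDsqrV. Qed.

Lemma integrable_oneDsqrV : leb.-integrable setT (EFin \o (fun x : R => (1 + x ^+ 2)^-1)).
Proof.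
apply/integrableP; split; first by apply/measurable_EFinP; exact: measurable_oneDsqrV.
under eq_integral do rewrite /= ger0_norm ?invr_ge0 ?(ltW (oneDsqr_gt0' _))//.
exact: integral_inv_oneDsqr_lty.
Qed.

Lemma integrable_dom2 h : meas2 h -> dom2 h ->
  (leb \x leb)%E.-integrable setT (fun p => (h p.1 p.2)%:E).
Proof.
move=> mh [C hC].
have i1 := integrable_prodM integrable_oneDsqrV integrable_oneDsqrV.
have := integrableZl measurableT `|C| i1.
apply: le_integrable => //; first exact/measurable_EFinP.
move=> [x y] _ /=; rewrite lee_fin (le_trans (hC x y))// !normrM normr_id.
rewrite !(@ger0_norm _ (_^-1)) ?invr_ge0 ?(ltW (oneDsqr_gt0' _))//.
by rewrite ler_wpM2r ?ler_norm// mulr_ge0// invr_ge0 (ltW (oneDsqr_gt0' _)).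
Qed.

Lemma measurable_intR2 h : meas2 h -> dom2 h -> measurable_fun [set: R] (fun x => intR (h x)).
Proof.
move=> mh dh; apply: measurableT_comp => //.
exact: measurable_fubini_F (integrable_dom2 mh dh).
Qed.

Lemma intR_exch h : meas2 h -> dom2 h ->
  intR (fun x => intR (h x)) = intR (fun y => intR (fun x => h x y)).
Proof.
move=> mh [C hC]; have ih := integrable_dom2 mh (ex_intro _ C hC).
have sec1 x : leb.-integrable setT (fun y => (h x y)%:E).
  apply: (le_integrable measurableT _ _ (integrableZl measurableT (`|C| * (1 + x ^+ 2)^-1) integrable_oneDsqrV)).
    by apply/measurable_EFinP; exact: (measurableT_comp mh (measurable_pair1 x)).
  move=> y _ /=; rewrite lee_fin (le_trans (hC x y))// mulrA [leRHS]ger0_norm.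
    by rewrite ler_wpM2r ?ler_wpM2r ?ler_norm// invr_ge0 (ltW (oneDsqr_gt0' _)).
  by rewrite !mulr_ge0// invr_ge0 (ltW (oneDsqr_gt0' _)).
have sec2 y : leb.-integrable setT (fun x => (h x y)%:E).
  apply: (le_integrable measurableT _ _ (integrableZl measurableT (`|C| * (1 + y ^+ 2)^-1) integrable_oneDsqrV)).
    by apply/measurable_EFinP; exact: (measurableT_comp mh (measurable_pair2 y)).
  move=> x _ /=; rewrite lee_fin (le_trans (hC x y))// mulrCA mulrA mulrC -mulrA [leRHS]ger0_norm.
    rewrite [leLHS](_ : _ = C * ((1 + y ^+ 2)^-1 * (1 + x ^+ 2)^-1)); last by ring.
    by rewrite ler_wpM2r ?ler_norm// mulr_ge0// invr_ge0 (ltW (oneDsqr_gt0' _)).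
  by rewrite !mulr_ge0// invr_ge0 (ltW (oneDsqr_gt0' _)).
rewrite /intR {1}/Rintegral [RHS]/Rintegral; congr fine.
transitivity (\int[(leb \x leb)%E]_p (h p.1 p.2)%:E)%E.
  rewrite -(integral12_prod_meas1 ih); apply: eq_integral => x _.
  by rewrite /fubini_F/= /Rintegral fineK//; exact: integrable_fin_num (sec1 x).
rewrite -(integral21_prod_meas1 ih); apply: eq_integral => x _.
by rewrite /fubini_G/= /Rintegral fineK//; exact: integrable_fin_num (sec2 x).
Qed.

End line_integral.

(** * The bump function and its rescalings *)

Section bump_facts.
Context {R : realType}.
Local Notation leb := (@lebesgue_measure R).

Lemma bump_raw_ge0 (x : R) : 0 <= bump_raw x.
Proof. by rewrite /bump_raw; case: ifP => // _; exact: expR_ge0. Qed.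

Lemma bump_raw_le1 (x : R) : bump_raw x <= 1.
Proof.
rewrite /bump_raw; case: ifP => // x1.
by rewrite -[leRHS]expR0 ler_expR oppr_le0 invr_ge0 subr_ge0 ltW.
Qed.

Lemma bump_raw_out (x : R) : 1 <= `|x| -> bump_raw x = 0.
Proof.
move=> x1; rewrite /bump_raw ifF//; apply/negbTE; rewrite -leNgt.
by rewrite -(real_normK (num_real x)) exprn_ege1.
Qed.

Lemma nice_supp (f : R -> R) C r : measurable_fun [set: R] f -> (forall x, `|f x| <= C) ->
  (forall x, r <= `|x| -> f x = 0) -> nice f.
Proof.
move=> mf fC f0; split=> // N; exists (C * (1 + r ^+ 2) ^+ N) => x.
have C0 : 0 <= C by exact: le_trans (fC 0).
have [rx|xr] := leP r `|x|.
  by rewrite f0// normr0 mul0r mulr_ge0// exprn_ge0// (ltW (oneDsqr_gt0' r)).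
apply: ler_pM => //; first by rewrite exprn_ge0// (ltW (oneDsqr_gt0' x)).
apply: leXn; first exact: (ltW (oneDsqr_gt0' x)).
by rewrite lerD2l -(real_normK (num_real x)); apply: leXn => //; exact: ltW.
Qed.

Lemma measurable_bump_raw : measurable_fun [set: R] (@bump_raw R).
Proof.
have -> : @bump_raw R = fun x => if x ^+ 2 < 1 then expR (- ((1 - x ^+ 2) `^ (-1))) else 0.
  apply/funext => x; rewrite /bump_raw; case: ifP => // x1.
  by rewrite powR_inv1// subr_ge0 ltW.
apply: measurable_fun_ifT.
- by apply: measurable_fun_ltr => //; exact: measurable_funX.
- apply: measurableT_comp => //; apply: measurableT_comp => //.
  apply: (measurableT_comp (measurable_powR (-1))).
  by apply: measurable_funB => //; exact: measurable_funX.
- exact: measurable_cst.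
Qed.

Lemma nice_bump_raw : nice (@bump_raw R).
Proof.
apply: (@nice_supp _ 1 1); first exact: measurable_bump_raw.
  by move=> x; rewrite ger0_norm ?bump_raw_ge0// bump_raw_le1.
exact: bump_raw_out.
Qed.

Lemma nice_indic (a b : R) : nice (\1_`[a, b]%classic : R -> R).
Proof.
apply: (@nice_supp _ 1 (Num.max `|a| `|b| + 1)); first exact: measurable_indic.
  by move=> x; rewrite indicE ger0_norm// lern1 leq_b1.
move=> x hx; rewrite indicE memNset//= in_itv/= => /andP[ax xb].
suff : `|x| <= Num.max `|a| `|b| by lra.
rewrite le_max; have [x0|x0] := leP 0 x.
  by rewrite (ger0_norm x0) (le_trans xb (ler_norm b)) orbT.
by rewrite (ltr0_norm x0) lerNl (le_trans _ ax)// lerNl -normrN ler_norm.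
Qed.

Lemma intR_indic (a b : R) : a <= b -> intR (\1_`[a, b]%classic : R -> R) = b - a.
Proof. by move=> ab; rewrite /intR /Rintegral integral_indic_itv. Qed.

Lemma intR_gt0_itv (f : R -> R) a b m : nice f -> (forall x, 0 <= f x) -> a <= b -> 0 <= m ->
  (forall x, a <= x <= b -> m <= f x) -> m * (b - a) <= intR f.
Proof.
move=> nf f0 ab m0 fm; rewrite -(intR_indic ab) -intRZ; last exact: nice_indic.
apply: intR_le => //; first by apply: niceZ; exact: nice_indic.
move=> x; rewrite indicE; case: (boolP (x \in _)) => xI; last by rewrite mulr0.
by rewrite mulr1; apply: fm; move: xI; rewrite inE/= in_itv/=.
Qed.

Lemma intR_bump_raw_gt0 : 0 < intR (@bump_raw R).
Proof.
have h2 : (0 : R) <= 2^-1 by rewrite invr_ge0.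
apply: lt_le_trans (intR_gt0_itv nice_bump_raw bump_raw_ge0 h2 (expR_ge0 (-2)) _).
  by rewrite subr0 mulr_gt0 ?expR_gt0// invr_gt0.
move=> x /andP[x0 x1]; have x2 : x ^+ 2 <= 4^-1.
  have -> : 4^-1 = (2^-1) ^+ 2 :> R by field.
  exact: leXn.
rewrite /bump_raw ifT; last lra.
rewrite ler_expR lerN2 -[leRHS]invrK lef_pV2 ?posrE ?invr_gt0 ?subr_gt0//; lra.
Qed.

Lemma bumpE : @bump R = (fun x => (intR bump_raw)^-1 * bump_raw x).
Proof. by apply/funext => x; rewrite /bump mulrC. Qed.

Lemma nice_bump : nice (@bump R).
Proof. by rewrite bumpE; apply: niceZ; exact: nice_bump_raw. Qed.

Lemma bump_ge0 (x : R) : 0 <= bump x.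
Proof. by rewrite bumpE mulr_ge0 ?bump_raw_ge0// invr_ge0 (ltW intR_bump_raw_gt0). Qed.

Lemma bump_out (x : R) : 1 <= `|x| -> bump x = 0.
Proof. by move=> x1; rewrite /bump bump_raw_out// mul0r. Qed.

Lemma intR_bump : intR (@bump R) = 1.
Proof.
by rewrite bumpE intRZ ?mulVf ?gt_eqF ?intR_bump_raw_gt0//; exact: nice_bump_raw.
Qed.

Variable b : R.
Hypothesis b0 : 0 < b.

Lemma nice_bump_b : nice (bump_b b).
Proof.
have := niceZ b (nice_affine 0 (lt0r_neq0 b0) nice_bump).
by under eq_fun do rewrite addr0.
Qed.

Lemma bump_b_ge0 x : 0 <= bump_b b x.
Proof. by rewrite mulr_ge0 ?bump_ge0// ltW. Qed.

Lemma bump_b_out x : b^-1 <= `|x| -> bump_b b x = 0.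
Proof.
move=> x1; rewrite /bump_b bump_out ?mulr0// normrM (gtr0_norm b0).
by rewrite -ler_pdivrMl// mulr1.
Qed.

Lemma intR_bump_b : intR (bump_b b) = 1.
Proof.
have := intR_affine 0 (lt0r_neq0 b0) nice_bump.
rewrite intR_bump (gtr0_norm b0) => ->.
rewrite -intRZ; last exact: (nice_affine 0 (lt0r_neq0 b0) nice_bump).
by apply: eq_intR => x; rewrite addr0.
Qed.

End bump_facts.

(** * Convolution *)

Section convolution.
Context {R : realType}.
Local Notation leb := (@lebesgue_measure R).
Implicit Types f g u c : R -> R.

Lemma nice_refl f x : nice f -> nice (fun y => f (x - y)).
Proof.
move=> /(nice_affine x (_ : -1 != 0 :> R)); rewrite oppr_eq0 oner_eq0 => /(_ isT).
by under eq_fun do rewrite mulN1r addrC.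
Qed.

Lemma nice_conv_sec f u x : nice f -> nice u -> nice (fun y => f (x - y) * u y).
Proof. by move=> nf nu; apply: niceM => //; apply: nice_pgrow; exact: nice_refl. Qed.

Lemma meas2_conv c f u : measurable_fun [set: R] c -> measurable_fun [set: R] f ->
  measurable_fun [set: R] u -> meas2 (fun x y => c x * (f (x - y) * u y)).
Proof.
move=> mc mf mu; apply: measurable_funM; first exact: (measurableT_comp mc).
apply: measurable_funM; last exact: (measurableT_comp mu).
by apply: (measurableT_comp mf); exact: measurable_funB.
Qed.

Lemma rdec_mulC N f : rdec f -> exists2 C, 0 <= C & forall x : R, (1 + x ^+ 2) ^+ N * `|f x| <= C.
Proof.
move=> /(_ N)[C hC]; exists C; last by move=> x; rewrite mulrC.
by apply: le_trans (hC 0); rewrite mulr_ge0// exprn_ge0// (ltW (oneDsqr_gt0' 0)).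
Qed.

Lemma dom2_conv c f u : pgrow c -> nice f -> nice u ->
  dom2 (fun x y => c x * (f (x - y) * u y)).
Proof.
move=> [_ [C [n hC]]] [_ rf] [_ ru].
(* One power beyond the growth [n] of [c] provides the decay in [x]. Peetre's inequality charges
   these [n.+1] powers to both [f] and [u], and [u] pays one more for the decay in [y]. *)
have [Cf Cf0 hf] := rdec_mulC n.+1 rf; have [Cu Cu0 hu] := rdec_mulC n.+2 ru.
exists (`|C| * (2 ^+ n.+1 * (Cf * Cu))) => x y.
rewrite (mulrA _ (_^-1)) ler_pdivlMr ?oneDsqr_gt0'// ler_pdivlMr ?oneDsqr_gt0'//.
have px := ltW (oneDsqr_gt0' x); have py := ltW (oneDsqr_gt0' y); have pxy := ltW (oneDsqr_gt0' (x - y)).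
rewrite !normrM.
apply: (@le_trans _ _ (`|C| * ((1 + x ^+ 2) ^+ n.+1 * (`|f (x - y)| * `|u y| * (1 + y ^+ 2))))).
  rewrite -!mulrA [leRHS](_ : _ = (`|C| * (1 + x ^+ 2) ^+ n) * (`|f (x - y)| * (`|u y| * ((1 + y ^+ 2) * (1 + x ^+ 2))))).
    apply: ler_pM => //; first by rewrite !mulr_ge0.
    by apply: le_trans (hC x) _; rewrite ler_wpM2r ?ler_norm// exprn_ge0.
  by rewrite exprS; ring.
rewrite ler_wpM2l//.
apply: (@le_trans _ _ ((2 * (1 + (x - y) ^+ 2) * (1 + y ^+ 2)) ^+ n.+1 * (`|f (x - y)| * `|u y| * (1 + y ^+ 2)))).
  by rewrite ler_wpM2r ?mulr_ge0//; apply: leXn => //; exact: oneDsqr_shift.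
rewrite !exprMn [leLHS](_ : _ = 2 ^+ n.+1 * (((1 + (x - y) ^+ 2) ^+ n.+1 * `|f (x - y)|) * ((1 + y ^+ 2) ^+ n.+2 * `|u y|))).
  rewrite ler_wpM2l ?exprn_ge0//; apply: ler_pM => //; by rewrite mulr_ge0 ?exprn_ge0.
by rewrite (exprS (1 + y ^+ 2) n.+1); ring.
Qed.

Lemma nice_conv f u : nice f -> nice u -> nice (conv f u).
Proof.
move=> nf nu; have [mf rf] := nf; have [mu ru] := nu; split.
  rewrite (_ : conv f u = fun x => intR (fun y => 1 * (f (x - y) * u y))); last first.
    by apply/funext => x; apply: eq_intR => y; rewrite mul1r.
  apply: measurable_intR2; first exact: (@meas2_conv (fun=> 1)).
  by apply: (@dom2_conv (fun=> 1)) => //; exact: pgrow_cst.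
move=> N; have [C C0 hC] := rdec_mulC N rf.
exists (2 ^+ N * C * intR (fun y => (1 + y ^+ 2) ^+ N * `|u y|)) => x.
have pN : pgrow (fun y : R => (1 + y ^+ 2) ^+ N).
  by apply: pgrowX; apply: pgrowD; [exact: pgrow_cst|apply: pgrowX; exact: pgrow_id].
have nN : nice (fun y => (1 + y ^+ 2) ^+ N * `|u y|) by apply: niceM => //; exact: nice_norm.
have px := ltW (oneDsqr_gt0' x).
rewrite -(@ger0_norm _ ((1 + x ^+ 2) ^+ N)) ?exprn_ge0// -normrM mulrC.
rewrite /conv -/(intR _) -intRZ; last exact: nice_conv_sec.
rewrite -intRZ//; apply: intR_le_abs.
- by apply: niceZ; exact: nice_conv_sec.
- exact: niceZ.
- move=> y; rewrite !normrM (@ger0_norm _ ((1 + x ^+ 2) ^+ N)) ?exprn_ge0//.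
  rewrite !mulrA ler_wpM2r//.
  apply: (@le_trans _ _ ((2 * (1 + (x - y) ^+ 2) * (1 + y ^+ 2)) ^+ N * `|f (x - y)|)).
    by rewrite ler_wpM2r//; apply: leXn => //; exact: oneDsqr_shift.
  rewrite !exprMn -!mulrA ler_wpM2l ?exprn_ge0// mulrCA mulrC.
  by rewrite ler_wpM2r ?hC// exprn_ge0// (ltW (oneDsqr_gt0' y)).
Qed.

Lemma intR_conv c f u : pgrow c -> nice f -> nice u ->
  intR (fun x => c x * conv f u x) = intR (fun y => u y * intR (fun x => c (x + y) * f x)).
Proof.
move=> pc nf nu; have [mf rf] := nf; have [mu ru] := nu.
transitivity (intR (fun x => intR (fun y => c x * (f (x - y) * u y)))).
  by apply: eq_intR => x; rewrite intRZ//; exact: nice_conv_sec.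
rewrite intR_exch; [|exact: (meas2_conv (proj1 pc))|exact: dom2_conv].
apply: eq_intR => y.
have nfy : nice (fun x => f (x - y)) by exact: nice_shift.
have n1 : nice (fun x => c x * f (x - y)) by exact: niceM.
transitivity (u y * intR (fun x => c x * f (x - y))).
  by rewrite -intRZ//; apply: eq_intR => x; ring.
congr (_ * _); rewrite -(intR_shift y n1).
by apply: eq_intR => x; rewrite addrK.
Qed.

Lemma conv_ge0 f u x : (forall x, 0 <= f x) -> (forall x, 0 <= u x) -> 0 <= conv f u x.
Proof. by move=> f0 u0; apply: intR_ge0 => y; rewrite mulr_ge0. Qed.

Lemma conv_mono f g u x : nice f -> nice g -> nice u -> (forall x, 0 <= u x) ->
  (forall x, f x <= g x) -> conv f u x <= conv g u x.
Proof.
move=> nf ng nu u0 fg; apply: intR_le; try exact: nice_conv_sec.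
by move=> y; rewrite ler_wpM2r.
Qed.

Lemma convZ k f u x : nice f -> nice u -> conv (fun y => k * f y) u x = k * conv f u x.
Proof.
move=> nf nu; rewrite /conv -/(intR _) -/(intR _) -intRZ; last exact: nice_conv_sec.
by apply: eq_intR => y; rewrite mulrA.
Qed.

Lemma convD f g u x : nice f -> nice g -> nice u ->
  conv (fun y => f y + g y) u x = conv f u x + conv g u x.
Proof.
move=> nf ng nu; rewrite /conv -!/(intR _) -intRD; try exact: nice_conv_sec.
by apply: eq_intR => y; rewrite mulrDl.
Qed.

Lemma intR_conv1 f u : nice f -> nice u -> intR (conv f u) = intR f * intR u.
Proof.
move=> nf nu.
transitivity (intR (fun x => 1 * conv f u x)); first by apply: eq_intR => x; rewrite mul1r.
rewrite (intR_conv (pgrow_cst 1))// -intRZ//; apply: eq_intR => y.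
by rewrite mulrC; congr (_ * _); apply: eq_intR => x; rewrite mul1r.
Qed.

End convolution.

(** * Fourier transforms on the line *)

Section phi_facts.
Context {R : realType}.
Implicit Types f g u : R -> R.

Lemma pgrow_cos t : pgrow (fun x : R => cos (t * x)).
Proof.
apply: (@pgrow_bdd _ _ 1); last by move=> x; rewrite ler_norml cos_geN1 cos_le1.
by apply: (measurableT_comp measurable_cos); exact: measurable_funM.
Qed.

Lemma pgrow_sin t : pgrow (fun x : R => sin (t * x)).
Proof.
apply: (@pgrow_bdd _ _ 1); last by move=> x; rewrite ler_norml sin_geN1 sin_le1.
by apply: (measurableT_comp measurable_sin); exact: measurable_funM.
Qed.

Lemma nice_cos t f : nice f -> nice (fun x => cos (t * x) * f x).
Proof. by move=> nf; apply: niceM => //; exact: pgrow_cos. Qed.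

Lemma nice_sin t f : nice f -> nice (fun x => sin (t * x) * f x).
Proof. by move=> nf; apply: niceM => //; exact: pgrow_sin. Qed.

Lemma PhiE f t : Phi f t = Complex (intR (fun x => cos (t * x) * f x)) (intR (fun x => sin (t * x) * f x)).
Proof. by []. Qed.

Lemma Phi_conv f u t : nice f -> nice u -> Phi (conv f u) t = Phi f t * Phi u t.
Proof.
move=> nf nu; rewrite !PhiE.
rewrite (intR_conv (pgrow_cos t) nf nu) (intR_conv (pgrow_sin t) nf nu).
set A := intR (fun x => cos (t * x) * f x); set B := intR (fun x => sin (t * x) * f x).
have nc := nice_cos t nf; have ns := nice_sin t nf.
have e1 y : intR (fun x => cos (t * (x + y)) * f x) = cos (t * y) * A - sin (t * y) * B.
  rewrite -!intRZ// -intRB; try exact: niceZ.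
  by apply: eq_intR => x; rewrite mulrDr cosD; ring.
have e2 y : intR (fun x => sin (t * (x + y)) * f x) = sin (t * y) * A + cos (t * y) * B.
  rewrite -!intRZ// -intRD; try exact: niceZ.
  by apply: eq_intR => x; rewrite mulrDr sinD; ring.
have uc := nice_cos t nu; have us := nice_sin t nu.
apply/eqP; rewrite eq_complex /=; apply/andP; split; apply/eqP.
  rewrite -!intRZ// -intRB; try exact: niceZ.
  by apply: eq_intR => y; rewrite e1; ring.
rewrite -!intRZ// -intRD; try exact: niceZ.
by apply: eq_intR => y; rewrite e2; ring.
Qed.

Lemma PhiZ k f t : nice f -> Phi (fun x => k * f x) t = Complex k 0 * Phi f t.
Proof.
move=> nf; rewrite !PhiE; apply/eqP; rewrite eq_complex /=; apply/andP; split; apply/eqP.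
  rewrite mul0r subr0 -intRZ; last exact: nice_cos.
  by apply: eq_intR => x; ring.
rewrite mul0r addr0 -intRZ; last exact: nice_sin.
by apply: eq_intR => x; ring.
Qed.

Lemma PhiD f g t : nice f -> nice g -> Phi (fun x => f x + g x) t = Phi f t + Phi g t.
Proof.
move=> nf ng; rewrite !PhiE; apply/eqP; rewrite eq_complex /=; apply/andP; split; apply/eqP.
  rewrite -intRD; [|exact: nice_cos|exact: nice_cos].
  by apply: eq_intR => x; rewrite mulrDr.
rewrite -intRD; [|exact: nice_sin|exact: nice_sin].
by apply: eq_intR => x; rewrite mulrDr.
Qed.

Lemma Phi_bump_b b t : 0 < b -> Phi (bump_b b) t = Phi (@bump R) (t / b).
Proof.
move=> b0; have bn := lt0r_neq0 b0; rewrite !PhiE; congr Complex.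
  rewrite (intR_affine 0 bn (nice_cos _ nice_bump)) (gtr0_norm b0) -intRZ; last first.
    exact: (nice_affine 0 bn (nice_cos _ nice_bump)).
  by apply: eq_intR => x; rewrite addr0 (_ : t / b * (b * x) = t * x); [rewrite /bump_b; ring|field].
rewrite (intR_affine 0 bn (nice_sin _ nice_bump)) (gtr0_norm b0) -intRZ; last first.
  exact: (nice_affine 0 bn (nice_sin _ nice_bump)).
by apply: eq_intR => x; rewrite addr0 (_ : t / b * (b * x) = t * x); [rewrite /bump_b; ring|field].
Qed.

Lemma Phi0 f : Phi f 0 = Complex (intR f) 0.
Proof.
rewrite PhiE; congr Complex.
  by apply: eq_intR => x; rewrite mul0r cos0 mul1r.
rewrite -[RHS](mul0r (intR f)); transitivity (intR (fun _ : R => 0)).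
  by apply: eq_intR => x; rewrite mul0r sin0 mul0r.
by rewrite mul0r /intR /Rintegral integral0.
Qed.

End phi_facts.

(** * The densities [zeta0] and [zeta1] *)

Section zeta_family.
Context {R : realType}.
Local Notation leb := (@lebesgue_measure R).
Variables (kappa x0 : R) (P : nat -> {poly R}) (F : R -> R) (c' tau : R).
Hypotheses (k01 : 0 < kappa < 1) (x00 : 0 < x0) (c0 : 0 < c') (tau0 : 0 <= tau).
Hypotheses (orthoP : orthonormal_polys kappa x0 P) (envF : envelope kappa x0 P F).
Hypothesis intF : (\int[leb]_x (F x * h_kappa kappa x0 x)%:E = 1)%E.
Hypothesis domF : forall x, F x <= c' * weight x0 tau x.

Local Notation hk := (h_kappa kappa x0).

Lemma nice_hk : nice hk.
Proof. by split; [exact: measurable_h_kappa|exact: rdec_h_kappa]. Qed.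

Lemma hk_gt0 x : 0 < hk x. Proof. exact: h_kappa_gt0. Qed.

Definition env_pdf x := F x * hk x.

Lemma F_ge0 x : 0 <= F x. Proof. by case: envF. Qed.

Lemma env_pdf_ge0 x : 0 <= env_pdf x.
Proof. by rewrite mulr_ge0 ?F_ge0// ltW// hk_gt0. Qed.

Lemma nice_hw : nice (fun x => hk x * weight x0 tau x).
Proof.
split; last exact: rdec_weight.
by apply: measurable_funM; [exact: measurable_h_kappa|exact: measurable_weight].
Qed.

Lemma env_pdf_le x : env_pdf x <= c' * (hk x * weight x0 tau x).
Proof. by rewrite /env_pdf mulrC mulrCA ler_wpM2l// ltW// hk_gt0. Qed.

Lemma nice_env_pdf : nice env_pdf.
Proof.
apply: (@nice_dom _ _ _ c' nice_hw).
  by apply: measurable_funM; [case: envF|exact: measurable_h_kappa].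
move=> x; rewrite ger0_norm ?env_pdf_ge0//; apply: le_trans (env_pdf_le x) _.
by rewrite ler_wpM2l ?ler_norm// ltW.
Qed.

Lemma intR_env_pdf : intR env_pdf = 1.
Proof. by rewrite /intR /Rintegral intF. Qed.

Definition weighted_poly K x := (P K).[x] * hk x ^+ 2.

Lemma weighted_polyE K x : weighted_poly K x = Ph kappa x0 P K x * hk x.
Proof. by rewrite /weighted_poly /Ph expr2 mulrA. Qed.

Lemma nice_poly_h2 (p : {poly R}) : nice (fun x => p.[x] * hk x ^+ 2).
Proof.
apply: niceM; first exact: pgrow_poly.
under eq_fun do rewrite expr2; apply: niceM; last exact: nice_hk.
exact: nice_pgrow nice_hk.
Qed.

Lemma nice_weighted_poly K : nice (weighted_poly K). Proof. exact: nice_poly_h2. Qed.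

(* [fine] is harmless: the supremum is finite by [envF]. *)
Definition env_sup := fine (ereal_sup [set ((K%:R `^ ((1 - kappa) / 2))%:E * sup_ratio (Ph kappa x0 P K) F)%E
         | K in [set K : nat | (1 <= K)%N]]).

Definition env_cst := `|env_sup| + 1.

Lemma env_cst_gt0 : 0 < env_cst. Proof. by rewrite ltr_wpDl. Qed.

Lemma sup_ratio_ge0 g : (forall x, 0 <= F x) -> (0 <= sup_ratio g F)%E.
Proof.
move=> F0; apply: (@le_trans _ _ (`|g 0|%:E / (F 0)%:E)%E).
  by rewrite mule_ge0// inve_ge0 lee_fin.
by apply: ereal_sup_ubound; exists 0.
Qed.

Lemma sup_ratio_le K : (1 <= K)%N ->
  (sup_ratio (Ph kappa x0 P K) F <= (env_cst * K%:R `^ (- ((1 - kappa) / 2)))%:E)%E.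
Proof.
move=> K1; have [_ F0 _ supE] := envF.
set B := ereal_sup _ in supE.
have K0 : 0 < K%:R `^ ((1 - kappa) / 2) :> R by apply: powR_gt0; rewrite ltr0n.
have h : ((K%:R `^ ((1 - kappa) / 2))%:E * sup_ratio (Ph kappa x0 P K) F <= B)%E.
  by apply: ereal_sup_ubound; exists K.
have s0 := sup_ratio_ge0 (Ph kappa x0 P K) F0.
have B0 : (0 <= B)%E by apply: le_trans h; rewrite mule_ge0// lee_fin ltW.
have Bfin : B = (env_sup)%:E by rewrite /env_sup -/B fineK// ge0_fin_numE.
move: h; rewrite Bfin powRN muleC -lee_pdivlMr// -EFinM => /le_trans; apply.
rewrite lee_fin ler_wpM2r ?invr_ge0 ?(ltW K0)//.
by rewrite /env_cst (le_trans (ler_norm _))// lerDl.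
Qed.

Lemma Ph_le K x : (1 <= K)%N -> `|Ph kappa x0 P K x| <= env_cst * K%:R `^ (- ((1 - kappa) / 2)) * F x.
Proof.
move=> K1; have [_ F0 _ _] := envF.
have h : (`|Ph kappa x0 P K x|%:E / (F x)%:E <= (env_cst * K%:R `^ (- ((1 - kappa) / 2)))%:E)%E.
  by apply: le_trans (sup_ratio_le K1); apply: ereal_sup_ubound; exists x.
have := F0 x; rewrite le_eqVlt => /orP[/eqP Fx|Fx].
  (* Where [F] vanishes, a nonzero numerator would make the quotient infinite, so [Ph] vanishes as
     well. *)
  move: h; rewrite -Fx inve0 mulr0 mulry.
  have [->|n0] := eqVneq (Ph kappa x0 P K x) 0; first by rewrite normr0.
  by rewrite gtr0_sg ?normr_gt0// mul1e leye_eq.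
by move: h; rewrite inver gt_eqF// -EFinM lee_fin ler_pdivrMr.
Qed.

Lemma le_inv_sup_ratio K al : (1 <= K)%N -> 0 <= al -> al * (env_cst * K%:R `^ (- ((1 - kappa) / 2))) <= 1 ->
  (al%:E <= (sup_ratio (Ph kappa x0 P K) F)^-1)%E.
Proof.
move=> K1 al0 al1; have := sup_ratio_le K1; set s := env_cst * _ in al1 *.
have [_ F0 _ _] := envF; have := sup_ratio_ge0 (Ph kappa x0 P K) F0.
have s0 : 0 < s by rewrite mulr_gt0 ?env_cst_gt0// powR_gt0// ltr0n.
case: (sup_ratio _ _) => // r; rewrite !lee_fin => r0 rs.
have [->|rn] := eqVneq r 0; first by rewrite inve0 leey.
have rp : 0 < r by rewrite lt_neqAle eq_sym rn.
rewrite inver (negbTE rn) lee_fin -[leRHS]mul1r ler_pdivlMr//.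
by apply: le_trans al1; rewrite ler_wpM2l.
Qed.

Lemma scaled_weighted_poly_le K al x : (1 <= K)%N -> 0 <= al -> al * (env_cst * K%:R `^ (- ((1 - kappa) / 2))) <= 1 ->
  `|al * weighted_poly K x| <= env_pdf x.
Proof.
move=> K1 al0 al1; rewrite weighted_polyE normrM (normrM (Ph _ _ _ _ _)) (ger0_norm al0) (gtr0_norm (hk_gt0 x)) mulrA.
rewrite ler_wpM2r ?(ltW (hk_gt0 x))//.
apply: (@le_trans _ _ (al * (env_cst * K%:R `^ (- ((1 - kappa) / 2)) * F x))).
  by rewrite ler_wpM2l// Ph_le.
by rewrite mulrA ler_piMl// F_ge0.
Qed.

(** Orthogonality to the [P L] with [L < K] extends to every polynomial of degree below [K] by
    eliminating leading coefficients one at a time. *)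
Lemma weighted_poly_ortho K (p : {poly R}) : (size p <= K)%N -> intR (fun x => p.[x] * weighted_poly K x) = 0.
Proof.
have [sP oP] := orthoP.
have nP (q : {poly R}) : nice (fun x => q.[x] * weighted_poly K x).
  by apply: niceM; [exact: pgrow_poly|exact: nice_weighted_poly].
have [m] := ubnP (size p); elim: m p => // m IH p; rewrite ltnS => pm pK.
have [->|p0] := eqVneq p 0.
  transitivity (intR (fun _ : R => 0)); first by apply: eq_intR => x; rewrite horner0 mul0r.
  by rewrite /intR /Rintegral integral0.
have sp : (0 < size p)%N by rewrite size_poly_gt0.
pose L := (size p).-1; pose k := lead_coef p / lead_coef (P L).
have lP : lead_coef (P L) != 0 by rewrite lead_coef_eq0 -size_poly_gt0 sP.
have sq : (size (p - k *: P L)%R < size p)%N.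
  have sE : size (k *: P L) = size p.
    have k0 : k != 0 by rewrite mulf_neq0 ?invr_eq0// lead_coef_eq0.
    by rewrite (size_scale _ k0) sP prednK.
  rewrite -(prednK sp) ltnS; apply/leq_sizeP => j; rewrite -/L leq_eqVlt => /orP[/eqP <-|Lj].
    have e1 : p`_L = lead_coef p by [].
    have e2 : (P L)`_L = lead_coef (P L) by rewrite lead_coefE sP.
    by rewrite coefB coefZ e1 e2 /k divfK ?subrr.
  rewrite coefB coefZ (nth_default 0 (_ : size p <= j)%N) ?(nth_default 0 (_ : size (P L) <= j)%N) ?mulr0 ?subrr//.
    by rewrite sP.
  by rewrite -(prednK sp).
have h1 : intR (fun x => (p - k *: P L).[x] * weighted_poly K x) = 0.
  by apply: IH; [exact: leq_trans sq pm|exact: ltnW (leq_trans sq pK)].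
have h2 : intR (fun x => (P L).[x] * weighted_poly K x) = 0.
  transitivity (\int[leb]_x ((P L).[x] * (P K).[x] * hk x ^+ 2)).
    by apply: eq_intR => x; rewrite /weighted_poly mulrA.
  by rewrite oP; case: eqP => // LK; move: pK; rewrite -LK /L -ltnS prednK// ltnn.
transitivity (intR (fun x => (p - k *: P L).[x] * weighted_poly K x) + k * intR (fun x => (P L).[x] * weighted_poly K x)).
  rewrite -intRZ// -intRD//; last exact: niceZ.
  by apply: eq_intR => x; rewrite hornerD hornerN hornerZ; ring.
by rewrite h1 h2 mulr0 addr0.
Qed.

Variables (b : R) (K : nat) (al : R).
Hypotheses (b0 : 0 < b) (K1 : (1 <= K)%N) (al0 : 0 <= al)
  (al1 : al * (env_cst * K%:R `^ (- ((1 - kappa) / 2))) <= 1).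

Local Notation u := (bump_b b).
Local Notation z0 := (zeta0 kappa x0 F b).
Local Notation z1 := (zeta1 kappa x0 P F al K b).

Definition zeta_diff := conv (fun x => al * weighted_poly K x) u.

Lemma nice_u : nice u. Proof. exact: nice_bump_b. Qed.

Lemma nice_scaled_weighted_poly : nice (fun x => al * weighted_poly K x).
Proof. by apply: niceZ; exact: nice_weighted_poly. Qed.

Lemma nice_zeta0 : nice z0. Proof. by apply: nice_conv nice_u; exact: nice_env_pdf. Qed.

Lemma nice_zeta_diff : nice zeta_diff.
Proof. exact: nice_conv nice_scaled_weighted_poly nice_u. Qed.

Lemma zeta1E x : z1 x = z0 x + zeta_diff x.
Proof. by rewrite /zeta1 convD//; [exact: nice_env_pdf|exact: nice_scaled_weighted_poly|exact: nice_u]. Qed.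

Lemma nice_zeta1 : nice z1.
Proof.
by rewrite (_ : z1 = fun x => z0 x + zeta_diff x); [apply: niceD; [exact: nice_zeta0|exact: nice_zeta_diff]|apply/funext => x; exact: zeta1E].
Qed.

Lemma zeta0_ge0 x : 0 <= z0 x.
Proof. by apply: conv_ge0; [exact: env_pdf_ge0|move=> y; exact: bump_b_ge0]. Qed.

(** Under [al1] the perturbation is dominated by the envelope density before smoothing, and
    convolution with a nonnegative kernel preserves this. Hence [zeta1] is nonnegative and at most
    twice [zeta0]. *)
Lemma zeta_diff_le x : `|zeta_diff x| <= z0 x.
Proof.
have u0 := bump_b_ge0 b0.
have nN : nice (fun x => - env_pdf x) by exact: niceN nice_env_pdf.
rewrite ler_norml; apply/andP; split.
  have -> : - z0 x = conv (fun y => -1 * env_pdf y) u x.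
    by rewrite (convZ _ _ nice_env_pdf nice_u) mulN1r.
  apply: (conv_mono x (niceZ (-1) nice_env_pdf) nice_scaled_weighted_poly nice_u u0).
  by move=> y; rewrite mulN1r; have := scaled_weighted_poly_le y K1 al0 al1; rewrite ler_norml => /andP[].
apply: (conv_mono x nice_scaled_weighted_poly nice_env_pdf nice_u u0).
by move=> y; rewrite (le_trans (ler_norm _))// scaled_weighted_poly_le.
Qed.

Lemma zeta1_ge0 x : 0 <= z1 x.
Proof. by rewrite zeta1E; have := zeta_diff_le x; rewrite ler_norml => /andP[]; lra. Qed.

Lemma zeta1_le x : z1 x <= 2 * z0 x.
Proof. by rewrite zeta1E; have := zeta_diff_le x; rewrite ler_norml => /andP[]; lra. Qed.

Lemma intR_zeta0 : intR z0 = 1.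
Proof. by rewrite (intR_conv1 nice_env_pdf nice_u) intR_env_pdf intR_bump_b// mulr1. Qed.

(** The convolution averages translates of the weighted polynomial, and translating a test
    polynomial does not raise its degree. *)
Lemma zeta_diff_ortho (p : {poly R}) : (size p <= K)%N -> intR (fun x => p.[x] * zeta_diff x) = 0.
Proof.
move=> pK; rewrite (intR_conv (pgrow_poly p) nice_scaled_weighted_poly nice_u).
transitivity (intR (fun _ : R => 0)); last by rewrite /intR /Rintegral integral0.
apply: eq_intR => y.
have -> : intR (fun x => p.[x + y] * (al * weighted_poly K x)) = al * intR (fun x => (p \Po ('X + y%:P)).[x] * weighted_poly K x).
  rewrite -intRZ; last by apply: niceM; [exact: pgrow_poly|exact: nice_weighted_poly].
  by apply: eq_intR => x; rewrite horner_comp hornerD hornerX hornerC; ring.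
by rewrite weighted_poly_ortho ?mulr0 ?mulr0// size_comp_poly2// size_XaddC.
Qed.

Lemma intR_zeta_diff : intR zeta_diff = 0.
Proof.
rewrite -[RHS](@zeta_diff_ortho 1); last by rewrite size_poly1.
by apply: eq_intR => x; rewrite hornerC mul1r.
Qed.

Lemma intR_zeta1 : intR z1 = 1.
Proof.
rewrite (eq_intR zeta1E) intRD ?intR_zeta0 ?intR_zeta_diff ?addr0//; [exact: nice_zeta0|exact: nice_zeta_diff].
Qed.

Lemma zeta0_pdf : is_pdf z0.
Proof.
split; [by case: nice_zeta0|exact: zeta0_ge0|].
by rewrite (intR_ereal nice_zeta0) intR_zeta0.
Qed.

Lemma zeta0_dom x : z0 x <= c' * conv (fun y => hk y * weight x0 tau y) u x.
Proof.
rewrite -(convZ _ _ nice_hw nice_u); exact: (conv_mono x nice_env_pdf (niceZ c' nice_hw) nice_u (bump_b_ge0 b0) env_pdf_le).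
Qed.

Lemma Phi_zeta_diff t : Phi zeta_diff t = Complex al 0 * Phi (weighted_poly K) t * Phi (@bump R) (t / b).
Proof.
rewrite (Phi_conv _ nice_scaled_weighted_poly nice_u) Phi_bump_b//; congr (_ * _).
by rewrite PhiZ//; exact: nice_weighted_poly.
Qed.

Lemma Phi_zeta1 t : Phi z1 t = Phi z0 t + Phi zeta_diff t.
Proof.
by rewrite -PhiD; [congr Phi; apply/funext => x; exact: zeta1E|exact: nice_zeta0|exact: nice_zeta_diff].
Qed.

End zeta_family.

(** * Moments and the class [Upsilon] *)

Section product_moments.
Context {R : realType}.
Local Notation C := (Cplx R).
Local Notation lam d := (@lebesgue_rV R d).

Lemma prod_Complex0 (I : Type) (r : seq I) (z : I -> R) :
  \prod_(i <- r) (Complex (z i) 0 : C) = Complex (\prod_(i <- r) z i) 0.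
Proof.
elim/big_rec2: _ => [//|i x y _ ->].
by apply/eqP; rewrite eq_complex /= !mul0r !mulr0 subr0 addr0 !eqxx.
Qed.

(** Read off from the value of the Fourier transform at 0. *)
Lemma Rintegral_prodf d (z : 'I_d -> R -> R) : (forall j, nice (z j)) ->
  \int[lam d]_s prodf z s = \prod_(j < d) intR (z j).
Proof.
move=> nz; have := @fourier_prodf R d z 0 (fun j => nice_integrable (nz j)).
have -> : \prod_(j < d) Phi (z j) ((0 : 'rV[R]_d) ord0 j) = Complex (\prod_(j < d) intR (z j)) 0.
  by rewrite -prod_Complex0; apply: eq_bigr => j _; rewrite mxE Phi0.
case=> <- _; apply: eq_Rintegral => s _.
by rewrite /dotp big1 ?cos0 ?mul1r// => j _; rewrite mxE mul0r.
Qed.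

Lemma mm_prodf d (i : {ffun 'I_d -> nat}) (z : 'I_d -> R -> R) (s : 'rV[R]_d) :
  mm i s * prodf z s = prodf (fun j x => x ^+ i j * z j x) s.
Proof. by rewrite /mm /prodf -big_split. Qed.

Lemma nice_powM k (f : R -> R) : nice f -> nice (fun x => x ^+ k * f x).
Proof. by move=> nf; apply: niceM => //; apply: pgrowX; exact: pgrow_id. Qed.

Lemma nice_absM k (f : R -> R) : nice f -> nice (fun x => `|x| ^+ k * f x).
Proof.
move=> nf; apply: niceM => //; apply: pgrowX; split.
  by apply: continuous_measurable_fun => x; exact: norm_continuous.
by exists 1, 1%N => x; rewrite normr_id mul1r expr1 abs_le_oneDsqr.
Qed.

Lemma natC n : (n%:R : C) = Complex n%:R 0.
Proof.
elim: n => [//|n IH]; rewrite !mulrS IH.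
by apply/eqP; rewrite eq_complex /= addr0 !eqxx.
Qed.

Lemma normc_divn (z : C) n : normc (z / n%:R) = normc z / n%:R.
Proof.
case: n => [|n]; first by rewrite invr0 !mulr0 normc0 invr0 mulr0.
have e : z = (z / n.+1%:R) * n.+1%:R by rewrite divfK.
have -> : normc z = normc (z / n.+1%:R) * n.+1%:R.
  by rewrite {1}e normcM natC normcR ger0_norm.
by rewrite mulfK.
Qed.

(** The [m]-th Taylor coefficient at 0 has modulus the absolute value of the [m]-th moment divided
    by [m!], so the bound that defines the class is a moment bound. *)
Lemma moment_of_Upsilon (z : R -> R) kappa T phi : nice z ->
  @Upsilon R 1 kappa T phi -> extends phi (fourier (as_rV1 z)) ->
  forall m, (0 < m)%N -> `|intR (fun x => x ^+ m * z x)| <= T ^+ m * (m`!%:R * m%:R `^ (- (kappa * m%:R))).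
Proof.
move=> nz [aphi _ _ bphi] ephi m m0.
have fE : @as_rV1 R z = prodf (fun=> z) by apply/funext => s; rewrite /prodf big_ord1.
have ii (i : {ffun 'I_1 -> nat}) : (lam 1).-integrable setT (EFin \o (fun x => mm i x * as_rV1 z x)).
  rewrite fE (_ : (fun x => _) = prodf (fun j x => x ^+ i j * z x)); last first.
    by apply/funext => s; exact: mm_prodf.
  by apply: integrable_prodf => j; apply: nice_integrable; exact: nice_powM.
pose i : {ffun 'I_1 -> nat} := [ffun=> m].
have n1 : norm1 i = m by rewrite /norm1 big_ord1 ffunE.
have := bphi i; rewrite n1 -lt0n => /(_ m0).
have -> : (\prod_(a < 1) (i a)`!)%N = m`! by rewrite big_ord1 ffunE.
rewrite normc_divn (multi_partial_moment ii); last 2 first.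
- exact: aphi.
- by move=> t; rewrite fourier_mG; exact: ephi.
have -> : \int[lam 1]_x (mm i x * as_rV1 z x) = intR (fun x => x ^+ m * z x).
  transitivity (\int[lam 1]_x prodf (fun j x => x ^+ i j * z x) x).
    by apply: eq_Rintegral => s _; rewrite fE mm_prodf.
  by rewrite Rintegral_prodf; [rewrite big_ord1 ffunE|move=> j; exact: nice_powM].
by rewrite ler_pdivrMr ?ltr0n ?fact_gt0// -mulrA (mulrC (m`!)%:R).
Qed.

End product_moments.

Section absolute_moments.
Context {R : realType}.
Variables (kappa T : R) (z : R -> R).
Hypotheses (k01 : 0 < kappa < 1) (T0 : 0 < T) (nz : nice z) (z0 : forall x, 0 <= z x)
  (iz : intR z = 1).

(* [T ^+ m * moment_bound m] is the bound on the [m]-th derivative at 0 that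
   membership in [Upsilon kappa T] provides. *)
Definition moment_bound (m : nat) : R := m`!%:R * m%:R `^ (- (kappa * m%:R)).

Lemma moment_bound_ge0 m : 0 <= moment_bound m.
Proof. by rewrite mulr_ge0// powR_ge0. Qed.

Lemma moment_bound0 : moment_bound 0 = 1.
Proof. by rewrite /moment_bound fact0 mulr0 oppr0 powRr0 mulr1. Qed.

Lemma powRDp (x a b : R) : 0 < x -> x `^ (a + b) = x `^ a * x `^ b.
Proof. by move=> x0; rewrite powRD// (gt_eqF x0) implybT. Qed.

Lemma natS_gt0 n : 0 < n.+1%:R :> R. Proof. by rewrite ltr0n. Qed.

(** This comparison of consecutive bounds and the next one serve [abs_moment_le]: the power of
    [n.+1] is the one that the interpolation weight brings in, and what remains is a geometric
    factor. *)
Lemma moment_bound_pred n : moment_bound n * n.+1%:R `^ (1 - kappa) <= 2 ^+ n * moment_bound n.+1.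
Proof.
have k0 : 0 < kappa by case/andP: k01.
have k1 : kappa < 1 by case/andP: k01.
have e1 : n.+1%:R `^ (1 - kappa) = n.+1%:R * n.+1%:R `^ (- kappa) :> R.
  by rewrite powRDp ?natS_gt0// powRr1.
have e2 : n.+1%:R `^ (- (kappa * n.+1%:R)) = n.+1%:R `^ (- (kappa * n%:R)) * n.+1%:R `^ (- kappa) :> R.
  by rewrite -powRDp ?natS_gt0//; congr (_ `^ _); rewrite -natr1; ring.
rewrite /moment_bound e1 e2 factS natrM.
have -> : n`!%:R * n%:R `^ (- (kappa * n%:R)) * (n.+1%:R * n.+1%:R `^ (- kappa)) =
  n.+1%:R * n`!%:R * n.+1%:R `^ (- kappa) * n%:R `^ (- (kappa * n%:R)) :> R by ring.
have -> : 2 ^+ n * (n.+1%:R * n`!%:R * (n.+1%:R `^ (- (kappa * n%:R)) * n.+1%:R `^ (- kappa))) =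
  n.+1%:R * n`!%:R * n.+1%:R `^ (- kappa) * (2 ^+ n * n.+1%:R `^ (- (kappa * n%:R))) :> R by ring.
rewrite ler_wpM2l ?mulr_ge0 ?powR_ge0//.
case: n {e1 e2} => [|n]; first by rewrite mulr0 oppr0 !powRr0 expr0 mulr1.
rewrite !powRN ler_pdivlMr ?powR_gt0 ?natS_gt0// mulrC ler_pdivrMr ?powR_gt0 ?natS_gt0//.
have -> : 2 ^+ n.+1 = 2 `^ n.+1%:R :> R by rewrite powR_mulrn.
apply: (@le_trans _ _ ((2 * n.+1%:R) `^ (kappa * n.+1%:R))).
  apply: ge0_ler_powR; rewrite ?nnegrE//; first by rewrite mulr_ge0// ltW.
  by rewrite -natrM ler_nat mul2n -addnn addnS -addSn leq_addr.
rewrite powRM// ler_wpM2r ?powR_ge0//; apply: ler_powR; first by rewrite ler1n.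
by rewrite ler_piMl// ltW.
Qed.

Lemma moment_bound_succ n : moment_bound n.+2 * n.+1%:R `^ (kappa - 1) <= 2 * moment_bound n.+1.
Proof.
have k0 : 0 < kappa by case/andP: k01.
have k1 : kappa < 1 by case/andP: k01.
set m := n.+1; have m0 : 0 < m%:R :> R by rewrite ltr0n.
have e1 : m%:R `^ (kappa - 1) = m%:R `^ kappa / m%:R :> R.
  by rewrite powRDp// powR_inv1// ltW.
have e2 : n.+2%:R `^ (- (kappa * n.+2%:R)) = n.+2%:R `^ (- (kappa * m%:R)) * n.+2%:R `^ (- kappa) :> R.
  by rewrite -powRDp ?natS_gt0//; congr (_ `^ _); rewrite /m -[n.+2%:R]natr1; ring.
rewrite /moment_bound e1 e2 -/m factS natrM.
have -> : n.+2%:R * m`!%:R * (n.+2%:R `^ (- (kappa * m%:R)) * n.+2%:R `^ (- kappa)) * (m%:R `^ kappa / m%:R)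
  = (n.+2%:R / m%:R) * (m`!%:R * n.+2%:R `^ (- (kappa * m%:R))) * (m%:R `^ kappa * n.+2%:R `^ (- kappa)) :> R by ring.
apply: (@le_trans _ _ (2 * (m`!%:R * m%:R `^ (- (kappa * m%:R))) * 1)); last by rewrite mulr1.
apply: ler_pM; rewrite ?mulr_ge0 ?powR_ge0 ?invr_ge0 ?(ltW m0)//.
- apply: ler_pM; rewrite ?mulr_ge0 ?powR_ge0 ?invr_ge0 ?(ltW m0)//.
    by rewrite ler_pdivrMr// -natrM ler_nat mul2n -addnn /m addSn ltnS addnS leq_addr.
  rewrite ler_wpM2l// !powRN lef_pV2 ?posrE ?powR_gt0//.
  by apply: ge0_ler_powR; rewrite ?nnegrE ?mulr_ge0 ?(ltW k0)// ler_nat.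
- rewrite powRN ler_pdivrMr ?powR_gt0 ?natS_gt0// mul1r.
  by apply: ge0_ler_powR; rewrite ?nnegrE ?(ltW k0)// ler_nat.
Qed.

Hypothesis mz : forall m, (0 < m)%N -> `|intR (fun x => x ^+ m * z x)| <= T ^+ m * moment_bound m.

(** Even absolute moments are ordinary moments. For odd order, [|x| <= (rho + x^2 / rho) / 2]
    interpolates between the two neighbouring even orders; the choice of [rho] as [T] times the
    power [1 - kappa] of the order balances their bounds up to the factor [2 ^+ m]. *)
Lemma abs_moment_le m : intR (fun x => `|x| ^+ m * z x) <= (2 * T) ^+ m * moment_bound m.
Proof.
have even_le n : ~~ odd n -> intR (fun x => x ^+ n * z x) <= T ^+ n * moment_bound n.
  case: n => [_|n _].
    by rewrite expr0 moment_bound0 mul1r (eq_intR (g := z)) ?iz// => x; rewrite expr0 mul1r.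
  by apply: le_trans (mz _); rewrite ?ler_norm.
have [om|em] := boolP (odd m); last first.
  apply: (@le_trans _ _ (T ^+ m * moment_bound m)).
    apply: le_trans (even_le m em); rewrite le_eqVlt; apply/orP; left; apply/eqP.
    by apply: eq_intR => x; rewrite -normrX ger0_norm// exprn_even_ge0.
  rewrite ler_wpM2r ?moment_bound_ge0// exprMn ler_peMl ?exprn_ge0 ?(ltW T0)//.
  by apply: exprn_ege1; rewrite ler1n.
case: m om => [//|n] /= en.
pose rho := T * n.+1%:R `^ (1 - kappa).
have pw : 0 < n.+1%:R `^ (1 - kappa) :> R by rewrite powR_gt0// natS_gt0.
have rho0 : 0 < rho by rewrite mulr_gt0.
have nn := nice_powM n nz; have nn2 := nice_powM n.+2 nz.
apply: (@le_trans _ _ (2^-1 * (rho * intR (fun x => x ^+ n * z x) + rho^-1 * intR (fun x => x ^+ n.+2 * z x)))).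
  rewrite -!intRZ// -intRD; [|exact: niceZ|exact: niceZ].
  rewrite -intRZ; last by apply: niceD; exact: niceZ.
  apply: intR_le; first exact: nice_absM.
    by apply: niceZ; apply: niceD; exact: niceZ.
  move=> x; rewrite exprS -[`|x| ^+ n]normrX [`|x ^+ n|]ger0_norm ?exprn_even_ge0//.
  rewrite [leRHS](_ : _ = (2^-1 * (rho + rho^-1 * x ^+ 2)) * (x ^+ n * z x)); last by rewrite !exprS; ring.
  rewrite -mulrA; apply: ler_wpM2r; first by rewrite mulr_ge0// exprn_even_ge0.
  rewrite -(real_normK (num_real x)).
  have ri0 : 0 < rho^-1 by rewrite invr_gt0.
  have := mulr_ge0 (ltW ri0) (sqr_ge0 (rho - `|x|)).
  have -> : rho^-1 * (rho - `|x|) ^+ 2 = rho - 2 * `|x| + rho^-1 * `|x| ^+ 2 by field; rewrite gt_eqF.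
  lra.
have h1 := even_le n en; have h2 : intR (fun x => x ^+ n.+2 * z x) <= T ^+ n.+2 * moment_bound n.+2.
  by apply: even_le => /=; rewrite negbK.
apply: (@le_trans _ _ (2^-1 * (rho * (T ^+ n * moment_bound n) + rho^-1 * (T ^+ n.+2 * moment_bound n.+2)))).
  rewrite ler_wpM2l//; apply: lerD; rewrite ler_wpM2l// ?invr_ge0 ltW//.
have -> : rho * (T ^+ n * moment_bound n) = T ^+ n.+1 * (moment_bound n * n.+1%:R `^ (1 - kappa)) by rewrite /rho exprS; ring.
have -> : rho^-1 * (T ^+ n.+2 * moment_bound n.+2) = T ^+ n.+1 * (moment_bound n.+2 * n.+1%:R `^ (kappa - 1)).
  have -> : kappa - 1 = - (1 - kappa) by ring.
  by rewrite powRN /rho !exprS; field; rewrite (gt_eqF pw) gt_eqF.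
have := moment_bound_pred n; have := moment_bound_succ n; set A := moment_bound n * _; set B := moment_bound n.+2 * _ => hB hA.
rewrite [leLHS](_ : _ = T ^+ n.+1 * (2^-1 * (A + B))); last by ring.
rewrite exprMn -mulrA [leRHS]mulrCA ler_wpM2l ?exprn_ge0 ?(ltW T0)//.
have := moment_bound_ge0 n.+1; have : 1 <= 2 ^+ n :> R by apply: exprn_ege1; rewrite ler1n.
rewrite exprS; set p := 2 ^+ n in hA *; set q := moment_bound n.+1 in hA hB *; nra.
Qed.

End absolute_moments.

(** * Moments of mixtures and Taylor bounds in several variables *)

Section mixture_moments.
Context {R : realType} (d : nat).
Local Notation C := (Cplx R).
Local Notation lam := (@lebesgue_rV R d).
Local Notation leb := (@lebesgue_measure R).
Variables (A : 'M[R]_d) (k : R) (z : 'I_d -> R -> R).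
Hypotheses (d0 : (0 < d)%N) (k0 : 0 < k) (uA : A \in unitmx)
  (A1 : forall i j, `|A i j| <= 1)
  (kA : forall f : 'rV[R]_d -> \bar R, measurable_fun setT f -> (forall x, 0 <= f x)%E ->
    (\int[lam]_x f (x *m A^T)%R = k%:E * \int[lam]_x f x)%E)
  (nz : forall j, nice (z j)) (z0 : forall j x, 0 <= z j x) (iz : forall j, intR (z j) = 1).

Local Notation f := (mixf A^T k z).

Let uAT : A^T \in unitmx. Proof. by rewrite unitmx_tr. Qed.
Let mz j : measurable_fun setT (z j). Proof. by case: (nz j). Qed.

Lemma pow_sum_le (y : 'I_d -> R) m : (forall b, 0 <= y b) ->
  (\sum_b y b) ^+ m <= d%:R ^+ m * \sum_b y b ^+ m.
Proof.
move=> y0; pose b0 : 'I_d := Ordinal d0.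
have [b hb] : exists b, forall b', y b' <= y b.
  case: (@arg_maxP _ _ _ b0 xpredT y isT) => b _ hb.
  by exists b => b'; exact: hb.
apply: (@le_trans _ _ ((d%:R * y b) ^+ m)).
  apply: leXn; first exact: sumr_ge0.
  apply: (@le_trans _ _ (\sum_(b' < d) y b)); first exact: ler_sum.
  by rewrite sumr_const card_ord mulr_natl.
rewrite exprMn ler_wpM2l ?exprn_ge0// (bigD1 b)//= lerDl sumr_ge0// => b' _.
exact: exprn_ge0.
Qed.

(** As the entries of [A] are at most 1, every coordinate of [s *m A^T] is at most the sum of the
    [|s b|]. A mixed monomial is thereby reduced to powers of single coordinates. *)
Lemma mm_le (i : {ffun 'I_d -> nat}) (s : 'rV[R]_d) :
  `|mm i (s *m A^T)| <= d%:R ^+ norm1 i * \sum_b `|s ord0 b| ^+ norm1 i.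
Proof.
apply: le_trans (pow_sum_le (norm1 i) (fun b => normr_ge0 (s ord0 b))).
rewrite /mm /norm1 normr_prod -prodrXr; apply: ler_prod => a _.
rewrite normr_ge0 normrX; apply: leXn => //.
rewrite mxE (le_trans (ler_norm_sum _ _ _))//; apply: ler_sum => b _.
by rewrite normrM mxE ler_piMr.
Qed.

(** Charging the whole power to the one factor [b] keeps the integrand a product over the
    coordinates. *)
Definition zpow m b (j : 'I_d) (x : R) : R := (if j == b then `|x| ^+ m else 1) * z j x.

Lemma nice_zpow m b j : nice (zpow m b j).
Proof.
rewrite /zpow; case: eqP => _; first exact: nice_absM.
by under eq_fun do rewrite mul1r.
Qed.

Lemma zpow_ge0 m b j x : 0 <= zpow m b j x.
Proof. by rewrite /zpow; case: eqP => _; rewrite mulr_ge0. Qed.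

Lemma zpowE m b (s : 'rV[R]_d) : `|s ord0 b| ^+ m * prodf z s = prodf (zpow m b) s.
Proof.
rewrite /prodf /zpow big_split/=; congr (_ * _).
by rewrite -big_mkcond/= big_pred1_eq.
Qed.

Lemma prod_intR_zpow m b : \prod_j intR (zpow m b j) = intR (fun x => `|x| ^+ m * z b x).
Proof.
rewrite (bigD1 b)//= big1 ?mulr1.
  by apply: eq_intR => x; rewrite /zpow eqxx.
move=> j /negbTE jb; rewrite -[RHS](iz j); apply: eq_intR => x.
by rewrite /zpow jb mul1r.
Qed.

Lemma measurable_mm i : measurable_fun setT (fun x : 'rV[R]_d => mm i x).
Proof.
apply: measurable_prod => b _; apply: measurable_funX; exact: measurable_rV_coord.
Qed.

Lemma abs_mixture_moment i Bd : (forall j, intR (fun x => `|x| ^+ norm1 i * z j x) <= Bd) ->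
  (\int[lam]_x `|(mm i x * f x)%:E| <= (d%:R ^+ norm1 i * (d%:R * Bd))%:E)%E.
Proof.
move=> hB.
rewrite (dens_push_abs (mixf_ge0 A^T k0 z0) (fun s => prodf_ge0 s z0)
  (mixf_push k0 uAT kA mz z0) (measurable_mm i)).
set m := norm1 i.
apply: (@le_trans _ _ (\int[lam]_s ((d%:R ^+ m)%:E * \sum_b (prodf (zpow m b) s)%:E)))%E.
  have mp b : measurable_fun setT (prodf (zpow m b)).
    by apply: measurable_prodf => j; case: (nice_zpow m b j).
  apply: ge0_le_integral => //.
  - apply/measurable_EFinP; apply: measurableT_comp => //; apply: measurable_funM.
      by apply: (measurableT_comp (measurable_mm i)); exact: measurable_mulmx.
    exact: measurable_prodf.
  - apply: measurable_funeM; apply: emeasurable_sum => b.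
    by apply/measurable_EFinP; exact: mp.
  - move=> s _; rewrite sumEFin -EFinM lee_fin normrM (ger0_norm (prodf_ge0 s z0)).
    apply: le_trans (ler_wpM2r (prodf_ge0 s z0) (mm_le i s)) _.
    rewrite -mulrA ler_wpM2l ?exprn_ge0// mulr_suml; apply: ler_sum => b _.
    by rewrite zpowE.
rewrite ge0_integralZl//; last 2 first.
- apply: emeasurable_sum => b; apply/measurable_EFinP.
  by apply: measurable_prodf => j; case: (nice_zpow m b j).
- by move=> s _; apply: sume_ge0 => b _; rewrite lee_fin prodf_ge0// => j x; exact: zpow_ge0.
rewrite ge0_integral_sum//; last 2 first.
- move=> b; apply/measurable_EFinP.
  by apply: measurable_prodf => j; case: (nice_zpow m b j).
- by move=> b s _; rewrite lee_fin prodf_ge0// => j x; exact: zpow_ge0.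
rewrite EFinM lee_wpmul2l ?lee_fin ?exprn_ge0//.
have e b : (\int[lam]_s (prodf (zpow m b) s)%:E = (intR (fun x => `|x| ^+ m * z b x))%:E)%E.
  rewrite ge0_integral_prodf; last 2 first.
  - by move=> j; case: (nice_zpow m b j).
  - by move=> j x; exact: zpow_ge0.
  rewrite -prod_intR_zpow -prodEFin; apply: eq_bigr => j _.
  by rewrite intR_ereal//; exact: nice_zpow.
under eq_bigr do rewrite e.
rewrite sumEFin lee_fin; apply: (@le_trans _ _ (\sum_(b < d) Bd)); first exact: ler_sum.
by rewrite sumr_const card_ord mulr_natl.
Qed.

Lemma mixture_moment_integrable i : lam.-integrable setT (EFin \o (fun x => mm i x * f x)).
Proof.
apply/integrableP; split.
  by apply/measurable_EFinP; apply: measurable_funM; [exact: measurable_mm|exact: measurable_mixf].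
pose Bd := \sum_j intR (fun x => `|x| ^+ norm1 i * z j x).
have hB j : intR (fun x => `|x| ^+ norm1 i * z j x) <= Bd.
  rewrite /Bd (bigD1 j)//= lerDl sumr_ge0// => j' _.
  by apply: intR_ge0 => x; rewrite mulr_ge0.
exact: le_lt_trans (abs_mixture_moment hB) (ltry _).
Qed.

Lemma mixture_moment_le i Bd : (forall j, intR (fun x => `|x| ^+ norm1 i * z j x) <= Bd) ->
  `|\int[lam]_x (mm i x * f x)| <= d%:R ^+ norm1 i * (d%:R * Bd).
Proof.
move=> hB; apply: le_trans (le_normr_Rintegral measurableT (mixture_moment_integrable i)) _.
rewrite -lee_fin; apply: le_trans (abs_mixture_moment hB).
have := mixture_moment_integrable i => /integrableP[_ fin].
rewrite /Rintegral fineK// ge0_fin_numE ?integral_ge0//.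
Qed.

(** A multinomial coefficient is a product of binomial coefficients, each at most a power of 2. This
    converts the factorial of the total order in the one-variable moments into the product of
    factorials in [Upsilon]. *)
Lemma fact_sum_le (i : 'I_d -> nat) :
  ((\sum_a i a)`! <= 2 ^ (d * \sum_a i a) * \prod_a (i a)`!)%N.
Proof.
elim: d i => [|n IH] i; first by rewrite !big_ord0.
rewrite !big_ord_recl; set s := (\sum_(j < n) _)%N; set p := (\prod_(j < n) _)%N.
have hs : (s`! <= 2 ^ (n * s) * p)%N by exact: (IH (fun j => i (lift ord0 j))).
have h2 : ('C(i ord0 + s, s) <= 2 ^ (i ord0 + s))%N.
  have sl : (s < (i ord0 + s).+1)%N by rewrite ltnS leq_addl.
  by rewrite -[2%N]/(1 + 1)%N expnDn (bigD1 (Ordinal sl))//= !exp1n !muln1 leq_addr.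
rewrite -(bin_fact (leq_addl (i ord0) s)) addnK mulSn expnD -!mulnA.
apply: leq_mul => //.
rewrite mulnCA (mulnC (s`!)).
rewrite leq_mul2l; apply/orP; right; apply: leq_trans hs _.
by rewrite leq_mul2r leq_exp2l// leq_mul2l leq_addl !orbT.
Qed.

Variables (kappa T : R).
Hypotheses (T0 : 0 < T).
Hypothesis hz : forall j m, (0 < m)%N -> intR (fun x => `|x| ^+ m * z j x) <= 2 * ((2 * T) ^+ m * moment_bound kappa m).

(** The constant collects [2 T] from the absolute moments, [d] from [mm_le] and [2 ^+ d] from
    [fact_sum_le]. A further [2 d], from the factor 2 in [hz] and the sum over coordinates, is
    absorbed into the power because the order is positive. *)
Lemma mixture_Upsilon S phi : 4 * d%:R ^+ 2 * 2 ^+ d * T <= S ->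
  analytic phi -> extends phi (fourier f) -> Upsilon kappa S phi.
Proof.
move=> TS aphi ephi.
have i0 : fourier f 0 = 1.
  have := @fourier_mixf R d A k z 0 k0 uA kA z0 (fun j => nice_integrable (nz j)) => ->.
  rewrite (_ : (0 : 'rV[R]_d) *m A = 0); last by rewrite mul0mx.
  by apply: big1 => j _; rewrite mxE Phi0 iz.
split => //.
- move=> t; rewrite !ephi /fourier; apply/eqP; rewrite eq_complex /=; apply/andP; split; apply/eqP.
    apply: eq_Rintegral => x _; congr (_ * _); rewrite -[in RHS]cosN; congr cos.
    by rewrite /dotp -sumrN; apply: eq_bigr => j _; rewrite mxE mulNr opprK.
  rewrite -[LHS]mulN1r -RintegralZl//; last first.
    have := mixture_moment_integrable [ffun=> 0%N].
    have -> : (fun x => mm [ffun=> 0%N] x * f x) = f.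
      by apply/funext => x; rewrite /mm big1 ?mul1r// => j _; rewrite ffunE expr0.
    apply: integrable_boundedM; last by move=> x; rewrite ler_norml sin_geN1 sin_le1.
    by apply: (measurableT_comp measurable_sin); exact: measurable_dotp.
  apply: eq_Rintegral => x _; rewrite mulrA; congr (_ * _); rewrite mulN1r -sinN; congr sin.
  by rewrite /dotp -sumrN; apply: eq_bigr => j _; rewrite mxE mulNr.
- rewrite -i0 -ephi; congr phi; apply/rowP => j; rewrite !mxE.
  by apply/eqP; rewrite eq_complex /= !eqxx.
move=> i; rewrite -lt0n => m0; set m := norm1 i in m0 *.
rewrite normc_divn (multi_partial_moment mixture_moment_integrable i aphi); last first.
  by move=> t; rewrite fourier_mG.
rewrite ler_pdivrMr; last by rewrite ltr0n prodn_gt0// => a; exact: fact_gt0.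
apply: le_trans (mixture_moment_le (fun j => hz j m0)) _; rewrite -/m.
have TS' : (4 * d%:R ^+ 2 * 2 ^+ d * T) ^+ m <= S ^+ m.
  by apply: leXn => //; rewrite !mulr_ge0 ?exprn_ge0// ltW.
set pw := m%:R `^ _; set pf := (\prod_(a < d) _)%N.
have pw0 : 0 <= pw by exact: powR_ge0.
apply: (@le_trans _ _ ((4 * d%:R ^+ 2 * 2 ^+ d * T) ^+ m * pw * pf%:R)); last first.
  by rewrite ler_wpM2r// ler_wpM2r.
have fb : m`!%:R <= 2 ^+ (d * m) * pf%:R :> R.
  by rewrite -natrX -natrM ler_nat; exact: fact_sum_le.
have d2 : 2 * d%:R <= (2 * d%:R) ^+ m :> R.
  case: (m) m0 => // n _; rewrite exprS ler_peMr// exprn_ege1//.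
  by rewrite -natrM ler1n muln_gt0.
rewrite /moment_bound -/pw.
rewrite [leLHS](_ : _ = (2 * d%:R) * ((d%:R * 2 * T) ^+ m * pw * m`!%:R)); last by rewrite !exprMn; ring.
have h0 : 0 <= (d%:R * 2 * T) ^+ m * pw by rewrite mulr_ge0// exprn_ge0// !mulr_ge0// ltW.
apply: (@le_trans _ _ ((2 * d%:R) ^+ m * ((d%:R * 2 * T) ^+ m * pw * (2 ^+ (d * m) * pf%:R)))).
  apply: ler_pM => //; first by rewrite mulr_ge0.
  by rewrite ler_wpM2l.
have -> : (4 * d%:R ^+ 2 * 2 ^+ d * T) ^+ m = (2 * d%:R) ^+ m * (d%:R * 2 * T) ^+ m * 2 ^+ (d * m).
  by rewrite exprM -!exprMn; congr (_ ^+ _); ring.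
rewrite le_eqVlt; apply/orP; left; apply/eqP.
set u := (2 * d%:R) ^+ m; set v := (d%:R * 2 * T) ^+ m; set w := 2 ^+ (d * m).
by ring.
Qed.

End mixture_moments.

(** * Noise density with geometric derivatives *)

Section real_derivatives.
Context {R : realType}.
Implicit Types f g : R -> R.

Lemma derD f g (x a b : R) : is_derive x 1 f a -> is_derive x 1 g b ->
  is_derive x 1 (fun y => f y + g y) (a + b).
Proof. by move=> ? ?; exact: is_deriveD. Qed.

Lemma derB f g (x a b : R) : is_derive x 1 f a -> is_derive x 1 g b ->
  is_derive x 1 (fun y => f y - g y) (a - b).
Proof. by move=> ? ?; exact: is_deriveB. Qed.

Lemma derM f g (x a b : R) : is_derive x 1 f a -> is_derive x 1 g b ->
  is_derive x 1 (fun y => f y * g y) (a * g x + f x * b).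
Proof.
move=> df dg; have := is_deriveM df dg; rewrite addrC => H.
by apply: is_derive_eq; rewrite /GRing.scale/= (mulrC a).
Qed.

Lemma derZ k f (x a : R) : is_derive x 1 f a -> is_derive x 1 (fun y => k * f y) (k * a).
Proof. by move=> df; exact: is_deriveZ. Qed.

Lemma derC f g (x a b : R) : is_derive (g x) 1 f a -> is_derive x 1 g b ->
  is_derive x 1 (fun y => f (g y)) (a * b).
Proof. by move=> df dg; exact: is_derive1_comp. Qed.

Lemma der_cst (k x : R) : is_derive x 1 (fun=> k : R) 0.
Proof. exact: is_derive_cst. Qed.

Lemma der_id (x : R) : is_derive x 1 (fun y : R => y) 1.
Proof. exact: is_derive_id. Qed.

Lemma der_eq f (x a b : R) : is_derive x 1 f a -> a = b -> is_derive x 1 f b.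
Proof. by move=> h <-. Qed.

Lemma der_affine (k d x : R) : is_derive x 1 (fun y : R => k * y + d) k.
Proof.
apply: (der_eq (derD (derZ k (der_id x)) (der_cst d x))).
by rewrite mulr1 addr0.
Qed.

Lemma derXn k (x : R) : is_derive x 1 (fun y : R => y ^+ k) (k%:R * x ^+ k.-1).
Proof.
elim: k => [|k IH].
  by apply: (der_eq (der_cst 1 x)); rewrite mul0r.
have -> : (fun y : R => y ^+ k.+1) = (fun y => y * y ^+ k) by apply/funext => y; rewrite exprS.
apply: (der_eq (derM (der_id x) IH)).
by case: k {IH} => [|k] /=; rewrite ?exprS -?[k.+2%:R]natr1; ring.
Qed.

(** Integrating a pointwise Taylor bound gives exactly such a quadratic remainder; differentiation
    under the integral sign on the line goes through this criterion. *)
Lemma der_quad f (x l C : R) : (forall h, `|h| <= 1 -> `|f (x + h) - f x - h * l| <= C * h ^+ 2) ->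
  is_derive x 1 f l.
Proof.
move=> H.
have cv : (fun h : R => h^-1 *: (f (h *: (1 : R) + x) - f x)) @ 0^' --> l.
  apply/cvgrPdist_le => e e0; near=> h.
  have hn : h != 0 by near: h; exact: nbhs_dnbhs_neq.
  have h1 : `|h| <= 1 by near: h; apply: dnbhs0_le.
  have h2 : `|h| <= e / (`|C| + 1) by near: h; apply: dnbhs0_le; rewrite divr_gt0// ltr_wpDl.
  have hE : h *: (1 : R) + x = x + h by rewrite /GRing.scale/= mulr1 addrC.
  rewrite hE distrC /GRing.scale/=.
  have -> : h^-1 * (f (x + h) - f x) - l = h^-1 * (f (x + h) - f x - h * l) by field.
  rewrite normrM normfV ler_pdivrMl ?normr_gt0//.
  apply: le_trans (H h h1) _; rewrite -(real_normK (num_real h)) expr2 mulrA [leRHS]mulrC.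
  rewrite ler_wpM2r//; apply: (@le_trans _ _ ((`|C| + 1) * `|h|)).
    by rewrite ler_wpM2r// (le_trans (ler_norm C))// lerDl.
  by move: h2; rewrite ler_pdivlMr ?ltr_wpDl// mulrC.
apply: DeriveDef; first by apply: cvgP; exact: cv.
by rewrite /derive; apply/cvg_lim.
Unshelve. all: by end_near. Qed.

Lemma der_continuous f : (forall x : R, exists a : R, is_derive x 1 f a) -> continuous f.
Proof.
move=> df x; have [a [da _]] := df x.
by apply: differentiable_continuous; apply/derivable1_diffP.
Qed.

Lemma der_mvt f g (s : R) : 0 <= s -> (forall x : R, is_derive x 1 f (g x)) ->
  exists2 c, 0 <= c <= s & f s - f 0 = g c * s.
Proof.
rewrite le_eqVlt => /predU1P[<-|s0] df.
  by exists 0; rewrite ?lexx// subrr mulr0.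
have cf : {within `[0, s], continuous f}.
  by apply: continuous_subspaceT; apply: der_continuous => x; exists (g x).
have [c] := @MVT R f g 0 s s0 (fun x _ => df x) cf.
rewrite in_itv/= subr0 => /andP[c0 cs] fE; exists c => //.
by rewrite (ltW c0) (ltW cs).
Qed.

(** A smooth function is carried as the sequence of its derivatives, so that bounds can be stated on
    explicit formulas for them. *)
Definition dfam (f : nat -> R -> R) := forall k (x : R), is_derive x 1 (f k) (f k.+1 x).

(** Induction on [K]: the derivative of the remainder is the remainder of the derivative, so
    [B + rem] and [B - rem] vanish at 0 and have nonnegative derivative on the interval. *)
Lemma taylor_pos (f : nat -> R -> R) K M (s : R) : dfam f -> 0 <= s ->
  (forall x, 0 <= x <= s -> `|f K x| <= M) ->
  `|f 0%N s - \sum_(k < K) f k 0 * s ^+ k / k`!%:R| <= M * s ^+ K / K`!%:R.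
Proof.
elim: K f s => [|K IH] f s df s0 fM.
  by rewrite big_ord0 subr0 expr0 fact0 divr1 mulr1 fM// lexx s0.
pose g k := f k.+1; have dg : dfam g by move=> k x; exact: df.
pose rem (x : R) := f 0%N x - \sum_(k < K.+1) f k 0 * x ^+ k / k`!%:R.
pose drem (x : R) := g 0%N x - \sum_(k < K) g k 0 * x ^+ k / k`!%:R.
have dsum (x : R) : is_derive x 1 (fun x : R => \sum_(k < K.+1) f k 0 * x ^+ k / k`!%:R)
    (\sum_(k < K) g k 0 * x ^+ k / k`!%:R).
  have -> : (fun x : R => \sum_(k < K.+1) f k 0 * x ^+ k / k`!%:R) =
      \sum_(k < K.+1) (fun x : R => (f k 0 / k`!%:R) * x ^+ k).
    by apply/funext => y; rewrite fct_sumE; apply: eq_bigr => k _; ring.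
  apply: (der_eq (is_derive_sum (fun k : 'I_K.+1 => derZ (f k 0 / k`!%:R) (derXn k x)))).
  rewrite big_ord_recl mul0r mulr0 add0r; apply: eq_bigr => k _.
  rewrite lift0 /g /= factS natrM.
  have k0 : k.+1%:R != 0 :> R by rewrite pnatr_eq0.
  have kf : k`!%:R != 0 :> R by rewrite pnatr_eq0 -lt0n fact_gt0.
  by move: (k.+1%:R : R) (k`!%:R : R) k0 kf => u v u0 v0; field; rewrite u0 v0.
have dr (x : R) : is_derive x 1 rem (drem x) by exact: (derB (df 0%N x) (dsum x)).
have rem0 : rem 0 = 0.
  rewrite /rem big_ord_recl big1 => [|k _]; last by rewrite lift0 expr0n mulr0 mul0r.
  by rewrite /= expr0 fact0 divr1 mulr1 addr0 subrr.
have hb (x : R) : 0 <= x <= s -> `|drem x| <= M * x ^+ K / K`!%:R.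
  move=> /andP[x0 xs]; apply: IH => // y /andP[y0 yx]; apply: fM.
  by rewrite y0 (le_trans yx).
pose B (x : R) := M * x ^+ K.+1 / K.+1`!%:R.
have dB (x : R) : is_derive x 1 B (M * x ^+ K / K`!%:R).
  have -> : B = (fun x => (M / K.+1`!%:R) * x ^+ K.+1) by apply/funext => y; rewrite /B; ring.
  apply: (der_eq (derZ _ (derXn _ x))).
  rewrite /= factS natrM.
  have k0 : K.+1%:R != 0 :> R by rewrite pnatr_eq0.
  have kf : K`!%:R != 0 :> R by rewrite pnatr_eq0 -lt0n fact_gt0.
  by move: (K.+1%:R : R) (K`!%:R : R) k0 kf => u v u0 v0; field; rewrite u0 v0.
have B0 : B 0 = 0 by rewrite /B expr0n mulr0 mul0r.
rewrite -/(rem s) -/(B s) ler_norml; apply/andP; split.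
  have dd (x : R) : is_derive x 1 (fun x => B x + rem x) (M * x ^+ K / K`!%:R + drem x) by exact: (derD (dB x) (dr x)).
  have [c cs] := der_mvt s0 dd; rewrite B0 rem0 addr0 subr0 => h.
  have : 0 <= B s + rem s.
    rewrite h mulr_ge0//; have := hb c cs; rewrite ler_norml => /andP[]; lra.
  lra.
have dd (x : R) : is_derive x 1 (fun x => B x - rem x) (M * x ^+ K / K`!%:R - drem x) by exact: (derB (dB x) (dr x)).
have [c cs] := der_mvt s0 dd; rewrite B0 rem0 !subr0 => h.
have : 0 <= B s - rem s.
  rewrite h mulr_ge0//; have := hb c cs; rewrite ler_norml => /andP[]; lra.
lra.
Qed.

Lemma taylor_dfam (f : nat -> R -> R) K M (s : R) : dfam f ->
  (forall x, `|x| <= `|s| -> `|f K x| <= M) ->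
  `|f 0%N s - \sum_(k < K) f k 0 * s ^+ k / k`!%:R| <= M * `|s| ^+ K / K`!%:R.
Proof.
move=> df fM; have [s0|s0] := leP 0 s.
  rewrite (ger0_norm s0); apply: taylor_pos => // x /andP[x0 xs].
  by apply: fM; rewrite !ger0_norm.
pose g k (x : R) := (-1) ^+ k * f k (-1 * x + 0).
have eN (x : R) : -1 * x + 0 = - x by rewrite mulN1r addr0.
have dg : dfam g.
  move=> k x; apply: (der_eq (derZ _ (derC (df k _) (der_affine (-1) 0 x)))).
  by rewrite /g exprS; ring.
have := @taylor_pos g K M (- s) dg; rewrite oppr_ge0 (ltW s0) => /(_ isT).
have -> : g 0%N (- s) = f 0%N s by rewrite /g eN expr0 mul1r opprK.
rewrite (ltr0_norm s0).
have -> : \sum_(k < K) g k 0 * (- s) ^+ k / k`!%:R = \sum_(k < K) f k 0 * s ^+ k / k`!%:R.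
  apply: eq_bigr => k _; rewrite /g eN oppr0 [(- s) ^+ k]exprNn.
  by rewrite mulrACA -exprMn mulrN1 opprK expr1n mul1r.
apply => x /andP[x0 xs]; rewrite /g eN normrM normrX normrN1 expr1n mul1r; apply: fM.
by rewrite normrN (ger0_norm x0) (ltr0_norm s0).
Qed.

(** Leibniz's formula, taken as the derivative sequence of a product. *)
Definition leib (f g : nat -> R -> R) k (x : R) := \sum_(i < k.+1) 'C(k, i)%:R * (f i x * g (k - i)%N x).

Lemma dfam_leib (f g : nat -> R -> R) : dfam f -> dfam g -> dfam (leib f g).
Proof.
move=> df dg k x.
have -> : leib f g k = \sum_(i < k.+1) (fun x => 'C(k, i)%:R * (f i x * g (k - i)%N x)).
  by apply/funext => y; rewrite fct_sumE.
apply: der_eq.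
  by apply: is_derive_sum => i; apply: derZ; apply: derM; [exact: df|exact: dg].
rewrite /leib; under eq_bigr do rewrite mulrDr; rewrite big_split/=.
rewrite [RHS]big_ord_recl [in RHS]big_ord_recr /=.
rewrite [X in X + _ = _]big_ord_recr [X in _ + X = _]big_ord_recl /=.
have bE n : fintype.bump 0 n = n.+1 by [].
rewrite !bE !subnn !subn0 !bin0 !binn !mul1r.
have -> : \sum_(i < k) 'C(k.+1, i.+1)%:R * (f i.+1 x * g (k.+1 - i.+1)%N x) =
  \sum_(i < k) 'C(k, i)%:R * (f i.+1 x * g (k - i)%N x) +
  \sum_(i < k) 'C(k, i.+1)%:R * (f i.+1 x * g (k - i.+1).+1 x).
  rewrite -big_split /=; apply: eq_bigr => i _.
  by rewrite binS natrD mulrDl subSS -subSn// addrC.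
ring.
Qed.

Lemma leib_bound (f g : nat -> R -> R) (k : nat) (x Cf Cg B : R) : (forall i, `|f i x| <= Cf * B ^+ i) ->
  (forall i, `|g i x| <= Cg * B ^+ i) -> 0 <= B ->
  `|leib f g k x| <= Cf * Cg * (2 * B) ^+ k.
Proof.
move=> hf hg B0; rewrite (le_trans (ler_norm_sum _ _ _))//.
have -> : Cf * Cg * (2 * B) ^+ k = \sum_(i < k.+1) 'C(k, i)%:R * (Cf * B ^+ i * (Cg * B ^+ (k - i))).
  have -> : (2 * B) ^+ k = \sum_(i < k.+1) 'C(k, i)%:R * B ^+ k.
    rewrite -mulr_suml -natr_sum exprMn; congr (_ * _).
    have := expnDn 1 1 k; rewrite /= => h; rewrite -natrX h; congr (_%:R).
    by apply: eq_bigr => i _; rewrite !exp1n !muln1.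
  rewrite mulr_sumr; apply: eq_bigr => i _.
  have -> : B ^+ k = B ^+ i * B ^+ (k - i) by rewrite -exprD subnKC// -ltnS.
  ring.
apply: ler_sum => i _; rewrite !normrM ger0_norm//.
by rewrite ler_wpM2l// ler_pM.
Qed.

End real_derivatives.

(** * The flat exponential at the origin *)

Section flat_exponential.
Context {R : realType}.

(** The powers of [s^-1] are those that differentiating [exp (- 1 / s)] creates; with them the
    family is closed under differentiation, up to linear combinations. *)
Definition flat_exp m (s : R) : R := if 0 < s then s^-1 ^+ m * expR (- s^-1) else 0.

Lemma flat_exp_ge0 m s : 0 <= flat_exp m s.
Proof.
rewrite /flat_exp; case: ifP => // s0; rewrite mulr_ge0 ?expR_ge0// exprn_ge0// invr_ge0.
exact: ltW.
Qed.

Lemma flat_exp_le m s : flat_exp m s <= m%:R ^+ m.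
Proof.
rewrite /flat_exp; case: ifP => [s0|_]; last exact: exprn_ge0.
rewrite expRN ler_pdivrMr ?expR_gt0//.
by apply: powe_le; rewrite invr_ge0 ltW.
Qed.

Lemma flat_expS m s : flat_exp m s = s * flat_exp m.+1 s.
Proof.
rewrite /flat_exp; case: ifP => [s0|_]; last by rewrite mulr0.
by rewrite exprS !mulrA divff ?mul1r// gt_eqF.
Qed.

Lemma der_inv (s : R) : s != 0 -> is_derive s 1 (fun y : R => y^-1) (- s^-1 ^+ 2).
Proof.
move=> s0; have d : derivable (id : R -> R) s 1 by exact: derivable_id.
apply: DeriveDef; first exact: (@derivableV _ _ id s 1 s0 d).
rewrite (@deriveV _ _ id s 1 s0 d) derive_id /GRing.scale/= mulr1.
by rewrite exprVn.
Qed.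

Lemma der_flat_exp m (s : R) : is_derive s 1 (flat_exp m) (flat_exp m.+2 s - m%:R * flat_exp m.+1 s).
Proof.
have [s0|s0|->] := ltgtP s 0.
- have -> : flat_exp m.+2 s - m%:R * flat_exp m.+1 s = 0.
    by rewrite /flat_exp ltNge (ltW s0) mulr0 subrr.
  apply: (@near_eq_is_derive _ _ _ (fun=> 0 : R) (flat_exp m) s 1 0).
  have := lt_nbhsl s0; apply: filterS => y y0.
  by rewrite /flat_exp ltNge (ltW y0).
- have sn : s != 0 by rewrite gt_eqF.
  have nE : \near s, (fun y : R => y^-1 ^+ m * expR (- y^-1)) s = flat_exp m s.
    by have := lt_nbhsr s0; apply: filterS => y y0; rewrite /flat_exp y0.
  have dN : is_derive s 1 (fun y : R => -1 * y^-1) (-1 * - s^-1 ^+ 2) := derZ (-1) (der_inv sn).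
  have d2 : is_derive s 1 (fun y : R => expR (- y^-1)) (expR (- s^-1) * (-1 * - s^-1 ^+ 2)).
    have -> : (fun y : R => expR (- y^-1)) = (fun y => expR (-1 * y^-1)).
      by apply: boolp.funext => y; rewrite mulN1r.
    by rewrite -(mulN1r s^-1); apply: derC dN; exact: is_derive_expR.
  have d1 : is_derive s 1 (fun y : R => y^-1 ^+ m) (m%:R * s^-1 ^+ m.-1 * (- s^-1 ^+ 2)).
    exact: (derC (derXn m s^-1) (der_inv sn)).
  apply: (der_eq (near_eq_is_derive nE (derM d1 d2))).
  rewrite /flat_exp s0; case: m {d1 nE} => [|m] /=; last by rewrite !exprS; ring.
  by rewrite !exprS !expr0; ring.
- have -> : flat_exp m.+2 0 - m%:R * flat_exp m.+1 0 = 0 :> R by rewrite /flat_exp ltxx mulr0 subrr.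
  (* At 0 two factors [h] are extracted by [flat_expS] and a bounded function remains: the remainder
     is quadratic and the derivative is 0. *)
  apply: (@der_quad _ _ _ _ (m.+2%:R ^+ m.+2)) => h _.
  rewrite add0r mulr0 subr0 {2}/flat_exp ltxx subr0 ger0_norm ?flat_exp_ge0//.
  by rewrite (flat_expS m) (flat_expS m.+1) mulrA -expr2 mulrC ler_wpM2r ?sqr_ge0// flat_exp_le.
Qed.

End flat_exponential.

(** * Derivatives of the bump and decay of its Fourier transform *)

Section bump_derivatives.
Context {R : realType}.
Local Notation leb := (@lebesgue_measure R).

(* The [j]-th derivative of [bump] is [pj j] times [(1 - t^2)^-(2j)] times the
   flat exponential of [1 - t^2]. *)
Fixpoint pj (j : nat) : {poly R} :=
  if j is i.+1 then (pj i)^`() * (1 - 'X^2) ^+ 2 +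
    ((2 * (2 * i)%:R) *: ('X * pj i * (1 - 'X^2)) - 2 *: ('X * pj i))
  else ((intR (@bump_raw R))^-1)%:P.

Definition bump_der j (t : R) := (pj j).[t] * flat_exp (2 * j) (1 - t ^+ 2).

Lemma bump_der0 : bump_der 0 = @bump R.
Proof.
apply: boolp.funext => t; rewrite bumpE /bump_der /= hornerC /bump_raw /flat_exp subr_gt0 expr0 mul1r.
by [].
Qed.

Lemma bump_der_out j t : 1 <= `|t| -> bump_der j t = 0.
Proof.
move=> t1; rewrite /bump_der /flat_exp ifF ?mulr0//; apply/negbTE; rewrite -leNgt subr_le0.
by rewrite -(real_normK (num_real t)) exprn_ege1.
Qed.

Lemma der_bump_der j : forall t : R, is_derive t 1 (bump_der j) (bump_der j.+1 t).
Proof.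
move=> t; have ds : is_derive t 1 (fun t : R => 1 - t ^+ 2) (- (2 * t)).
  by apply: (der_eq (derB (der_cst 1 t) (derXn 2 t))); rewrite expr1 sub0r.
have dp : is_derive t 1 (horner (pj j)) (pj j)^`().[t] by exact: is_derive_poly.
have h := derM dp (@derC _ (flat_exp (2 * j)) (fun t => 1 - t ^+ 2) t _ _ (der_flat_exp (2 * j) (1 - t ^+ 2)) ds).
have -> : bump_der j = fun t => (pj j).[t] * flat_exp (2 * j) (1 - t ^+ 2) by [].
apply: (der_eq h).
rewrite /bump_der mulnS add2n /=.
set m := (2 * j)%N; set s := 1 - t ^+ 2.
rewrite (flat_expS m) (flat_expS m.+1) !hornerE /= -/s; ring.
Qed.

Lemma continuous_bump_der j : continuous (bump_der j).
Proof. by apply: der_continuous => x; exists (bump_der j.+1 x); exact: der_bump_der. Qed.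

Lemma nice_bump_der j : nice (bump_der j).
Proof.
have mb : measurable_fun [set: R] (bump_der j) by exact: continuous_measurable_fun (continuous_bump_der (j := j)).
have [_ [C [n hC]]] := pgrow_poly (pj j).
apply: (@nice_supp _ _ (`|C| * 2 ^+ n * (2 * j)%:R ^+ (2 * j)) 1 mb); last exact: bump_der_out.
move=> t; have [t1|t1] := leP 1 `|t|.
  by rewrite bump_der_out// normr0 !mulr_ge0// exprn_ge0.
rewrite /bump_der normrM (ger0_norm (flat_exp_ge0 _ _)); apply: ler_pM => //; [exact: flat_exp_ge0| |exact: flat_exp_le].
apply: le_trans (hC t) _.
have h : (1 + t ^+ 2) ^+ n <= 2 ^+ n.
  apply: leXn; first exact: (ltW (oneDsqr_gt0' t)).
  have : `|t| ^+ 2 <= 1 by apply: exprn_ile1 => //; exact: ltW.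
  by rewrite (real_normK (num_real t)); lra.
apply: (@le_trans _ _ (`|C| * (1 + t ^+ 2) ^+ n)).
  by rewrite ler_wpM2r ?ler_norm// exprn_ge0// (ltW (oneDsqr_gt0' t)).
by rewrite ler_wpM2l.
Qed.

Lemma intR_der0 (H dH : R -> R) : (forall t : R, is_derive t 1 H (dH t)) -> continuous dH ->
  (forall t, 1 <= `|t| -> H t = 0) -> (forall t, 1 <= `|t| -> dH t = 0) -> intR dH = 0.
Proof.
move=> dHH cdH H0 dH0.
have cH : continuous H by apply: der_continuous => x; exists (dH x).
have -> : intR dH = \int[leb]_(x in `[-1, 1]) dH x.
  rewrite Rintegral_mkcond; apply: eq_intR => x; rewrite patchE; case: ifPn => //.
  rewrite notin_setE/= in_itv/= => xn; apply: dH0; rewrite leNgt; apply/negP => x1; apply: xn.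
  by rewrite -ler_norml ltW.
rewrite /Rintegral (@continuous_FTC2 _ _ H)//.
- by rewrite !H0 ?normrN ?normr1// subee.
- by apply: continuous_subspaceT => x; exact: cdH.
- split.
  + by move=> x _; have [] := dHH x.
  + by apply: cvg_at_right_filter; exact: cH.
  + by apply: cvg_at_left_filter; exact: cH.
- by move=> x _; rewrite derive1E; have [_ ->] := dHH x.
Qed.

(* The phase [th] closes the family under both differentiation in [x] and
   integration by parts in [t]. *)
Definition bump_trig k j (th x : R) := intR (fun t => t ^+ k * (cos (x * t + th) * bump_der j t)).

Lemma pgrow_cos_aff x th : pgrow (fun t : R => cos (x * t + th)).
Proof.
apply: (@pgrow_bdd _ _ 1); last by move=> y; rewrite ler_norml cos_geN1 cos_le1.
apply: (measurableT_comp measurable_cos); exact: measurable_funD.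
Qed.

Lemma nice_bump_trig k j th x : nice (fun t => t ^+ k * (cos (x * t + th) * bump_der j t)).
Proof.
by apply: nice_powM; apply: niceM; [exact: pgrow_cos_aff|exact: nice_bump_der].
Qed.

Definition bump_der_mass j := intR (fun t => `|bump_der j t|).

Lemma bump_der_mass_ge0 j : 0 <= bump_der_mass j. Proof. by apply: intR_ge0. Qed.

Lemma bump_trig_le k j th x : `|bump_trig k j th x| <= bump_der_mass j.
Proof.
apply: intR_le_abs; [exact: nice_bump_trig|exact: nice_norm (nice_bump_der j)|move=> t].
have [t1|t1] := leP 1 `|t|; first by rewrite bump_der_out// !mulr0.
rewrite !normrM mulrA ler_piMl// mulr_ile1// ?normrX.
  by apply: exprn_ile1 => //; exact: ltW.
by rewrite ler_norml cos_geN1 cos_le1.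
Qed.

Lemma cosDpihalf' (v : R) : cos (v + pi / 2) = - sin v.
Proof. by rewrite cosD cos_pihalf sin_pihalf mulr0 sub0r mulr1. Qed.

Lemma cosBpihalf' (v : R) : cos (v - pi / 2) = sin v.
Proof. by rewrite cosB cos_pihalf sin_pihalf mulr0 add0r mulr1. Qed.

Lemma der_bump_trig k j th (x : R) : is_derive x 1 (bump_trig k j th) (bump_trig k.+1 j (th + pi / 2) x).
Proof.
pose C := intR (fun t => `|t ^+ k.+2 * bump_der j t|).
apply: (@der_quad _ _ _ _ (2 * C)) => h _.
have n1 := nice_bump_trig k j th (x + h); have n2 := nice_bump_trig k j th x.
have n3 := nice_bump_trig k.+1 j (th + pi / 2) x.
have nb := nice_norm (nice_powM k.+2 (nice_bump_der j)).
have nB := niceB n1 n2; have nZ := niceZ h n3.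
rewrite /bump_trig -(intRB n1 n2) -(intRZ h n3) -(intRB nB nZ).
rewrite (_ : 2 * C * h ^+ 2 = (2 * h ^+ 2) * C); last by ring.
rewrite /C -(intRZ _ nb); apply: intR_le_abs; [exact: niceB|exact: niceZ|].
move=> t; rewrite addrA cosDpihalf'.
rewrite (_ : _ - _ = t ^+ k * bump_der j t * (cos ((x * t + th) + h * t) - cos (x * t + th) + (h * t) * sin (x * t + th))); last first.
  by rewrite (_ : (x + h) * t + th = x * t + th + h * t) ?exprS; ring.
rewrite normrM; apply: (@le_trans _ _ (`|t ^+ k * bump_der j t| * (2 * (h * t) ^+ 2))).
  by rewrite ler_wpM2l// cos_taylor.
have -> : `|t ^+ k.+2 * bump_der j t| = `|t ^+ k * bump_der j t| * t ^+ 2.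
  rewrite (_ : t ^+ k.+2 * bump_der j t = t ^+ k * bump_der j t * t ^+ 2); last by rewrite !exprS expr0; ring.
  by rewrite normrM (ger0_norm (sqr_ge0 t)).
by rewrite le_eqVlt; apply/orP; left; apply/eqP; rewrite exprMn; ring.
Qed.

(** The function [t ^+ k * (sin (x * t + th) * bump_der j t)] vanishes outside the support, so its
    derivative has integral 0; the sine is rewritten as a cosine of phase [th - pi / 2]. *)
Lemma bump_trig_ibp k j th x :
  x * bump_trig k j th x = - (k%:R * bump_trig k.-1 j (th - pi / 2) x + bump_trig k j.+1 (th - pi / 2) x).
Proof.
pose H t := t ^+ k * (sin (x * t + th) * bump_der j t).
pose dH t := k%:R * (t ^+ k.-1 * (cos (x * t + (th - pi / 2)) * bump_der j t)) +
  (x * (t ^+ k * (cos (x * t + th) * bump_der j t)) + t ^+ k * (cos (x * t + (th - pi / 2)) * bump_der j.+1 t)).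
have dsin (t : R) : is_derive t 1 (fun t => sin (x * t + th)) (cos (x * t + th) * x).
  by apply: derC (der_affine x th t); exact: is_derive_sin.
have dHH (t : R) : is_derive t 1 H (dH t).
  apply: (der_eq (derM (derXn k t) (derM (dsin t) (der_bump_der j t)))).
  by rewrite /dH (addrA _ th) cosBpihalf'; ring.
have cX n : continuous (fun t : R => t ^+ n).
  by apply: der_continuous => t; eexists; exact: derXn.
have cc a : continuous (fun t : R => cos (x * t + a)).
  apply: der_continuous => t; eexists; apply: derC (der_affine x a t); exact: is_derive_cos.
have ct n a i : continuous (fun t : R => t ^+ n * (cos (x * t + a) * bump_der i t)).
  move=> t; apply: cvgM; first exact: cX.
  by apply: cvgM; [exact: cc|exact: continuous_bump_der].
have cdH : continuous dH.
  move=> t; apply: cvgD; first by apply: cvgM; [exact: cvg_cst|exact: ct].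
  by apply: cvgD; [apply: cvgM; [exact: cvg_cst|exact: ct]|exact: ct].
have := intR_der0 dHH cdH; rewrite /H /dH => h0.
have n1 := nice_bump_trig k.-1 j (th - pi / 2) x; have n2 := nice_bump_trig k j th x.
have n3 := nice_bump_trig k j.+1 (th - pi / 2) x.
have e : k%:R * bump_trig k.-1 j (th - pi / 2) x + (x * bump_trig k j th x + bump_trig k j.+1 (th - pi / 2) x) = 0.
  rewrite /bump_trig -!intRZ// -(intRD (niceZ x n2) n3) -intRD; [|exact: niceZ|exact: niceD (niceZ x n2) n3].
  by apply: h0 => t t1; rewrite ?bump_der_out ?mulr0 ?addr0.
lra.
Qed.

Lemma bump_trig_x k j th x : `|x * bump_trig k j th x| <= k%:R * bump_der_mass j + bump_der_mass j.+1.
Proof.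
rewrite bump_trig_ibp normrN (le_trans (ler_normD _ _))//; apply: lerD; last exact: bump_trig_le.
by rewrite normrM ger0_norm// ler_wpM2l// bump_trig_le.
Qed.

(** Two integrations by parts. The quadratic factor in [k] that they create is absorbed by [4 ^+ k],
    so the growth in [k] stays geometric. *)
Lemma bump_trig_x2 k j th x : `|x ^+ 2 * bump_trig k j th x| <= 4 ^+ k * (bump_der_mass j + 2 * bump_der_mass j.+1 + bump_der_mass j.+2).
Proof.
rewrite expr2 -mulrA bump_trig_ibp mulrN normrN mulrDr mulrCA.
have h1 : `|k%:R * (x * bump_trig k.-1 j (th - pi / 2) x)| <= k%:R * (k%:R * bump_der_mass j + bump_der_mass j.+1).
  rewrite normrM ger0_norm// ler_wpM2l// (le_trans (bump_trig_x _ _ _ _))// lerD2r.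
  by rewrite ler_wpM2r ?bump_der_mass_ge0// ler_nat leq_pred.
apply: le_trans (ler_normD _ _) _; apply: le_trans (lerD h1 (bump_trig_x _ _ _ _)) _.
have k2 : k%:R + 1 <= 2 ^+ k :> R by rewrite natr1 -natrX ler_nat ltn_expl.
have k4 : (k%:R + 1) ^+ 2 <= 4 ^+ k :> R.
  have -> : 4 ^+ k = (2 ^+ k) ^+ 2 :> R by rewrite -exprM mulnC exprM; congr (_ ^+ _); ring.
  by apply: leXn => //; rewrite addr_ge0.
apply: (@le_trans _ _ ((k%:R + 1) ^+ 2 * (bump_der_mass j + 2 * bump_der_mass j.+1 + bump_der_mass j.+2))).
  have := bump_der_mass_ge0 j; have := bump_der_mass_ge0 j.+1; have := bump_der_mass_ge0 j.+2.
  have : 0 <= k%:R :> R by [].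
  move: (k%:R : R) (bump_der_mass j) (bump_der_mass j.+1) (bump_der_mass j.+2) => a b c e a0 e0 c0 b0; nra.
by rewrite ler_wpM2r// !addr_ge0 ?mulr_ge0 ?bump_der_mass_ge0.
Qed.

Lemma bump_trig_xN N j th x : `|x| ^+ N * `|bump_trig 0 j th x| <= bump_der_mass (j + N).
Proof.
elim: N j th => [|N IH] j th; first by rewrite addn0 expr0 mul1r bump_trig_le.
rewrite exprSr -mulrA -normrM bump_trig_ibp mul0r add0r normrN.
by rewrite addnS -addSn; exact: IH.
Qed.

Lemma pow_oneD_le (y : R) N : 0 <= y -> (1 + y) ^+ N <= 2 ^+ N * (1 + y ^+ N).
Proof.
move=> y0; have yN : 0 <= y ^+ N by exact: exprn_ge0.
have p2 : 0 <= 2 ^+ N :> R by exact: exprn_ge0.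
have [y1|y1] := leP y 1.
  apply: (@le_trans _ _ (2 ^+ N)); first by apply: leXn; lra.
  by rewrite ler_peMr// lerDl.
apply: (@le_trans _ _ ((2 * y) ^+ N)); first by apply: leXn; lra.
by rewrite exprMn ler_wpM2l// lerDr.
Qed.

Lemma bump_trig_decay N j th x : `|bump_trig 0 j th x| * (1 + x ^+ 2) ^+ N <= 2 ^+ N * (bump_der_mass j + bump_der_mass (j + 2 * N)).
Proof.
apply: (@le_trans _ _ (`|bump_trig 0 j th x| * (2 ^+ N * (1 + (x ^+ 2) ^+ N)))).
  by rewrite ler_wpM2l// pow_oneD_le// sqr_ge0.
rewrite mulrCA ler_wpM2l ?exprn_ge0// mulrDr mulr1; apply: lerD; first exact: bump_trig_le.
by rewrite mulrC -(real_normK (num_real x)) -exprM bump_trig_xN.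
Qed.

Lemma nice_bump_trig0 j th : nice (bump_trig 0 j th).
Proof.
split; last by move=> N; exists (2 ^+ N * (bump_der_mass j + bump_der_mass (j + 2 * N))) => x; exact: bump_trig_decay.
apply: continuous_measurable_fun; apply: der_continuous => x; eexists; exact: der_bump_trig.
Qed.

Lemma Phi_bump_decay N : exists2 C, 0 < C & forall v : R,
  normc (Phi (@bump R) v) * (1 + v ^+ 2) ^+ N <= C.
Proof.
pose C := 2 ^+ N * (bump_der_mass 0 + bump_der_mass (0 + 2 * N)).
have C0 : 0 <= C by rewrite mulr_ge0 ?exprn_ge0// addr_ge0 ?bump_der_mass_ge0.
exists (2 * C + 1); first by rewrite ltr_wpDl// mulr_ge0.
move=> v; have p0 : 0 <= (1 + v ^+ 2) ^+ N by rewrite exprn_ge0// (ltW (oneDsqr_gt0' v)).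
apply: (@le_trans _ _ (2 * C)); last by rewrite lerDl.
rewrite PhiE -bump_der0.
have -> : intR (fun x => cos (v * x) * bump_der 0 x) = bump_trig 0 0 0 v.
  by apply: eq_intR => t; rewrite expr0 mul1r addr0.
have -> : intR (fun x => sin (v * x) * bump_der 0 x) = bump_trig 0 0 (- (pi / 2)) v.
  by apply: eq_intR => t; rewrite expr0 mul1r cosBpihalf'.
apply: le_trans (ler_wpM2r p0 (normc_Complex _ _)) _.
rewrite mulrDl mulr_natl mulr2n; apply: lerD; exact: bump_trig_decay.
Qed.

End bump_derivatives.

(** * A noise density with geometric derivative bounds *)

Section noise_density.
Context {R : realType}.

(* [psi 0] is the Fourier transform of [bump], a real function because [bump] is
   even, and [psi k] is its [k]-th derivative. *)
Definition psi k (x : R) := bump_trig k 0 (k%:R * (pi / 2)) x.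

Lemma dfam_psi : dfam psi.
Proof.
move=> k x; apply: (der_eq (der_bump_trig k 0 (k%:R * (pi / 2)) x)).
by rewrite /psi; congr bump_trig; rewrite -natr1; ring.
Qed.

(** On the support [[-1, 1]] of the bump the factor [t ^+ k] is at most 1 in modulus, hence no
    factorial growth in [k]; two integrations by parts give the decay in [x]. *)
Lemma psi_decay : exists2 C, 0 < C & forall k x, `|psi k x| <= C * (1 + x ^+ 2)^-1 * 4 ^+ k.
Proof.
pose C := 2 * bump_der_mass 0 + 2 * bump_der_mass 1 + bump_der_mass 2 + 1 : R.
have L0 := @bump_der_mass_ge0 R 0; have L1 := @bump_der_mass_ge0 R 1; have L2 := @bump_der_mass_ge0 R 2.
exists C; first by rewrite /C; lra.
move=> k x; rewrite mulrAC ler_pdivlMr ?oneDsqr_gt0'// mulrDr mulr1.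
have h1 := bump_trig_le k 0 (k%:R * (pi / 2)) x.
have h2 := bump_trig_x2 k 0 (k%:R * (pi / 2)) x; rewrite -/(psi k x) in h1 h2.
have k4 : 1 <= 4 ^+ k :> R by apply: exprn_ege1; rewrite ler1n.
rewrite (mulrC _ (x ^+ 2)) -{1}[x ^+ 2]ger0_norm ?sqr_ge0// -normrM.
apply: le_trans (lerD h1 h2) _; rewrite /C.
move: (bump_der_mass 0) (bump_der_mass 1) (bump_der_mass 2) (4 ^+ k : R) L0 L1 L2 k4 => a b c e a0 b0 c0 e0; nra.
Qed.

Lemma nice_psi0 : nice (psi 0).
Proof. exact: nice_bump_trig0. Qed.

(** From [cos v >= 1 - v^2] on the support of the bump. It ensures that the square of [psi 0] has
    positive mass and can be normalized. *)
Lemma psi0_ge (x : R) : 1 - x ^+ 2 <= psi 0 x.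
Proof.
have nb := @nice_bump_der R 0.
have i1 : intR (@bump_der R 0) = 1 by rewrite bump_der0 intR_bump.
have -> : 1 - x ^+ 2 = (1 - x ^+ 2) * intR (@bump_der R 0) by rewrite i1 mulr1.
rewrite -intRZ//; apply: intR_le; [exact: niceZ|exact: nice_bump_trig|move=> t].
have b0 : 0 <= bump_der 0 t by rewrite bump_der0 bump_ge0.
rewrite expr0 mul1r mul0r addr0; have [t1|t1] := leP 1 `|t|; first by rewrite bump_der_out// !mulr0.
rewrite ler_wpM2r//; have := cosB1_le (x * t); rewrite ler_norml exprMn => /andP[h _].
have t2 : t ^+ 2 <= 1 by rewrite -(real_normK (num_real t)); apply: exprn_ile1 => //; exact: ltW.
have := sqr_ge0 x; nra.
Qed.

Lemma noise_density : exists (q : nat -> R -> R) (C B : R), [/\ dfam q, nice (q 0%N),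
  (forall x, 0 <= q 0%N x), intR (q 0%N) = 1 &
  0 < C /\ 1 <= B /\ forall k x, `|q k x| <= C * (1 + x ^+ 2)^-1 * B ^+ k].
Proof.
have [C C0 hC] := psi_decay.
pose L := leib psi psi.
have L0E x : L 0%N x = psi 0 x * psi 0 x.
  by rewrite /L /leib big_ord_recl big_ord0 addr0 bin0 mul1r.
have nL : nice (L 0%N).
  rewrite (_ : L 0%N = fun x => psi 0 x * psi 0 x); last exact: boolp.funext.
  by apply: niceM nice_psi0; exact: nice_pgrow nice_psi0.
have L_ge0 x : 0 <= L 0%N x by rewrite L0E -expr2 sqr_ge0.
have iL : 0 < intR (L 0%N).
  have h2 : 0 <= 2^-1 :> R by rewrite invr_ge0.
  have m0 : 0 <= 4^-1 :> R by rewrite invr_ge0.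
  apply: lt_le_trans (intR_gt0_itv nL L_ge0 h2 m0 _).
    by rewrite subr0 mulr_gt0 ?invr_gt0.
  move=> x /andP[x0 x1]; rewrite L0E; have := psi0_ge x => h.
  have : 2^-1 <= psi 0 x by nra.
  by move=> h'; nra.
exists (fun k x => (intR (L 0%N))^-1 * L k x), ((intR (L 0%N))^-1 * (C * C)), (2 * 4); split.
- by move=> k x; apply: derZ; apply: dfam_leib; exact: dfam_psi.
- exact: niceZ.
- by move=> x; rewrite mulr_ge0// invr_ge0 ltW.
- by rewrite intRZ// mulVf// gt_eqF.
split; first by rewrite !mulr_gt0// invr_gt0.
split; first by rewrite -natrM ler1n.
move=> k x; rewrite normrM ger0_norm ?invr_ge0 ?(ltW iL)// -!mulrA ler_wpM2l ?invr_ge0 ?(ltW iL)//.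
have p0 := oneDsqr_gt0' x.
have := @leib_bound _ psi psi k x _ _ 4 (fun i => hC i x) (fun i => hC i x).
move=> /(_ _)/le_trans; apply => //.
have -> : C * (1 + x ^+ 2)^-1 * (C * (1 + x ^+ 2)^-1) * (2 * 4) ^+ k =
  (C * (C * ((1 + x ^+ 2)^-1 * (2 * 4) ^+ k))) * (1 + x ^+ 2)^-1 by ring.
rewrite ler_piMr// ?invf_le1// ?oneDsqr_ge1'//.
by rewrite !mulr_ge0 ?(ltW C0) ?invr_ge0 ?(ltW p0)// exprn_ge0// mulr_ge0.
Qed.

End noise_density.

(** * Distance between the observation laws *)

Section taylor_cancellation.
Context {R : realType}.
Variables (q : nat -> R -> R) (C B r a kappa T : R).
Hypotheses (dq : dfam q) (nq : nice (q 0%N)) (C0 : 0 < C) (B1 : 1 <= B)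
  (qC : forall k x, `|q k x| <= C * (1 + x ^+ 2)^-1 * B ^+ k)
  (r0 : 0 < r) (a1 : `|a| <= 1) (k01 : 0 < kappa < 1) (T0 : 0 < T).

Definition qshift c x k (s : R) := c ^+ k * q k (c * s + x).

Lemma dfam_qshift c x : dfam (qshift c x).
Proof.
move=> k s; apply: (der_eq (derZ _ (derC (dq k _) (der_affine c x s)))).
by rewrite /qshift exprSr; ring.
Qed.

(** Peetre's inequality turns decay in [c * u + x] into decay in [x] at the cost of a factor
    quadratic in [u]. With two such factors in the kernel, this accounts for the four extra
    moments. *)
Lemma qshift_le c x u k : `|c| <= r ->
  `|qshift c x k u| <= C * (2 * (1 + (r * u) ^+ 2) * (1 + x ^+ 2)^-1) * (r * B) ^+ k.
Proof.
move=> cr; rewrite /qshift normrM [(r * B) ^+ k]exprMn normrX.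
have ck : `|c| ^+ k <= r ^+ k by exact: leXn.
have px := oneDsqr_gt0' x; have pu := oneDsqr_gt0' (c * u + x).
have B0 : 0 <= B by apply: le_trans B1.
rewrite [leRHS](_ : _ = r ^+ k * (C * (2 * (1 + (r * u) ^+ 2) * (1 + x ^+ 2)^-1) * B ^+ k)); last by ring.
apply: ler_pM => //; apply: le_trans (qC _ _) _.
rewrite ler_wpM2r ?exprn_ge0// ler_wpM2l ?(ltW C0)//.
rewrite ler_pdivlMr// ler_pdivrMl//.
have h := oneDsqr_shift x (- (c * u)); rewrite opprK sqrrN (addrC x) in h.
apply: le_trans h _; rewrite -mulrA mulrCA ler_wpM2l ?(ltW pu)// ler_wpM2l// lerD2l.
rewrite !exprMn ler_wpM2r ?sqr_ge0// -(real_normK (num_real c)).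
exact: leXn.
Qed.

Lemma q_le x : `|q 0%N x| <= C.
Proof.
apply: le_trans (qC 0 x) _; rewrite expr0 mulr1 ler_piMr ?(ltW C0)//.
by rewrite invf_le1 ?oneDsqr_gt0'// oneDsqr_ge1'.
Qed.

Lemma pgrow_qshift c x : pgrow (fun s => q 0%N (c * s + x)).
Proof.
apply: (@pgrow_bdd _ _ C); last by move=> s; exact: q_le.
case: nq => mq _; apply: (measurableT_comp mq).
by apply: measurable_funD => //; exact: measurable_funM.
Qed.

(** With [r] the inverse noise scale, this is the joint density at [(x, y)] of the two noisy
    coordinates, in units of that scale, when the value [s] of [S_1] translates them by [r * s] and
    [r * a * s]. *)
Definition kernel2 x y (s : R) := q 0%N (- r * s + x) * q 0%N (- (r * a) * s + y).

Lemma pgrow_kernel2 x y : pgrow (kernel2 x y).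
Proof. by apply: pgrowM; exact: pgrow_qshift. Qed.

(* In [taylor_cancel], [(2 r B)^K / K!] comes from the derivatives of the kernel
   and [(32 T)^K K! K^(- kappa K)] from the moments, [16^K] of which pays for the
   four extra moments that restore the decay of the kernel in [x] and [y]. *)
Definition TV1 := 8 * C ^+ 2 * (1 + r ^+ 4 * (32 * T) ^+ 4).
Definition TVB := 64 * r * B * T.

(** Each of the four new factors of the factorial is at most [2 ^ (K + 4)], and the negative power
    only decreases. *)
Lemma moment_bound_add4 K : (0 < K)%N -> moment_bound kappa (K + 4) <= 16 ^+ (K + 4) * moment_bound kappa K.
Proof.
move=> K0; have K4 : 0 < (K + 4)%:R :> R by rewrite ltr0n addn4.
have k0 : 0 < kappa by case/andP: k01.
rewrite /moment_bound mulrA; apply: ler_pM => //.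
  rewrite -natrX -natrM ler_nat !addnS addn0 !factS.
  have le2 m : (m <= 2 ^ m)%N by exact: ltnW (ltn_expl _ _).
  have -> : (16 ^ K.+4 = 2 ^ K.+4 * (2 ^ K.+4 * (2 ^ K.+4 * 2 ^ K.+4)))%N by rewrite -!expnMn.
  have hle m : (m <= K.+4)%N -> (m <= 2 ^ K.+4)%N by move=> mK; exact: leq_trans mK (le2 _).
  have h1 : (K.+1 <= 2 ^ K.+4)%N by apply: hle; lia.
  have h2 : (K.+2 <= 2 ^ K.+4)%N by apply: hle; lia.
  have h3 := hle K.+3 (leqnSn _); have h4 := hle K.+4 (leqnn _).
  move: (2 ^ K.+4)%N h1 h2 h3 h4 => P h1 h2 h3 h4.
  by rewrite !mulnA !leq_mul.
have KR : 0 < K%:R :> R by rewrite ltr0n.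
rewrite !powRN lef_pV2 ?posrE ?powR_gt0//.
apply: (@le_trans _ _ ((K + 4)%:R `^ (kappa * K%:R))).
  by apply: ge0_ler_powR; rewrite ?nnegrE ?mulr_ge0 ?(ltW k0) ?ler_nat ?leq_addr//.
apply: ler_powR; first by rewrite ler1n addn4.
by rewrite ler_wpM2l ?(ltW k0)// ler_nat leq_addr.
Qed.

Lemma taylor_cancel (w z : R -> R) K : (0 < K)%N -> nice w -> nice z -> (forall x, 0 <= z x) ->
  (forall x, `|w x| <= z x) ->
  (forall p : {poly R}, (size p <= K)%N -> intR (fun x => p.[x] * w x) = 0) ->
  (forall m, (0 < m)%N -> intR (fun x => `|x| ^+ m * z x) <= (2 * T) ^+ m * moment_bound kappa m) ->
  forall x y, `|intR (fun s => kernel2 x y s * w s)| <=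
    TV1 * TVB ^+ K * K%:R `^ (- (kappa * K%:R)) * ((1 + x ^+ 2)^-1 * (1 + y ^+ 2)^-1).
Proof.
move=> K0 nw nz z0 wz wo mz x y.
pose G := leib (qshift (- r) x) (qshift (- (r * a)) y).
have dG : dfam G by apply: dfam_leib; exact: dfam_qshift.
have G0 s : G 0%N s = kernel2 x y s.
  by rewrite /G /leib big_ord_recl big_ord0 addr0 bin0 mul1r /qshift !expr0 !mul1r.
have B0 : 0 <= B by apply: le_trans B1.
have px := oneDsqr_gt0' x; have py := oneDsqr_gt0' y.
set ix := (1 + x ^+ 2)^-1; set iy := (1 + y ^+ 2)^-1.
have ix0 : 0 <= ix by rewrite invr_ge0 ltW.
have iy0 : 0 <= iy by rewrite invr_ge0 ltW.
have rB0 : 0 <= 2 * (r * B) by rewrite mulr_ge0// mulr_ge0// ltW.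
pose M (s : R) := 4 * C ^+ 2 * (1 + (r * s) ^+ 2) ^+ 2 * (2 * (r * B)) ^+ K * (ix * iy).
have GM s u : `|u| <= `|s| -> `|G K u| <= M s.
  move=> us.
  have h1 i : `|qshift (- r) x i u| <= C * (2 * (1 + (r * u) ^+ 2) * ix) * (r * B) ^+ i.
    by apply: qshift_le; rewrite normrN gtr0_norm.
  have h2 i : `|qshift (- (r * a)) y i u| <= C * (2 * (1 + (r * u) ^+ 2) * iy) * (r * B) ^+ i.
    by apply: qshift_le; rewrite normrN normrM (gtr0_norm r0) ler_piMr// ltW.
  have rB : 0 <= r * B by rewrite mulr_ge0// ltW.
  apply: le_trans (leib_bound K h1 h2 rB) _.
  rewrite [leLHS](_ : _ = 4 * C ^+ 2 * (1 + (r * u) ^+ 2) ^+ 2 * (2 * (r * B)) ^+ K * (ix * iy)); last by ring.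
  rewrite /M ler_wpM2r ?mulr_ge0// ler_wpM2r ?exprn_ge0// ler_wpM2l ?mulr_ge0 ?(ltW C0)//.
  apply: leXn; first exact: (ltW (oneDsqr_gt0' _)).
  rewrite lerD2l -(real_normK (num_real (r * u))) -(real_normK (num_real (r * s))).
  by apply: leXn => //; rewrite !normrM ler_wpM2l.
(* The Taylor polynomial of the kernel in [s] has degree below [K], so [w] annihilates it and it may
   be subtracted. *)
pose p := \poly_(k < K) (G k 0 / k`!%:R).
have pE s : p.[s] = \sum_(k < K) G k 0 * s ^+ k / k`!%:R.
  by rewrite horner_poly; apply: eq_bigr => k _; rewrite mulrAC.
have tay s : `|kernel2 x y s - p.[s]| <= M s * `|s| ^+ K / K`!%:R.
  by rewrite -G0 pE; apply: taylor_dfam => // u; exact: GM.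
have nqw : nice (fun s => kernel2 x y s * w s) by apply: niceM => //; exact: pgrow_kernel2.
have npw : nice (fun s => p.[s] * w s) by apply: niceM => //; exact: pgrow_poly.
have -> : intR (fun s => kernel2 x y s * w s) = intR (fun s => kernel2 x y s * w s - p.[s] * w s).
  by rewrite intRB// wo ?subr0// size_poly.
pose D := 4 * C ^+ 2 * (2 * (r * B)) ^+ K * (ix * iy) / K`!%:R * 2.
have D0 : 0 <= D.
  have h4 : 0 <= 4 * C ^+ 2 by rewrite mulr_ge0// exprn_ge0// ltW.
  rewrite /D; apply: mulr_ge0 => //; apply: mulr_ge0; last by rewrite invr_ge0.
  exact: mulr_ge0 (mulr_ge0 h4 (exprn_ge0 _ rB0)) (mulr_ge0 ix0 iy0).
have n1 := nice_absM K nz; have n2 := niceZ (r ^+ 4) (nice_absM (K + 4) nz).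
have bd1 : `|intR (fun s => kernel2 x y s * w s - p.[s] * w s)| <=
    D * (intR (fun s => `|s| ^+ K * z s) + r ^+ 4 * intR (fun s => `|s| ^+ (K + 4) * z s)).
  rewrite -(intRZ (r ^+ 4) (nice_absM (K + 4) nz)) -(intRD n1 n2) -(intRZ D (niceD n1 n2)).
  apply: intR_le_abs; [exact: niceB|exact: niceZ (niceD n1 n2)|move=> s].
  rewrite -mulrBl normrM; apply: le_trans (ler_pM _ _ (tay s) (wz s)) _ => //.
  rewrite /M.
  have e1 : (1 + (r * s) ^+ 2) ^+ 2 <= 2 * (1 + r ^+ 4 * `|s| ^+ 4).
    have -> : r ^+ 4 * `|s| ^+ 4 = ((r * s) ^+ 2) ^+ 2.
      by rewrite -[`|s| ^+ 4]normrX ger0_norm ?exprn_even_ge0//; ring.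
    by move: ((r * s) ^+ 2) => v; have := sqr_ge0 (v - 1); nra.
  rewrite [leRHS](_ : _ = 4 * C ^+ 2 * (2 * (1 + r ^+ 4 * `|s| ^+ 4)) * (2 * (r * B)) ^+ K * (ix * iy) * `|s| ^+ K / K`!%:R * z s); last first.
    by rewrite /D exprD; ring.
  rewrite ler_wpM2r// ler_wpM2r ?invr_ge0// ler_wpM2r ?exprn_ge0// ler_wpM2r ?mulr_ge0//.
  by rewrite ler_wpM2r ?exprn_ge0// ler_wpM2l ?mulr_ge0 ?(ltW C0).
apply: le_trans bd1 _.
have m1 := mz K K0; have m2 : intR (fun x => `|x| ^+ (K + 4) * z x) <= (2 * T) ^+ (K + 4) * (16 ^+ (K + 4) * moment_bound kappa K).
  apply: le_trans (mz _ _) _; first by rewrite addn4.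
  by rewrite ler_wpM2l ?moment_bound_add4// exprn_ge0// mulr_ge0// ltW.
have T2 : 0 <= 2 * T by rewrite mulr_ge0// ltW.
apply: (@le_trans _ _ (D * ((2 * T) ^+ K * moment_bound kappa K + r ^+ 4 * ((2 * T) ^+ (K + 4) * (16 ^+ (K + 4) * moment_bound kappa K))))).
  by rewrite ler_wpM2l// lerD// ler_wpM2l// exprn_ge0// ltW.
have -> : (2 * T) ^+ (K + 4) * (16 ^+ (K + 4) * moment_bound kappa K) = (32 * T) ^+ 4 * ((32 * T) ^+ K * moment_bound kappa K).
  rewrite mulrA -exprMn (_ : 2 * T * 16 = 32 * T); last by ring.
  by rewrite exprD; ring.
have h32 : (2 * T) ^+ K <= (32 * T) ^+ K by apply: leXn => //; rewrite ler_wpM2r ?(ltW T0)// ler_nat.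
apply: (@le_trans _ _ (D * ((32 * T) ^+ K * moment_bound kappa K + r ^+ 4 * ((32 * T) ^+ 4 * ((32 * T) ^+ K * moment_bound kappa K))))).
  by rewrite ler_wpM2l// lerD2r ler_wpM2r// moment_bound_ge0.
have f0 : K`!%:R != 0 :> R by rewrite pnatr_eq0 -lt0n fact_gt0.
rewrite le_eqVlt; apply/orP; left; apply/eqP.
rewrite /D /TV1 /TVB /moment_bound (_ : 64 * r * B * T = (2 * (r * B)) * (32 * T)); last by ring.
rewrite [(2 * (r * B) * (32 * T)) ^+ K]exprMn.
set P1 := (2 * (r * B)) ^+ K; set P2 := (32 * T) ^+ K; set P3 := K%:R `^ _.
by clearbody P1 P2 P3; move: (K`!%:R : R) f0 => kf kf0; field.
Qed.

End taylor_cancellation.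

Section swaps.
Context {R : realType}.
Local Notation RT := (measurableTypeR R).
Local Notation leb := (@lebesgue_measure R).
Local Open Scope ereal_scope.

Lemma ge0_integral_shift (d : R) (f : R -> \bar R) : measurable_fun [set: R] f -> (forall x, 0 <= f x) ->
  \int[leb]_x f (x + d)%R = \int[leb]_x f x.
Proof.
move=> mf f0; rewrite [RHS](@ge0_integral_affine R 1 d f (oner_neq0 R) mf f0) normr1 mul1e.
by apply: eq_integral => x _; rewrite mul1r.
Qed.

Variable h : RT * RT * RT -> \bar R.
Hypotheses (mh : measurable_fun setT h) (h0 : forall p, 0 <= h p).

Lemma measurable_int3 : measurable_fun [set: RT * RT] (fun p => \int[leb]_y h (p.1, p.2, y)).
Proof.
have -> : (fun p : RT * RT => \int[leb]_y h (p.1, p.2, y)) = fubini_F leb h.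
  by apply: boolp.funext => -[x y].
exact: measurable_fun_fubini_tonelli_F.
Qed.

(** Two exchanges of neighbouring integrals bring [s] to the innermost place, where the cancellation
    against [w] happens. *)
Lemma integral3_rot : \int[leb]_s \int[leb]_x \int[leb]_y h (s, x, y) =
  \int[leb]_x \int[leb]_y \int[leb]_s h (s, x, y).
Proof.
rewrite (fubini_tonelli (fun p : RT * RT => \int[leb]_y h (p.1, p.2, y)) measurable_int3)/=; last first.
  by move=> p; exact: integral_ge0.
apply: eq_integral => x _.
have m2 : measurable_fun setT (fun p : RT * RT => h (p.1, x, p.2)).
  apply: (measurableT_comp mh); apply: measurable_fun_pair => //=.
  by apply: measurable_fun_pair => //=.
by rewrite (fubini_tonelli _ m2).
Qed.

End swaps.

(** * The noise laws and their class *)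

Section noise.
Context {R : realType}.
Local Notation RT := (measurableTypeR R).
Local Notation leb := (@lebesgue_measure R).
Local Notation lam d := (@lebesgue_rV R d).
Variable q : R -> R.
Hypotheses (nq : nice q) (q0 : forall x, 0 <= q x) (q1 : intR q = 1).

Definition qpdf : pdf leb := @Pdf _ _ _ leb q (proj1 nq) q0
  (etrans (intR_ereal nq) (congr1 EFin q1)).

Definition qm : probability RT R := pdf_measure qpdf.

Lemma integral_qm (G : R -> \bar R) : measurable_fun [set: R] G -> (forall x, 0 <= G x)%E ->
  (\int[qm]_x G x = \int[leb]_x (G x * (q x)%:E))%E.
Proof.
by move=> mG G0; rewrite (@dens_push_measure _ _ _ leb qm q (proj1 nq) q0).
Qed.

Lemma Rintegral_qm_cos t : \int[qm]_x cos (t * x) = intR (fun x => cos (t * x) * q x).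
Proof.
have mc : measurable_fun [set: RT] (fun x : R => cos (t * x)) by case: (pgrow_cos t).
have mq : measurable_fun [set: RT] q by case: nq.
have push : dens_push leb qm q (fun=> 1) id.
  by move=> G mG G0; rewrite -integral_qm//; apply: eq_integral => x _; rewrite mule1.
have mp : measurable_fun [set: RT] (fun=> 1 : R) by exact: measurable_cst.
have mi : measurable_fun [set: RT] (@id R) by exact: measurable_id.
rewrite /intR (dens_push_Rintegral mq mp mi q0 (fun=> ler01) push (G := fun x => cos (t * x)) mc).
  by apply: eq_Rintegral => x _; rewrite mulr1.
apply: (@integrable_boundedM _ _ _ qm) => //; first by move=> x; rewrite ler_norml cos_geN1 cos_le1.
exact: finite_measure_integrable_cst.
Qed.

Definition m2 := intR (fun x => x ^+ 2 * q x).

Lemma m2_ge0 : 0 <= m2.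
Proof. by apply: intR_ge0 => x; rewrite mulr_ge0 ?sqr_ge0. Qed.

Lemma cos_qm_ge t : 1 - t ^+ 2 * m2 <= intR (fun x => cos (t * x) * q x).
Proof.
have n2 := nice_powM 2 nq; have nc := nice_cos t nq.
rewrite -q1 -intRZ// -intRB//; last exact: niceZ.
apply: intR_le => //; first by apply: niceB => //; exact: niceZ.
move=> x; rewrite (_ : q x - _ = (1 - (t * x) ^+ 2) * q x); last by ring.
rewrite ler_wpM2r//; have := cosB1_le (t * x); rewrite ler_norml => /andP[h _]; lra.
Qed.

Variable sg : R.

Lemma dotp_first_coord d (d0 : (0 < d)%N) (t : 'rV[R]_d) y :
  dotp t (first_coord d y) = t ord0 (Ordinal d0) * y.
Proof.
rewrite /dotp (bigD1 (Ordinal d0))//= mxE eqxx big1 ?addr0// => j jn.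
by rewrite mxE ifF ?mulr0//; apply/negbTE; move: jn; rewrite -val_eqE.
Qed.

(** The real part alone is bounded below, by [cos v >= 1 - v^2] and the second moment; a small scale
    [sg] then keeps the modulus away from 0 on the whole box. *)
Lemma char_fun_first_law d (d0 : (0 < d)%N) (nu : R) t : 0 <= nu -> box nu t ->
  1 - (nu * sg) ^+ 2 * m2 <= normc (char_fun (@first_law R d qm sg) t).
Proof.
move=> nu0 bt; apply: le_trans (le_trans (ler_norm _) (Re_le_normc _)).
rewrite /char_fun /= (@Rintegral_first_law _ d qm sg (fun x => cos (dotp t x))); last 2 first.
- by apply: (measurableT_comp measurable_cos); exact: measurable_dotp.
- by move=> x; rewrite ler_norml cos_geN1 cos_le1.
pose t0 := t ord0 (Ordinal d0).
have -> : \int[qm]_x cos (dotp t (first_coord d (sg * x))) = \int[qm]_x cos ((t0 * sg) * x).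
  by apply: eq_Rintegral => x _; rewrite dotp_first_coord mulrA.
rewrite Rintegral_qm_cos; apply: le_trans (cos_qm_ge _).
rewrite lerD2l lerN2 ler_wpM2r ?m2_ge0// !exprMn ler_wpM2r ?sqr_ge0//.
by rewrite -(real_normK (num_real t0)); apply: leXn => //; exact: bt.
Qed.

Lemma sqnorm_noise d1 d2 (d10 : (0 < d1)%N) (d20 : (0 < d2)%N) :
  (\int[noise_law (@first_law R d1 qm sg) (@first_law R d2 qm sg)]_e (sqnorm e)%:E = (2 * (sg ^+ 2 * m2))%:E)%E.
Proof.
have msq d : measurable_fun setT (fun e : 'rV[R]_d => (sqnorm e)%:E).
  apply/measurable_EFinP; apply: measurable_sum => i.
  by apply: measurable_funM; exact: measurable_rV_coord.
have sq0 d (e : 'rV[R]_d) : (0 <= (sqnorm e)%:E)%E.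
  by rewrite lee_fin sumr_ge0// => i _; rewrite -expr2 sqr_ge0.
rewrite ge0_integral_noise_law//.
have sqcat (x : 'rV[R]_d1) (y : 'rV[R]_d2) : sqnorm (row_mx x y) = sqnorm x + sqnorm y.
  rewrite /sqnorm /dotp big_split_ord /=; congr (_ + _); apply: eq_bigr => i _.
    by rewrite row_mxEl.
  by rewrite row_mxEr.
have I1 d (d0 : (0 < d)%N) : (\int[@first_law R d qm sg]_e (sqnorm e)%:E = (sg ^+ 2 * m2)%:E)%E.
  rewrite ge0_integral_first_law// integral_qm; last 2 first.
  - by apply/measurable_EFinP; under eq_fun do rewrite /sqnorm dotp_first_coord mxE /= mulrACA; apply: measurable_funM => //; apply: measurable_funM => //; apply: measurable_funM.
  - by move=> x; exact: sq0.
  rewrite /m2 -(intRZ _ (nice_powM 2 nq)) -intR_ereal; last by apply: niceZ; exact: nice_powM.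
  apply: eq_integral => x _; rewrite -EFinM /sqnorm dotp_first_coord mxE /=; congr EFin; ring.
have s0 : (0 <= (sg ^+ 2 * m2)%:E)%E by rewrite lee_fin mulr_ge0 ?sqr_ge0 ?m2_ge0.
transitivity (\int[@first_law R d1 qm sg]_x ((sqnorm x)%:E + (sg ^+ 2 * m2)%:E))%E.
  apply: eq_integral => x _; under eq_integral do rewrite sqcat EFinD.
  rewrite ge0_integralD//; last exact: msq.
  rewrite [X in (_ + X)%E](I1 d2 d20).
  by rewrite integral_cst// [X in (_ * X)%E](@probability_setT _ _ _ (@first_law R d2 qm sg)) mule1.
rewrite ge0_integralD//; last exact: msq.
by rewrite [X in (X + _)%E](I1 d1 d10) integral_cst// [X in (_ * X)%E](@probability_setT _ _ _ (@first_law R d1 qm sg)) mule1 -EFinD; congr EFin; ring.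
Qed.

End noise.

Section noise_exists.
Context {R : realType}.

Lemma noise_in_class (q : R -> R) (nq : nice q) (q0 : forall x, 0 <= q x) (q1 : intR q = 1)
  (nu cnu cQ : R) : 0 < nu -> 0 < cnu < 1 -> 0 < cQ -> exists2 sg, 0 < sg &
  forall d1 d2, (0 < d1)%N -> (0 < d2)%N ->
    noise_class nu cnu cQ (@first_law R d1 (qm nq q0 q1) sg) (@first_law R d2 (qm nq q0 q1) sg).
Proof.
move=> nu0 /andP[c0 c1] cQ0; have m0 := m2_ge0 q0; set m := m2 q in m0.
(* Chosen so that [nu^2 sg^2 m <= 1 - cnu] and [2 sg^2 m <= cQ]. The denominator [m + 1] is positive
   whatever [m] is, and the cap [sg <= 1] gives [sg ^+ 2 <= e]. *)
pose e := Num.min ((1 - cnu) / nu ^+ 2) (cQ / 2) / (m + 1).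
have mn0 : 0 < Num.min ((1 - cnu) / nu ^+ 2) (cQ / 2).
  by rewrite lt_min !divr_gt0 ?subr_gt0// exprn_gt0.
have m10 : 0 < m + 1 by rewrite ltr_wpDl.
have e0 : 0 < e by rewrite divr_gt0.
pose sg := Num.min 1 e.
have sg0 : 0 < sg by rewrite lt_min ltr01.
have sg2 : sg ^+ 2 <= e.
  rewrite expr2; apply: (@le_trans _ _ (1 * e)); last by rewrite mul1r.
  by apply: ler_pM; rewrite ?(ltW sg0)// ge_min lexx ?orbT.
have sgm : sg ^+ 2 * m <= Num.min ((1 - cnu) / nu ^+ 2) (cQ / 2).
  apply: (@le_trans _ _ (e * (m + 1))); last by rewrite divfK// gt_eqF.
  by apply: ler_pM => //; rewrite ?sqr_ge0// lerDl.
have h1 : nu ^+ 2 * (sg ^+ 2 * m) <= 1 - cnu.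
  rewrite mulrC -ler_pdivlMr ?exprn_gt0//; apply: le_trans sgm _.
  by rewrite ge_min lexx.
have h2 : sg ^+ 2 * m <= cQ / 2 by apply: le_trans sgm _; rewrite ge_min lexx orbT.
exists sg => // d1 d2 d10 d20; split.
- move=> t bt; apply: le_trans (char_fun_first_law nq q0 q1 sg d10 (ltW nu0) bt).
  by rewrite exprMn -mulrA -/m; lra.
- move=> t bt; apply: le_trans (char_fun_first_law nq q0 q1 sg d20 (ltW nu0) bt).
  by rewrite exprMn -mulrA -/m; lra.
- by rewrite sqnorm_noise// lee_fin -/m; lra.
Qed.

End noise_exists.

(** * Smoothing of the law of the first source by the noise *)

Section observation_distance.
Context {R : realType}.
Local Notation RT := (measurableTypeR R).
Local Notation leb := (@lebesgue_measure R).
Local Notation lam d := (@lebesgue_rV R d).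
Variables (d1' d2' : nat).
Local Notation d1 := d1'.+1.
Local Notation d2 := d2'.+1.
Local Notation d' := (d1' + d2)%N.
Variable q : R -> R.
Hypotheses (nq : nice q) (q0 : forall x, 0 <= q x) (q1 : intR q = 1).
Variables (sg a : R).
Hypothesis sg0 : 0 < sg.
Local Notation r := (sg^-1).
Local Notation A := (mixing_mx d1 d2 a).
Local Notation Q1 := (@first_law R d1 (qm nq q0 q1) sg).
Local Notation Q2 := (@first_law R d2 (qm nq q0 q1) sg).

Definition noise_vec (x y : R) : 'rV[R]_(d1 + d2) :=
  row_mx (first_coord d1 (sg * x)) (first_coord d2 (sg * y)).

Lemma noise_vecD x y x' y' : noise_vec (x + x') (y + y') = noise_vec x y + noise_vec x' y'.
Proof.
rewrite /noise_vec add_row_mx; congr row_mx; apply/rowP => j; rewrite !mxE;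
  by case: ifP => _; rewrite ?addr0// mulrDr.
Qed.

Lemma measurable_noise_vec dT (T : measurableType dT) (f g : T -> R) :
  measurable_fun setT f -> measurable_fun setT g ->
  measurable_fun setT (fun t => noise_vec (f t) (g t)).
Proof.
move=> mf mg; apply: measurable_row_mx.
  by apply: (measurableT_comp (@measurable_first_coord R d1)); exact: measurable_funM.
by apply: (measurableT_comp (@measurable_first_coord R d2)); exact: measurable_funM.
Qed.

(** The first source enters the observation exactly in the two coordinates that carry noise, which
    is why a translation of the noise can absorb it. *)
Lemma mixing_rV_cons s (t : 'rV[R]_d') :
  (rV_cons (s, t) : 'rV[R]_(d1 + d2)) *m A^T =
  noise_vec (r * s) (r * a * s) + (rV_cons (0, t) : 'rV[R]_(d1 + d2)) *m A^T.
Proof.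
have sgn : sg != 0 by rewrite gt_eqF.
have o0 : (ord0 : 'I_(d1 + d2)) = lshift d2 (ord0 : 'I_d1) by exact: val_inj.
apply/rowP => j; rewrite [LHS]mxE [RHS]mxE [X in _ = _ + X]mxE.
rewrite ![in LHS](big_ord_recl d') [X in _ = _ + X](big_ord_recl d').
rewrite !rV_cons_ord0 mul0r add0r; congr (_ + _); last first.
  by apply: eq_bigr => k _; rewrite !rV_cons_lift.
rewrite mxE; have -> : (ord0 : 'I_(d'.+1)) = lshift d2 (ord0 : 'I_d1) by exact: val_inj.
case: (split_ordP j) => i ->; rewrite /mixing_mx /noise_vec.
  rewrite block_mxEul row_mxEl !mxE -val_eqE /=; case: (i == 0%N :> nat) => /=; last by rewrite mulr0.
  by rewrite mulr1 mulrA divff// mul1r.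
rewrite block_mxEdl row_mxEr !mxE; case: (i == 0%N :> nat); last by rewrite mulr0.
by field.
Qed.

Variable g : 'rV[R]_(d1 + d2) -> R.
Hypotheses (mg : measurable_fun setT g) (g01 : forall v, 0 <= g v <= 1).

Let g0 v : 0 <= g v. Proof. by case/andP: (g01 v). Qed.

(** The expectation of [g] over the noise when the mixture takes the value [v]. *)
Definition smooth_g (v : 'rV[R]_(d1 + d2)) : \bar R :=
  (\int[leb]_x \int[leb]_y (q x * (q y * g (v + noise_vec x y)%R))%:E)%E.

Let mq : measurable_fun [set: RT] q. Proof. by case: nq. Qed.

Lemma smooth_g_ge0 v : (0 <= smooth_g v)%E.
Proof. by apply: integral_ge0 => x _; apply: integral_ge0 => y _; rewrite lee_fin !mulr_ge0. Qed.

Lemma measurable_smooth_g : measurable_fun setT smooth_g.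
Proof.
pose h3 (p : 'rV[R]_(d1 + d2) * RT * RT) := (q p.1.2 * (q p.2 * g (p.1.1 + noise_vec p.1.2 p.2)))%:E.
have m3 : measurable_fun setT h3.
  apply/measurable_EFinP; apply: measurable_funM.
    by apply: (measurableT_comp mq); exact: (measurableT_comp measurable_snd measurable_fst).
  apply: measurable_funM; first exact: (measurableT_comp mq measurable_snd).
  apply: (measurableT_comp mg); apply: measurable_addmx.
    exact: (measurableT_comp measurable_fst measurable_fst).
  by apply: measurable_noise_vec => //; exact: (measurableT_comp measurable_snd measurable_fst).
have h30 p : (0 <= h3 p)%E by rewrite lee_fin !mulr_ge0.
have m2 := @measurable_fun_fubini_tonelli_F _ _ _ _ R leb h3 m3 h30.
have h20 p : (0 <= fubini_F leb h3 p)%E by exact: integral_ge0.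
exact: (@measurable_fun_fubini_tonelli_F _ _ _ _ R leb _ m2 h20).
Qed.

Lemma obs_smooth (P : probability 'rV[R]_(d1 + d2) R) :
  (\int[obs_law P Q1 Q2]_x (g x)%:E = \int[P]_v smooth_g v)%E.
Proof.
have mgE : measurable_fun setT (fun x => (g x)%:E) by exact/measurable_EFinP.
rewrite ge0_integral_obs_law//; apply: eq_integral => v _.
have mv (f : R -> R) (y : 'rV[R]_d1) : measurable_fun [set: RT] f ->
    measurable_fun [set: RT] (fun x => (g (v + row_mx y (first_coord d2 (f x))))%:E).
  move=> mf; apply/measurable_EFinP; apply: (measurableT_comp mg).
  apply: measurable_addmx => //; apply: measurable_row_mx => //.
  exact: (measurableT_comp (@measurable_first_coord R d2)).
have inner (x : 'rV[R]_d1) : (\int[Q2]_y (g (v + row_mx x y)%R)%:E =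
    \int[leb]_y (q y * g (v + row_mx x (first_coord d2 (sg * y)))%R)%:E)%E.
  rewrite ge0_integral_first_law; last 2 first.
  - apply/measurable_EFinP; apply: (measurableT_comp mg).
    by apply: measurable_addmx => //; exact: measurable_row_mx.
  - by move=> y; rewrite lee_fin.
  rewrite integral_qm; last 2 first.
  - by apply: mv; exact: measurable_funM.
  - by move=> y; rewrite lee_fin.
  by apply: eq_integral => y _; rewrite -EFinM mulrC.
under eq_integral do rewrite inner.
have mh2 : measurable_fun setT (fun x : 'rV[R]_d1 =>
    (\int[leb]_y (q y * g (v + row_mx x (first_coord d2 (sg * y)))%R)%:E))%E.
  pose h2 (p : 'rV[R]_d1 * RT) := (q p.2 * g (v + row_mx p.1 (first_coord d2 (sg * p.2))))%:E.
  apply: (@measurable_fun_fubini_tonelli_F _ _ _ _ R leb h2); last first.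
    by move=> p; rewrite lee_fin mulr_ge0.
  apply/measurable_EFinP; apply: measurable_funM; first exact: (measurableT_comp mq measurable_snd).
  apply: (measurableT_comp mg); apply: measurable_addmx => //; apply: measurable_row_mx => //.
  by apply: (measurableT_comp (@measurable_first_coord R d2)); exact: measurable_funM.
have h20 (x : 'rV[R]_d1) : (0 <= \int[leb]_y (q y * g (v + row_mx x (first_coord d2 (sg * y)))%R)%:E)%E.
  by apply: integral_ge0 => y _; rewrite lee_fin mulr_ge0.
rewrite ge0_integral_first_law// integral_qm; last 2 first.
- apply: (measurableT_comp mh2); apply: (measurableT_comp (@measurable_first_coord R d1)).
  exact: measurable_funM.
- by move=> x; exact: h20.
apply: eq_integral => x _; rewrite muleC -leb_integralZl//.
- apply/measurable_EFinP; apply: measurable_funM => //.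
  by apply/measurable_EFinP; apply: mv; exact: measurable_funM.
- by move=> y; rewrite lee_fin mulr_ge0.
Qed.

Local Notation qr := (kernel2 (fun=> q) r a).

Lemma kernel2_fun x y s : qr x y s = q (- r * s + x) * q (- (r * a) * s + y).
Proof. by []. Qed.

Lemma kernel2_ge0 x y s : 0 <= qr x y s. Proof. by rewrite mulr_ge0. Qed.

Lemma nice_kernel2 z x y : nice z -> nice (fun s => qr x y s * z s).
Proof.
have [_ /rdec_bounded[C C0 hC]] := nq.
move=> nz; apply: niceM => //.
suff h c e : pgrow (fun s => q (c * s + e)) by apply: pgrowM.
apply: (@pgrow_bdd _ _ C) => //; apply: (measurableT_comp mq).
by apply: measurable_funD => //; exact: measurable_funM.
Qed.

Definition smoothed z x y := intR (fun s => qr x y s * z s).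

Lemma smoothed_ge0 z x y : (forall s, 0 <= z s) -> 0 <= smoothed z x y.
Proof. by move=> z0; apply: intR_ge0 => s; rewrite mulr_ge0// kernel2_ge0. Qed.

Section inner_integral.
Variables (z : R -> R) (v : 'rV[R]_(d1 + d2)).
Hypotheses (nz : nice z) (z0 : forall s, 0 <= z s).

Let mz : measurable_fun [set: RT] z. Proof. by case: nz. Qed.

Let h3 (p : RT * RT * RT) := (qr p.1.2 p.2 p.1.1 * z p.1.1 * g (v + noise_vec p.1.2 p.2))%:E.

Let mh3 : measurable_fun setT h3.
Proof.
have m11 : measurable_fun setT (fun p : RT * RT * RT => p.1.1).
  exact: (measurableT_comp measurable_fst measurable_fst).
have m12 : measurable_fun setT (fun p : RT * RT * RT => p.1.2).
  exact: (measurableT_comp measurable_snd measurable_fst).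
have m2 : measurable_fun setT (fun p : RT * RT * RT => p.2) by exact: measurable_snd.
apply/measurable_EFinP; apply: measurable_funM.
  apply: measurable_funM; last exact: (measurableT_comp mz).
  apply: measurable_funM; apply: (measurableT_comp mq); apply: measurable_funD => //.
  - exact: (measurable_funM (measurable_cst _)).
  - exact: (measurable_funM (measurable_cst _)).
apply: (measurableT_comp mg); apply: measurable_addmx => //.
exact: measurable_noise_vec.
Qed.

Let h30 p : (0 <= h3 p)%E.
Proof. by rewrite lee_fin !mulr_ge0. Qed.

Let msec x : measurable_fun [set: RT] (fun y => g (v + noise_vec x y)).
Proof. by apply: (measurableT_comp mg); apply: measurable_addmx => //; exact: measurable_noise_vec. Qed.

(** Translating the two noise variables moves the dependence on [s] from the arbitrary test
    function, which has no regularity, to the smooth kernel. *)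
Lemma smooth_shift s : (smooth_g (noise_vec (r * s) (r * a * s) + v) * (z s)%:E =
  \int[leb]_x \int[leb]_y h3 (s, x, y))%E.
Proof.
pose G2 x y := (q (y - r * a * s) * g (v + noise_vec x y))%:E.
have mG2 x : measurable_fun [set: RT] (G2 x).
  apply/measurable_EFinP; apply: measurable_funM => //.
  by apply: (measurableT_comp mq); exact: measurable_funB.
pose G1 x := (\int[leb]_y (q (x - r * s) * (q (y - r * a * s) * g (v + noise_vec x y)))%:E)%E.
have mG1 : measurable_fun [set: RT] G1.
  pose h2 (p : RT * RT) := (q (p.1 - r * s) * (q (p.2 - r * a * s) * g (v + noise_vec p.1 p.2)))%:E.
  apply: (@measurable_fun_fubini_tonelli_F _ _ _ _ R leb h2); last first.
    by move=> p; rewrite lee_fin !mulr_ge0.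
  apply/measurable_EFinP; apply: measurable_funM.
    by apply: (measurableT_comp mq); exact: measurable_funB.
  apply: measurable_funM; first by apply: (measurableT_comp mq); exact: measurable_funB.
  by apply: (measurableT_comp mg); apply: measurable_addmx => //; exact: measurable_noise_vec.
have G10 x : (0 <= G1 x)%E by apply: integral_ge0 => y _; rewrite lee_fin !mulr_ge0.
have -> : smooth_g (noise_vec (r * s) (r * a * s) + v) = (\int[leb]_x G1 x)%E.
  rewrite -(ge0_integral_shift (r * s) mG1 G10); apply: eq_integral => x _.
  have mG : measurable_fun [set: RT] (fun y => (q x * (q (y - r * a * s) * g (v + noise_vec (x + r * s) y)))%:E).
    apply/measurable_EFinP; apply: measurable_funM => //; apply/measurable_EFinP; exact: mG2.
  rewrite /G1 addrK -(ge0_integral_shift (r * a * s) mG); last by move=> y; rewrite lee_fin !mulr_ge0.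
  apply: eq_integral => y _; rewrite addrK noise_vecD.
  by rewrite (addrC (noise_vec _ _) v) -addrA (addrC (noise_vec (r * s) _)).
rewrite muleC -leb_integralZl//; apply: eq_integral => x _.
rewrite -leb_integralZl//; last 2 first.
- by apply/measurable_EFinP; apply: measurable_funM => //; apply/measurable_EFinP; exact: mG2.
- by move=> y; rewrite lee_fin !mulr_ge0.
apply: eq_integral => y _; rewrite -EFinM /h3 /= kernel2_fun.
by rewrite !mulNr (addrC _ x) (addrC _ y); congr EFin; ring.
Qed.

Lemma inner_swap : (\int[leb]_s (smooth_g (noise_vec (r * s) (r * a * s) + v) * (z s)%:E) =
  \int[leb]_x \int[leb]_y (smoothed z x y * g (v + noise_vec x y)%R)%:E)%E.
Proof.
under eq_integral do rewrite smooth_shift.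
rewrite (integral3_rot mh3 h30).
apply: eq_integral => x _; apply: eq_integral => y _.
transitivity (\int[leb]_s ((g (v + noise_vec x y))%:E * (qr x y s * z s)%:E))%E.
  by apply: eq_integral => s _; rewrite -EFinM mulrC.
have nn := nice_kernel2 x y nz.
rewrite leb_integralZl//; last 2 first.
- by apply/measurable_EFinP; case: nn.
- by move=> s; rewrite lee_fin mulr_ge0// kernel2_ge0.
by rewrite (intR_ereal nn) -EFinM mulrC.
Qed.

Lemma measurable_smoothed : measurable_fun [set: RT * RT] (fun p => smoothed z p.1 p.2).
Proof.
pose k3 (p : RT * RT * RT) := (qr p.1.1 p.1.2 p.2 * z p.2)%:E.
have m3 : measurable_fun setT k3.
  have m11 : measurable_fun setT (fun p : RT * RT * RT => p.1.1).
    exact: (measurableT_comp measurable_fst measurable_fst).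
  have m12 : measurable_fun setT (fun p : RT * RT * RT => p.1.2).
    exact: (measurableT_comp measurable_snd measurable_fst).
  have m2 : measurable_fun setT (fun p : RT * RT * RT => p.2) by exact: measurable_snd.
  apply/measurable_EFinP; apply: measurable_funM; last exact: (measurableT_comp mz).
  apply: measurable_funM; apply: (measurableT_comp mq); apply: measurable_funD => //.
  - exact: (measurable_funM (measurable_cst _)).
  - exact: (measurable_funM (measurable_cst _)).
have k30 p : (0 <= k3 p)%E by rewrite lee_fin !mulr_ge0.
apply/measurable_EFinP.
have := @measurable_fun_fubini_tonelli_F _ _ _ _ R leb k3 m3 k30.
congr (measurable_fun _ _); apply: boolp.funext => p /=.
by rewrite /fubini_F /smoothed -(intR_ereal (nice_kernel2 p.1 p.2 nz)); case: p.
Qed.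

End inner_integral.

Definition oneDsqrV_mass : R := fine (\int[leb]_x ((1 + x ^+ 2)^-1)%:E)%E.

Lemma oneDsqrV_massE : (\int[leb]_x ((1 + x ^+ 2)^-1)%:E = oneDsqrV_mass%:E)%E.
Proof.
rewrite /oneDsqrV_mass fineK// ge0_fin_numE; first exact: integral_inv_oneDsqr_lty.
by apply: integral_ge0 => x _; rewrite lee_fin invr_ge0 (ltW (oneDsqr_gt0' x)).
Qed.

Lemma oneDsqrV_mass_ge0 : 0 <= oneDsqrV_mass.
Proof.
by apply: fine_ge0; apply: integral_ge0 => x _; rewrite lee_fin invr_ge0 (ltW (oneDsqr_gt0' x)).
Qed.

Variables (z0 z1 : R -> R) (de : R).
Hypotheses (nz0 : nice z0) (nz1 : nice z1) (z00 : forall s, 0 <= z0 s) (z10 : forall s, 0 <= z1 s).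
Hypotheses (de0 : 0 <= de) (zd : forall x y, smoothed z0 x y <= smoothed z1 x y + de * ((1 + x ^+ 2)^-1 * (1 + y ^+ 2)^-1)).

(** As [g] is at most 1, the pointwise bound [zd] integrates to [de] times the squared mass of
    [1 / (1 + x^2)], uniformly in [v]; this is what the decay in [x] and [y] was kept for. *)
Lemma inner_le v :
  (\int[leb]_s (smooth_g (noise_vec (r * s) (r * a * s) + v) * (z0 s)%:E) <=
   \int[leb]_s (smooth_g (noise_vec (r * s) (r * a * s) + v) * (z1 s)%:E) + (de * oneDsqrV_mass ^+ 2)%:E)%E.
Proof.
rewrite !inner_swap//.
have mmg z : nice z -> (forall s, 0 <= z s) -> measurable_fun [set: RT * RT] (fun p => (smoothed z p.1 p.2 * g (v + noise_vec p.1 p.2))%:E).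
  move=> nz zz; apply/measurable_EFinP; apply: measurable_funM; first exact: measurable_smoothed.
  by apply: (measurableT_comp mg); apply: measurable_addmx => //; exact: measurable_noise_vec.
have mg0 z p : (forall s, 0 <= z s) -> (0 <= (smoothed z p.1 p.2 * g (v + noise_vec p.1 p.2))%:E)%E.
  by move=> zz; rewrite lee_fin mulr_ge0// smoothed_ge0.
have mi : measurable_fun [set: RT] (fun x : R => (1 + x ^+ 2)^-1) by exact: measurable_oneDsqrV.
have i0 (x : R) : 0 <= (1 + x ^+ 2)^-1 by rewrite invr_ge0 (ltW (oneDsqr_gt0' x)).
have msec z x : nice z -> (forall s, 0 <= z s) -> measurable_fun [set: RT] (fun y => (smoothed z x y * g (v + noise_vec x y))%:E).
  by move=> nz zz; exact: (measurableT_comp (mmg z nz zz) (measurable_pair1 x)).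
have mout z : nice z -> (forall s, 0 <= z s) ->
    measurable_fun [set: RT] (fun x => \int[leb]_y (smoothed z x y * g (v + noise_vec x y)%R)%:E)%E.
  move=> nz zz; exact: (@measurable_fun_fubini_tonelli_F _ _ _ _ R leb _ (mmg z nz zz) (fun p => mg0 z p zz)).
have -> : (de * oneDsqrV_mass ^+ 2)%:E = (\int[leb]_x \int[leb]_y (de * ((1 + x ^+ 2)^-1 * (1 + y ^+ 2)^-1))%:E)%E.
  transitivity (\int[leb]_x ((de * oneDsqrV_mass)%:E * ((1 + x ^+ 2)^-1)%:E))%E.
    rewrite leb_integralZl; [|exact/measurable_EFinP|by move=> x; rewrite lee_fin|by rewrite mulr_ge0// oneDsqrV_mass_ge0].
    by rewrite oneDsqrV_massE -EFinM; congr EFin; ring.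
  apply: eq_integral => x _; transitivity (\int[leb]_y ((de * (1 + x ^+ 2)^-1)%:E * ((1 + y ^+ 2)^-1)%:E))%E.
    rewrite leb_integralZl; [|exact/measurable_EFinP|by move=> y; rewrite lee_fin|by rewrite mulr_ge0].
    by rewrite oneDsqrV_massE -!EFinM; congr EFin; ring.
  by apply: eq_integral => y _; rewrite -EFinM; congr EFin; ring.
have md x : measurable_fun [set: RT] (fun y : R => (de * ((1 + x ^+ 2)^-1 * (1 + y ^+ 2)^-1))%:E).
  by apply/measurable_EFinP; apply: measurable_funM => //; exact: measurable_funM.
have d0 x y : (0 <= (de * ((1 + x ^+ 2)^-1 * (1 + y ^+ 2)^-1))%:E)%E by rewrite lee_fin !mulr_ge0.
have mD : measurable_fun [set: RT] (fun x : R => \int[leb]_y (de * ((1 + x ^+ 2)^-1 * (1 + y ^+ 2)^-1))%:E)%E.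
  pose h2 (p : RT * RT) := (de * ((1 + p.1 ^+ 2)^-1 * (1 + p.2 ^+ 2)^-1))%:E.
  apply: (@measurable_fun_fubini_tonelli_F _ _ _ _ R leb h2); last by move=> p; exact: d0.
  apply/measurable_EFinP; apply: measurable_funM => //.
  by apply: measurable_funM; [exact: (measurableT_comp mi measurable_fst)|exact: (measurableT_comp mi measurable_snd)].
have pos1 z x : (forall s, 0 <= z s) -> (0 <= \int[leb]_y (smoothed z x y * g (v + noise_vec x y)%R)%:E)%E.
  by move=> zz; apply: integral_ge0 => y _; exact: (mg0 z (x, y)).
have posd x : (0 <= \int[leb]_y (de * ((1 + x ^+ 2)^-1 * (1 + y ^+ 2)^-1))%:E)%E.
  by apply: integral_ge0 => y _; exact: d0.
rewrite -ge0_integralD; [|exact: measurableT|by move=> x _; exact: pos1|exact: mout|by move=> x _; exact: posd|exact: mD].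
apply: ge0_le_integral; [exact: measurableT|by move=> x _; exact: pos1|exact: mout|by apply: emeasurable_funD; [exact: mout|exact: mD]|].
move=> x _; rewrite -ge0_integralD; [|exact: measurableT|by move=> y _; exact: (mg0 z1 (x, y))|exact: msec|by move=> y _; exact: d0|exact: md].
apply: ge0_le_integral; [exact: measurableT|by move=> y _; exact: (mg0 z0 (x, y))|exact: msec|by apply: emeasurable_funD; [exact: msec|exact: md]|].
move=> y _; rewrite -EFinD lee_fin.
have /andP[gg0 gg1] := g01 (v + noise_vec x y).
apply: le_trans (ler_wpM2r gg0 (zd x y)) _; rewrite mulrDl lerD2l ler_piMr//.
by rewrite !mulr_ge0.
Qed.

Section laws.
Variables (zt : R -> R) (k : R).
Hypotheses (nzt : nice zt) (zt0 : forall s, 0 <= zt s) (izt : intR zt = 1).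
Hypotheses (k0 : 0 < k) (uA : A \in unitmx)
  (kA : forall f : 'rV[R]_(d1 + d2) -> \bar R, measurable_fun setT f -> (forall x, 0 <= f x)%E ->
    (\int[lam _]_x f (x *m A^T)%R = k%:E * \int[lam _]_x f x)%E).

Definition first_factor (z : R -> R) (j : 'I_(d1 + d2)) : R -> R := if j == 0%N :> nat then z else zt.

Let tailf (t : 'rV[R]_d') := prodf (fun=> zt) t.

Let tail1 : (\int[lam d']_t (tailf t)%:E = 1)%E.
Proof.
rewrite ge0_integral_prodf//; last by move=> j; case: nzt.
rewrite big1// => j _; by rewrite (intR_ereal nzt) izt.
Qed.

Let mtail : measurable_fun setT tailf.
Proof. by apply: measurable_prodf => j; case: nzt. Qed.

Let tail0 t : 0 <= tailf t. Proof. exact: prodf_ge0. Qed.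

Let shiftv (t : 'rV[R]_d') := (rV_cons (0, t) : 'rV[R]_(d1 + d2)) *m A^T.

(** Conditions on the sources other than the first. Their law is the same under both hypotheses, and
    they act on the test function by a translation. *)
Lemma obs_peel (P : probability 'rV[R]_(d1 + d2) R) z : nice z -> (forall s, 0 <= z s) ->
  has_density P (mixf A^T k (first_factor z)) ->
  (\int[obs_law P Q1 Q2]_x (g x)%:E = \int[lam d']_t ((tailf t)%:E *
     \int[leb]_s (smooth_g (noise_vec (r * s) (r * a * s) + shiftv t) * (z s)%:E)))%E.
Proof.
move=> nz zz [mf f0 PE].
have mff j : measurable_fun setT (first_factor z j).
  by rewrite /first_factor; case: ifP => _; [case: nz|case: nzt].
have ff0 j x : 0 <= first_factor z j x by rewrite /first_factor; case: ifP.
have uAT : A^T \in unitmx by rewrite unitmx_tr.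
have mS := measurable_smooth_g; have S0 := smooth_g_ge0.
rewrite obs_smooth -(@dens_push_measure _ _ _ (lam (d1 + d2)) P _ mf f0 PE _ mS S0).
rewrite (mixf_push k0 uAT kA mff ff0 mS S0).
pose G (s : 'rV[R]_(d'.+1)) := (smooth_g ((s : 'rV[R]_(d1 + d2)) *m A^T) * (prodf (first_factor z) (s : 'rV[R]_(d1 + d2)))%:E)%E.
have mG : measurable_fun setT G.
  apply: emeasurable_funM.
    by apply: (measurableT_comp mS); exact: measurable_mulmx.
  by apply/measurable_EFinP; exact: measurable_prodf.
have G0 s : (0 <= G s)%E by rewrite mule_ge0// lee_fin prodf_ge0.
rewrite (ge0_integral_rV_cons mG G0).
rewrite (fubini_tonelli (fun p : RT * 'rV[R]_d' => G (rV_cons p)))//; last first.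
  by apply: (measurableT_comp mG); exact: measurable_rV_cons'.
apply: eq_integral => t _.
have mst : measurable_fun [set: RT] (fun s => smooth_g (noise_vec (r * s) (r * a * s) + shiftv t)).
  apply: (measurableT_comp mS); apply: measurable_addmx => //.
  by apply: measurable_noise_vec; exact: measurable_funM.
rewrite -leb_integralZl//; last 2 first.
- by apply: emeasurable_funM => //; apply/measurable_EFinP; case: nz.
- by move=> s; rewrite mule_ge0// lee_fin.
apply: eq_integral => s _; rewrite /G mixing_rV_cons prodf_cons muleC.
rewrite (_ : first_factor z ord0 = z)//.
rewrite (_ : prodf _ t = tailf t).
  by rewrite mulrC EFinM -muleA; congr (_ * _)%E; rewrite muleC.
by rewrite /prodf.
Qed.

(** The bound of [inner_le] does not depend on the other sources, over whose probability density it
    is averaged. *)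
Lemma obs_diff (P0 P1 : probability 'rV[R]_(d1 + d2) R) :
  has_density P0 (mixf A^T k (first_factor z0)) ->
  has_density P1 (mixf A^T k (first_factor z1)) ->
  (\int[obs_law P0 Q1 Q2]_x (g x)%:E <= \int[obs_law P1 Q1 Q2]_x (g x)%:E + (de * oneDsqrV_mass ^+ 2)%:E)%E.
Proof.
move=> h0 h1; rewrite (obs_peel nz0 z00 h0) (obs_peel nz1 z10 h1).
pose I z t := (\int[leb]_s (smooth_g (noise_vec (r * s) (r * a * s) + shiftv t) * (z s)%:E))%E.
have I0 z t : (forall s, 0 <= z s) -> (0 <= I z t)%E.
  by move=> zz; apply: integral_ge0 => s _; rewrite mule_ge0// ?lee_fin// smooth_g_ge0.
have mI z : nice z -> (forall s, 0 <= z s) -> measurable_fun setT (I z).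
  move=> nz zz.
  pose h2 (p : 'rV[R]_d' * RT) := (smooth_g (noise_vec (r * p.2) (r * a * p.2) + shiftv p.1) * (z p.2)%:E)%E.
  apply: (@measurable_fun_fubini_tonelli_F _ _ _ _ R leb h2); last first.
    by move=> p; rewrite mule_ge0// ?lee_fin// smooth_g_ge0.
  apply: emeasurable_funM; last first.
    by apply/measurable_EFinP; apply: measurableT_comp => //; case: nz.
  apply: (measurableT_comp measurable_smooth_g); apply: measurable_addmx.
    by apply: measurable_noise_vec; exact: (measurable_funM (measurable_cst _)).
  apply: (measurableT_comp (measurable_mulmx A^T)).
  have := measurableT_comp (@measurable_rV_cons_r R d' 0) (@measurable_fst _ _ 'rV[R]_d' RT).
  exact.
have mt : measurable_fun setT (fun t => (tailf t)%:E) by exact/measurable_EFinP.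
have t0 t : (0 <= (tailf t)%:E)%E by rewrite lee_fin.
have dJ0 : (0 <= (de * oneDsqrV_mass ^+ 2)%:E)%E by rewrite lee_fin mulr_ge0// exprn_ge0// oneDsqrV_mass_ge0.
have -> : (de * oneDsqrV_mass ^+ 2)%:E = (\int[lam d']_t ((de * oneDsqrV_mass ^+ 2)%:E * (tailf t)%:E))%E.
  by rewrite ge0_integralZl// tail1 mule1.
rewrite -ge0_integralD; [|exact: measurableT| | | |].
- apply: ge0_le_integral; [exact: measurableT| | | |].
  + by move=> t _; rewrite mule_ge0// I0.
  + by apply: emeasurable_funM => //; exact: mI.
  + apply: emeasurable_funD; first by apply: emeasurable_funM => //; exact: mI.
    exact: measurable_funeM.
  + move=> t _; rewrite [X in (_ + X)%E]muleC -ge0_muleDr// ?I0//.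
    by apply: lee_wpmul2l => //; exact: inner_le.
- by move=> t _; rewrite mule_ge0// I0.
- by apply: emeasurable_funM => //; exact: mI.
- by move=> t _; rewrite mule_ge0.
- exact: measurable_funeM.
Qed.

End laws.

End observation_distance.

(** * Sobolev energies *)

Section bessel.
Context {R : realType}.
Local Notation leb := (@lebesgue_measure R).
Local Notation C := (Cplx R).
Implicit Types g k : R -> R.

Definition Cf g u := intR (fun x => cos (u * x) * g x).
Definition Sf g u := intR (fun x => sin (u * x) * g x).

Lemma normc_Phi2 g u : normc (Phi g u) ^+ 2 = Cf g u ^+ 2 + Sf g u ^+ 2.
Proof. by rewrite PhiE /normc sqr_sqrtr// addr_ge0 ?sqr_ge0. Qed.

Lemma nice_idM g : nice g -> nice (fun x => x * g x).
Proof. by move=> ng; apply: niceM => //; exact: pgrow_id. Qed.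

Lemma der_Cf g (u : R) : nice g -> is_derive u 1 (Cf g) (- Sf (fun x => x * g x) u).
Proof.
move=> ng; have nx := nice_idM ng.
have nB := nice_norm (nice_powM 2 ng).
apply: (@der_quad _ _ _ _ (2 * intR (fun x => `|x ^+ 2 * g x|))) => h _.
have n1 := nice_cos (u + h) ng; have n2 := nice_cos u ng; have n3 := nice_sin u nx.
rewrite mulrN opprK /Cf /Sf -(intRB n1 n2) -(intRZ h n3) -(intRD (niceB n1 n2) (niceZ h n3)).
rewrite (_ : 2 * _ * h ^+ 2 = (2 * h ^+ 2) * intR (fun x => `|x ^+ 2 * g x|)); last by ring.
rewrite -(intRZ _ nB); apply: intR_le_abs; [exact: niceD (niceB n1 n2) (niceZ h n3)|exact: niceZ|move=> x].
rewrite (_ : _ + _ = g x * (cos (u * x + h * x) - cos (u * x) + (h * x) * sin (u * x))); last first.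
  by rewrite mulrDl; ring.
rewrite normrM; apply: le_trans (ler_wpM2l (normr_ge0 _) (cos_taylor _ _)) _.
rewrite normrM (ger0_norm (sqr_ge0 x)) le_eqVlt; apply/orP; left; apply/eqP; ring.
Qed.

Lemma der_Sf g (u : R) : nice g -> is_derive u 1 (Sf g) (Cf (fun x => x * g x) u).
Proof.
move=> ng; have nx := nice_idM ng.
have nB := nice_norm (nice_powM 2 ng).
apply: (@der_quad _ _ _ _ (2 * intR (fun x => `|x ^+ 2 * g x|))) => h _.
have n1 := nice_sin (u + h) ng; have n2 := nice_sin u ng; have n3 := nice_cos u nx.
rewrite /Cf /Sf -(intRB n1 n2) -(intRZ h n3) -(intRB (niceB n1 n2) (niceZ h n3)).
rewrite (_ : 2 * _ * h ^+ 2 = (2 * h ^+ 2) * intR (fun x => `|x ^+ 2 * g x|)); last by ring.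
rewrite -(intRZ _ nB); apply: intR_le_abs; [exact: niceB (niceB n1 n2) (niceZ h n3)|exact: niceZ|move=> x].
rewrite (_ : _ - _ = g x * (sin (u * x + h * x) - sin (u * x) - (h * x) * cos (u * x))); last first.
  by rewrite mulrDl; ring.
rewrite normrM; apply: le_trans (ler_wpM2l (normr_ge0 _) (sin_taylor _ _)) _.
rewrite normrM (ger0_norm (sqr_ge0 x)) le_eqVlt; apply/orP; left; apply/eqP; ring.
Qed.

Lemma measurable_Cf g : nice g -> measurable_fun [set: R] (Cf g).
Proof.
move=> ng; apply: continuous_measurable_fun; apply: der_continuous => u.
by eexists; exact: der_Cf.
Qed.

Lemma measurable_Sf g : nice g -> measurable_fun [set: R] (Sf g).
Proof.
move=> ng; apply: continuous_measurable_fun; apply: der_continuous => u.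
by eexists; exact: der_Sf.
Qed.

Lemma Cf_le g u : nice g -> `|Cf g u| <= intR (fun x => `|g x|).
Proof.
move=> ng; apply: intR_le_abs; [exact: nice_cos|exact: nice_norm|move=> x].
by rewrite normrM ler_piMl// ler_norml cos_geN1 cos_le1.
Qed.

Lemma Sf_le g u : nice g -> `|Sf g u| <= intR (fun x => `|g x|).
Proof.
move=> ng; apply: intR_le_abs; [exact: nice_sin|exact: nice_norm|move=> x].
by rewrite normrM ler_piMl// ler_norml sin_geN1 sin_le1.
Qed.

Lemma measurable_normcPhi g : nice g -> measurable_fun [set: R] (fun u => normc (Phi g u) ^+ 2).
Proof.
move=> ng; under eq_fun do rewrite normc_Phi2; apply: measurable_funD.
  by apply: measurable_funX; exact: measurable_Cf.
by apply: measurable_funX; exact: measurable_Sf.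
Qed.

Lemma pgrow_normcPhi g : nice g -> pgrow (fun u => normc (Phi g u) ^+ 2).
Proof.
move=> ng; apply: (@pgrow_bdd _ _ (2 * intR (fun x => `|g x|) ^+ 2)); first exact: measurable_normcPhi.
move=> u; rewrite normc_Phi2 ger0_norm ?addr_ge0 ?sqr_ge0//.
rewrite -(real_normK (num_real (Cf g u))) -(real_normK (num_real (Sf g u))) mulr2n mulrDl mul1r.
by apply: lerD; apply: leXn => //; [exact: Cf_le|exact: Sf_le].
Qed.

Lemma nice_decay1 f : nice f -> exists2 D, 0 <= D & forall x : R, `|f x| <= D * (1 + x ^+ 2)^-1.
Proof.
move=> [_ rf]; have [D D0 hD] := rdec_mulC 1 rf; exists D => // x.
by rewrite ler_pdivlMr ?oneDsqr_gt0'// mulrC; exact: hD.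
Qed.

Lemma dom2_prod k g (c : R -> R -> R) M : nice k -> nice g -> (forall u x, `|c u x| <= M) ->
  dom2 (fun u x => c u x * (k u * g x)).
Proof.
move=> nk ng cM; have [D D0 hD] := nice_decay1 nk; have [E E0 hE] := nice_decay1 ng.
have M0 : 0 <= M by exact: le_trans (cM 0 0).
exists (M * (D * E)) => u x; rewrite !normrM.
rewrite [leRHS](_ : _ = M * ((D * (1 + u ^+ 2)^-1) * (E * (1 + x ^+ 2)^-1))); last by ring.
by apply: ler_pM => //; apply: ler_pM.
Qed.

Lemma meas2_prod k g (c : R -> R -> R) : nice k -> nice g -> meas2 c ->
  meas2 (fun u x => c u x * (k u * g x)).
Proof.
move=> [mk _] [mg _] mc; apply: measurable_funM => //.
by apply: measurable_funM; [exact: (measurableT_comp mk)|exact: (measurableT_comp mg)].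
Qed.

Lemma meas2_cosM (f : R -> R) : measurable_fun [set: R] f -> meas2 (fun u x => f u * cos (u * x)).
Proof.
move=> mf; apply: measurable_funM; first exact: (measurableT_comp mf).
by apply: (measurableT_comp measurable_cos); exact: measurable_funM.
Qed.

Lemma meas2_sinM (f : R -> R) : measurable_fun [set: R] f -> meas2 (fun u x => f u * sin (u * x)).
Proof.
move=> mf; apply: measurable_funM; first exact: (measurableT_comp mf).
by apply: (measurableT_comp measurable_sin); exact: measurable_funM.
Qed.

Lemma cs_cos g u x : nice g ->
  Cf g u * cos (u * x) + Sf g u * sin (u * x) = intR (fun y => cos (u * (x - y)) * g y).
Proof.
move=> ng; have n1 := nice_cos u ng; have n2 := nice_sin u ng.
rewrite mulrC [X in _ + X]mulrC /Cf /Sf -(intRZ _ n1) -(intRZ _ n2) -(intRD (niceZ _ n1) (niceZ _ n2)).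
by apply: eq_intR => y; rewrite mulrBr cosB; ring.
Qed.

(** The squared modulus is the double integral of [cos (u * (x - y)) * (g x * g y)]; integrating
    over [u] first leaves the cosine transform of the weight [k] as a convolution kernel. *)
Lemma weighted_energy k g : nice k -> nice g -> nice (Cf k) ->
  intR (fun u => k u * normc (Phi g u) ^+ 2) = intR (fun x => g x * conv (Cf k) g x).
Proof.
move=> nk ng nK; set G1 := intR (fun x => `|g x|).
have G0 : 0 <= G1 by apply: intR_ge0.
pose c u x := Cf g u * cos (u * x) + Sf g u * sin (u * x).
have cle u x : `|c u x| <= 2 * G1.
  rewrite (le_trans (ler_normD _ _))// mulr2n mulrDl mul1r; apply: lerD; rewrite normrM.
    by apply: le_trans (Cf_le u ng); rewrite ler_piMr// ler_norml cos_geN1 cos_le1.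
  by apply: le_trans (Sf_le u ng); rewrite ler_piMr// ler_norml sin_geN1 sin_le1.
have mc : meas2 c.
  by apply: measurable_funD; [exact: meas2_cosM (measurable_Cf ng)|exact: meas2_sinM (measurable_Sf ng)].
transitivity (intR (fun u => intR (fun x => c u x * (k u * g x)))).
  apply: eq_intR => u; have n1 := nice_cos u ng; have n2 := nice_sin u ng.
  have -> : k u * normc (Phi g u) ^+ 2 = k u * Cf g u * Cf g u + k u * Sf g u * Sf g u.
    by rewrite normc_Phi2; ring.
  rewrite {2}/Cf {2}/Sf -(intRZ _ n1) -(intRZ _ n2) -(intRD (niceZ _ n1) (niceZ _ n2)).
  by apply: eq_intR => x; rewrite /c; ring.
rewrite intR_exch; [|exact: meas2_prod|exact: dom2_prod cle].
apply: eq_intR => x.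
have mcos : meas2 (fun u y => 1 * cos (u * (x - y))).
  apply: measurable_funM; first exact: measurable_cst.
  apply: (measurableT_comp measurable_cos); apply: measurable_funM => //.
  by apply: measurable_funB.
have bcos u y : `|1 * cos (u * (x - y))| <= 1 by rewrite mul1r ler_norml cos_geN1 cos_le1.
transitivity (intR (fun u => g x * intR (fun y => 1 * cos (u * (x - y)) * (k u * g y)))).
  apply: eq_intR => u.
  have n1 : nice (fun y => cos (u * (x - y)) * g y).
    apply: niceM => //; apply: (@pgrow_bdd _ _ 1); last by move=> y; rewrite ler_norml cos_geN1 cos_le1.
    by apply: (measurableT_comp measurable_cos); apply: measurable_funM => //; exact: measurable_funB.
  have -> : intR (fun y => 1 * cos (u * (x - y)) * (k u * g y)) = k u * intR (fun y => cos (u * (x - y)) * g y).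
    by rewrite -(intRZ (k u) n1); apply: eq_intR => y; ring.
  by rewrite -cs_cos// -/(c u x); ring.
have mm := meas2_prod nk ng mcos; have dd := dom2_prod nk ng bcos.
rewrite intRZ; last first.
  split; first exact: measurable_intR2 mm dd.
  have ns u : nice (fun y => 1 * cos (u * (x - y)) * (k u * g y)).
    rewrite (_ : (fun y => _) = fun y => (k u * cos (u * (x - y))) * g y); last first.
      by apply: boolp.funext => y; ring.
    apply: niceM => //; apply: pgrowM; first exact: pgrow_cst.
    apply: (@pgrow_bdd _ _ 1); last by move=> y; rewrite ler_norml cos_geN1 cos_le1.
    by apply: (measurableT_comp measurable_cos); apply: measurable_funM => //; exact: measurable_funB.
  apply: (@rdec_dom _ k _ G1); first by case: nk.
  move=> u; rewrite mulrC -[`|k u|]ger0_norm// /G1 -(intRZ _ (nice_norm ng)).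
  apply: intR_le_abs => //; first by apply: niceZ; exact: nice_norm.
  by move=> y; rewrite normr_id !normrM mulrCA; apply: ler_wpM2l => //; rewrite ler_piMl// -normrM.
rewrite (intR_exch mm dd) /conv -/(intR _); congr (_ * _); apply: eq_intR => y.
rewrite /Cf mulrC -(intRZ (g y) (nice_cos (x - y) nk)); apply: eq_intR => u.
by rewrite (mulrC (x - y)); ring.
Qed.

(* Schur test with AM-GM. Applied to the transform of a bump it gives Bessel's
   inequality, and Plancherel's theorem is not needed. *)
Lemma schur (K g : R -> R) : nice K -> nice g ->
  intR (fun x => g x * conv K g x) <= intR (fun x => `|K x|) * intR (fun x => g x ^+ 2).
Proof.
move=> nK ng; set LK := intR (fun x => `|K x|).
have nAK := nice_norm nK; have ng2 : nice (fun x => g x ^+ 2).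
  by under eq_fun do rewrite expr2; apply: niceM => //; exact: nice_pgrow.
have nc := nice_conv nK ng; have nc2 := nice_conv nAK ng2.
have ngc : nice (fun x => g x * conv K g x) by apply: niceM => //; exact: nice_pgrow.
apply: (@le_trans _ _ (intR (fun x => 2^-1 * (LK * g x ^+ 2 + conv (fun x => `|K x|) (fun x => g x ^+ 2) x)))).
  apply: intR_le => //; first by apply: niceZ; apply: niceD => //; exact: niceZ.
  move=> x; rewrite /conv -!/(intR _).
  have nr := nice_refl x nAK.
  have LE : LK = intR (fun y => `|K (x - y)|).
    have := intR_affine x (_ : -1 != 0 :> R) nAK; rewrite oppr_eq0 oner_eq0 => /(_ isT).
    rewrite normrN1 mul1r => e; rewrite /LK e; apply: eq_intR => y.
    by rewrite mulN1r addrC.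
  have n1 := nice_conv_sec x nK ng; have n2 := nice_conv_sec x nAK ng2.
  rewrite LE [X in 2^-1 * (X + _)]mulrC -(intRZ _ nr) -(intRD (niceZ _ nr) n2) -(intRZ _ (niceD (niceZ _ nr) n2)) -(intRZ _ n1).
  apply: intR_le; [exact: niceZ|exact: niceZ (niceD (niceZ _ nr) n2)|move=> y].
  rewrite (le_trans (ler_norm _))// !normrM.
  rewrite -(real_normK (num_real (g x))) -(real_normK (num_real (g y))).
  rewrite [leRHS](_ : _ = `|K (x - y)| * (2^-1 * (`|g x| ^+ 2 + `|g y| ^+ 2))); last by ring.
  rewrite mulrCA ler_wpM2l//; have := sqr_ge0 (`|g x| - `|g y|); nra.
rewrite intRZ; last by apply: niceD => //; exact: niceZ.
rewrite (intRD (niceZ LK ng2) nc2) intRZ// (intR_conv1 nAK ng2) -/LK.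
by rewrite le_eqVlt; apply/orP; left; apply/eqP; field.
Qed.

Lemma Cf_bump : Cf (@bump R) = bump_trig 0 0 0.
Proof. by apply: boolp.funext => u; apply: eq_intR => t; rewrite expr0 mul1r addr0 bump_der0. Qed.

Definition bumpL : R := intR (fun x => `|bump_trig 0 0 0 x|).

(** Rescaling the weight to width [L] multiplies both the normalization of [bump_b] and the mass of
    its transform by [L^-1], so the constant does not depend on [L]. *)
Lemma bessel_bump g L : nice g -> 0 < L ->
  intR (fun u => bump (u / L) * normc (Phi g u) ^+ 2) <= bumpL * intR (fun x => g x ^+ 2).
Proof.
move=> ng L0; have b0 : 0 < L^-1 by rewrite invr_gt0.
have nk := nice_bump_b b0.
have KE u : Cf (bump_b L^-1) u = bump_trig 0 0 0 (L * u + 0).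
  have := Phi_bump_b u b0; rewrite !PhiE invrK => -[h _].
  by rewrite addr0 (mulrC L) -Cf_bump; exact: h.
have Ln : L != 0 by rewrite gt_eqF.
have nT := @nice_bump_trig0 R 0 0.
have nK : nice (Cf (bump_b L^-1)) by rewrite (boolp.funext KE); exact: nice_affine.
have := schur nK ng; rewrite -(weighted_energy nk ng nK).
have -> : intR (fun x => `|Cf (bump_b L^-1) x|) = L^-1 * bumpL.
  rewrite /bumpL (intR_affine 0 Ln (nice_norm nT)) (gtr0_norm L0) mulrA mulVf// mul1r.
  by apply: eq_intR => x; rewrite KE.
have nn : nice (fun u => bump (u / L) * normc (Phi g u) ^+ 2).
  rewrite (_ : (fun u => _) = fun u => normc (Phi g u) ^+ 2 * bump (L^-1 * u + 0)); last first.
    by apply: boolp.funext => u; rewrite addr0 [RHS]mulrC (mulrC L^-1).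
  apply: niceM; first exact: pgrow_normcPhi.
  by apply: nice_affine nice_bump; rewrite gt_eqF.
have -> : intR (fun u => bump_b L^-1 u * normc (Phi g u) ^+ 2) =
    L^-1 * intR (fun u => bump (u / L) * normc (Phi g u) ^+ 2).
  by rewrite -intRZ//; apply: eq_intR => u; rewrite /bump_b mulrA (mulrC L^-1 u).
by rewrite -mulrA ler_pM2l.
Qed.

Definition bump_lo : R := (intR (@bump_raw R))^-1 * expR (-2).

Lemma bump_lo_gt0 : 0 < bump_lo.
Proof. by rewrite mulr_gt0 ?expR_gt0// invr_gt0 intR_bump_raw_gt0. Qed.

Lemma bump_ge_lo (x : R) : `|x| <= 2^-1 -> bump_lo <= bump x.
Proof.
move=> x1; rewrite bumpE ler_wpM2l ?invr_ge0 ?(ltW intR_bump_raw_gt0)//.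
have x2 : x ^+ 2 <= 4^-1.
  have -> : 4^-1 = (2^-1) ^+ 2 :> R by field.
  by rewrite -(real_normK (num_real x)); exact: leXn.
rewrite /bump_raw ifT; last lra.
rewrite ler_expR lerN2 -[leRHS]invrK lef_pV2 ?posrE ?invr_gt0 ?subr_gt0//; lra.
Qed.

Lemma mono_integral_le (f : R -> \bar R) M : measurable_fun [set: R] f -> (forall x, 0 <= f x)%E ->
  (forall n : nat, \int[leb]_(x in `[(- (n%:R : R))%R, (n%:R : R)]) f x <= M)%E -> (\int[leb]_x f x <= M)%E.
Proof.
move=> mf f0 H.
pose D n : set (measurableTypeR R) := `[(- (n%:R : R)), (n%:R : R)]%classic.
have DT : \bigcup_n D n = setT.
  rewrite -subTset => x _; exists (Num.trunc `|x|).+1; first by [].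
  by rewrite /D/= in_itv/= -ler_norml ltW// truncnS_gt.
have nd : nondecreasing_seq D.
  move=> m n mn; apply/subsetPset => x; rewrite /D/= !in_itv/= -!ler_norml => /le_trans; apply.
  by rewrite ler_nat.
have := @ge0_nondecreasing_set_cvg_integral _ (measurableTypeR R) R D f leb nd (fun i => measurable_itv _) (fun i => measurable_funTS mf) (fun i x _ => f0 x).
rewrite DT => cv.
rewrite -(cvg_lim _ cv)//; apply: lime_le; first by apply: cvgP cv.
by apply: nearW.
Qed.

Definition besselC : R := bumpL / bump_lo.

(** A bump of width [2 * n.+1%:R] is at least [bump_lo] on [[- n, n]]; the bound there is uniform in
    [n] and passes to the whole line by monotone convergence. *)
Lemma bessel g : nice g ->
  (\int[leb]_u (normc (Phi g u) ^+ 2)%:E <= (besselC * intR (fun x => g x ^+ 2))%:E)%E.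
Proof.
move=> ng; have mP := measurable_normcPhi ng.
have mPE : measurable_fun [set: R] (fun u => (normc (Phi g u) ^+ 2)%:E) by exact/measurable_EFinP.
apply: mono_integral_le => //; first by move=> x; rewrite lee_fin sqr_ge0.
move=> n; rewrite integral_mkcond.
pose L : R := 2 * n.+1%:R; have L0 : 0 < L by rewrite mulr_gt0.
have nn : nice (fun u => bump_lo^-1 * (bump (u / L) * normc (Phi g u) ^+ 2)).
  apply: niceZ; rewrite (_ : (fun u => _) = fun u => normc (Phi g u) ^+ 2 * bump (L^-1 * u + 0)); last first.
    by apply: boolp.funext => u; rewrite addr0 [RHS]mulrC (mulrC L^-1).
  apply: niceM; first exact: pgrow_normcPhi.
  by apply: nice_affine nice_bump; rewrite invr_eq0 gt_eqF.
apply: (@le_trans _ _ (\int[leb]_u (bump_lo^-1 * (bump (u / L) * normc (Phi g u) ^+ 2))%:E)%E).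
  apply: ge0_le_integral => //.
  - by move=> u _; rewrite patchE; case: ifP => _; rewrite lee_fin ?sqr_ge0.
  - by apply/(measurable_restrictT _ _).1 => //; exact: measurable_funTS.
  - by apply/measurable_EFinP; case: nn.
  move=> u _; rewrite patchE; case: ifPn => [|_]; rewrite lee_fin; last first.
    apply: mulr_ge0; first by rewrite invr_ge0 ltW// bump_lo_gt0.
    by apply: mulr_ge0; [exact: bump_ge0|exact: sqr_ge0].
  rewrite inE/= in_itv/= -ler_norml => un.
  rewrite mulrA ler_peMl ?sqr_ge0// ler_pdivlMl ?bump_lo_gt0// mulr1; apply: bump_ge_lo.
  rewrite normrM normfV (gtr0_norm L0) ler_pdivrMr// /L mulrA mulVf// mul1r.
  by apply: le_trans un _; rewrite ler_nat.
have nn' : nice (fun u => bump (u / L) * normc (Phi g u) ^+ 2).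
  rewrite (_ : (fun u => _) = fun u => bump_lo * (bump_lo^-1 * (bump (u / L) * normc (Phi g u) ^+ 2))); first exact: niceZ.
  by apply: boolp.funext => u; rewrite mulVKf// gt_eqF// bump_lo_gt0.
rewrite (intR_ereal nn) lee_fin intRZ// /besselC (mulrC bumpL) -mulrA ler_wpM2l ?invr_ge0 ?(ltW bump_lo_gt0)//.
exact: bessel_bump.
Qed.

End bessel.

(** * Weighted energies on the line *)

Section sobolev_line.
Context {R : realType}.
Local Notation leb := (@lebesgue_measure R).
Implicit Types z : R -> R.

Definition sobolev_weight beta z (u : R) : R := normc (Phi z u) ^+ 2 * (1 + u ^+ 2) `^ beta.

Lemma sobolev_weight_ge0 beta z u : 0 <= sobolev_weight beta z u.
Proof. by rewrite mulr_ge0 ?sqr_ge0// powR_ge0. Qed.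

Lemma measurable_sobolev_weight beta z : nice z -> measurable_fun [set: R] (sobolev_weight beta z).
Proof.
move=> nz; apply: measurable_funM; first exact: measurable_normcPhi.
by apply: (measurableT_comp (measurable_powR beta)); apply: measurable_funD.
Qed.

(** The second moment keeps the cosine transform above 1/2 on [[0, de]]. The bound allows
    [energy_perturb] to divide by the energies of the factors other than the first. *)
Lemma energy_lower z m : nice z -> (forall x, 0 <= z x) -> intR z = 1 -> intR (fun x => x ^+ 2 * z x) <= m ->
  (((8 * (m + 1))^-1)%:E <= \int[leb]_u (normc (Phi z u) ^+ 2)%:E)%E.
Proof.
move=> nz z0 z1 zm; have m0 : 0 <= m by apply: le_trans zm; exact: (m2_ge0 z0).
pose de := (2 * (m + 1))^-1; have de0 : 0 < de by rewrite invr_gt0 mulr_gt0// ltr_wpDl.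
apply: (@le_trans _ _ (\int[leb]_u (4^-1 * \1_`[0, de]%classic u)%:E)%E).
  have ni := niceZ 4^-1 (@nice_indic R 0 de).
  rewrite (intR_ereal ni) lee_fin intRZ; last exact: nice_indic.
  rewrite intR_indic ?(ltW de0)// subr0 /de -invfM mulrA -natrM.
  by rewrite lexx.
apply: ge0_le_integral => //.
- by apply/measurable_EFinP; apply: measurable_funM => //; exact: measurable_indic.
- by apply/measurable_EFinP; exact: measurable_normcPhi.
move=> u _; rewrite lee_fin indicE; case: (boolP (u \in _)) => uI; last by rewrite mulr0 sqr_ge0.
rewrite mulr1; move: uI; rewrite inE/= in_itv/= => /andP[u0 ud].
have um : u ^+ 2 * m2 z <= 2^-1.
  have dm : de * (m + 1) = 2^-1 by rewrite /de; field; rewrite gt_eqF// ltr_wpDl.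
  have d1 : de <= 1 by rewrite invf_le1 ?mulr_gt0 ?ltr_wpDl//; lra.
  apply: (@le_trans _ _ (de ^+ 2 * m)).
    by apply: ler_pM; rewrite ?sqr_ge0 ?(m2_ge0 z0)//; exact: leXn.
  by rewrite expr2 -mulrA; have := mulr_ge0 (ltW de0) m0; nra.
have h := cos_qm_ge nz z0 z1 u.
have h2 : 2^-1 <= Cf z u by rewrite /Cf; lra.
rewrite normc_Phi2; have := sqr_ge0 (Sf z u); nra.
Qed.

Lemma bump_weight beta : 0 <= beta -> exists2 D : R, 0 < D &
  forall v, normc (Phi (@bump R) v) ^+ 2 * (1 + v ^+ 2) `^ beta <= D.
Proof.
move=> b0; pose N := (Num.trunc beta).+1.
have [C1 C10 h1] := @Phi_bump_decay R 0; have [C2 C20 h2] := @Phi_bump_decay R N.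
exists (C1 * C2); first exact: mulr_gt0.
move=> v; have v1 := oneDsqr_ge1' v.
rewrite expr2 -mulrA; apply: ler_pM; rewrite ?normc_ge0 ?mulr_ge0 ?normc_ge0 ?powR_ge0//.
  by have := h1 v; rewrite expr0 mulr1.
apply: le_trans (h2 v); rewrite ler_wpM2l ?normc_ge0//.
rewrite -[leRHS]powR_mulrn ?(le_trans _ v1)//; apply: ler_powR => //.
by rewrite ltW// truncnS_gt.
Qed.

End sobolev_line.

Section sobolev_zeta_diff.
Context {R : realType}.
Local Notation leb := (@lebesgue_measure R).
Variables (kappa x0 : R) (P : nat -> {poly R}) (F : R -> R) (c' tau : R).
Hypotheses (k01 : 0 < kappa < 1) (x00 : 0 < x0) (c0 : 0 < c') (tau0 : 0 <= tau).
Hypotheses (orthoP : orthonormal_polys kappa x0 P) (envF : envelope kappa x0 P F).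
Hypothesis domF : forall x, F x <= c' * weight x0 tau x.

Local Notation env_pdf := (env_pdf kappa x0 F).
Local Notation weighted_poly := (weighted_poly kappa x0 P).
Local Notation env_cst := (env_cst kappa x0 P F).

Lemma weighted_poly_le K x : (1 <= K)%N -> `|weighted_poly K x| <= env_cst * K%:R `^ (- ((1 - kappa) / 2)) * env_pdf x.
Proof.
move=> K1; rewrite weighted_polyE normrM (gtr0_norm (hk_gt0 k01 x00 x)) /env_pdf [leRHS]mulrA.
apply: ler_wpM2r; first exact: ltW (hk_gt0 k01 x00 x).
exact: (Ph_le envF).
Qed.

Lemma weighted_poly_norm2 K : (1 <= K)%N ->
  intR (fun x => weighted_poly K x ^+ 2) <= env_cst ^+ 2 * K%:R `^ (- (1 - kappa)) * intR (fun x => env_pdf x ^+ 2).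
Proof.
move=> K1; have nf := nice_env_pdf k01 x00 c0 tau0 envF domF.
have ng := nice_weighted_poly P k01 x00 K.
have sq f : nice f -> nice (fun x : R => f x ^+ 2).
  by move=> n; under eq_fun do rewrite expr2; apply: niceM => //; exact: nice_pgrow.
rewrite -(intRZ _ (sq _ nf)); apply: intR_le; [exact: sq|exact: niceZ (sq _ nf)|move=> x].
have K0 : 0 < K%:R :> R by rewrite ltr0n.
have -> : K%:R `^ (- (1 - kappa)) = (K%:R `^ (- ((1 - kappa) / 2))) ^+ 2 :> R.
  by rewrite -powR_mulrn ?powR_ge0// -powRrM; congr (_ `^ _); field.
rewrite -!exprMn -(real_normK (num_real (weighted_poly K x))); apply: leXn => //.
exact: weighted_poly_le.
Qed.

(** The Sobolev weight is spent on the transform of the bump, whose scale [b] turns it into a factor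
    [b^(2 beta)]. Bessel's inequality bounds the energy of the weighted polynomial by its squared
    norm, of order [K^(- (1 - kappa))] thanks to the envelope. *)
Lemma sobolev_zeta_diff beta : 0 <= beta -> exists2 Cw : R, 0 < Cw &
  forall b K al, 1 <= b -> (1 <= K)%N -> 0 <= al ->
  (\int[leb]_u (sobolev_weight beta (zeta_diff kappa x0 P b K al) u)%:E <=
    (Cw * (al ^+ 2 * b `^ (2 * beta) * K%:R `^ (- (1 - kappa))))%:E)%E.
Proof.
move=> be0; have [D D0 hD] := bump_weight be0.
pose I2 := intR (fun x => env_pdf x ^+ 2).
have I20 : 0 <= I2 by apply: intR_ge0 => x; rewrite sqr_ge0.
have B0 : 0 <= @besselC R.
  by rewrite mulr_ge0 ?invr_ge0 ?(ltW bump_lo_gt0)//; exact: intR_ge0.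
exists (D * (besselC * (env_cst ^+ 2 * I2)) + 1).
  have h := mulr_ge0 (ltW D0) (mulr_ge0 B0 (mulr_ge0 (sqr_ge0 env_cst) I20)).
  by rewrite (ltr_wpDl h).
move=> b K al b1 K1 al0; have b0 : 0 < b by exact: lt_le_trans b1.
have ng := nice_weighted_poly P k01 x00 K.
have nw := nice_zeta_diff P k01 x00 K al b0.
have mPE : measurable_fun [set: R] (fun u => (normc (Phi (weighted_poly K) u) ^+ 2)%:E).
  by apply/measurable_EFinP; exact: measurable_normcPhi.
pose k := al ^+ 2 * b `^ (2 * beta) * D.
have k0 : 0 <= k by rewrite !mulr_ge0 ?powR_ge0 ?(ltW D0).
apply: (@le_trans _ _ (\int[leb]_u (k%:E * (normc (Phi (weighted_poly K) u) ^+ 2)%:E))%E).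
  apply: ge0_le_integral => //.
  - by move=> u _; rewrite lee_fin sobolev_weight_ge0.
  - by apply/measurable_EFinP; exact: measurable_sobolev_weight.
  - exact: measurable_funeM.
  move=> u _; rewrite -EFinM lee_fin /sobolev_weight (Phi_zeta_diff P k01 x00 K al b0).
  rewrite !normcM normcR (ger0_norm al0).
  set p := normc (Phi (weighted_poly K) u); set v := u / b.
  have wv : (1 + u ^+ 2) `^ beta <= b `^ (2 * beta) * (1 + v ^+ 2) `^ beta.
    have -> : b `^ (2 * beta) = (b ^+ 2) `^ beta by rewrite -powR_mulrn ?(ltW b0)// -powRrM.
    rewrite -powRM ?sqr_ge0// ?(ltW (oneDsqr_gt0' v))//; apply: ge0_ler_powR => //.
    + by rewrite nnegrE (ltW (oneDsqr_gt0' u)).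
    + by rewrite nnegrE mulr_ge0 ?sqr_ge0// (ltW (oneDsqr_gt0' v)).
    rewrite mulrDr mulr1 -exprMn /v mulrC divfK ?gt_eqF// lerD2r.
    by rewrite exprn_ege1.
  apply: (@le_trans _ _ ((al * p * normc (Phi bump v)) ^+ 2 * (b `^ (2 * beta) * (1 + v ^+ 2) `^ beta))).
    by rewrite ler_wpM2l ?sqr_ge0.
  have := hD v; set w := normc (Phi bump v); set y := _ `^ beta => hv.
  rewrite [leLHS](_ : _ = (al ^+ 2 * b `^ (2 * beta) * p ^+ 2) * (w ^+ 2 * y)); last by ring.
  rewrite [leRHS](_ : _ = (al ^+ 2 * b `^ (2 * beta) * p ^+ 2) * D); last by rewrite /k; ring.
  apply: ler_wpM2l => //; apply: mulr_ge0; last exact: sqr_ge0.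
  by apply: mulr_ge0; [exact: sqr_ge0|exact: powR_ge0].
rewrite leb_integralZl; [|exact: mPE|by move=> u; rewrite lee_fin sqr_ge0|exact: k0].
apply: le_trans (lee_wpmul2l _ (bessel ng)) _; first by rewrite lee_fin.
rewrite -EFinM lee_fin.
apply: (@le_trans _ _ (k * (besselC * (env_cst ^+ 2 * K%:R `^ (- (1 - kappa)) * I2)))).
  by rewrite ler_wpM2l// ler_wpM2l// weighted_poly_norm2.
rewrite /k.
set pb := b `^ _; set pK := K%:R `^ _.
have pp : 0 <= al ^+ 2 * pb * pK by rewrite !mulr_ge0 ?powR_ge0 ?sqr_ge0.
rewrite [leLHS](_ : _ = (D * (besselC * (env_cst ^+ 2 * I2))) * (al ^+ 2 * pb * pK)); last by ring.
by rewrite ler_wpM2r// lerDl.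
Qed.

End sobolev_zeta_diff.

(** * Sobolev energies of mixtures *)

Section energy.
Context {R : realType} (d : nat).
Local Notation leb := (@lebesgue_measure R).
Local Notation lam := (@lebesgue_rV R d).
Variables (A : 'M[R]_d) (beta : R).
Hypotheses (d0 : (0 < d)%N) (uA : A \in unitmx) (A1 : forall i j, `|A i j| <= 1)
  (jA : lin_jac A) (be0 : 0 <= beta).

(** The Sobolev energy of a mixture expressed through its factors; in this form it also makes sense
    for the signed perturbation. *)
Definition mixture_energy (zs : 'I_d -> R -> R) : \bar R :=
  (\int[lam]_t ((\prod_j normc (Phi (zs j) ((t *m A) ord0 j)) ^+ 2) * (1 + sqnorm t) `^ beta)%:E)%E.

Lemma sqnorm_ge0 (t : 'rV[R]_d) : 0 <= sqnorm t.
Proof. by apply: sumr_ge0 => i _; rewrite -expr2 sqr_ge0. Qed.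

Lemma sqnormE (t : 'rV[R]_d) : sqnorm t = \sum_i `|t ord0 i| ^+ 2.
Proof. by apply: eq_bigr => i _; rewrite real_normK ?num_real// expr2. Qed.

Lemma one_sum_le_prod (x : 'I_d -> R) : (forall j, 0 <= x j) -> 1 + \sum_j x j <= \prod_j (1 + x j).
Proof.
move=> x0; suff : 0 <= \sum_j x j /\ 1 + \sum_j x j <= \prod_j (1 + x j) by case.
elim/big_rec2: _ => [|j p s _ [s0 sp]]; first by rewrite addr0 lexx.
have xj := x0 j; split; first exact: addr_ge0.
by rewrite mulrDl mul1r; nra.
Qed.

Lemma mulmx_sqr_le (B : 'M[R]_d) m (t : 'rV[R]_d) i : 0 <= m -> (forall i j, `|B i j| <= m) ->
  ((t *m B) ord0 i) ^+ 2 <= (m * d%:R) ^+ 2 * sqnorm t.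
Proof.
move=> m0 Bm; rewrite -(real_normK (num_real _)).
apply: (@le_trans _ _ ((m * \sum_j `|t ord0 j|) ^+ 2)).
  apply: leXn => //; rewrite mxE (le_trans (ler_norm_sum _ _ _))// mulr_sumr.
  by apply: ler_sum => j _; rewrite normrM mulrC ler_wpM2r.
have h : (\sum_j `|t ord0 j|) ^+ 2 <= d%:R ^+ 2 * sqnorm t.
  by rewrite sqnormE; exact: (pow_sum_le d0 2 (fun j => normr_ge0 (t ord0 j))).
move: (\sum_j _) h => s h.
by rewrite (exprMn 2 m s) (exprMn 2 m d%:R) -[leRHS]mulrA; apply: ler_wpM2l => //; exact: sqr_ge0.
Qed.

Lemma first_coord_le (t : 'rV[R]_d) i : 1 + ((t *m A) ord0 i) ^+ 2 <= (1 + d%:R ^+ 2) * (1 + sqnorm t).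
Proof.
have := mulmx_sqr_le t i ler01 A1; rewrite mul1r => h.
have := sqnorm_ge0 t; have := sqr_ge0 (d%:R : R); nra.
Qed.

(** The norm of [t] is controlled by that of [t *m A] through the entries of the inverse matrix. The
    product on the right is what lets the weight factorize over the coordinates. *)
Lemma sqnorm_le_prod : exists2 D : R, 1 <= D & forall t : 'rV[R]_d,
  1 + sqnorm t <= D * \prod_j (1 + ((t *m A) ord0 j) ^+ 2).
Proof.
pose m := \sum_i \sum_j `|invmx A i j|.
have m0 : 0 <= m by apply: sumr_ge0 => i _; exact: sumr_ge0.
have Bm i j : `|invmx A i j| <= m.
  rewrite /m (bigD1 i)//= (bigD1 j)//= -addrA lerDl addr_ge0//; first exact: sumr_ge0.
  by apply: sumr_ge0 => i' _; exact: sumr_ge0.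
pose c := (m * d%:R) ^+ 2; have c0 : 0 <= c by exact: sqr_ge0.
exists (1 + d%:R * c); first by rewrite lerDl mulr_ge0.
move=> t; pose u := t *m A.
have tu : t = u *m invmx A by rewrite /u mulmxK.
have h : sqnorm t <= d%:R * (c * sqnorm u).
  rewrite sqnormE; apply: (@le_trans _ _ (\sum_(i < d) c * sqnorm u)).
    by apply: ler_sum => i _; rewrite real_normK ?num_real// {1}tu; exact: mulmx_sqr_le.
  by rewrite sumr_const card_ord mulr_natl.
apply: (@le_trans _ _ ((1 + d%:R * c) * (1 + sqnorm u))).
  have := sqnorm_ge0 u; have dc : 0 <= d%:R * c by rewrite mulr_ge0.
  by rewrite mulrA in h; nra.
rewrite ler_wpM2l//; first by rewrite addr_ge0// mulr_ge0.
have -> : sqnorm u = \sum_j (u ord0 j) ^+ 2 by apply: eq_bigr => j _; rewrite expr2.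
by apply: one_sum_le_prod => j; exact: sqr_ge0.
Qed.

Lemma measurable_mixture_energy zs : (forall j, nice (zs j)) -> measurable_fun setT
  (fun t : 'rV[R]_d => ((\prod_j normc (Phi (zs j) ((t *m A) ord0 j)) ^+ 2) * (1 + sqnorm t) `^ beta)%:E).
Proof.
move=> nz; apply/measurable_EFinP; apply: measurable_funM.
  have m1 := measurable_prodf (fun j => measurable_normcPhi (nz j)).
  exact: (measurableT_comp m1 (measurable_mulmx A)).
apply: (measurableT_comp (measurable_powR beta)); apply: measurable_funD => //.
apply: measurable_sum => i; apply: measurable_funM; exact: measurable_rV_coord.
Qed.

Lemma mixture_energy_integrand_ge0 zs (t : 'rV[R]_d) :
  0 <= (\prod_j normc (Phi (zs j) ((t *m A) ord0 j)) ^+ 2) * (1 + sqnorm t) `^ beta.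
Proof. by rewrite mulr_ge0 ?powR_ge0// prodr_ge0// => j _; rewrite sqr_ge0. Qed.

Lemma mixture_energy_le_prod : exists2 Cu : R, 0 < Cu & forall zs, (forall j, nice (zs j)) ->
  (mixture_energy zs <= Cu%:E * \prod_j \int[leb]_u (sobolev_weight beta (zs j) u)%:E)%E.
Proof.
have [D D1 hD] := sqnorm_le_prod; have [k k0 kA] := jA.
have D0 : 0 < D by exact: lt_le_trans D1.
exists (D `^ beta * k); first by rewrite mulr_gt0// powR_gt0.
move=> zs nz.
have mW j : measurable_fun setT (sobolev_weight beta (zs j)) by exact: measurable_sobolev_weight.
have W0 j x : 0 <= sobolev_weight beta (zs j) x by exact: sobolev_weight_ge0.
have mP := measurable_prodf mW.
have mPE : measurable_fun setT (fun u : 'rV[R]_d => (prodf (fun j => sobolev_weight beta (zs j)) u)%:E) by exact/measurable_EFinP.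
have P0 (u : 'rV[R]_d) : (0 <= (prodf (fun j => sobolev_weight beta (zs j)) u)%:E)%E by rewrite lee_fin prodf_ge0.
rewrite -(ge0_integral_prodf mW W0) EFinM -muleA -(kA _ mPE P0).
have mPA : measurable_fun setT (fun u : 'rV[R]_d => (prodf (fun j => sobolev_weight beta (zs j)) (u *m A))%:E).
  exact: (measurableT_comp mPE (measurable_mulmx A)).
have Db : 0 <= D `^ beta by exact: powR_ge0.
rewrite -ge0_integralZlT//.
apply: ge0_le_integral => //.
- by move=> t _; rewrite lee_fin mixture_energy_integrand_ge0.
- exact: measurable_mixture_energy.
- exact: measurable_funeM.
move=> t _; rewrite -EFinM lee_fin /prodf.
have -> : \prod_j sobolev_weight beta (zs j) ((t *m A) ord0 j) =
    (\prod_j normc (Phi (zs j) ((t *m A) ord0 j)) ^+ 2) * \prod_j (1 + (t *m A) ord0 j ^+ 2) `^ beta by rewrite -big_split.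
rewrite [leRHS]mulrCA.
apply: ler_wpM2l; first by rewrite prodr_ge0// => j _; rewrite sqr_ge0.
set u := t *m A.
have pE : \prod_j (1 + u ord0 j ^+ 2) `^ beta = (\prod_j (1 + u ord0 j ^+ 2)) `^ beta.
  have : 0 <= \prod_j (1 + u ord0 j ^+ 2) /\ \prod_j (1 + u ord0 j ^+ 2) `^ beta = (\prod_j (1 + u ord0 j ^+ 2)) `^ beta.
    elim/big_rec2: _ => [|j x y _ [y0 ->]]; first by rewrite powR1.
    have pj := ltW (oneDsqr_gt0' (u ord0 j)).
    by rewrite powRM// mulr_ge0.
  by case.
rewrite pE -powRM ?(ltW D0)//; last by apply: prodr_ge0 => j _; exact: (ltW (oneDsqr_gt0' _)).
apply: ge0_ler_powR => //.
- by rewrite nnegrE addr_ge0// sqnorm_ge0.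
- by rewrite nnegrE mulr_ge0 ?(ltW D0)//; apply: prodr_ge0 => j _; exact: (ltW (oneDsqr_gt0' _)).
Qed.

Definition i0 : 'I_d := Ordinal d0.

(** Only the first coordinate of [t *m A] keeps its Sobolev weight, by [first_coord_le]; the other
    factors retain their unweighted energies. *)
Lemma mixture_energy_ge_prod : exists2 cl : R, 0 < cl & forall zs, (forall j, nice (zs j)) ->
  (cl%:E * (\int[leb]_u (sobolev_weight beta (zs i0) u)%:E * \prod_(j | j != i0) \int[leb]_u (normc (Phi (zs j) u) ^+ 2)%:E)
    <= mixture_energy zs)%E.
Proof.
have [k k0 kA] := jA; pose D : R := 1 + d%:R ^+ 2.
have D0 : 0 < D by rewrite ltr_wpDr// sqr_ge0.
have Db : 0 < D `^ beta by rewrite powR_gt0.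
exists ((D `^ beta)^-1 * k); first by rewrite mulr_gt0// invr_gt0.
move=> zs nz.
pose V (j : 'I_d) (u : R) := if j == i0 then sobolev_weight beta (zs j) u else normc (Phi (zs j) u) ^+ 2.
have mV j : measurable_fun setT (V j).
  by rewrite /V; case: (j == i0); [exact: measurable_sobolev_weight|exact: measurable_normcPhi].
have V0 j x : 0 <= V j x by rewrite /V; case: ifP => _; rewrite ?sobolev_weight_ge0// sqr_ge0.
have mPE : measurable_fun setT (fun u : 'rV[R]_d => (prodf V u)%:E) by apply/measurable_EFinP; exact: measurable_prodf.
have P0 (u : 'rV[R]_d) : (0 <= (prodf V u)%:E)%E by rewrite lee_fin prodf_ge0.
have -> : (\int[leb]_u (sobolev_weight beta (zs i0) u)%:E * \prod_(j | j != i0) \int[leb]_u (normc (Phi (zs j) u) ^+ 2)%:E =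
    \int[lam]_u (prodf V u)%:E)%E.
  rewrite ge0_integral_prodf// [RHS](bigD1 i0)//.
  have -> : (\int[leb]_x (V i0 x)%:E = \int[leb]_u (sobolev_weight beta (zs i0) u)%:E)%E.
    by apply: eq_integral => u _; rewrite /V eqxx.
  have E (j : 'I_d) : j != i0 -> (\int[leb]_u (normc (Phi (zs j) u) ^+ 2)%:E = \int[leb]_x (V j x)%:E)%E.
    by move=> /negbTE jn; apply: eq_integral => u _; rewrite /V jn.
  by rewrite (eq_bigr _ E).
rewrite EFinM -muleA -(kA _ mPE P0).
have mPA : measurable_fun setT (fun u : 'rV[R]_d => (prodf V (u *m A))%:E).
  exact: (measurableT_comp mPE (measurable_mulmx A)).
have Dbi : 0 <= (D `^ beta)^-1 by rewrite invr_ge0 ltW.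
rewrite -ge0_integralZlT//.
apply: ge0_le_integral => //.
- by move=> t _; rewrite mule_ge0.
- exact: measurable_funeM.
- exact: measurable_mixture_energy.
move=> t _; rewrite -EFinM lee_fin /prodf; set u := t *m A.
have -> : \prod_j V j (u ord0 j) = (\prod_j normc (Phi (zs j) (u ord0 j)) ^+ 2) * (1 + u ord0 i0 ^+ 2) `^ beta.
  rewrite (bigD1 i0)//= [in RHS](bigD1 i0)//= {1}/V eqxx /sobolev_weight mulrAC; congr (_ * _ * _).
  by apply: eq_bigr => j /negbTE jn; rewrite /V jn.
rewrite mulrCA; apply: ler_wpM2l; first by rewrite prodr_ge0// => j _; rewrite sqr_ge0.
rewrite mulrC ler_pdivrMr// mulrC -powRM ?(ltW D0)//; last by rewrite addr_ge0// sqnorm_ge0.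
apply: ge0_ler_powR => //.
- by rewrite nnegrE (ltW (oneDsqr_gt0' _)).
- by rewrite nnegrE mulr_ge0 ?(ltW D0)// addr_ge0// sqnorm_ge0.
exact: first_coord_le.
Qed.

Definition at0 (z' z : R -> R) (j : 'I_d) : R -> R := if j == i0 then z' else z.

Lemma nice_at0 z' z j : nice z' -> nice z -> nice (at0 z' z j).
Proof. by rewrite /at0; case: ifP. Qed.

Lemma sqr_normcD_le (x y : Cplx R) eta : 0 < eta ->
  normc (x + y) ^+ 2 <= (1 + eta) * normc x ^+ 2 + (1 + eta^-1) * normc y ^+ 2.
Proof.
move=> e0; have nD : normc (x + y) <= normc x + normc y.
  by have := ler_normD x y; rewrite !normr_normc -rmorphD lecR.
have := normc_ge0 x; have := normc_ge0 y; have := normc_ge0 (x + y).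
move: (normc x) (normc y) (normc (x + y)) nD => p q r nD r0 q0 p0.
apply: (@le_trans _ _ ((p + q) ^+ 2)); first exact: leXn.
have : 0 <= eta^-1 * (eta * p - q) ^+ 2 by rewrite mulr_ge0 ?sqr_ge0// invr_ge0 ltW.
have -> : eta^-1 * (eta * p - q) ^+ 2 = eta * p ^+ 2 - 2 * p * q + eta^-1 * q ^+ 2 by field; rewrite gt_eqF.
rewrite sqrrD; lra.
Qed.

(* The factors other than the first contribute powers of the Sobolev energy of
   [z0], which [hl] bounds by the energy of the unperturbed mixture. *)
Lemma energy_perturb (Cu cl c1 cb e om : R) z0 z1 w :
  (forall zs, (forall j, nice (zs j)) -> (mixture_energy zs <= Cu%:E * \prod_j \int[leb]_u (sobolev_weight beta (zs j) u)%:E)%E) ->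
  (forall zs, (forall j, nice (zs j)) ->
    (cl%:E * (\int[leb]_u (sobolev_weight beta (zs i0) u)%:E * \prod_(j | j != i0) \int[leb]_u (normc (Phi (zs j) u) ^+ 2)%:E) <= mixture_energy zs)%E) ->
  0 < Cu -> 0 < cl -> 0 < c1 -> 0 < cb -> 0 < e -> 0 <= om ->
  nice z0 -> nice z1 -> nice w -> (forall u, Phi z1 u = Phi z0 u + Phi w u) ->
  (c1%:E <= \int[leb]_u (normc (Phi z0 u) ^+ 2)%:E)%E ->
  (mixture_energy (fun=> z0) <= (cb - e)%:E)%E ->
  (\int[leb]_u (sobolev_weight beta w u)%:E <= om%:E)%E ->
  (1 + 2 * cb / e) * (Cu * (om * (cb / (cl * c1 ^+ d.-1)) ^+ d.-1)) <= e / 2 ->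
  (mixture_energy (at0 z1 z0) <= cb%:E)%E.
Proof.
move=> hu hl Cu0 cl0 c10 cb0 e0 om0 nz0 nz1 nw zE hc1 hE hw hsmall.
pose M := cb / (cl * c1 ^+ d.-1).
have clc : 0 < cl * c1 ^+ d.-1 by rewrite mulr_gt0// exprn_gt0.
have M0 : 0 < M by rewrite divr_gt0.
set W0 := (\int[leb]_u (sobolev_weight beta z0 u)%:E)%E.
have W00 : (0 <= W0)%E by apply: integral_ge0 => u _; rewrite lee_fin sobolev_weight_ge0.
have card' : #|[pred j : 'I_d | j != i0]| = d.-1 by rewrite cardC1 card_ord.
have W0M : (W0 <= M%:E)%E.
  have h := le_trans (hl (fun=> z0) (fun=> nz0)) hE.
  have h2 : (cl%:E * (W0 * (c1 ^+ d.-1)%:E) <= cb%:E)%E.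
    apply: (@le_trans _ _ (cb - e)%:E%E); last by rewrite lee_fin; lra.
    apply: le_trans h; apply: lee_wpmul2l; first by rewrite lee_fin ltW.
    apply: lee_wpmul2l => //; rewrite -card' -prodr_const -prodEFin.
    suff : (0 <= \prod_(j < d | j != i0) c1%:E <= \prod_(j < d | j != i0) \int[leb]_u (normc (Phi z0 u) ^+ 2)%:E)%E by case/andP.
    elim/big_rec2: _ => [|j x y _ /andP[x0 xy]]; first by rewrite lexx lee_fin ler01.
    by rewrite mule_ge0 ?lee_fin ?(ltW c10)//=; apply: lee_pmul => //; rewrite lee_fin ltW.
  rewrite /M EFinM lee_pdivlMr// EFinM muleCA -?muleA; exact: h2.
(* With this weight in the square inequality, [(1 + eta) * (cb - e)] is at most [cb - e / 2], which
   leaves [e / 2] for the perturbation. *)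
pose eta := e / (2 * cb); have eta0 : 0 < eta by rewrite divr_gt0// mulr_gt0.
have etaV : eta^-1 = 2 * cb / e by rewrite /eta invf_div.
have nz : forall j, nice (at0 z1 z0 j) by move=> j; exact: nice_at0.
have nzw : forall j, nice (at0 w z0 j) by move=> j; exact: nice_at0.
have split_le : (mixture_energy (at0 z1 z0) <= (1 + eta)%:E * mixture_energy (fun=> z0) + (1 + eta^-1)%:E * mixture_energy (at0 w z0))%E.
  have e1 : 0 <= 1 + eta by rewrite addr_ge0// ltW.
  have e2 : 0 <= 1 + eta^-1 by rewrite addr_ge0// invr_ge0 ltW.
  rewrite /mixture_energy -(ge0_integralZlT _ _ _ e1); [|exact: measurable_mixture_energy|by move=> t; rewrite lee_fin mixture_energy_integrand_ge0].
  rewrite -(ge0_integralZlT _ _ _ e2); [|exact: measurable_mixture_energy|by move=> t; rewrite lee_fin mixture_energy_integrand_ge0].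
  rewrite -ge0_integralD; [|exact: measurableT|by move=> t _; rewrite mule_ge0// lee_fin mixture_energy_integrand_ge0|apply: measurable_funeM; exact: measurable_mixture_energy|by move=> t _; rewrite mule_ge0// lee_fin mixture_energy_integrand_ge0|apply: measurable_funeM; exact: measurable_mixture_energy].
  apply: ge0_le_integral; [exact: measurableT|by move=> t _; rewrite lee_fin mixture_energy_integrand_ge0|exact: measurable_mixture_energy| |].
    by apply: emeasurable_funD; apply: measurable_funeM; exact: measurable_mixture_energy.
  move=> t _; rewrite -!EFinM -EFinD lee_fin !mulrA -mulrDl ler_wpM2r ?powR_ge0//.
  set u := t *m A; pose Q := \prod_(i < d | i != i0) normc (Phi z0 (u ord0 i)) ^+ 2.
  have pr z' : \prod_j normc (Phi (at0 z' z0 j) (u ord0 j)) ^+ 2 = normc (Phi z' (u ord0 i0)) ^+ 2 * Q.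
    rewrite (bigD1 i0)// {1}/at0 eqxx; congr (_ * _).
    by apply: eq_bigr => j /negbTE jn; rewrite /at0 jn.
  have pr0 : \prod_j normc (Phi z0 (u ord0 j)) ^+ 2 = normc (Phi z0 (u ord0 i0)) ^+ 2 * Q by rewrite (bigD1 i0).
  rewrite (pr z1) (pr w) pr0.
  have := sqr_normcD_le (Phi z0 (u ord0 i0)) (Phi w (u ord0 i0)) eta0; rewrite -zE.
  have : 0 <= Q by rewrite prodr_ge0// => j _; rewrite sqr_ge0.
  clear pr pr0; move: Q (normc (Phi z1 _) ^+ 2) (normc (Phi z0 _) ^+ 2) (normc (Phi w _) ^+ 2) (1 + eta) (1 + eta^-1) => Q p q r s s' Q0 h.
  have -> : s * (q * Q) + s' * (r * Q) = (s * q + s' * r) * Q by ring.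
  exact: ler_wpM2r.
have ENw : (mixture_energy (at0 w z0) <= (Cu * (om * M ^+ d.-1))%:E)%E.
  apply: le_trans (hu _ nzw) _; rewrite EFinM; apply: lee_wpmul2l; first by rewrite lee_fin ltW.
  rewrite (bigD1 i0)//= EFinM; apply: lee_pmul.
  - by apply: integral_ge0 => u _; rewrite lee_fin sobolev_weight_ge0.
  - by apply: prode_ge0 => j _; apply: integral_ge0 => u _; rewrite lee_fin sobolev_weight_ge0.
  - by rewrite /at0 eqxx.
  rewrite -card' -prodr_const -prodEFin.
  have : (forall j : 'I_d, j != i0 -> 0 <= \int[leb]_u (sobolev_weight beta (at0 w z0 j) u)%:E <= M%:E)%E.
    move=> j /negbTE jn; rewrite /at0 jn -/W0 W00; exact: W0M.
  move=> hj.
  suff : (0 <= \prod_(j | j != i0) \int[leb]_u (sobolev_weight beta (at0 w z0 j) u)%:E <= \prod_(j < d | j != i0) M%:E)%E by case/andP.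
  elim/big_rec2: _ => [|j x y jn /andP[y0 yx]]; first by rewrite lexx lee_fin ler01.
  have /andP[h1 h2] := hj j jn.
  by rewrite mule_ge0//=; apply: lee_pmul.
apply: le_trans split_le _.
apply: (@le_trans _ _ ((1 + eta) * (cb - e) + (1 + eta^-1) * (Cu * (om * M ^+ d.-1)))%:E%E).
  rewrite [leRHS]EFinD (EFinM (1 + eta)) (EFinM (1 + eta^-1)); apply: leeD; apply: lee_wpmul2l => //.
  - by rewrite lee_fin addr_ge0// ltW.
  - by rewrite lee_fin addr_ge0// invr_ge0 ltW.
rewrite lee_fin; rewrite -/M -etaV in hsmall; move: hsmall; move: (_ * (Cu * _)) => y hsmall.
have he : eta * cb = e / 2 by rewrite /eta; field; rewrite gt_eqF.
have := mulr_gt0 eta0 e0; nra.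
Qed.

End energy.

(** * [L^2] separation *)

Section oscillation_energy.
Context {R : realType}.
Implicit Types f : R -> R.

Lemma intR_sum m (f : 'I_m -> R -> R) : (forall i, nice (f i)) ->
  nice (fun x => \sum_i f i x) /\ intR (fun x => \sum_i f i x) = \sum_i intR (f i).
Proof.
elim: m f => [|m IH] f nf.
  have E : (fun x => \sum_(i < 0) f i x) = fun x : R => 0 * bump x.
    by apply/funext => x; rewrite big_ord0 mul0r.
  by rewrite E big_ord0 intRZ ?mul0r//; [split=> //; apply: niceZ|]; exact: nice_bump.
have [n1 i1] := IH _ (fun i => nf (lift ord0 i)).
have E : (fun x => \sum_(i < m.+1) f i x) = fun x => f ord0 x + \sum_(i < m) f (lift ord0 i) x.
  by apply/funext => x; rewrite big_ord_recl.
by rewrite E big_ord_recl intRD// i1; split=> //; exact: niceD.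
Qed.

(** By the intermediate value theorem. A fixed sign on the interval prevents cancellation when the
    values are averaged by the bump. *)
Lemma sign_cst f (l r p : R) : continuous f -> 0 < p -> (forall x, l <= x <= r -> p <= `|f x|) ->
  exists e : R, `|e| = 1 /\ forall x, l <= x <= r -> p <= e * f x.
Proof.
move=> cf p0 h.
have [lr|lr] := leP l r; last by exists 1; split=> [|x]; rewrite ?normr1//; lra.
have nz c : l <= c <= r -> f c != 0 by move=> hc; have := h _ hc; apply: contraTneq => ->; rewrite normr0; lra.
have key x y : l <= x <= r -> l <= y <= r -> 0 < f x -> 0 < f y.
  move=> hx hy fx; rewrite ltNge; apply/negP => fy.
  pose s := Num.min x y; pose t := Num.max x y.
  have st : s <= t by rewrite /s /t; case: (leP x y) => ?; lra.
  have hs : l <= s /\ t <= r by rewrite /s /t; case: (leP x y) => ?; lra.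
  have [|c] := @IVT R f s t 0 st (continuous_subspaceT cf).
    by rewrite ge_min le_max /s /t; case: (leP x y) => _; rewrite fy (ltW fx) ?orbT.
  rewrite in_itv/= => /andP[sc ct] fc.
  by have := nz c; rewrite fc eqxx => /(_ _)/negP; case; rewrite ?eqxx//; lra.
have hl : l <= l <= r by rewrite lexx.
have [fl|fl] := ltP 0 (f l).
  exists 1; split=> [|x hx]; first by rewrite normr1.
  by rewrite mul1r -(gtr0_norm (key _ _ hl hx fl)); exact: h.
exists (-1); split=> [|x hx]; first by rewrite normrN1.
rewrite mulN1r -ler0_norm; first exact: h.
rewrite leNgt; apply/negP => fx; have := key _ _ hx hl fx; lra.
Qed.

(** Uses [z^2 >= 2 t z - t^2] on [[- L, L]] and Chebyshev's inequality for the mass outside. With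
    [L = 1 + m] the outer mass is at most 1/4, and [t = 1 / (4 L)] makes the term in [t ^+ 2] equal
    to [t / 2]. *)
Lemma sqr_mass_lower (z : R -> R) (m : R) : nice z -> (forall x, 0 <= z x) -> intR z = 1 ->
  intR (fun x => x ^+ 2 * z x) <= m -> 0 <= m -> (8 * (1 + m))^-1 <= intR (fun x => z x ^+ 2).
Proof.
move=> nz z0 z1 hm m0; pose L := 1 + m; have L0 : 0 < L by rewrite ltr_wpDr.
pose t := (4 * L)^-1; have t0 : 0 < t by rewrite invr_gt0 mulr_gt0.
have nx : nice (fun x => x ^+ 2 * z x) by apply: niceM => //; exact: (pgrowX 2 pgrow_id).
have n2 : nice (fun x => z x ^+ 2).
  by under eq_fun do rewrite expr2; apply: niceM => //; exact: nice_pgrow.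
have ni := nice_indic (- L) L.
pose g x := 2 * t * z x - 2 * t / L ^+ 2 * (x ^+ 2 * z x) - t ^+ 2 * \1_(`[- L, L]%classic) x.
have ng : nice g by apply: niceB; [apply: niceB|]; exact: niceZ.
have gE : intR g = 2 * t - 2 * t / L ^+ 2 * intR (fun x => x ^+ 2 * z x) - t ^+ 2 * (2 * L).
  rewrite /g intRB; [|by apply: niceB; exact: niceZ|exact: niceZ].
  rewrite intRB; [|exact: niceZ|exact: niceZ].
  rewrite (intRZ _ nz) (intRZ _ nx) (intRZ _ ni) z1 mulr1 intR_indic; last lra.
  by congr (_ - _ * _); rewrite opprK mulr2n mulrDl mul1r.
have gle x : g x <= z x ^+ 2.
  have L2 : 0 < L ^+ 2 by rewrite exprn_gt0.
  have h : 0 <= 2 * t / L ^+ 2 * z x by rewrite mulr_ge0// divr_ge0 ?(ltW L2)// mulr_ge0// ltW.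
  rewrite /g indicE; case: (boolP (x \in _)) => xI.
    have : 0 <= (2 * t / L ^+ 2) * (x ^+ 2 * z x).
      by rewrite mulrCA mulr_ge0 ?sqr_ge0.
    have := sqr_ge0 (z x - t); rewrite mulr1n mulr1; nra.
  have xL : L ^+ 2 <= x ^+ 2.
    rewrite -[leRHS](real_normK (num_real x)); apply: leXn; first exact: ltW.
    by move: xI; rewrite notin_setE/= in_itv/= -ler_norml => /negP; rewrite -ltNge => /ltW.
  have E : 2 * t * z x = (2 * t / L ^+ 2 * z x) * L ^+ 2 by field; rewrite gt_eqF.
  have -> : 2 * t * z x - 2 * t / L ^+ 2 * (x ^+ 2 * z x) - t ^+ 2 * false%:R = 2 * t / L ^+ 2 * z x * (L ^+ 2 - x ^+ 2).
    by rewrite E; move: (2 * t / L ^+ 2) => c; rewrite mulr0n; ring.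
  apply: (@le_trans _ _ 0); last exact: sqr_ge0.
  by rewrite mulr_ge0_le0// subr_le0.
apply: le_trans (intR_le ng n2 gle); rewrite gE.
have L2 : 0 < L ^+ 2 by rewrite exprn_gt0.
have hh : 2 * t / L ^+ 2 * intR (fun x => x ^+ 2 * z x) <= 2 * t / 4.
  rewrite -[leLHS]mulrA; apply: ler_wpM2l; first by rewrite mulr_ge0// ltW.
  rewrite ler_pdivrMl//; apply: le_trans hm _.
  have := sqr_ge0 (1 - m); rewrite /L; nra.
have E : t ^+ 2 * (2 * L) = t / 2 by rewrite /t; field; rewrite gt_eqF.
have E2 : (8 * L)^-1 = t / 2 by rewrite /t; field; rewrite gt_eqF.
rewrite E -/L E2; lra.
Qed.

End oscillation_energy.

Section zeta_diff_lower_bound.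
Context {R : realType}.
Local Notation leb := (@lebesgue_measure R).
Variables (kappa x0 : R) (P : nat -> {poly R}) (F : R -> R) (c' tau : R).
Hypotheses (k01 : 0 < kappa < 1) (x00 : 0 < x0).

Local Notation hk := (h_kappa kappa x0).

Lemma continuous_Ph K : continuous (Ph kappa x0 P K).
Proof.
move=> x; apply: cvgM; first exact: continuous_horner.
exact: continuous_h_kappa.
Qed.

(** At distance at least [b^-1] from the endpoints the bump averages values of one sign, all of
    modulus at least [al * (p * m)]. *)
Lemma zeta_diff_itv_ge b K al l r p m x : 0 < b -> 0 <= al -> 0 < p -> 0 < m ->
  (forall x, `|x| <= 1 -> m <= hk x) -> -1 <= l -> r <= 1 ->
  (forall x, l <= x <= r -> p <= `|Ph kappa x0 P K x|) ->
  l + b^-1 <= x <= r - b^-1 -> al * (p * m) <= `|zeta_diff kappa x0 P b K al x|.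
Proof.
move=> b0 al0 p0 m0 hm l1 r1 hp hx.
have [e [e1 he]] := sign_cst (@continuous_Ph K) p0 hp.
have nu : nice (bump_b b) by exact: nice_bump_b.
have ng := nice_scaled_weighted_poly P k01 x00 K al.
have ns := nice_conv_sec x ng nu.
have : al * (p * m) <= e * zeta_diff kappa x0 P b K al x.
  rewrite /zeta_diff /conv -/(intR _) -intRZ// -[leLHS]mulr1 -(intR_bump_b b0) -intRZ//.
  apply: intR_le; [exact: niceZ|exact: niceZ|move=> y].
  have [yb|yb] := leP b^-1 `|y|; first by rewrite (bump_b_out b0 yb) !mulr0.
  rewrite [leRHS]mulrA; apply: ler_wpM2r; first exact: bump_b_ge0.
  have hxy : l <= x - y <= r by move: yb; rewrite ltr_norml; lra.
  have h1 := he _ hxy; have h2 : m <= hk (x - y) by apply: hm; rewrite ler_norml; lra.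
  rewrite weighted_polyE; move: (Ph _ _ _ _ _) (h_kappa _ _ _) h1 h2 => v w h1 h2.
  have -> : e * (al * (v * w)) = al * ((e * v) * w) by ring.
  by apply: ler_wpM2l => //; apply: ler_pM => //; exact: ltW.
move=> h; apply: le_trans h _; apply: le_trans (ler_norm _) _.
by rewrite normrM e1 mul1r.
Qed.

(** The choice of [b] makes [b^-1] a quarter of the guaranteed interval length: trimmed on both
    sides, each interval keeps half of that length. The trimmed intervals stay disjoint, so their
    contributions add up. *)
Lemma zeta_diff_L2_ge c1 c2 K m (l r : 'I_m -> R) b al mh : 0 < c1 -> 0 < c2 -> (1 <= K)%N -> 0 <= al -> 0 < mh ->
  (forall x, `|x| <= 1 -> mh <= hk x) -> b = 4 / c1 * K%:R `^ kappa ->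
  (forall i j, i != j -> r i <= l j \/ r j <= l i) ->
  (forall i, [/\ -1 <= l i, r i <= 1, c1 * K%:R `^ (- kappa) <= r i - l i &
     forall x, l i <= x <= r i -> c2 * K%:R `^ ((kappa - 1) / 2) <= `|Ph kappa x0 P K x|]) ->
  m%:R * (c1 / 2 * K%:R `^ (- kappa) * (al * (c2 * K%:R `^ ((kappa - 1) / 2) * mh)) ^+ 2) <=
    intR (fun x => zeta_diff kappa x0 P b K al x ^+ 2).
Proof.
move=> c10 c20 K1 al0 mh0 hm bE dis hi.
have KK s : 0 < K%:R `^ s :> R by rewrite powR_gt0// ltr0n.
have b0 : 0 < b by rewrite bE mulr_gt0// divr_gt0.
have bV : b^-1 = c1 / 4 * K%:R `^ (- kappa) by rewrite bE powRN; field; rewrite !gt_eqF.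
set p := c2 * _; have p0 : 0 < p by rewrite mulr_gt0.
set v := (al * (p * mh)) ^+ 2; have v0 : 0 <= v by rewrite sqr_ge0.
have nw : nice (zeta_diff kappa x0 P b K al) by exact: nice_zeta_diff.
have n2 : nice (fun x => zeta_diff kappa x0 P b K al x ^+ 2).
  by under eq_fun do rewrite expr2; apply: niceM => //; exact: nice_pgrow.
pose I i : set R := `[l i + b^-1, r i - b^-1]%classic.
have ni i : nice (fun x => v * \1_(I i) x) by apply: niceZ; exact: nice_indic.
have [nS iS] := intR_sum ni.
apply: (@le_trans _ _ (intR (fun x => \sum_i v * \1_(I i) x))).
  rewrite iS; apply: (@le_trans _ _ (\sum_(i < m) c1 / 2 * K%:R `^ (- kappa) * v)).
    by rewrite sumr_const card_ord mulr_natl.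
  apply: ler_sum => i _; have [_ _ hlr _] := hi i.
  have hw : c1 / 2 * K%:R `^ (- kappa) <= (r i - b^-1) - (l i + b^-1) by rewrite bV; lra.
  have hp : 0 <= c1 / 2 * K%:R `^ (- kappa) by rewrite mulr_ge0 ?(ltW (KK _))// divr_ge0// ltW.
  rewrite intRZ; last exact: nice_indic.
  by rewrite intR_indic; [rewrite mulrC; exact: ler_wpM2l|lra].
apply: intR_le => // x; rewrite -mulr_sumr.
have [[i xi]|hN] := pselect (exists i, I i x); last first.
  rewrite big1 ?mulr0 ?sqr_ge0// => i _.
  by rewrite indicE memNset// => xi; apply: hN; exists i.
rewrite (bigD1 i)//= big1 => [|j ji]; last first.
  rewrite indicE memNset// => xj; have bp : 0 < b^-1 by rewrite invr_gt0.
  move: xi xj; rewrite /I/= !in_itv/=; case: (dis j i ji); lra.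
rewrite indicE mem_set// addr0 mulr1 -[leRHS](real_normK (num_real _)).
apply: leXn; first by rewrite mulr_ge0// mulr_ge0// ltW.
have [h1 h2 _ h4] := hi i; apply: (@zeta_diff_itv_ge b K al (l i) (r i) p mh x) => //.
Qed.

End zeta_diff_lower_bound.

Section mixture_distance.
Context {R : realType} (d : nat).
Local Notation leb := (@lebesgue_measure R).
Local Notation lam := (@lebesgue_rV R d).

(** The two densities share every factor but the first, so their difference is again a product and
    its squared norm factorizes after the linear change of variables. *)
Lemma mixture_L2 (A : 'M[R]_d) (k : R) (d0 : (0 < d)%N) z0 z1 w :
  0 < k -> A \in unitmx ->
  (forall f : 'rV[R]_d -> \bar R, measurable_fun setT f -> (forall x, 0 <= f x)%E ->
    (\int[lam]_x f (x *m A^T)%R = k%:E * \int[lam]_x f x)%E) ->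
  nice z0 -> nice w -> (forall x, z1 x = z0 x + w x) ->
  (\int[lam]_x ((mixf A^T k (at0 d0 z1 z0) x - mixf A^T k (fun=> z0) x) ^+ 2)%:E =
    (k * (intR (fun x => w x ^+ 2) * intR (fun x => z0 x ^+ 2) ^+ d.-1))%:E)%E.
Proof.
move=> k0 uA kA nz0 nw zE.
pose V (j : 'I_d) x := at0 d0 w z0 j x ^+ 2.
have n2 z : nice z -> nice (fun x => z x ^+ 2).
  by move=> nz; under eq_fun do rewrite expr2; apply: niceM => //; exact: nice_pgrow.
have nV j : nice (V j) by apply: n2; exact: nice_at0.
have mV j : measurable_fun setT (V j) by case: (nV j).
have V0 j x : 0 <= V j x by exact: sqr_ge0.
pose G (x : 'rV[R]_d) := (k ^+ 2 * prodf V (x *m invmx A^T))%:E.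
have mG : measurable_fun setT G.
  apply/measurable_EFinP; apply: measurable_funM => //.
  by apply: (measurableT_comp (measurable_prodf mV)); exact: measurable_mulmx.
have G0 x : (0 <= G x)%E by rewrite lee_fin mulr_ge0 ?sqr_ge0// prodf_ge0.
have uAT : A^T \in unitmx by rewrite unitmx_tr.
have GE x : ((mixf A^T k (at0 d0 z1 z0) x - mixf A^T k (fun=> z0) x) ^+ 2)%:E = G x.
  rewrite /mixf -mulrBr exprMn /G; congr (_ * _)%:E.
  set s := x *m _; rewrite /prodf /V prodrXl; congr (_ ^+ 2).
  rewrite (bigD1 (i0 d0))// [X in _ - X](bigD1 (i0 d0))// [RHS](bigD1 (i0 d0))//=.
  have e z' : \prod_(i < d | i != i0 d0) at0 d0 z' z0 i (s ord0 i) = \prod_(i < d | i != i0 d0) z0 (s ord0 i).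
    by apply: eq_bigr => i /negbTE ni; rewrite /at0 ni.
  by rewrite !e -mulrBl /at0 eqxx zE addrAC subrr add0r.
rewrite (eq_integral _ _ (fun x _ => GE x)).
have kn : k != 0 by rewrite gt_eqF.
have : (k%:E * \int[lam]_x G x = (k ^+ 2)%:E * \int[lam]_x (prodf V x)%:E)%E.
  rewrite -kA// -ge0_integralZlT; [|by apply/measurable_EFinP; exact: measurable_prodf|by move=> x; rewrite lee_fin prodf_ge0|exact: sqr_ge0].
  by apply: eq_integral => x _; rewrite /G mulmxK.
rewrite ge0_integral_prodf// (eq_bigr (fun j => (intR (V j))%:E)); last by move=> j _; rewrite intR_ereal.
rewrite prodEFin -EFinM (bigD1 (i0 d0))//= (eq_bigr (fun=> intR (fun x => z0 x ^+ 2))); last first.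
  by move=> j /negbTE nj; rewrite /V /at0 nj.
rewrite prodr_const cardC1 card_ord.
have -> : V (i0 d0) = fun x => w x ^+ 2 by apply/funext => x; rewrite /V /at0 eqxx.
(* The identity gives [k] times the integral; infinite values are excluded because the other side is
   finite and [k] is positive. *)
move: (\int[lam]_x G x)%E => -[y||].
- move=> [] h; congr (_%:E); apply: (mulfI kn); rewrite h; ring.
- by rewrite gt0_muley ?lte_fin.
- by rewrite gt0_muleNy ?lte_fin.
Qed.

End mixture_distance.

(** * Choice of the degree and conclusion *)

Section degree_choice.
Context {R : realType}.

(** From the sixth power of [exp (- 1 / 6) >= 5 / 6]. It makes [ln n > 1], hence [ln (ln n)]
    positive, from [n = 3] on. *)
Lemma expR1_lt3 : expR 1 < 3 :> R.
Proof.
have h : 5 / 6 <= expR (- 6^-1) :> R.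
  by have := expR_ge1Dx (- 6^-1 : R); lra.
have E : expR (- 6^-1) ^+ 6 = (expR 1)^-1 :> R.
  by rewrite -expRM_natl -expRN; congr expR; field.
have h6 : (5 / 6) ^+ 6 <= (expR 1)^-1 :> R by rewrite -E; apply: leXn => //; lra.
have e0 := expR_gt0 (1 : R).
have : (5 / 6) ^+ 6 * expR 1 <= 1 :> R by rewrite -ler_pdivlMr// mul1r.
suff : 1 / 3 < (5 / 6) ^+ 6 :> R by nra.
have a2 : (5 / 6) ^+ 2 = 25 / 36 :> R by lra.
have a4 : 13 / 27 <= (25 / 36) ^+ 2 :> R by lra.
rewrite (exprM _ 2 3) a2 exprS; apply: (@lt_le_trans _ _ (25 / 36 * (13 / 27))); first by lra.
by apply: ler_wpM2l => //; lra.
Qed.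

Lemma ln_nat_gt1 n : (3 <= n)%N -> 1 < ln (n%:R : R).
Proof.
move=> n3; rewrite -[ltLHS](@expRK R) ltr_ln ?posrE ?expR_gt0 ?ltr0n ?(leq_trans _ n3)//.
by apply: lt_le_trans expR1_lt3 _; rewrite ler_nat.
Qed.

Lemma ln_le_self (x : R) : 0 < x -> ln x <= x.
Proof. by move=> x0; rewrite -{2}(lnK (x := x)) ?posrE//; have := expR_ge1Dx (ln x); lra. Qed.

(* Compare [j] with [sqrt L]. *)
Lemma le_div_ln (c j L : R) : 0 <= c -> 1 < L -> 1 <= j -> j * ln j <= c * L -> j <= (2 * c + 2) * (L / ln L).
Proof.
move=> c0 L1 j1 h; have L0 : 0 < L by lra.
have lL : 0 < ln L by rewrite ln_gt0.
rewrite mulrA ler_pdivlMr//.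
pose s := Num.sqrt L; have s0 : 0 < s by rewrite sqrtr_gt0.
have sL : s * s = L by rewrite -expr2 sqr_sqrtr// ltW.
have lnL : ln L = 2 * ln s by rewrite -sL lnM ?posrE// mulr2n mulrDl mul1r.
have ls := ln_le_self s0.
have [js|sj] := leP j s.
  have : j * ln s <= s * s by apply: ler_pM => //; [lra|rewrite -(pmulr_rge0 _ (ltr0n R 2)) -lnL ltW].
  rewrite lnL sL; have := mulr_ge0 c0 (ltW L0); lra.
have : j * ln s <= j * ln j.
  by apply: ler_wpM2l; [lra|rewrite ler_ln ?posrE//; lra].
rewrite lnL; have := mulr_ge0 c0 (ltW L0); lra.
Qed.

Lemma choose_degree (kappa V B : R) (K0 : nat) : 0 < kappa -> 1 <= V -> 1 <= B ->
  exists2 C : R, 0 < C & forall n, (3 <= n)%N -> exists K : nat,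
    [/\ (K0 <= K)%N, n%:R * (V * (B ^+ K * K%:R `^ (- (kappa * K%:R)))) <= 2^-1 &
        K%:R <= C * (ln n%:R / ln (ln n%:R))].
Proof.
move=> k0 V1 B1; have V0 : 0 < V by lra. have B0 : 0 < B by lra.
pose C2 := 2 * (ln (2 * V) + 1) / kappa.
have C20 : 0 <= C2.
  by rewrite divr_ge0 ?(ltW k0)// mulr_ge0// addr_ge0// ln_ge0//; lra.
(* From [K1] on, [B] is at most the power [kappa / 2] of the degree, so the geometric factor uses up
   only half of the exponent [kappa]. *)
pose K1 := (maxn K0 (Num.trunc (B `^ (2 / kappa)))).+2.
exists (K1%:R + (2 * C2 + 3)); first by rewrite ltr_wpDl//; lra.
move=> n n3; have L1 := ln_nat_gt1 n3; set L := ln n%:R in L1 *.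
have n0 : 0 < n%:R :> R by rewrite ltr0n (leq_trans _ n3).
have lL : 0 < ln L by rewrite ln_gt0.
have Q1 : 1 <= L / ln L.
  by rewrite ler_pdivlMr// mul1r ln_le_self//; lra.
have pE (K : nat) : (0 < K)%N -> K%:R `^ (- (kappa * K%:R)) = (K%:R `^ (- kappa)) ^+ K :> R.
  by move=> K0'; rewrite -mulNr powRrM powR_mulrn ?powR_ge0.
(* The least admissible [K] is small because [K - 1] is not admissible. *)
pose ok K := (K0 <= K)%N && (n%:R * (V * (B ^+ K * K%:R `^ (- (kappa * K%:R)))) <= 2^-1).
have exK : exists K, ok K.
  (* Existence alone: for [K] this large the base [B K^(- kappa)] is at most 1/2, and [2 ^+ K]
     exceeds [2 * (n%:R * V)]. *)
  pose K := (maxn K0 (maxn (Num.trunc ((2 * B) `^ kappa^-1)) (Num.trunc (2 * (n%:R * V))))).+1.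
  have h1 : (2 * B) `^ kappa^-1 <= K%:R.
    by apply: le_trans (ltW (truncnS_gt _)) _; rewrite ler_nat ltnS /K leq_max leq_max leqnn orbT.
  have h2 : 2 * (n%:R * V) <= K%:R.
    by apply: le_trans (ltW (truncnS_gt _)) _; rewrite ler_nat ltnS /K !leq_max leqnn !orbT.
  have Kp : 0 < K%:R :> R by rewrite ltr0n.
  exists K; rewrite /ok; apply/andP; split; first by rewrite /K leqW// leq_max leqnn.
  rewrite pE// -exprMn.
  have h3 : B * K%:R `^ (- kappa) <= 2^-1.
    rewrite powRN ler_pdivrMr ?powR_gt0// ler_pdivlMl//.
    have -> : 2 * B = ((2 * B) `^ kappa^-1) `^ kappa by rewrite -powRrM mulVf ?gt_eqF// powRr1// mulr_ge0// ltW.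
    by apply: ge0_ler_powR => //; rewrite ?nnegrE ?powR_ge0// ltW.
  have h4 : (B * K%:R `^ (- kappa)) ^+ K <= 2^-1 ^+ K.
    by apply: leXn h3; rewrite mulr_ge0 ?powR_ge0// ltW.
  have h5 : K%:R <= 2 ^+ K :> R by rewrite -natrX ler_nat ltnW// ltn_expl.
  rewrite mulrA; apply: (@le_trans _ _ (n%:R * V * 2^-1 ^+ K)).
    by apply: ler_wpM2l => //; rewrite mulr_ge0// ltW.
  rewrite exprVn ler_pdivrMr ?exprn_gt0// ler_pdivlMl//; exact: le_trans h2 h5.
have [K /andP[KK0 hK] Kmin] : exists2 K, ok K & forall j, ok j -> (K <= j)%N.
  by exists (ex_minn exK); case: ex_minnP.
exists K; split => //.
have Q0 : 0 <= L / ln L by exact: le_trans ler01 Q1.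
have [KK1|K1K] := leqP K K1.
  rewrite mulrDl; apply: (@le_trans _ _ (K1%:R * (L / ln L))).
    by apply: (@le_trans _ _ K1%:R); [rewrite ler_nat|rewrite ler_peMr].
  by rewrite lerDl mulr_ge0//; lra.
pose J := K.-1; have KJ : K = J.+1 by rewrite /J prednK// (leq_trans _ K1K).
have JK1 : (K1 <= J)%N by rewrite -ltnS -KJ.
have J0 : (0 < J)%N by rewrite (leq_trans _ JK1).
have J1 : 1 <= J%:R :> R by rewrite ler1n.
have Jp : 0 < J%:R :> R by lra.
have nok : ~~ ok J by apply/negP => /Kmin; rewrite KJ ltnn.
have JK0 : (K0 <= J)%N by apply: leq_trans JK1; rewrite /K1 leqW// leqW// leq_max leqnn.
move: nok; rewrite /ok JK0/= -ltNge => nok.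
have hB : ln B <= kappa / 2 * ln J%:R.
  have h : B `^ (2 / kappa) <= J%:R.
    apply: le_trans (ltW (truncnS_gt _)) _; rewrite ler_nat (leq_trans _ JK1)// /K1 ltnS leqW// leq_max leqnn orbT//.
  have : ln (B `^ (2 / kappa)) <= ln J%:R by rewrite ler_ln ?posrE ?powR_gt0.
  rewrite ln_powR => h'; rewrite -ler_pdivrMl ?divr_gt0//.
  by rewrite invf_div mulrC in h' *.
(* The logarithm of the failed condition at [J]. By [hB], half of [kappa J ln J] survives, and
   [ln (2 * V)] is absorbed because [L > 1]. *)
have hJ : J%:R * ln J%:R <= C2 * L.
  have : ln 2^-1 < ln (n%:R * (V * (B ^+ J * J%:R `^ (- (kappa * J%:R))))) :> R.
    by rewrite ltr_ln ?posrE ?invr_gt0// !mulr_gt0// ?exprn_gt0 ?powR_gt0.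
  rewrite !lnM ?posrE ?mulr_gt0 ?exprn_gt0 ?powR_gt0// ln_powR lnXn// lnV ?posrE// -/L.
  have l2V : ln (2 * V) = ln 2 + ln V :> R by rewrite lnM ?posrE.
  have h0 : 0 <= ln (2 * V) by rewrite ln_ge0//; lra.
  have h1 : J%:R * ln B <= J%:R * (kappa / 2 * ln J%:R) by apply: ler_wpM2l => //; lra.
  rewrite -[ln B *+ J]mulr_natl => h2.
  have h3 : kappa / 2 * (J%:R * ln J%:R) <= ln (2 * V) + L.
    rewrite l2V; move: h1 h2; rewrite mulrCA.
    have -> : - (kappa * J%:R) * ln J%:R = - 2 * (kappa / 2 * (J%:R * ln J%:R)) by field.
    lra.
  have h4 : ln (2 * V) + L <= (ln (2 * V) + 1) * L by move: (ln (2 * V)) h0 L1; clear => y y0 L1; nra.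
  have -> : C2 * L = (2 / kappa) * ((ln (2 * V) + 1) * L) by rewrite /C2; field; rewrite gt_eqF.
  rewrite -ler_pdivrMl ?divr_gt0// invf_div; exact: le_trans h3 h4.
have h := le_div_ln C20 L1 J1 hJ.
rewrite KJ -natr1; move: h; move: (L / ln L) Q1 Q0 => Q Q1 Q0 h.
have : 0 <= K1%:R * Q by rewrite mulr_ge0.
nra.
Qed.

End degree_choice.

(** * The laws of the two hypotheses *)

Section density_law.
Context {R : realType} (d : nat).
Local Notation lam := (@lebesgue_rV R d).

Lemma char_fun_density (P : probability 'rV[R]_d R) f : has_density P f -> char_fun P =1 fourier f.
Proof.
move=> [mf f0 PE] t.
have push : dens_push lam P f (cst 1) id.
  move=> G mG G0; rewrite (dens_push_measure mf f0 PE mG G0).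
  by apply: eq_integral => x _; rewrite mule1.
have key (G : R -> R) : measurable_fun [set: R] G -> (forall x, `|G x| <= 1) ->
    \int[P]_x G (dotp t x) = \int[lam]_x (G (dotp t x) * f x).
  move=> mG G1; have mGd : measurable_fun setT (fun x => G (dotp t x)).
    by apply: (measurableT_comp mG); exact: measurable_dotp.
  rewrite (dens_push_Rintegral mf (measurable_cst (1 : R)) (@measurable_id _ _ setT) f0 (fun=> ler01) push mGd).
    by apply: eq_Rintegral => x _; rewrite mulr1.
  apply: integrable_boundedM => //; exact: finite_measure_integrable_cst.
rewrite /char_fun /fourier; congr Complex; apply: key => //.
- exact: measurable_cos.
- by move=> x; rewrite ler_norml cos_geN1 cos_le1.
- exact: measurable_sin.
- by move=> x; rewrite ler_norml sin_geN1 sin_le1.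
Qed.

Lemma density_law (f : 'rV[R]_d -> R) : measurable_fun setT f -> (forall x, 0 <= f x) ->
  (\int[lam]_x (f x)%:E = 1)%E -> exists P : probability 'rV[R]_d R, has_density P f.
Proof.
move=> mf f0 i1.
by exists (pdf_measure (Pdf (mu := lam) mf f0 i1) : probability 'rV[R]_d R).
Qed.

End density_law.

Section mixing_coefficients.
Context {R : realType} (d1 d2 : nat) (a : R).

Lemma mixing_mx_le1 : `|a| <= 1 -> forall i j, `|mixing_mx d1 d2 a i j| <= 1.
Proof.
move=> a1 i j; rewrite /mixing_mx.
case: (split_ordP i) => i' ->; case: (split_ordP j) => j' ->;
  rewrite ?block_mxEul ?block_mxEur ?block_mxEdl ?block_mxEdr !mxE.
- by rewrite normr_nat lern1 leq_b1.
- by case: ifP => // _; rewrite normr0.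
- by case: ifP => // _; rewrite normr0.
- by rewrite normr_nat lern1 leq_b1.
Qed.

End mixing_coefficients.

Section two_hypotheses.
Context {R : realType} (d1' d2' : nat).
Local Notation d1 := d1'.+1.
Local Notation d2 := d2'.+1.
Local Notation d := (d1 + d2)%N.
Local Notation leb := (@lebesgue_measure R).
Local Notation lam := (@lebesgue_rV R (d1 + d2)).
Variables (kappa S T x0 c' tau a : R) (P : nat -> {poly R}) (F : R -> R)
  (H : set ('rV[Cplx R]_(d1 + d2) -> Cplx R)).
Hypotheses (k01 : 0 < kappa < 1) (T0 : 0 < T) (TS : 4 * d%:R ^+ 2 * 2 ^+ d * T <= S)
  (x00 : 0 < x0) (c0 : 0 < c') (tau0 : 0 <= tau) (sc : scale_choice kappa x0 c' tau T)
  (orthoP : orthonormal_polys kappa x0 P) (envF : envelope kappa x0 P F)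
  (intF : (\int[leb]_x (F x * h_kappa kappa x0 x)%:E = 1)%E)
  (domF : forall x, F x <= c' * weight x0 tau x) (a1 : `|a| < 1)
  (HF : contains_family a kappa x0 P F H).

Local Notation A := (mixing_mx d1 d2 a).

Let A1 : forall i j, `|A i j| <= 1.
Proof. by apply: mixing_mx_le1; exact: ltW. Qed.

Let jA : lin_jac A. Proof. by have [] := @lin_jac_mixing R d1 d2 a isT isT a1. Qed.

Let uA : A \in unitmx. Proof. by have [] := @lin_jac_mixing R d1 d2 a isT isT a1. Qed.

(* [contains_family] quantifies over whole sequences, but any admissible triple
   is the term of index 0 of admissible sequences. *)
Lemma single_index b K al f : x0^-1 <= b -> (1 <= K)%N -> 0 <= al ->
  (al%:E <= (sup_ratio (Ph kappa x0 P K) F)^-1)%E ->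
  density_f0 a kappa x0 F b f \/ density_fn a kappa x0 P F al K b f ->
  exists phi, [/\ H phi, analytic phi & extends phi (fourier f)].
Proof.
move=> hb K1 al0 hal hf.
pose als n : R := if n == 0%N then al else 0.
pose Ks n : nat := if n == 0%N then K else n.+1.
pose bs n : R := if n == 0%N then b else n%:R + x0^-1.
apply: (HF (alpha := als) (K := Ks) (b := bs) (n := 0%N)) => //; split.
- move=> [|n]; first by [].
  split => //; first by rewrite /bs/= lerDr.
  by rewrite /als/= inve_ge0; apply: sup_ratio_ge0; case: envF.
- apply: (@cvg_trans _ ((fun=> 0 : R) @ \oo)); last exact: cvg_cst.
  by apply: near_eq_cvg; exists 1%N => // n /=; rewrite /als; case: n.
- by move=> M; exists M.+1 => // n /= Mn; rewrite /Ks; case: eqP => [n0|_]; [move: Mn; rewrite n0|rewrite ltnW// ltnW].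
- apply/cvgryPge => M; exists (Num.trunc `|M|).+1 => // n /= hn.
  have n0 : (n == 0%N) = false by case: n hn.
  rewrite /bs n0; apply: (@le_trans _ _ n%:R); last by rewrite lerDl invr_ge0 ltW.
  apply: le_trans (ler_norm _) _; apply: le_trans (ltW (truncnS_gt _)) _; by rewrite ler_nat.
Qed.

Section at_scale.
Variables (b : R) (bx : x0^-1 <= b).
Let b0 : 0 < b. Proof. by apply: lt_le_trans bx; rewrite invr_gt0. Qed.
Local Notation z0 := (zeta0 kappa x0 F b).

(** The point where [scale_choice] enters: membership of the one-variable density in [Upsilon]
    becomes a family of moment bounds. *)
Lemma zeta0_moment m : (0 < m)%N -> `|intR (fun x => x ^+ m * z0 x)| <= T ^+ m * moment_bound kappa m.
Proof.
move=> m0; have zp := zeta0_pdf k01 x00 c0 tau0 envF intF domF b0.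
have [phi U E] := sc bx zp (zeta0_dom k01 x00 c0 tau0 envF domF b0).
exact: (moment_of_Upsilon (nice_zeta0 k01 x00 c0 tau0 envF domF b0) U E m0).
Qed.

Lemma zeta0_abs_moment m : intR (fun x => `|x| ^+ m * z0 x) <= (2 * T) ^+ m * moment_bound kappa m.
Proof.
apply: (abs_moment_le k01 T0); [exact: (nice_zeta0 k01 x00 c0 tau0 envF domF b0)| | |exact: zeta0_moment].
- by move=> x; exact: (zeta0_ge0 k01 x00 envF b0).
- exact: (intR_zeta0 k01 x00 c0 tau0 envF intF domF b0).
Qed.

End at_scale.

Section member.
Variables (k : R) (zs : 'I_d -> R -> R).
Hypotheses (k0 : 0 < k) (kA : forall f : 'rV[R]_(d1 + d2) -> \bar R, measurable_fun setT f -> (forall x, 0 <= f x)%E ->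
    (\int[lam]_x f (x *m A^T)%R = k%:E * \int[lam]_x f x)%E)
  (nz : forall j, nice (zs j)) (z0 : forall j x, 0 <= zs j x) (iz : forall j, intR (zs j) = 1).

Lemma fourier_mixture t : fourier (mixf A^T k zs) t = \prod_j Phi (zs j) ((t *m A) ord0 j).
Proof. by apply: fourier_mixf => // j; exact: nice_integrable. Qed.

Lemma sobolev_energy_mixture beta : sobolev_energy beta (fourier (mixf A^T k zs)) = mixture_energy A beta zs.
Proof.
by apply: eq_integral => t _; rewrite fourier_mixture normc_prod prodrXl.
Qed.

(** The three ingredients are independent: [H] supplies the analytic extension, the absolute moments
    bound its Taylor coefficients, and the energy bound is the Sobolev condition. *)
Lemma in_class beta cb :
  (forall j m, (0 < m)%N -> intR (fun x => `|x| ^+ m * zs j x) <= 2 * ((2 * T) ^+ m * moment_bound kappa m)) ->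
  (exists phi, [/\ H phi, analytic phi & extends phi (fourier (mixf A^T k zs))]) ->
  (mixture_energy A beta zs <= cb%:E)%E ->
  exists2 Pr : probability 'rV[R]_(d1 + d2) R, has_density Pr (mixf A^T k zs) &
    exists phi, [/\ extends phi (char_fun Pr), Psi kappa S beta cb phi & H phi].
Proof.
move=> hz [phi [Hphi aphi ephi]] hE.
have mz j : measurable_fun setT (zs j) by case: (nz j).
have [|Pr hPr] := @density_law R _ (mixf A^T k zs) (measurable_mixf _ _ mz) (mixf_ge0 _ k0 z0).
  by apply: integral_mixf => // j; rewrite (intR_ereal (nz j)) iz.
exists Pr => //; exists phi; have ec : extends phi (char_fun Pr).
  by move=> t; rewrite ephi (char_fun_density hPr).
split => //; split.
- exact: (mixture_Upsilon _ k0 uA A1 kA nz z0 iz T0 hz TS aphi ephi).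
- by exists Pr.
- rewrite (_ : (fun t => phi (toC t)) = fourier (mixf A^T k zs)); last exact/funext/ephi.
  by rewrite sobolev_energy_mixture.
Qed.

End member.

End two_hypotheses.

Section lower_bound.
Context {R : realType} (d1' d2' : nat).
Local Notation d1 := d1'.+1.
Local Notation d2 := d2'.+1.
Local Notation d := (d1 + d2)%N.
Local Notation leb := (@lebesgue_measure R).
Local Notation lam := (@lebesgue_rV R (d1 + d2)).
Variables (kappa S T x0 c' tau a : R) (P : nat -> {poly R}) (F : R -> R)
  (H : set ('rV[Cplx R]_(d1 + d2) -> Cplx R)).
Hypotheses (k01 : 0 < kappa < 1) (T0 : 0 < T) (TS : 4 * d%:R ^+ 2 * 2 ^+ d * T <= S)
  (x00 : 0 < x0) (c0 : 0 < c') (tau0 : 0 <= tau) (sc : scale_choice kappa x0 c' tau T)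
  (orthoP : orthonormal_polys kappa x0 P) (envF : envelope kappa x0 P F)
  (intF : (\int[leb]_x (F x * h_kappa kappa x0 x)%:E = 1)%E)
  (domF : forall x, F x <= c' * weight x0 tau x) (a1 : `|a| < 1)
  (HF : contains_family a kappa x0 P F H).
Variables (q : nat -> R -> R) (C B sg nu cnu cQ : R).
Hypotheses (dq : dfam q) (nq : nice (q 0%N)) (q0 : forall x, 0 <= q 0%N x) (q1 : intR (q 0%N) = 1)
  (C0 : 0 < C) (B1 : 1 <= B) (qC : forall k x, `|q k x| <= C / (1 + x ^+ 2) * B ^+ k) (sg0 : 0 < sg).

Local Notation A := (mixing_mx d1 d2 a).
Local Notation Q1 := (@first_law R d1 (qm nq q0 q1) sg).
Local Notation Q2 := (@first_law R d2 (qm nq q0 q1) sg).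

Lemma dim_gt0 : (0 < d)%N. Proof. by []. Qed.

Lemma at0_first_factor z z0 : at0 dim_gt0 z z0 = @first_factor R d1' d2' z0 z.
Proof. by apply/funext => j; rewrite /at0 /first_factor -val_eqE. Qed.

Lemma first_factor_cst z0 : @first_factor R d1' d2' z0 z0 = fun=> z0.
Proof. by apply/funext => j; rewrite /first_factor; case: ifP. Qed.

Section pair.
Variables (k beta cb b al D : R) (K n : nat).
Hypotheses (k0 : 0 < k) (kA : forall f : 'rV[R]_(d1 + d2) -> \bar R, measurable_fun setT f -> (forall x, 0 <= f x)%E ->
    (\int[lam]_x f (x *m A^T)%R = k%:E * \int[lam]_x f x)%E).
Hypotheses (bx : x0^-1 <= b) (K1 : (1 <= K)%N) (al0 : 0 <= al)
  (al1 : al * (env_cst kappa x0 P F * K%:R `^ (- ((1 - kappa) / 2))) <= 1).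
Local Notation z0 := (zeta0 kappa x0 F b).
Local Notation z1 := (zeta1 kappa x0 P F al K b).
Local Notation w := (zeta_diff kappa x0 P b K al).
Hypotheses (E0 : (mixture_energy A beta (fun=> z0) <= cb%:E)%E) (E1 : (mixture_energy A beta (at0 dim_gt0 z1 z0) <= cb%:E)%E)
  (hQ : noise_class nu cnu cQ Q1 Q2) (D0 : 0 < D)
  (hD : 2 * D <= k * (intR (fun x => w x ^+ 2) * intR (fun x => z0 x ^+ 2) ^+ d.-1)).
Let de := TV1 C sg^-1 T * TVB B sg^-1 T ^+ K * K%:R `^ (- (kappa * K%:R)) * @oneDsqrV_mass R ^+ 2.
Hypothesis hn : n%:R * de <= 2^-1.

Let b0 : 0 < b. Proof. by apply: lt_le_trans bx; rewrite invr_gt0. Qed.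
Let nz0 : nice z0. Proof. exact: (nice_zeta0 k01 x00 c0 tau0 envF domF b0). Qed.
Let nz1 : nice z1. Proof. exact: (nice_zeta1 k01 x00 c0 tau0 envF domF K al b0). Qed.
Let nw : nice w. Proof. exact: (nice_zeta_diff P k01 x00 K al b0). Qed.
Let z00 x : 0 <= z0 x. Proof. exact: (zeta0_ge0 k01 x00 envF b0). Qed.
Let z10 x : 0 <= z1 x. Proof. exact: (zeta1_ge0 k01 x00 c0 tau0 envF domF b0 K1 al0 al1). Qed.
Let i0 : intR z0 = 1. Proof. exact: (intR_zeta0 k01 x00 c0 tau0 envF intF domF b0). Qed.
Let i1 : intR z1 = 1. Proof. exact: (intR_zeta1 k01 x00 c0 tau0 orthoP envF intF domF al b0 K1). Qed.
Let zE x : z1 x = z0 x + w x. Proof. exact: (zeta1E k01 x00 c0 tau0 envF domF K al b0). Qed.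
Let uA : A \in unitmx. Proof. by have [] := @lin_jac_mixing R d1 d2 a isT isT a1. Qed.
Let m0 := zeta0_abs_moment k01 T0 x00 c0 tau0 sc envF intF domF bx.

Let TV0 : 0 <= TV1 C sg^-1 T * TVB B sg^-1 T ^+ K * K%:R `^ (- (kappa * K%:R)).
Proof.
have s0 : 0 < sg^-1 by rewrite invr_gt0.
apply: mulr_ge0; last exact: powR_ge0.
apply: mulr_ge0.
  apply: mulr_ge0; first by apply: mulr_ge0 => //; exact: sqr_ge0.
  by apply: addr_ge0 => //; apply: mulr_ge0; apply: exprn_ge0; [exact: ltW|apply: mulr_ge0 => //; exact: ltW].
apply: exprn_ge0; apply: mulr_ge0; last exact: ltW.
by apply: mulr_ge0; [apply: mulr_ge0 => //; exact: ltW|exact: le_trans ler01 B1].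
Qed.

Lemma smoothed_diff x y : smoothed (q 0%N) sg a z1 x y <= smoothed (q 0%N) sg a z0 x y +
  TV1 C sg^-1 T * TVB B sg^-1 T ^+ K * K%:R `^ (- (kappa * K%:R)) * ((1 + x ^+ 2)^-1 * (1 + y ^+ 2)^-1).
Proof.
have s0 : 0 < sg^-1 by rewrite invr_gt0.
have pq := pgrow_kernel2 sg^-1 a nq C0 qC x y.
have hw := taylor_cancel dq nq C0 B1 qC s0 (ltW a1) k01 T0 K1 nw nz0 z00
  (zeta_diff_le k01 x00 c0 tau0 envF domF b0 K1 al0 al1)
  (fun p hp => zeta_diff_ortho k01 x00 orthoP al b0 hp) (fun m _ => m0 m) x y.
have E : smoothed (q 0%N) sg a z1 x y = smoothed (q 0%N) sg a z0 x y + intR (fun s => kernel2 q sg^-1 a x y s * w s).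
  rewrite /smoothed -intRD; [|exact: niceM|exact: niceM].
  by apply: eq_intR => s; rewrite zE mulrDr.
by rewrite E lerD2l; exact: le_trans (ler_norm _) hw.
Qed.

Let al_sup : (al%:E <= (sup_ratio (Ph kappa x0 P K) F)^-1)%E.
Proof. exact: le_inv_sup_ratio. Qed.

(** The factor 2 pays for [zeta1 <= 2 * zeta0] in the first coordinate. *)
Let hz j m : (0 < m)%N -> intR (fun x => `|x| ^+ m * @first_factor R d1' d2' z0 z1 j x) <= 2 * ((2 * T) ^+ m * moment_bound kappa m).
Proof.
move=> _; have nx (z : R -> R) : nice z -> nice (fun x => `|x| ^+ m * z x) by exact: nice_absM.
have h : intR (fun x => `|x| ^+ m * z0 x) <= 2 * ((2 * T) ^+ m * moment_bound kappa m).
  by apply: le_trans (m0 m) _; rewrite ler_peMl ?ler1n// mulr_ge0 ?moment_bound_ge0// exprn_ge0// mulr_ge0// ltW.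
rewrite /first_factor; case: (j == 0%N :> nat); last exact: h.
apply: (@le_trans _ _ (2 * intR (fun x => `|x| ^+ m * z0 x))); last by rewrite ler_pM2l// m0.
rewrite -intRZ; last exact: nx.
apply: intR_le; [exact: nx|by apply: niceZ; exact: nx|move=> x].
rewrite mulrCA; apply: ler_wpM2l; first exact: exprn_ge0.
exact: (zeta1_le k01 x00 c0 tau0 envF domF b0 K1 al0 al1).
Qed.

Lemma minimax_ge_pair : ((D / 4)%:E <= minimax_risk n kappa S beta cb nu cnu cQ H)%E.
Proof.
pose ff := @first_factor R d1' d2' z0 z1.
have nff j : nice (ff j) by rewrite /ff /first_factor; case: ifP.
have ff0 j x : 0 <= ff j x by rewrite /ff /first_factor; case: ifP.
have iff j : intR (ff j) = 1 by rewrite /ff /first_factor; case: ifP.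
have E1' : (mixture_energy A beta ff <= cb%:E)%E by rewrite /ff -at0_first_factor.
have hz0 (j : 'I_d) m : (0 < m)%N -> intR (fun x => `|x| ^+ m * z0 x) <= 2 * ((2 * T) ^+ m * moment_bound kappa m).
  move=> _; apply: le_trans (m0 m) _.
  by rewrite ler_peMl ?ler1n// mulr_ge0 ?moment_bound_ge0// exprn_ge0// mulr_ge0// ltW.
have [Pr1 h1 c1] := in_class T0 TS a1 k0 kA nff ff0 iff hz
  (single_index x00 envF HF bx K1 al0 al_sup (or_intror (mixture_densityP k0 uA kA (fun j => (nff j).1) ff0))) E1'.
have [Pr0 h0 cc0] := in_class T0 TS a1 k0 kA (fun=> nz0) (fun=> z00) (fun=> i0)
  hz0
  (single_index x00 envF HF bx K1 al0 al_sup (or_introl (mixture_densityP k0 uA kA (fun=> nz0.1) (fun=> z00)))) E0.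
apply: le_ereal_inf_tmp => _ [fhat est <-].
have [] := @minimax_lower R d1 d2 n fhat Pr1 Pr0 (mixf A^T k ff) (mixf A^T k (fun=> z0)) Q1 Q2 D de est D0.
- by rewrite mulr_ge0// sqr_ge0.
- exact: hn.
- by case: h1.
- by case: h0.
- move=> g mg g01.
  have gE x : (fine (g x))%:E = g x.
    have /andP[g0 g1] := g01 x; rewrite fineK// ge0_fin_numE//; apply: le_lt_trans g1 _; exact: ltry.
  have mfg : measurable_fun setT (fun x => fine (g x)) by apply/measurable_EFinP; rewrite (_ : _ \o _ = g)//; exact/funext/gE.
  have fg01 x : 0 <= fine (g x) <= 1 by rewrite -!lee_fin gE.
  rewrite -(eq_integral _ _ (fun x _ => gE x)) -[X in (_ <= X + _)%E](eq_integral _ _ (fun x _ => gE x)).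
  have h0' : has_density Pr0 (mixf A^T k (@first_factor R d1' d2' z0 z0)) by rewrite first_factor_cst.
  exact: (obs_diff nq q0 q1 sg0 mfg fg01 nz1 nz0 z10 z00 TV0 smoothed_diff nz0 z00 i0 k0 uA kA h1 h0').
- rewrite /ff -at0_first_factor (mixture_L2 dim_gt0 k0 uA kA nz0 nw zE) lee_fin; exact: hD.
- move=> h; apply: le_trans h _; apply: ereal_sup_ubound.
  by exists Pr1, (mixf A^T k ff), Q1, Q2; split.
- move=> h; apply: le_trans h _; apply: ereal_sup_ubound.
  by exists Pr0, (mixf A^T k (fun=> z0)), Q1, Q2; split.
Qed.

End pair.

Lemma powR_natN_le1 (K : nat) (s : R) : (1 <= K)%N -> 0 <= s -> K%:R `^ (- s) <= 1.
Proof. by move=> K1 s0; rewrite -[leRHS](powRr0 K%:R) ler_powR ?ler1n// oppr_le0. Qed.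

Lemma room_energy k beta cb : 0 < k ->
  (forall f : 'rV[R]_(d1 + d2) -> \bar R, measurable_fun setT f -> (forall x, 0 <= f x)%E ->
    (\int[lam]_x f (x *m A^T)%R = k%:E * \int[lam]_x f x)%E) ->
  sobolev_room d1 d2 a kappa x0 F beta cb ->
  exists2 e, 0 < e & exists2 b1, 0 < b1 & forall b, b1 <= b ->
    (mixture_energy A beta (fun=> zeta0 kappa x0 F b) <= (cb - e)%:E)%E.
Proof.
have uA : A \in unitmx by have [] := @lin_jac_mixing R d1 d2 a isT isT a1.
move=> k0 kA [e e0 [M [Mr hM]]]; exists e => //.
exists (`|M| + 1) => [|b hb]; first by rewrite ltr_wpDl.
have Mb : M < b by apply: le_lt_trans (ler_norm M) _; lra.
have b0 : 0 < b by have := normr_ge0 M; lra.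
have nz0 := nice_zeta0 k01 x00 c0 tau0 envF domF b0.
have z00 := zeta0_ge0 k01 x00 envF b0.
rewrite -(sobolev_energy_mixture a1 k0 kA (fun=> nz0) (fun=> z00)).
exact: (hM b Mb _ (mixture_densityP k0 uA kA (fun=> nz0.1) (fun=> z00))).
Qed.

(** The exponent of [al] is fixed by the second identity, in which all powers of [K] cancel, so the
    Sobolev energy stays of constant order. The first identity keeps [al] within the envelope
    constraint; the third, number of intervals times length times squared height, is the resulting
    rate. *)
Lemma scale_exponents (K : nat) (e M beta : R) : (1 <= K)%N -> 0 < M ->
  let al := e * K%:R `^ ((1 - kappa) / 2 - kappa * beta) in
  [/\ al * K%:R `^ (- ((1 - kappa) / 2)) = e * K%:R `^ (- (kappa * beta)),
      al ^+ 2 * (M * K%:R `^ kappa) `^ (2 * beta) * K%:R `^ (- (1 - kappa)) = e ^+ 2 * M `^ (2 * beta) &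
      K%:R `^ kappa * (K%:R `^ (- kappa) * (al * K%:R `^ ((kappa - 1) / 2)) ^+ 2) =
        e ^+ 2 * K%:R `^ (- (2 * kappa * beta))].
Proof.
move=> K1 M0 al; have K0 : 0 < K%:R :> R by rewrite ltr0n.
have Kn : K%:R != 0 :> R by rewrite gt_eqF.
have pD s t : K%:R `^ s * K%:R `^ t = K%:R `^ (s + t) :> R by rewrite powRD// Kn implybT.
have pX s : (K%:R `^ s) ^+ 2 = K%:R `^ (2 * s) :> R by rewrite expr2 pD; congr (_ `^ _); ring.
rewrite /al; split.
- by rewrite -[LHS]mulrA pD; congr (_ * _ `^ _); ring.
- rewrite exprMn pX powRM ?(ltW M0) ?powR_ge0// -powRrM.
  have -> : e ^+ 2 * K%:R `^ (2 * ((1 - kappa) / 2 - kappa * beta)) * (M `^ (2 * beta) * K%:R `^ (kappa * (2 * beta))) * K%:R `^ (- (1 - kappa)) =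
    e ^+ 2 * M `^ (2 * beta) * (K%:R `^ (2 * ((1 - kappa) / 2 - kappa * beta)) * (K%:R `^ (kappa * (2 * beta)) * K%:R `^ (- (1 - kappa)))) by ring.
  rewrite !pD (_ : _ + _ = 0); first by rewrite powRr0 mulr1.
  by field.
- set X := K%:R `^ ((1 - kappa) / 2 - _); set Y := K%:R `^ ((kappa - 1) / 2).
  have -> : K%:R `^ kappa * (K%:R `^ (- kappa) * (e * X * Y) ^+ 2) =
    e ^+ 2 * ((X * Y) ^+ 2 * (K%:R `^ kappa * K%:R `^ (- kappa))) by ring.
  rewrite /X /Y !pD pX pD; congr (_ * _ `^ _); by field.
Qed.

Lemma minimax_rate beta cb : 0 < beta -> 0 < cb -> oscillation kappa x0 P ->
  noise_class nu cnu cQ Q1 Q2 -> sobolev_room d1 d2 a kappa x0 F beta cb ->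
  exists2 c : R, 0 < c & forall n : nat, (3 <= n)%N ->
    ((c * (ln n%:R / ln (ln n%:R)) `^ (- (2 * kappa * beta)))%:E
     <= minimax_risk n kappa S beta cb nu cnu cQ H)%E.
Proof.
move=> be0 cb0 [ o0 [ o1 [ o2 [ o00 o10 o20 [Ko hosc]]]]] hQ room.
have [ka0 ka1] : 0 < kappa /\ kappa < 1 by case/andP: k01.
have [jA [k k0 kA] uA] := @lin_jac_mixing R d1 d2 a isT isT a1.
have A1 := @mixing_mx_le1 R d1 d2 a (ltW a1).
have [e e0 [b1 b10 hE]] := room_energy k0 kA room.
have [Cu Cu0 hu] := mixture_energy_le_prod dim_gt0 uA jA (ltW be0).
have [cl cl0 hl] := mixture_energy_ge_prod dim_gt0 A1 jA (ltW be0).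
have [Cw Cw0 hw] := sobolev_zeta_diff k01 x00 c0 tau0 envF domF (ltW be0).
have [mh mh0 hmh] := h_kappa_min k01 x00.
pose m2 := (2 * T) ^+ 2 * moment_bound kappa 2.
have m20 : 0 <= m2 by rewrite mulr_ge0 ?moment_bound_ge0// sqr_ge0.
pose g1 := (8 * (1 + m2))^-1.
have g10 : 0 < g1 by rewrite invr_gt0 mulr_gt0// ltr_wpDr.
pose M := 4 / o1; have M0 : 0 < M by rewrite divr_gt0.
(* With the energy of the perturbation from [sobolev_zeta_diff], [G * ep ^+ 2] is the left side of
   the smallness condition of [energy_perturb]. *)
pose G := (1 + 2 * cb / e) * (Cu * (Cw * M `^ (2 * beta) * (cb / (cl * g1 ^+ d.-1)) ^+ d.-1)).
have G0 : 0 <= G.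
  have h1 : 0 <= 2 * cb / e by rewrite divr_ge0 ?(ltW e0)// mulr_ge0// ltW.
  have h2 : 0 <= cb / (cl * g1 ^+ d.-1).
    by rewrite divr_ge0 ?(ltW cb0)// mulr_ge0 ?(ltW cl0)// exprn_ge0// ltW.
  apply: mulr_ge0; first exact: addr_ge0.
  apply: mulr_ge0; first exact: ltW.
  by apply: mulr_ge0; [apply: mulr_ge0; [exact: ltW|exact: powR_ge0]|exact: exprn_ge0].
have Ce0 := @env_cst_gt0 R kappa x0 P F.
(* The entries serve, in turn, [ep ^+ 2 <= ep], the envelope constraint on [al], and the Sobolev
   room [e / 2]. *)
pose ep := Num.min 1 (Num.min (env_cst kappa x0 P F)^-1 (e / 2 / (G + 1))).
have Gp : 0 < G + 1 by rewrite ltr_wpDl.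
have ep0 : 0 < ep by rewrite !lt_min ltr01 invr_gt0 Ce0 !divr_gt0.
have epC : ep * env_cst kappa x0 P F <= 1 by rewrite -ler_pdivlMr// div1r !ge_min lexx !orbT.
have epG : G * ep ^+ 2 <= e / 2.
  have h1 : ep <= 1 by rewrite ge_min lexx.
  have h2 : ep * (G + 1) <= e / 2 by rewrite -ler_pdivlMr// !ge_min lexx !orbT.
  have h3 : G * ep ^+ 2 <= G * ep by rewrite ler_wpM2l// expr2 ler_piMr// ltW.
  by apply: le_trans h3 _; apply: le_trans h2; rewrite mulrDr mulr1 mulrC lerDl ltW.
pose V := TV1 C sg^-1 T * @oneDsqrV_mass R ^+ 2 + 1.
pose Bt := TVB B sg^-1 T + 1.
have s0 : 0 < sg^-1 by rewrite invr_gt0.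
have TV10 : 0 <= TV1 C sg^-1 T.
  apply: mulr_ge0; first by apply: mulr_ge0 => //; exact: sqr_ge0.
  by apply: addr_ge0 => //; apply: mulr_ge0; apply: exprn_ge0; [exact: ltW|apply: mulr_ge0 => //; exact: ltW].
have TVB0 : 0 <= TVB B sg^-1 T.
  apply: mulr_ge0; last exact: ltW.
  by apply: mulr_ge0; [apply: mulr_ge0 => //; exact: ltW|exact: le_trans ler01 B1].
have V1 : 1 <= V by rewrite lerDr mulr_ge0// sqr_ge0.
have Bt1 : 1 <= Bt by rewrite lerDr.
(* The scale [b] must exceed the threshold [b1] of the Sobolev room, 1 for [sobolev_zeta_diff], and
   the lower end of the range in [scale_choice]. As [b] grows with [K], the bound [K0] on the degree
   enforces all three. *)
pose bm := Num.max b1 (Num.max 1 x0^-1).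
have bm0 : 0 < bm by rewrite lt_max b10.
pose K0 := maxn Ko (Num.trunc ((bm / M) `^ kappa^-1)).+1.
have [Cc Cc0 hdeg] := choose_degree K0 ka0 V1 Bt1.
(* The constant in the lower bound of the squared distance, halved because [minimax_lower] asks for
   separation [2 * D]. *)
pose D0 := k * (o0 * (o1 / 2 * (ep * o2 * mh) ^+ 2) * g1 ^+ d.-1) / 2.
have D00 : 0 < D0.
  apply: mulr_gt0 => //; apply: mulr_gt0 => //; apply: mulr_gt0; last exact: exprn_gt0.
  apply: mulr_gt0 => //; apply: mulr_gt0; first exact: divr_gt0.
  by apply: exprn_gt0; apply: mulr_gt0 => //; exact: mulr_gt0.
exists (D0 / 4 * Cc `^ (- (2 * kappa * beta))); first by apply: mulr_gt0; [exact: divr_gt0|exact: powR_gt0].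
move=> n n3; have [K [KK0 hn KQ]] := hdeg n n3.
have K1 : (1 <= K)%N by apply: leq_trans KK0; rewrite leq_max orbT.
have Kp : 0 < K%:R :> R by rewrite ltr0n.
pose b := M * K%:R `^ kappa.
have hb : bm <= b.
  rewrite /b mulrC -ler_pdivrMr//.
  have -> : bm / M = ((bm / M) `^ kappa^-1) `^ kappa.
    by rewrite -powRrM mulVf ?gt_eqF// powRr1// divr_ge0// ltW.
  apply: ge0_ler_powR; rewrite ?nnegrE ?powR_ge0// ?(ltW ka0)//.
  apply: le_trans (ltW (truncnS_gt _)) _; rewrite ler_nat.
  by apply: leq_trans KK0; rewrite leq_max leqnn orbT.
have [hb1 [hb2 bx]] : b1 <= b /\ 1 <= b /\ x0^-1 <= b.
  by move: hb; rewrite !ge_max => /and3P[].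
have b0 : 0 < b by exact: lt_le_trans hb2.
have [x1 x2 x3] := scale_exponents ep beta K1 M0.
set al := ep * _ in x1 x2 x3.
have al0 : 0 <= al by rewrite mulr_ge0 ?powR_ge0// ltW.
have kb0 : 0 <= kappa * beta by rewrite mulr_ge0// ltW.
have al1 : al * (env_cst kappa x0 P F * K%:R `^ (- ((1 - kappa) / 2))) <= 1.
  rewrite mulrCA x1 mulrA [env_cst _ _ _ _ * _]mulrC; apply: le_trans epC.
  by rewrite ler_piMr ?powR_natN_le1// mulr_ge0// ltW.
have nz0 := nice_zeta0 k01 x00 c0 tau0 envF domF b0.
have z00 := zeta0_ge0 k01 x00 envF b0.
have iz0 := intR_zeta0 k01 x00 c0 tau0 envF intF domF b0.
have mom : intR (fun x => x ^+ 2 * zeta0 kappa x0 F b x) <= m2.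
  apply: le_trans (zeta0_abs_moment k01 T0 x00 c0 tau0 sc envF intF domF bx 2).
  by rewrite (eq_intR (g := fun x => `|x| ^+ 2 * zeta0 kappa x0 F b x))// => x; rewrite real_normK ?num_real.
have hc1 := energy_lower nz0 z00 iz0 mom; rewrite (addrC m2) -/g1 in hc1.
have om0 : 0 <= Cw * (ep ^+ 2 * M `^ (2 * beta)).
  by rewrite mulr_ge0 ?(ltW Cw0)// mulr_ge0 ?powR_ge0// sqr_ge0.
have hww := hw b K al hb2 K1 al0; rewrite x2 in hww.
have E1 : (mixture_energy A beta (at0 dim_gt0 (zeta1 kappa x0 P F al K b) (zeta0 kappa x0 F b)) <= cb%:E)%E.
  apply: (energy_perturb hu hl Cu0 cl0 g10 cb0 e0 om0 nz0
    (nice_zeta1 k01 x00 c0 tau0 envF domF K al b0) (nice_zeta_diff P k01 x00 K al b0)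
    (Phi_zeta1 k01 x00 c0 tau0 envF domF K al b0) hc1 (hE b hb1) hww).
  apply: le_trans epG; rewrite le_eqVlt; apply/orP; left; apply/eqP; rewrite /G; ring.
have E0 : (mixture_energy A beta (fun=> zeta0 kappa x0 F b) <= cb%:E)%E.
  by apply: le_trans (hE b hb1) _; rewrite lee_fin gerBl ltW.
pose D := D0 * K%:R `^ (- (2 * kappa * beta)).
have D1 : 0 < D by rewrite mulr_gt0// powR_gt0.
have hz2 := sqr_mass_lower nz0 z00 iz0 mom m20; rewrite -/g1 in hz2.
have hD : 2 * D <= k * (intR (fun x => zeta_diff kappa x0 P b K al x ^+ 2) *
    intR (fun x => zeta0 kappa x0 F b x ^+ 2) ^+ d.-1).
  have [m [l [r [hm dis hi]]]] := hosc K (leq_trans (leq_maxl _ _) KK0).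
  have hww2 := zeta_diff_L2_ge k01 x00 o10 o20 K1 al0 mh0 hmh (erefl b) dis hi.
  have -> : 2 * D = k * ((o0 * (o1 / 2 * (o2 * mh) ^+ 2) * (ep ^+ 2 * K%:R `^ (- (2 * kappa * beta)))) * g1 ^+ d.-1).
    by rewrite /D /D0; move: (K%:R `^ _) (g1 ^+ _) => X Y; field.
  rewrite -x3; apply: ler_wpM2l; first exact: ltW.
  have hq : o0 * (o1 / 2 * (o2 * mh) ^+ 2) * (K%:R `^ kappa * (K%:R `^ (- kappa) * (al * K%:R `^ ((kappa - 1) / 2)) ^+ 2))
     <= intR (fun x => zeta_diff kappa x0 P b K al x ^+ 2).
    apply: le_trans hww2.
    have -> : o0 * (o1 / 2 * (o2 * mh) ^+ 2) * (K%:R `^ kappa * (K%:R `^ (- kappa) * (al * K%:R `^ ((kappa - 1) / 2)) ^+ 2)) =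
      o0 * K%:R `^ kappa * (o1 / 2 * K%:R `^ (- kappa) * (al * (o2 * K%:R `^ ((kappa - 1) / 2) * mh)) ^+ 2).
      move: (K%:R `^ kappa) (K%:R `^ (- kappa)) (K%:R `^ ((kappa - 1) / 2)) => X Y Z; ring.
    apply: ler_wpM2r hm; apply: mulr_ge0; last exact: sqr_ge0.
    by apply: mulr_ge0; [rewrite divr_ge0// ltW|exact: powR_ge0].
  apply: ler_pM hq _; last by apply: leXn hz2; exact: ltW.
    apply: mulr_ge0; first by apply: mulr_ge0; [exact: ltW|apply: mulr_ge0; [rewrite divr_ge0// ltW|exact: sqr_ge0]].
    by apply: mulr_ge0; [exact: powR_ge0|apply: mulr_ge0; [exact: powR_ge0|exact: sqr_ge0]].
  by apply: exprn_ge0; exact: ltW.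
have hde : n%:R * (TV1 C sg^-1 T * TVB B sg^-1 T ^+ K * K%:R `^ (- (kappa * K%:R)) * @oneDsqrV_mass R ^+ 2) <= 2^-1.
  apply: le_trans hn; apply: ler_wpM2l => //.
  have hV : TV1 C sg^-1 T * @oneDsqrV_mass R ^+ 2 <= V by rewrite lerDl.
  have hBt : TVB B sg^-1 T ^+ K <= Bt ^+ K by apply: leXn => //; rewrite lerDl.
  move: (TV1 C sg^-1 T) (@oneDsqrV_mass R ^+ 2) (sqr_ge0 (@oneDsqrV_mass R)) TV10 hV => v J J0 v0 hV.
  have tB : 0 <= TVB B sg^-1 T ^+ K by exact: exprn_ge0.
  move: (TVB B sg^-1 T ^+ K) (Bt ^+ K) (K%:R `^ _) (powR_ge0 K%:R (- (kappa * K%:R))) hBt tB => t t' p p0 ht t0.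
  have -> : v * t * p * J = (v * J) * (t * p) by ring.
  apply: ler_pM => //; [exact: mulr_ge0|exact: mulr_ge0|exact: ler_wpM2r].
have main := minimax_ge_pair k0 kA bx K1 al0 al1 E0 E1 hQ D1 hD hde.
apply: le_trans main; rewrite lee_fin /D.
set Q := ln n%:R / _ in KQ *.
have Q0 : 0 < Q by have := lt_le_trans Kp KQ; rewrite (pmulr_rgt0 Q Cc0).
have p0 : 0 <= 2 * kappa * beta by rewrite -mulrA mulr_ge0.
have hK : (Cc * Q) `^ (- (2 * kappa * beta)) <= K%:R `^ (- (2 * kappa * beta)).
  have CQ : 0 < Cc * Q by apply: mulr_gt0.
  rewrite !powRN lef_pV2 ?posrE ?powR_gt0//.
  by apply: ge0_ler_powR; rewrite ?nnegrE ?(ltW CQ).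
move: hK; rewrite powRM ?(ltW Cc0) ?(ltW Q0)//.
move: (Cc `^ _) (Q `^ _) (K%:R `^ _) => X Y Z hK.
have -> : D0 / 4 * X * Y = D0 / 4 * (X * Y) by ring.
have -> : D0 * Z / 4 = D0 / 4 * Z by field.
by apply: ler_wpM2l => //; rewrite divr_ge0// ltW.
Qed.

End lower_bound.

(** [T] has to be small compared with [S] because the mixing and the passage to multi-indices
    inflate the Taylor bounds by a factor that depends on the dimension. A characteristic function
    is 1 at the origin, so [cnu < 1] leaves room for a noise that is not a point mass; [3 <= n]
    makes [ln (ln n)] positive. *)
Theorem theorem8 (R : realType) (d1 d2 : nat) (kappa S : R) :
  (0 < d1)%N -> (0 < d2)%N -> 0 < kappa < 1 -> 0 < S ->
  exists2 T0 : R, 0 < T0 &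
  forall (T c' tau x0 a nuest : R) (P : nat -> {poly R}) (F : R -> R)
    (H : set ('rV[Cplx R]_(d1 + d2) -> Cplx R)),
  (* choice of x0, T and h_kappa *)
  0 < T <= T0 -> 0 < c' -> 0 <= tau -> 0 < x0 ->
  scale_choice kappa x0 c' tau T ->
  orthonormal_polys kappa x0 P ->
  (* the conjecture, and the envelope function *)
  conjecture kappa x0 P ->
  envelope kappa x0 P F ->
  (\int[lebesgue_measure]_x (F x * h_kappa kappa x0 x)%:E = 1)%E ->
  (forall x, F x <= c' * weight x0 tau x) ->
  `|a| < 1 ->
  (* the set H *)
  0 < nuest ->
  closed_L2_box nuest H ->
  (forall phi, H phi -> nonnull_sections phi) ->
  contains_family a kappa x0 P F H ->
  forall beta cbeta cQ nu cnu : R,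
  0 < beta -> 0 < cbeta -> 0 < cQ -> 0 < nu -> 0 < cnu < 1 ->
  sobolev_room d1 d2 a kappa x0 F beta cbeta ->
  exists2 c : R, 0 < c &
  forall n : nat, (3 <= n)%N ->
    ((c * (ln n%:R / ln (ln n%:R)) `^ (- (2 * kappa * beta)))%:E
     <= minimax_risk n kappa S beta cbeta nu cnu cQ H)%E.
Proof.
case: d1 => // d1'; case: d2 => // d2' _ _ k01 S0.
have c0 : 0 < 4 * (d1'.+1 + d2'.+1)%:R ^+ 2 * 2 ^+ (d1'.+1 + d2'.+1) :> R.
  by apply: mulr_gt0; [apply: mulr_gt0 => //; apply: exprn_gt0|apply: exprn_gt0].
(* The largest [T] for which [mixture_Upsilon] yields the class with constant [S]. *)
exists (S / (4 * (d1'.+1 + d2'.+1)%:R ^+ 2 * 2 ^+ (d1'.+1 + d2'.+1))); first exact: divr_gt0.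
move=> T c' tau x0 a nuest P F H /andP[T0 TT] c'0 tau0 x00 sc orthoP conjP envF intF domF a1 _ _ _ HF
  beta cbeta cQ nu cnu be0 cb0 cQ0 nu0 cnu01 room.
have TS : 4 * (d1'.+1 + d2'.+1)%:R ^+ 2 * 2 ^+ (d1'.+1 + d2'.+1) * T <= S.
  by move: TT; rewrite ler_pdivlMr// mulrC.
have [q [C [B [dq nq q0 q1 [C0 [B1 qC]]]]]] := @noise_density R.
have [sg sg0 hQ] := noise_in_class nq q0 q1 nu0 cnu01 cQ0.
exact: (minimax_rate k01 T0 TS x00 c'0 tau0 sc orthoP envF intF domF a1 HF dq C0 B1 qC sg0
  be0 cb0 conjP.2 (hQ d1'.+1 d2'.+1 isT isT) room).
Qed.
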